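(* Let $\mathfrak{g}$ be a finite-dimensional real Lie algebra and let $M=\mathfrak{g}^*$ carry the Kirillov--Kostant Poisson structure. Let $G$ be the connected, simply connected Lie group with Lie algebra $\mathfrak{g}$. Then the phase space $\mathcal{G}=\mathcal{C}/H$ of the Poisson sigma model with target $\mathfrak{g}^*$ is diffeomorphic to $T^*G$, and under a suitable such diffeomorphism the symplectic groupoid structure of $\mathcal{G}$ becomes the symplectic groupoid structure on $T^*G$ described in the context.
   Context: Poisson structure. In a basis of $\mathfrak{g}$ with structure constants $f^{ij}_k$, the Kirillov--Kostant structure on $\mathfrak{g}^*$ is $\alpha^{ij}(x)=f^{ij}_kx^k$ (the bracket of linear functions is the Lie bracket). Phase space. Let $I=[0,1]$. $\mathcal{C}$ is the Banach manifold of pairs $(X,\eta)$, $X\in C^1(I,\mathfrak{g}^* )$, $\eta$ a continuous $\mathfrak{g}$-valued 1-form on $I$, with $\mathrm{d}X^i+f^{ij}_kX^k\eta_j=0$. Infinitesimal gauge transformations: for $\beta\in C^1(I,\mathfrak{g})$ vanishing at $u=0,1$, $\delta X^i=-f^{ij}_kX^k\beta_j$, $\delta\eta_i=\mathrm{d}\beta_i+f_i^{jk}\eta_j\beta_k$. $\mathcal{G}=\mathcal{C}/H$ is the space of leaves (orbits) of the foliation of $\mathcal{C}$ whose tangent spaces are formed by these infinitesimal transformations: two solutions are equivalent iff they are joined by a path in $\mathcal{C}$ whose velocity is at each time an infinitesimal gauge transformation. ''$\mathcal{G}$ is diffeomorphic to a manifold $N$'' means that the quotient $\mathcal{G}$ is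 a smooth manifold for which the projection $\mathcal{C}\to\mathcal{G}$ is a smooth submersion, and that this manifold is diffeomorphic to $N$. Groupoid structure on $\mathcal{G}$: $j(x)$ is the class of $X(u)=x$, $\eta=0$; $l([(X,\eta)])=X(0)$, $r([(X,\eta)])=X(1)$; if $X_1(1)=X_2(0)$, choosing representatives with $\eta_1,\eta_2$ vanishing at $u=0,1$ (which exist), $[(X_1,\eta_1)]\bullet[(X_2,\eta_2)]$ is the class of the concatenation: $X(u)=X_1(2u)$, $\eta(u)=2\eta_{1u}(2u)\,\mathrm{d}u$ for $u\le\frac12$; $X(u)=X_2(2u-1)$, $\eta(u)=2\eta_{2u}(2u-1)\,\mathrm{d}u$ for $u\ge\frac12$, where $\eta_i=\eta_{iu}\,\mathrm{d}u$. The symplectic form on $\mathcal{G}$ is the one whose pull-back to $\mathcal{C}$ is the restriction of $\omega(\delta_1,\delta_2)=\int_0^1(\delta_1X^i\delta_2\eta_i-\delta_2X^i\delta_1\eta_i)$. Symplectic groupoid structure on $T^*G$: the symplectic form is the canonical one, with the sign for which the map $l$ below is a Poisson map, where the Poisson bracket on a symplectic manifold is $\{f,g\}=\xi_fg$, $\iota_{\xi_f}\omega=\mathrm{d}f$ (that is, $\omega$ is the exterior derivative of the tautological 1-form). Let $L_g(h)=gh$, $R_g(h)=hg$. The inclusion $j:\mathfrak{g}^*\to T^*G$ is the inclusion as the cotangent space at the identity $e$; for $g\in G$, $a\in T^*_gG$: $l(g,a)=\mathrm{d}R_g(e)^*a$, $r(g,a)=\mathrm{d}L_g(e)^*a$;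 if $r(g,a)=l(h,b)$, then $(g,a)\bullet(h,b)=(gh,c)$ with $c=(\mathrm{d}R_h(g)^* )^{-1}a=(\mathrm{d}L_g(h)^* )^{-1}b$. *)

(* Defs.v *)
From HB Require Import structures.
From mathcomp Require Import all_boot all_order all_algebra.
From mathcomp Require Import all_classical all_reals all_analysis.
Set Implicit Arguments.
Unset Strict Implicit.
Unset Printing Implicit Defensive.
Import Order.TTheory GRing.Theory Num.Theory.
Import numFieldNormedType.Exports.
Local Open Scope classical_set_scope.
Local Open Scope ring_scope.

Section UnitInterval.
Context {R : realType}.

Definition unitI : set R := `[0, 1]%classic.

Definition clampI (u : R) : R := Num.max 0 (Num.min 1 u).

Lemma clampI_in (u : R) : unitI (clampI u).
Proof.
rewrite /unitI /clampI /= in_itv /=; apply/andP; split.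
  by rewrite le_max lexx.
by rewrite ge_max ler01 ge_min lexx.
Qed.

Lemma clampI_id (u : R) : unitI u -> clampI u = u.
Proof.
rewrite /unitI /clampI /= in_itv /= => /andP[u0 u1].
by rewrite (min_r u1) (max_r u0).
Qed.

Context {W : normedModType R}.

Definition supI (f : R -> W) : R := sup [set `|f u| | u in unitI].

Lemma supI_has_sup (f : R -> W) :
  continuous f -> has_sup [set `|f u| | u in unitI].
Proof.
move=> cf; split.
  by exists `|f 0|, 0 => //; rewrite /unitI /= in_itv /= lexx ler01.
have c1 : compact (f @` unitI).
  apply: continuous_compact; last exact: segment_compact.
  by apply: continuous_subspaceT => x; exact: cf.
have [M [_ /(_ (M + 1))]] := compact_bounded c1.
rewrite ltrDl ltr01 => /(_ isT) Mf.
by exists (M + 1) => _ [u uI <-]; apply: Mf; exists u.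
Qed.

Lemma supI_ub (f : R -> W) u : continuous f -> unitI u -> `|f u| <= supI f.
Proof.
by move=> cf uI; apply: (sup_upper_bound (supI_has_sup cf)); exists u.
Qed.

Lemma supI_le (f : R -> W) b :
  (forall u, unitI u -> `|f u| <= b) -> supI f <= b.
Proof.
move=> fb; apply: ge_sup => [|_ [u uI <-]]; last exact: fb.
by exists `|f 0|, 0 => //; rewrite /unitI /= in_itv /= lexx ler01.
Qed.

Lemma supID (f g : R -> W) : continuous f -> continuous g ->
  supI (f + g) <= supI f + supI g.
Proof.
move=> cf cg; apply: supI_le => u uI.
by apply: le_trans (ler_normD _ _) _; apply: lerD; exact: supI_ub.
Qed.

Lemma supI0 : supI (0 : R -> W) = 0.
Proof.
apply/eqP; rewrite eq_le; apply/andP; split.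
  by apply: supI_le => u _; rewrite normr0.
have c0 : continuous (0 : R -> W) by move=> x; exact: cvg_cst.
have -> : 0 = `|(0 : R -> W) 0| :> R by rewrite normr0.
by apply: supI_ub => //; rewrite /unitI /= in_itv /= lexx ler01.
Qed.

Lemma supIZ (l : R) (f : R -> W) : continuous f ->
  supI (l *: f) = `|l| * supI f.
Proof.
move=> cf; have [->|l0] := eqVneq l 0.
  by rewrite scale0r supI0 normr0 mul0r.
have nl0 : 0 < `|l| by rewrite normr_gt0.
apply/eqP; rewrite eq_le; apply/andP; split.
  apply: supI_le => u uI; rewrite normrZ.
  by apply: ler_wpM2l => //; exact: supI_ub.
rewrite -ler_pdivlMl //; apply: supI_le => u uI.
rewrite ler_pdivlMl // -normrZ.
have cl : continuous (l *: f) by move=> x; apply: cvgZl_tmp; exact: cf.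
exact: (supI_ub cl uI).
Qed.

Lemma supI_ge0 (f : R -> W) : continuous f -> 0 <= supI f.
Proof.
move=> cf; apply: le_trans (supI_ub cf (clampI_in 0)).
exact: normr_ge0.
Qed.

Lemma supI_eq0 (f : R -> W) : continuous f -> supI f = 0 ->
  forall u, unitI u -> f u = 0.
Proof.
move=> cf f0 u uI; apply/eqP; rewrite -normr_eq0 eq_le normr_ge0 andbT.
by rewrite -f0; exact: supI_ub.
Qed.

End UnitInterval.

(* An element of C^0(I, W) is represented by its unique continuous extension *)
(* to R that is constant on ]-oo, 0] and on [1, +oo[.                        *)
Section C0.
Context {R : realType} (W : normedModType R).

Definition C0_pred : {pred R -> W} :=
  [pred f | `[< continuous f /\ forall u, f u = f (clampI u) >]].

Record C0 := MkC0 { C0_val :> R -> W; _ : C0_val \in C0_pred }.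

HB.instance Definition _ := [isSub for C0_val].
HB.instance Definition _ := [Choice of C0 by <:].

Lemma C0_submod_closed : submod_closed C0_pred.
Proof.
split; first by apply/asboolP; split=> // x; exact: cvg_cst.
move=> a f g /asboolP[cf ef] /asboolP[cg eg]; apply/asboolP; split.
  by move=> x; apply: cvgD; [apply: cvgZl_tmp; exact: cf|exact: cg].
by move=> u; rewrite -[LHS]/(a *: f u + g u) ef eg.
Qed.

HB.instance Definition _ :=
  GRing.isSubmodClosed.Build R (R -> W) C0_pred C0_submod_closed.
HB.instance Definition _ := [SubChoice_isSubLmodule of C0 by <:].

Lemma C0_continuous (f : C0) : continuous f.
Proof. by case: f => f /= fP; have /asboolP[] := fP. Qed.

Lemma C0_clamp (f : C0) u : f u = f (clampI u).
Proof. by case: f => f /= fP; have /asboolP[_] := fP; exact. Qed.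

Definition C0_norm (f : C0) : R := supI f.

Lemma C0_normD (f g : C0) : C0_norm (f + g) <= C0_norm f + C0_norm g.
Proof. by apply: supID; exact: C0_continuous. Qed.

Lemma C0_normZ (l : R) (f : C0) : C0_norm (l *: f) = `|l| * C0_norm f.
Proof. by apply: supIZ; exact: C0_continuous. Qed.

Lemma C0_norm_eq0 (f : C0) : C0_norm f = 0 -> f = 0.
Proof.
move=> /(supI_eq0 (@C0_continuous f)) f0; apply/val_inj/funext => u /=.
by rewrite C0_clamp f0 //; exact: clampI_in.
Qed.

HB.instance Definition _ :=
  Lmodule_isNormed.Build R C0 C0_normD C0_normZ C0_norm_eq0.

Lemma C0_pred_cst (w : W) : cst w \in C0_pred.
Proof. by apply/asboolP; split=> // x; exact: cvg_cst. Qed.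

End C0.

(* An element of C^1(I, W) is represented by its unique C^1 extension to R   *)
(* that is affine on ]-oo, 0] and on [1, +oo[; its derivative at 0 and at 1  *)
(* is thus the one-sided derivative.                                         *)
Section C1.
Context {R : realType} (W : normedModType R).

Definition C1_pred : {pred R -> W} :=
  [pred f | `[< [/\ forall u : R, derivable f u 1, continuous (derive1 f) &
    forall u, f u = f (clampI u) + (u - clampI u) *: derive1 f (clampI u)] >]].

Record C1 := MkC1 { C1_val :> R -> W; _ : C1_val \in C1_pred }.

HB.instance Definition _ := [isSub for C1_val].
HB.instance Definition _ := [Choice of C1 by <:].

Lemma derive1_lin (a : R) (f g : R -> W) :
  (forall u : R, derivable f u 1) -> (forall u : R, derivable g u 1) ->
  derive1 (a *: f + g) = a *: derive1 f + derive1 g.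
Proof.
move=> df dg; apply/funext => u.
rewrite derive1E deriveD; [|exact: derivableZ|exact: dg].
rewrite deriveZ; last exact: df.
by rewrite -!derive1E.
Qed.

Lemma derive1_cst0 (w : W) : derive1 (cst w : R -> W) = 0.
Proof. by apply/funext => u; rewrite derive1_cst. Qed.

Lemma C1_pred_cst (w : W) : cst w \in C1_pred.
Proof.
apply/asboolP; split; first by move=> u; exact: derivable_cst.
  by rewrite derive1_cst0 => x; exact: cvg_cst.
by move=> u; rewrite derive1_cst0 scaler0 addr0.
Qed.

Lemma C1_submod_closed : submod_closed C1_pred.
Proof.
split; first exact: C1_pred_cst.
move=> a f g /asboolP[df cf ef] /asboolP[dg cg eg]; apply/asboolP; split.
- by move=> u; apply: derivableD; [apply: derivableZ|].
- rewrite derive1_lin // => x.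
  by apply: cvgD; [apply: cvgZl_tmp; exact: cf|exact: cg].
- move=> u; rewrite derive1_lin // -[LHS]/(a *: f u + g u).
  rewrite ef eg.
  rewrite -[X in _ = _ + _ *: X]/(a *: derive1 f (clampI u) +
    derive1 g (clampI u)).
  rewrite -[X in _ = X + _]/(a *: f (clampI u) + g (clampI u)).
  rewrite !scalerDr addrACA; congr (_ + (_ + _)).
  by rewrite !scalerA mulrC.
Qed.

HB.instance Definition _ :=
  GRing.isSubmodClosed.Build R (R -> W) C1_pred C1_submod_closed.
HB.instance Definition _ := [SubChoice_isSubLmodule of C1 by <:].

Lemma C1_derivable (f : C1) (u : R) : derivable f u 1.
Proof. by case: f => f /= fP; have /asboolP[df _ _] := fP; exact: df. Qed.

Lemma C1_deriv_continuous (f : C1) : continuous (derive1 f).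
Proof. by case: f => f /= fP; have /asboolP[] := fP. Qed.

Lemma C1_clamp (f : C1) u :
  f u = f (clampI u) + (u - clampI u) *: derive1 f (clampI u).
Proof. by case: f => f /= fP; have /asboolP[_ _] := fP; exact. Qed.

Lemma C1_continuous (f : C1) : continuous f.
Proof.
move=> u; apply: differentiable_continuous.
by apply/derivable1_diffP; exact: C1_derivable.
Qed.

Lemma C1_derivD (f g : C1) : derive1 ((f : R -> W) + g) = derive1 f + derive1 g.
Proof.
have -> : (f : R -> W) + g = 1 *: (f : R -> W) + g by rewrite scale1r.
by rewrite derive1_lin ?scale1r // => u; exact: C1_derivable.
Qed.

Lemma C1_derivZ (l : R) (f : C1) : derive1 (l *: (f : R -> W)) = l *: derive1 f.
Proof.
rewrite -[in LHS](addr0 (l *: _)) -[0]/(cst 0 : R -> W) derive1_lin.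
- by rewrite derive1_cst0 addr0.
- by move=> u; exact: C1_derivable.
- by move=> u; exact: derivable_cst.
Qed.

Definition C1_norm (f : C1) : R := supI f + supI (derive1 f).

Lemma C1_normD (f g : C1) : C1_norm (f + g) <= C1_norm f + C1_norm g.
Proof.
rewrite /C1_norm addrACA; apply: lerD.
  by apply: supID; exact: C1_continuous.
by rewrite C1_derivD; apply: supID; exact: C1_deriv_continuous.
Qed.

Lemma C1_normZ (l : R) (f : C1) : C1_norm (l *: f) = `|l| * C1_norm f.
Proof.
rewrite /C1_norm mulrDr; congr (_ + _).
  by apply: supIZ; exact: C1_continuous.
by rewrite C1_derivZ; apply: supIZ; exact: C1_deriv_continuous.
Qed.

Lemma C1_norm_eq0 (f : C1) : C1_norm f = 0 -> f = 0.
Proof.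
have cf := @C1_continuous f; have cdf := @C1_deriv_continuous f.
move/eqP; rewrite /C1_norm paddr_eq0 ?supI_ge0 // => /andP[/eqP f0 /eqP df0].
apply/val_inj/funext => u /=.
have cI := clampI_in u.
by rewrite C1_clamp (supI_eq0 cf f0 cI) (supI_eq0 cdf df0 cI) scaler0 addr0.
Qed.

HB.instance Definition _ :=
  Lmodule_isNormed.Build R C1 C1_normD C1_normZ C1_norm_eq0.

End C1.

Section Smooth.
Context {R : realType}.

(* For U open: f is C^(k+1) when it is Frechet differentiable on U and its   *)
(* tangent map (x, v) |-> 'd f x v is C^k on U x V. On normed spaces the     *)
(* order k of this hierarchy may differ by one from the order defined with   *)
(* operator norms, but the smooth (C^oo) maps are the same.                  *)
Fixpoint Ck (k : nat) :
    forall V W : normedModType R, set V -> (V -> W) -> Prop :=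
  match k with
  | 0 => fun V W U f => forall x, U x -> {for x, continuous f}
  | k'.+1 => fun V W U f => (forall x, U x -> differentiable f x) /\
      @Ck k' (V * V)%type W (U `*` setT) (fun p : V * V => 'd f (fst p) (snd p))
  end.

Definition smooth_on (V W : normedModType R) (U : set V) (f : V -> W) :=
  forall k, Ck k U f.

End Smooth.

Section Atlas.
Context {R : realType}.

(* fwd is only meaningful on dom, and bwd on fwd @` dom. *)
Record chart (F : normedModType R) (M : Type) :=
  Chart { dom : set M; fwd : M -> F; bwd : F -> M }.

Definition cod (F : normedModType R) M (c : chart F M) : set F :=
  fwd c @` dom c.

(* chart_at selects a preferred chart around each point. The tangent space   *)
(* at x is the model space F: a tangent vector at x is given by its          *)
(* components in the chart chart_at x.                                       *)
Record atlas (F : normedModType R) (M : Type) :=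
  Atlas { charts : set (chart F M); chart_at : M -> chart F M }.

Definition mspace (F : normedModType R) M (A : atlas F M) : Type := M.

End Atlas.

Section ManifoldTopology.
Context {R : realType} (F : normedModType R) (M : Type) (A : atlas F M).

Definition mopen (U : set (mspace A)) : Prop :=
  forall c, charts A c -> forall x, dom c x -> U x ->
    exists W : set F, [/\ open W, W (fwd c x) &
      forall y, dom c y -> W (fwd c y) -> U y].

Lemma mopenT : mopen setT.
Proof. by move=> c _ x _ _; exists setT; split=> //; exact: openT. Qed.

Lemma mopenI : setI_closed mopen.
Proof.
move=> U V oU oV c Ac x cx [Ux Vx].
have [W [oW Wx WU]] := oU c Ac x cx Ux.
have [W' [oW' Wx' WV]] := oV c Ac x cx Vx.
exists (W `&` W'); split=> //; first exact: openI.
by move=> y cy [Wy Wy']; split; [exact: WU|exact: WV].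
Qed.

Lemma mopen_bigU (I : Type) (f : I -> set (mspace A)) :
  (forall i, mopen (f i)) -> mopen (\bigcup_i f i).
Proof.
move=> fo c Ac x cx [i _ fx]; have [W [oW Wx Wf]] := fo i c Ac x cx fx.
by exists W; split=> // y cy Wy; exists i => //; exact: Wf.
Qed.

HB.instance Definition _ := gen_eqMixin (mspace A).
HB.instance Definition _ := gen_choiceMixin (mspace A).
HB.instance Definition _ :=
  isOpenTopological.Build (mspace A) mopenT mopenI mopen_bigU.

Definition is_manifold : Prop :=
  [/\ forall c, charts A c ->
        open (cod c) /\ (forall x, dom c x -> bwd c (fwd c x) = x),
      forall x, charts A (chart_at A x) /\ dom (chart_at A x) x,
      forall c d, charts A c -> charts A d ->
        open (fwd c @` (dom c `&` dom d)) /\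
        smooth_on (fwd c @` (dom c `&` dom d)) (fwd d \o bwd c) &
      hausdorff_space (mspace A)].

(* Passage between the components of a tangent vector at p in the chart      *)
(* chart_at A p and its components in the chart c.                           *)
Definition tcoord (c : chart F M) (p : M) : F -> F :=
  'd (fwd c \o bwd (chart_at A p)) (fwd (chart_at A p) p).

Definition tvec (c : chart F M) (y : F) : F -> F :=
  'd (fwd (chart_at A (bwd c y)) \o bwd c) y.

(* The Lie bracket [X, Y] = DY.X - DX.Y, computed in the chart chart_at A x. *)
Definition vfield_rep (c : chart F M) (X : M -> F) (y : F) : F :=
  tcoord c (bwd c y) (X (bwd c y)).

Definition vfield_bracket (X Y : M -> F) (x : M) : F :=
  let c := chart_at A x in
  'd (vfield_rep c Y) (fwd c x) (X x) - 'd (vfield_rep c X) (fwd c x) (Y x).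

(* Differential forms of degree 1 and 2: families of multilinear forms on    *)
(* the tangent spaces. In a chart, d a(v, w) = D_v (a w) - D_w (a v).        *)
Definition form1_rep (c : chart F M) (a : M -> F -> R) (y : F) (v : F) : R^o :=
  a (bwd c y) (tvec c y v).

Definition form2_rep (c : chart F M) (o : M -> F -> F -> R) (y v w : F) : R^o :=
  o (bwd c y) (tvec c y v) (tvec c y w).

Definition ext_d (a : M -> F -> R) (x : M) (v w : F) : R :=
  let c := chart_at A x in
  'D_v (fun y => form1_rep c a y w) (fwd c x) -
  'D_w (fun y => form1_rep c a y v) (fwd c x).

Definition closed2 (o : M -> F -> F -> R) : Prop := forall x u v w,
  let c := chart_at A x in
  'D_u (fun y => form2_rep c o y v w) (fwd c x) +
  'D_v (fun y => form2_rep c o y w u) (fwd c x) +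
  'D_w (fun y => form2_rep c o y u v) (fwd c x) = 0.

Definition smooth2 (o : M -> F -> F -> R) : Prop := forall c, charts A c ->
  smooth_on (cod c `*` setT)
    (fun p : F * (F * F) => form2_rep c o p.1 p.2.1 p.2.2).

(* On a finite-dimensional manifold. *)
Definition symplectic (o : M -> F -> F -> R) : Prop :=
  [/\ forall x a v v' w, o x (a *: v + v') w = a * o x v w + o x v' w,
      forall x v, o x v v = 0,
      smooth2 o, closed2 o &
      forall x v, (forall w, o x v w = 0) -> v = 0].

End ManifoldTopology.

Section Maps.
Context {R : realType}.

Definition smooth_map (F F' : normedModType R) M N
    (A : atlas F M) (B : atlas F' N) (f : M -> N) : Prop :=
  forall c d p, charts A c -> charts B d -> dom c p -> dom d (f p) ->
    exists W : set F, [/\ open W, W (fwd c p), W `<=` cod c,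
      (forall y, W y -> dom d (f (bwd c y))) &
      smooth_on W (fwd d \o f \o bwd c)].

Definition mdiff (F F' : normedModType R) M N
    (A : atlas F M) (B : atlas F' N) (f : M -> N) (x : M) : F -> F' :=
  'd (fwd (chart_at B (f x)) \o f \o bwd (chart_at A x))
     (fwd (chart_at A x) x).

Definition diffeomorphism (F F' : normedModType R) M N
    (A : atlas F M) (B : atlas F' N) (f : M -> N) : Prop :=
  smooth_map A B f /\
  exists g, [/\ cancel f g, cancel g f & smooth_map B A g].

(* The differential of a submersion of Banach manifolds is a split           *)
(* surjection: it has a continuous linear right inverse.                     *)
Definition submersion (F F' : normedModType R) M N
    (A : atlas F M) (B : atlas F' N) (f : M -> N) : Prop :=
  smooth_map A B f /\
  forall x, exists s : {linear F' -> F},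
    continuous s /\ cancel s (mdiff A B f x).

Definition pullback2 (F F' : normedModType R) M N
    (A : atlas F M) (B : atlas F' N) (f : M -> N) (o : N -> F' -> F' -> R)
    (x : M) (v w : F) : R :=
  o (f x) (mdiff A B f x v) (mdiff A B f x w).

Definition space_atlas (F : normedModType R) : atlas F F :=
  let c := Chart setT id id in Atlas [set c] (fun=> c).

Definition prod_chart (F F' : normedModType R) M N
    (c : chart F M) (d : chart F' N) : chart (F * F')%type (M * N) :=
  Chart (dom c `*` dom d) (fun p => (fwd c p.1, fwd d p.2))
    (fun q => (bwd c q.1, bwd d q.2)).

Definition prod_atlas (F F' : normedModType R) M N
    (A : atlas F M) (B : atlas F' N) : atlas (F * F')%type (M * N) :=
  Atlas [set e | exists c d, [/\ charts A c, charts B d & e = prod_chart c d]]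
    (fun p => prod_chart (chart_at A p.1) (chart_at B p.2)).

(* A makes the subset S of E a (split) submanifold of E modelled on F: every *)
(* point of S has a chart (W, phi) of E with values in F x F' such that      *)
(* phi (W `&` S) = phi W `&` (F x 0), and the first component of phi is one  *)
(* of the charts of A.                                                       *)
Definition is_submanifold (E F : normedModType R) (S : set E)
    (A : atlas F {x : E | S x}) : Prop :=
  is_manifold A /\
  forall p : {x : E | S x}, exists (F' : normedModType R)
      (phi : E -> (F * F')%type) (psi : (F * F')%type -> E) (W : set E),
    [/\ open W, W (sval p), open (phi @` W),
        smooth_on W phi /\ smooth_on (phi @` W) psi &
        forall x, W x -> psi (phi x) = x] /\
    [/\ forall x, W x -> (S x <-> (phi x).2 = 0) &
        exists c, [/\ charts A c,
          dom c = [set q | W (sval q)] &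
          forall q, dom c q -> fwd c q = (phi (sval q)).1]].

End Maps.

Definition simply_connected {R : realType} (T : topologicalType) : Prop :=
  forall gamma : R -> T,
    {within unitI, continuous gamma} -> gamma 0 = gamma 1 ->
  exists H : R * R -> T,
    [/\ {within unitI `*` unitI, continuous H},
        forall s, unitI s -> H (s, 0) = gamma s,
        forall s, unitI s -> H (s, 1) = gamma 0 &
        forall t, unitI t -> H (0, t) = gamma 0 /\ H (1, t) = gamma 0].

(* (p, a): a is the covector at p with components a in the dual of the basis *)
(* of T_p M given by the preferred chart at p.                               *)
Definition cotangent (R : realType) (n : nat) (M : Type) : Type :=
  (M * 'rV[R]_n)%type.

Section Lie.
Context {R : realType} {n : nat}.
Implicit Types (br : 'rV[R]_n -> 'rV[R]_n -> 'rV[R]_n) (a v w x : 'rV[R]_n).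

Definition is_lie_bracket br : Prop :=
  [/\ forall (k : R) u v w, br (k *: u + v) w = k *: br u w + br v w,
      forall v, br v v = 0 &
      forall u v w, br u (br v w) + br v (br w u) + br w (br u v) = 0].

(* struct_const br i j k is f^{ij}_k: [e^i, e^j] = f^{ij}_k e^k. *)
Definition struct_const br (i j k : 'I_n) : R :=
  br (delta_mx 0 i) (delta_mx 0 j) 0 k.

(* A linear form on R^n is represented by its row of coordinates in the dual *)
(* basis, with the pairing:                                                  *)
Definition pairing a v : R := \sum_i a 0 i * v 0 i.

(* The transpose L^* of a linear map L. *)
Definition dual_map (L : 'rV[R]_n -> 'rV[R]_n) a : 'rV[R]_n :=
  \row_i pairing a (L (delta_mx 0 i)).

Definition kirillov_kostant br x (i j : 'I_n) : R :=
  \sum_k struct_const br i j k * x 0 k.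

Section Group.
Context {G : groupType} (A : atlas 'rV[R]_n G).

Definition is_lie_group : Prop :=
  [/\ is_manifold A, @second_countable (mspace A),
      smooth_map (prod_atlas A A) A (fun p : G * G => (p.1 * p.2)%g) &
      smooth_map A A (fun g : G => (g^-1)%g)].

Definition ltrans (g h : G) : G := (g * h)%g.
Definition rtrans (g h : G) : G := (h * g)%g.

Definition left_invariant_field v (g : G) : 'rV[R]_n :=
  mdiff A A (ltrans g) 1%g v.

(* theta identifies the Lie algebra (R^n, br) with T_e G, the bracket of     *)
(* T_e G being that of left invariant vector fields.                         *)
Definition is_lie_algebra_of br (theta theta' : {linear 'rV[R]_n -> 'rV[R]_n}) :
    Prop :=
  [/\ cancel theta theta', cancel theta' theta &
      forall v w, theta (br v w) =
        vfield_bracket A (left_invariant_field (theta v))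
          (left_invariant_field (theta w)) 1%g].

End Group.

Section Cotangent.
Context {M : Type} (A : atlas 'rV[R]_n M).

Definition cot_chart (c : chart 'rV[R]_n M) :
    chart ('rV[R]_n * 'rV[R]_n)%type (cotangent R n M) :=
  Chart [set q : cotangent R n M | dom c q.1]
    (fun q : cotangent R n M =>
       (fwd c q.1, dual_map (tvec A c (fwd c q.1)) q.2))
    (fun y => (bwd c y.1, dual_map (tcoord A c (bwd c y.1)) y.2)).

Definition cot_atlas : atlas ('rV[R]_n * 'rV[R]_n)%type (cotangent R n M) :=
  Atlas [set cot_chart c | c in charts A]
    (fun q => cot_chart (chart_at A q.1)).

Definition tautological (q : cotangent R n M) (v : 'rV[R]_n * 'rV[R]_n) : R :=
  pairing q.2 (mdiff cot_atlas A (fun q : cotangent R n M => q.1) q v).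

Definition canonical_form := ext_d cot_atlas tautological.

End Cotangent.

Section CotangentGroupoid.
Context {G : groupType} (A : atlas 'rV[R]_n G).
Context (theta theta' : {linear 'rV[R]_n -> 'rV[R]_n}).

Definition cot_unit x : cotangent R n G := (1%g, dual_map theta' x).

Definition cot_l (q : cotangent R n G) : 'rV[R]_n :=
  dual_map theta (dual_map (mdiff A A (rtrans q.1) 1%g) q.2).

Definition cot_r (q : cotangent R n G) : 'rV[R]_n :=
  dual_map theta (dual_map (mdiff A A (ltrans q.1) 1%g) q.2).

(* cot_mul p q s means that p and q are composable with product s. *)
Definition cot_mul (p q s : cotangent R n G) : Prop :=
  [/\ cot_r p = cot_l q, s.1 = (p.1 * q.1)%g,
      dual_map (mdiff A A (rtrans q.1) p.1) s.2 = p.2 &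
      dual_map (mdiff A A (ltrans p.1) q.1) s.2 = q.2].

End CotangentGroupoid.
End Lie.

Section PhaseSpace.
Context {R : realType} {n : nat}.
Variable br : 'rV[R]_n -> 'rV[R]_n -> 'rV[R]_n.

(* A pair (X, eta) is given by X and the coefficient eta_u of eta = eta_u du. *)
Definition is_solution (c : C1 'rV[R]_n * C0 'rV[R]_n) : Prop :=
  forall u, unitI u -> forall i,
    (derive1 c.1 u) 0 i +
    \sum_j kirillov_kostant br (c.1 u) i j * c.2 u 0 j = 0.

Definition phase_space : Type := {c | is_solution c}.

Definition is_gauge (c v : C1 'rV[R]_n * C0 'rV[R]_n) : Prop :=
  exists beta : C1 'rV[R]_n, [/\ beta 0 = 0, beta 1 = 0 &
    forall u, unitI u -> forall i,
      v.1 u 0 i = - \sum_j kirillov_kostant br (c.1 u) i j * beta u 0 j /\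
      v.2 u 0 i = (derive1 beta u) 0 i +
        \sum_j \sum_k struct_const br j k i * c.2 u 0 j * beta u 0 k].

Definition gauge_equiv (c c' : phase_space) : Prop :=
  exists gamma : C1 (C1 'rV[R]_n * C0 'rV[R]_n)%type,
    [/\ gamma 0 = sval c, gamma 1 = sval c' &
      forall t, unitI t ->
        is_solution (gamma t) /\ is_gauge (gamma t) (derive1 gamma t)].

Definition is_leaf (L : set phase_space) : Prop :=
  exists c, L = [set c' | gauge_equiv c c'].

Definition leaf_space : Type := {L | is_leaf L}.

Lemma leaf_subproof (c : phase_space) : is_leaf [set c' | gauge_equiv c c'].
Proof. by exists c. Qed.

Definition leaf (c : phase_space) : leaf_space := exist _ _ (leaf_subproof c).

Lemma is_solution_cst (x : 'rV[R]_n) : is_solution (MkC1 (C1_pred_cst x), 0).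
Proof.
move=> u _ i /=; rewrite derive1_cst mxE add0r.
by apply: big1 => j _; rewrite mxE mulr0.
Qed.

Definition unit_solution (x : 'rV[R]_n) : phase_space :=
  exist _ _ (is_solution_cst x).

Definition leaf_mul (p q s : leaf_space) : Prop :=
  exists c1 c2 c : phase_space,
    let X1 := (sval c1).1 in let eta1 := (sval c1).2 in
    let X2 := (sval c2).1 in let eta2 := (sval c2).2 in
    let X := (sval c).1 in let eta := (sval c).2 in
    [/\ leaf c1 = p, leaf c2 = q, leaf c = s & X1 1 = X2 0] /\
    [/\ eta1 0 = 0, eta1 1 = 0, eta2 0 = 0 & eta2 1 = 0] /\
    (forall u : R, 0 <= u <= 2^-1 ->
       X u = X1 (2 * u) /\ eta u = 2 *: eta1 (2 * u)) /\
    (forall u : R, 2^-1 <= u <= 1 ->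
       X u = X2 (2 * u - 1) /\ eta u = 2 *: eta2 (2 * u - 1)).

Definition field_form (v w : C1 'rV[R]_n * C0 'rV[R]_n) : R :=
  \int[lebesgue_measure]_(u in unitI)
    (\sum_i (v.1 u 0 i * w.2 u 0 i - w.1 u 0 i * v.2 u 0 i)).

End PhaseSpace.

(* Main.v *)
(* Integrating eta along I gives a path hpath eta in G starting at 1 whose left
   logarithmic derivative is eta; put Hol eta := hpath eta 1. The equation for X
   says that X(u) is the coadjoint translate of X(0) by hpath eta u, so the phase space
   is the Banach space of pairs (X(0), eta). Along a gauge path both X(0) and Hol eta are
   constant. Conversely, two forms with the same holonomy have paths in G with the same
   end points, which are homotopic rel end points as G is simply connected, and the
   velocity of such a homotopy is an infinitesimal gauge transformation. As Hol is onto
   by connectedness, (X, eta) |-> (Hol eta, X(0)) induces a bijection of the leaf space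
   with G x g^*, that is, with T^*G trivialized by right translations. Through it l is the
   second component and the concatenation becomes the multiplication of T^*G, because Hol
   is multiplicative. The derivative of Hol at eta in the direction zeta, translated to
   the unit from the right, is the integral k of Ad(hpath eta) zeta; in terms of k the
   form omega is the integral of a total derivative, whose boundary value is the canonical
   form of T^*G in the right trivialization, by the Maurer--Cartan equation. *)

Require Import Defs.
From HB Require Import structures.
From mathcomp Require Import all_boot all_order all_algebra.
From mathcomp Require Import all_classical all_reals all_analysis.
From mathcomp Require Import ring lra.
Set Implicit Arguments.
Unset Strict Implicit.
Unset Printing Implicit Defensive.
Import Order.TTheory GRing.Theory Num.Theory.
Import numFieldNormedType.Exports.
Local Open Scope classical_set_scope.
Local Open Scope ring_scope.

(** * Differential calculus in normed spaces *)

Section Differential.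
Context {R : realType}.
Implicit Types U V W Z : normedModType R.

(** No charts are constructed on the leaf space itself: the leaves are the fibres of the pair (X(0),
    holonomy), so the atlas of T^*G is transported along the bijection, and it remains to show that
    the projection is a submersion. All smoothness comes from one identity: adding zeta to eta
    multiplies the path of eta on the left by the path of zeta twisted by Ad. Differentiability at
    any form thus follows from that at 0, where the path stays in a chart at the unit; the
    derivative is again expressed through Ad along the path, so each order of smoothness yields the
    next. The obstacle is that simple connectedness gives only continuous homotopies, whereas gauge
    paths are C1 curves in a Banach space. It is applied to a loop of end points: along the segment
    between two forms of equal holonomy, the holonomies run round a loop. A contraction of it is
    sampled on a fine grid whose edges become straight rays in the chart at the unit. Multiplying
    paths by these rays moves the segment row by row to constant holonomy, up to C1 deformations
    inside a chart; step functions flatten the ends of these deformations so that they compose. *)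

Definition mklin V W (f : V -> W) (l : linear f) : {linear V -> W} :=
  HB.pack f (GRing.isLinear.Build _ _ _ _ f l).

Lemma is_diff_eps V W (f df : V -> W) x : linear df -> continuous df ->
  (forall e, 0 < e -> \forall h \near 0, `|f (h + x) - f x - df h| <= e * `|h|) ->
  is_diff x f df.
Proof.
move=> l c H.
have E : f \o shift x = cst (f x) + mklin l +o_ (0 : V) id.
  apply/eqaddoP => e e0; have := H e e0; apply: filterS => h /=.
  by rewrite -[(f \o shift x - (cst (f x) + df)) h]/(f (h + x) - (f x + df h)) opprD addrA.
have D := diff_unique (df := mklin l) c E.
split => //; apply/diff_locallyP; rewrite D; split => //.
Qed.

Lemma diff_eps V W (f : V -> W) x : differentiable f x ->
  forall e, 0 < e -> \forall h \near 0, `|f (h + x) - f x - 'd f x h| <= e * `|h|.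
Proof.
move=> /diff_locallyP[_ /eqaddoP H] e e0; have := H e e0; apply: filterS => h /=.
by rewrite -[(f \o shift x - (cst (f x) + _)) h]/(f (h + x) - (f x + 'd f x h)) opprD addrA.
Qed.

Lemma near_is_diff V W (f g df : V -> W) x : {near x, f =1 g} ->
  is_diff x f df -> is_diff x g df.
Proof.
move=> fg [df1 df2].
apply: is_diff_eps => [a u v|v|e e0].
- by rewrite -df2 linearP.
- by rewrite -df2; exact: diff_continuous.
have fgx := nbhs_singleton fg.
have := diff_eps df1 e0; rewrite df2.
have fg' : \forall h \near (0 : V), f (h + x) = g (h + x).
  by move: fg; rewrite (near_shift 0) /= subr0.
move: fg'; apply: filterS2 => h <-; by rewrite -fgx.
Qed.

Lemma near_differentiable V W (f g : V -> W) x : {near x, f =1 g} ->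
  differentiable f x -> differentiable g x.
Proof. by move=> fg df; have [] := near_is_diff fg (differentiableP df). Qed.

Lemma near_diff V W (f g : V -> W) x : {near x, f =1 g} ->
  differentiable f x -> 'd g x = 'd f x :> (V -> W).
Proof. by move=> fg df; have [] := near_is_diff fg (differentiableP df). Qed.

Lemma lin_bound_continuous V W (f : V -> W) (k : R) : linear f ->
  (forall x, `|f x| <= k * `|x|) -> continuous f.
Proof.
move=> l fk.
have -> : f = mklin l by [].
apply: bounded_linear_continuous; apply/linear_boundedP.
near=> r => x; by rewrite (le_trans (fk x))// ler_wpM2r//; near: r; apply: nbhs_pinfty_ge; exact: num_real.
Unshelve. all: by end_near. Qed.

(** A predicate on bare functions rather than a bundled type, so that derivatives given by formulas
    compose freely. *)
Definition contlin V W (f : V -> W) := linear f /\ continuous f.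

Lemma contlin_is_diff V W (f : V -> W) x : contlin f -> is_diff x f f.
Proof.
move=> [l c]; apply: is_diff_eps => // e e0; apply: filterE => h.
have -> : f (h + x) = f h + f x by exact: (linearD (mklin l)).
by rewrite addrK subrr normr0 mulr_ge0 // ltW.
Qed.

Lemma contlin_bound V W (f : V -> W) : contlin f ->
  exists2 k, 0 < k & forall x, `|f x| <= k * `|x|.
Proof. by move=> [l c]; exact: (@linear_lipschitz _ _ _ (mklin l)). Qed.

Lemma contlin_fst V W : contlin (fst : V * W -> V).
Proof. by split=> // x; exact: cvg_fst. Qed.

Lemma contlin_snd V W : contlin (snd : V * W -> W).
Proof. by split=> // x; exact: cvg_snd. Qed.

Lemma contlin_comp U V W (g : V -> W) (f : U -> V) : contlin f -> contlin g ->
  contlin (g \o f).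
Proof.
move=> [fl fc] [gl gc]; split=> [a u v|x] /=; first by rewrite fl gl.
by apply: continuous_comp; [exact: fc|exact: gc].
Qed.

Lemma contlin_pair U V W (f : U -> V) (g : U -> W) : contlin f -> contlin g ->
  contlin (fun x => (f x, g x)).
Proof.
move=> [fl fc] [gl gc]; split=> [a u v|x]; first by rewrite fl gl.
by apply: cvg_pair; [exact: fc|exact: gc].
Qed.

Lemma contlin_id V : contlin (fun x : V => x).
Proof. by split=> // x; exact: cvg_id. Qed.

Lemma contlin_0 V W : contlin (fun _ : V => 0 : W).
Proof. by split=> [a u v|x]; [rewrite scaler0 addr0|exact: cvg_cst]. Qed.

Lemma contlin_diff V W (f : V -> W) x : differentiable f x -> contlin ('d f x).
Proof. by move=> df; split; [exact: linearP|exact: diff_continuous]. Qed.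

(** Continuity is stated as a bound, the form in which it controls the quadratic remainder and
    passes pointwise to [C0]. *)
Definition contbil U V W (B : U -> V -> W) :=
  [/\ forall u, linear (B u), forall v, linear (B^~ v) &
    exists C, forall u v, `|B u v| <= C * `|u| * `|v|].

Lemma contbil_bound U V W (B : U -> V -> W) : contbil B ->
  exists2 C, 0 < C & forall u v, `|B u v| <= C * `|u| * `|v|.
Proof.
move=> [_ _ [C HC]]; exists (`|C| + 1); first by rewrite ltr_wpDl.
move=> u v; apply: le_trans (HC u v) _; rewrite -!mulrA ler_wpM2r ?mulr_ge0//.
by rewrite (le_trans (ler_norm C))// lerDl.
Qed.

(** The remainder is exactly [B h.1 h.2], which is of second order in [h]. *)
Lemma contbil_is_diff U V W (B : U -> V -> W) p : contbil B ->
  is_diff p (fun q : U * V => B q.1 q.2) (fun q : U * V => B p.1 q.2 + B q.1 p.2).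
Proof.
move=> cB; have [Br Bl _] := cB; have [C C0 HC] := contbil_bound cB.
have lin : linear (fun q : U * V => B p.1 q.2 + B q.1 p.2).
  by move=> a u v /=; rewrite Br Bl scalerDr addrACA.
apply: is_diff_eps => //.
- apply: (@lin_bound_continuous _ _ _ (C * `|p.1| + C * `|p.2|)) => // q.
  apply: le_trans (ler_normD _ _) _; rewrite mulrDl lerD//.
    by apply: le_trans (HC _ _) _; rewrite ler_wpM2l ?mulr_ge0 ?(ltW C0)// le_max lexx orbT.
  apply: le_trans (HC _ _) _; rewrite mulrAC ler_wpM2l ?mulr_ge0 ?(ltW C0)//.
  by rewrite le_max lexx.
- move=> e e0; near=> h.
  have -> : B (h + p).1 (h + p).2 - B p.1 p.2 - (B p.1 h.2 + B h.1 p.2) = B h.1 h.2.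
    have := Bl (h + p).2 1 h.1 p.1; rewrite !scale1r => ->.
    have := Br h.1 1 h.2 p.2; rewrite !scale1r => ->.
    have := Br p.1 1 h.2 p.2; rewrite !scale1r => ->.
    by rewrite addrA addrK -addrA [X in _ + X - _]addrC addrK.
  apply: le_trans (HC _ _) _.
  have h1 : `|h.1| <= `|h| by rewrite le_max lexx.
  have h2 : `|h.2| <= `|h| by rewrite le_max lexx orbT.
  have hs : C * `|h| <= e.
    rewrite mulrC -ler_pdivlMr//; near: h.
    exact: (@nbhs0_le _ (U * V)%type _ (divr_gt0 e0 C0)).
  apply: ler_pM => //; rewrite ?mulr_ge0 ?(ltW C0)//.
  by apply: le_trans hs; rewrite ler_wpM2l// ltW.
Unshelve. all: by end_near. Qed.

End Differential.

(** * Calculus of Ck and smooth maps *)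

Section Smooth.
Context {R : realType}.
Implicit Types U V W Z : normedModType R.

Lemma nbhs_open V (U : set V) x : open U -> U x -> nbhs x U.
Proof. by move=> oU Ux; apply: open_nbhs_nbhs. Qed.

Lemma openXT V W (U : set V) : open U -> open (U `*` [set: W]).
Proof. by move=> oU; rewrite openE => -[x y] [/= Ux _]; exists (U, setT) => /=; [split; [exact: nbhs_open|exact: filterT]|]. Qed.

(** As in all inductions on [k] here, the spaces and maps are generalized first, because the tangent
    map lives on [V * V]. *)
Lemma Ck_ext k V W (U : set V) (f g : V -> W) : open U ->
  (forall x, U x -> f x = g x) -> Ck k U f -> Ck k U g.
Proof.
elim: k V W U f g => [|k IH] V W U f g oU fg /=.
  move=> cf x Ux; have := cf x Ux; rewrite /prop_for /continuous_at (fg x Ux) => cfx.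
  apply: cvg_trans cfx; apply: near_eq_cvg.
  by apply: filterS (nbhs_open oU Ux) => y /fg.
have nfg x : U x -> {near x, f =1 g} by move=> Ux; apply: filterS (nbhs_open oU Ux) => y /fg.
move=> [df cf]; split=> [x Ux|].
  by apply: near_differentiable (nfg x Ux) (df x Ux).
apply: IH cf; first exact: openXT.
by move=> [x v] [/= Ux _]; rewrite (near_diff (nfg x Ux) (df x Ux)).
Qed.

Lemma Ck_sub k V W (U U' : set V) (f : V -> W) : U' `<=` U -> Ck k U f -> Ck k U' f.
Proof.
elim: k V W U U' f => [|k IH] V W U U' f UU /=; first by move=> H x /UU /H.
move=> [H1 H2]; split; first by move=> x /UU /H1.
by apply: IH H2 => -[x v] [/= /UU]; split.
Qed.

Lemma Ck_local k V W (U : set V) (f : V -> W) :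
  (forall x, U x -> exists U' : set V, U' x /\ Ck k U' f) -> Ck k U f.
Proof.
elim: k V W U f => [|k IH] V W U f H /=.
  by move=> x /H[U' [U'x]]; exact.
split; first by move=> x /H[U' [U'x []]] + _; exact.
apply: IH => -[x v] [/= Ux _]; have [U' [U'x [_ cU']]] := H x Ux.
by exists (U' `*` setT).
Qed.

Lemma CkS k V W (U : set V) (f : V -> W) : Ck k.+1 U f -> Ck k U f.
Proof.
elim: k V W U f => [|k IH] V W U f /=.
  by move=> [df _] x Ux; apply: differentiable_continuous; exact: df.
by move=> [df cf]; split=> //; exact: IH.
Qed.

Lemma Ck_cst k V W (U : set V) (w : W) : open U -> Ck k U (fun=> w).
Proof.
elim: k V W U w => [|k IH] V W U w oU /=; first by move=> x _; exact: cvg_cst.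
split; first by move=> x _; exact: differentiable_cst.
apply: Ck_ext (IH _ _ _ 0 (openXT oU)); first exact: openXT.
by move=> x _ /=; rewrite diff_cst.
Qed.

Lemma Ck_lin k V W (U : set V) (f : V -> W) : open U -> contlin f -> Ck k U f.
Proof.
elim: k V W U f => [|k IH] V W U f oU cf /=.
  by move=> x _; exact: cf.2.
have D x : is_diff x f f by exact: contlin_is_diff.
split; first by move=> x _.
apply: Ck_ext (IH _ _ _ _ (openXT oU) (contlin_comp (contlin_snd _ _) cf)).
  exact: openXT.
by move=> x _ /=; rewrite diff_val.
Qed.

Lemma Ck_pair k U V W (A : set U) (f : U -> V) (g : U -> W) : open A ->
  Ck k A f -> Ck k A g -> Ck k A (fun x => (f x, g x)).
Proof.
elim: k U V W A f g => [|k IH] U V W A f g oA /=.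
  by move=> cf cg x Ax; apply: cvg_pair; [exact: cf|exact: cg].
move=> [df cf] [dg cg]; split=> [x Ax|].
  by apply: differentiable_pair; [exact: df|exact: dg].
apply: Ck_ext (IH _ _ _ _ _ _ (openXT oA) cf cg); first exact: openXT.
by move=> [x v] [/= Ax _]; rewrite diff_pair//; [exact: df|exact: dg].
Qed.

(** The tangent map of [g \o f] is that of [g] after the pair of [f] and ['d f]. The induction
    therefore needs [f] at order [k] besides its tangent map, which [CkS] supplies. *)
Lemma Ck_comp k U V W (A : set U) (B : set V) (f : U -> V) (g : V -> W) :
  open A -> (forall x, A x -> B (f x)) -> Ck k A f -> Ck k B g -> Ck k A (g \o f).
Proof.
elim: k U V W A B f g => [|k IH] U V W A B f g oA AB /=.
  move=> cf cg x Ax; apply: continuous_comp; first exact: cf.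
  by apply: cg; exact: AB.
move=> Cf [dg cg]; have [df cf] := Cf; split=> [x Ax|].
  by apply: differentiable_comp; [exact: df|apply: dg; exact: AB].
have c1 : Ck k (A `*` [set: U]) (fun p => (f (fst p), 'd f (fst p) (snd p))).
  apply: Ck_pair => //; first exact: openXT.
  apply: (IH _ _ _ _ A fst f) => //; first exact: openXT.
  - by move=> p [].
  - by apply: Ck_lin; [exact: openXT|exact: contlin_fst].
  - exact: CkS.
have AB' : forall p : U * U, (A `*` [set: U]) p -> (B `*` [set: V]) (f (fst p), 'd f (fst p) (snd p)).
  by move=> [x v] [/= Ax _]; split=> //=; exact: AB.
apply: Ck_ext (IH _ _ _ _ _ _ _ (openXT oA) AB' c1 cg); first exact: openXT.
by move=> [x v] [/= Ax _]; rewrite (diff_comp (df x Ax) (dg _ (AB x Ax))).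
Qed.

Lemma Ck_add_id k V W : Ck k [set: V * V] (fun p : V * V => p.1 + p.2).
Proof.
apply: Ck_lin; first exact: openT.
split=> [a u v /=|x]; first by rewrite scalerDr addrACA.
by apply: cvgD; [exact: cvg_fst|exact: cvg_snd].
Qed.

Lemma Ck_add k V W (U : set V) (f g : V -> W) : open U -> Ck k U f -> Ck k U g ->
  Ck k U (fun x => f x + g x).
Proof.
move=> oU cf cg; have := Ck_pair oU cf cg => c.
by have := Ck_comp (B := setT) oU _ c (Ck_add_id k W W); exact.
Qed.

(** It is enough to treat [B] on [U * V]: its tangent map is a sum of two copies of [B] precomposed
    with linear maps, so the induction closes. *)
Lemma Ck_bil k U V W Z (A : set Z) (B : U -> V -> W) (f : Z -> U) (g : Z -> V) :
  contbil B -> open A -> Ck k A f -> Ck k A g -> Ck k A (fun z => B (f z) (g z)).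
Proof.
move=> cB oA cf cg.
suff H : Ck k [set: U * V] (fun q : U * V => B q.1 q.2).
  by have := Ck_comp (B := setT) oA _ (Ck_pair oA cf cg) H; exact.
elim: k {cf cg f g oA A Z} => [|k IH] /=.
  move=> p _; apply: differentiable_continuous.
  exact: (@ex_diff _ _ _ _ _ _ _ (contbil_is_diff p cB)).
split=> [p _|]; first exact: (@ex_diff _ _ _ _ _ _ _ (contbil_is_diff p cB)).
have oT : open ([set: U * V] `*` [set: U * V]) by apply: openXT; exact: openT.
have H1 : Ck k ([set: U * V] `*` [set: U * V]) (fun p => B p.1.1 p.2.2).
  apply: (@Ck_comp k _ _ _ _ setT (fun p => (p.1.1, p.2.2)) (fun q => B q.1 q.2)) => //.
  apply: Ck_lin => //; apply: contlin_pair.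
    exact: (contlin_comp (contlin_fst _ _) (contlin_fst _ _)).
  exact: (contlin_comp (contlin_snd _ _) (contlin_snd _ _)).
have H2 : Ck k ([set: U * V] `*` [set: U * V]) (fun p => B p.2.1 p.1.2).
  apply: (@Ck_comp k _ _ _ _ setT (fun p => (p.2.1, p.1.2)) (fun q => B q.1 q.2)) => //.
  apply: Ck_lin => //; apply: contlin_pair.
    exact: (contlin_comp (contlin_snd _ _) (contlin_fst _ _)).
  exact: (contlin_comp (contlin_fst _ _) (contlin_snd _ _)).
apply: Ck_ext (Ck_add oT H1 H2) => // p _.
by rewrite (@diff_val _ _ _ _ _ _ _ (contbil_is_diff p.1 cB)).
Qed.

Lemma smooth_tangent V W (U : set V) (f : V -> W) : smooth_on U f ->
  smooth_on (U `*` setT) (fun p : V * V => 'd f (fst p) (snd p)).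
Proof. by move=> sf k; case: (sf k.+1). Qed.

Lemma smooth_diff V W (U : set V) (f : V -> W) x : smooth_on U f -> U x ->
  differentiable f x.
Proof. by move=> sf Ux; case: (sf 1%N) => + _; exact. Qed.

Lemma smooth_cont V W (U : set V) (f : V -> W) x : smooth_on U f -> U x ->
  {for x, continuous f}.
Proof. by move=> /(_ 0%N) /= + Ux; exact. Qed.

Lemma smooth_ext V W (U : set V) (f g : V -> W) : open U ->
  (forall x, U x -> f x = g x) -> smooth_on U f -> smooth_on U g.
Proof. by move=> oU fg sf k; exact: Ck_ext (sf k). Qed.

Lemma smooth_sub V W (U U' : set V) (f : V -> W) : U' `<=` U ->
  smooth_on U f -> smooth_on U' f.
Proof. by move=> UU sf k; exact: Ck_sub (sf k). Qed.

Lemma smooth_local V W (U : set V) (f : V -> W) :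
  (forall x, U x -> exists U' : set V, U' x /\ smooth_on U' f) -> smooth_on U f.
Proof.
by move=> H k; apply: Ck_local => x /H[U' [U'x s]]; exists U'; split.
Qed.

Lemma smooth_cst V W (U : set V) (w : W) : open U -> smooth_on U (fun=> w).
Proof. by move=> oU k; exact: Ck_cst. Qed.

Lemma smooth_lin V W (U : set V) (f : V -> W) : open U -> contlin f -> smooth_on U f.
Proof. by move=> oU cf k; exact: Ck_lin. Qed.

Lemma smooth_id V (U : set V) : open U -> smooth_on U (fun x => x).
Proof. by move=> oU; apply: (smooth_lin oU); exact: contlin_id. Qed.

Lemma smooth_pair U V W (A : set U) (f : U -> V) (g : U -> W) : open A ->
  smooth_on A f -> smooth_on A g -> smooth_on A (fun x => (f x, g x)).
Proof. by move=> oA sf sg k; exact: Ck_pair. Qed.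

Lemma smooth_comp U V W (A : set U) (B : set V) (f : U -> V) (g : V -> W) :
  open A -> (forall x, A x -> B (f x)) -> smooth_on A f -> smooth_on B g ->
  smooth_on A (fun x => g (f x)).
Proof. by move=> oA AB sf sg k; exact: (Ck_comp oA AB). Qed.

Lemma smooth_add V W (U : set V) (f g : V -> W) : open U ->
  smooth_on U f -> smooth_on U g -> smooth_on U (fun x => f x + g x).
Proof. by move=> oU sf sg k; exact: Ck_add. Qed.

Lemma smooth_bil U V W Z (A : set Z) (B : U -> V -> W) (f : Z -> U) (g : Z -> V) :
  contbil B -> open A -> smooth_on A f -> smooth_on A g ->
  smooth_on A (fun z => B (f z) (g z)).
Proof. by move=> cB oA sf sg k; exact: Ck_bil. Qed.

Lemma smooth_sum V W (U : set V) (I : Type) (r : seq I) (f : I -> V -> W) : open U ->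
  (forall i, smooth_on U (f i)) -> smooth_on U (fun x => \sum_(i <- r) f i x).
Proof.
move=> oU sf; elim: r => [|i r IH].
  apply: smooth_ext (smooth_cst 0 oU) => // x _; by rewrite big_nil.
apply: smooth_ext (smooth_add oU (sf i) IH) => // x _; by rewrite big_cons.
Qed.

Lemma smooth_partial U V W (A : set (U * V)) (f : U * V -> W) : open A ->
  smooth_on A f -> smooth_on (A `*` [set: V])
    (fun p : (U * V) * V => 'd f (fst p) (0, snd p)).
Proof.
move=> oA sf.
apply: (smooth_comp (B := A `*` setT) (f := fun p : (U * V) * V => (p.1, (0 : U, p.2)))
  (g := fun q => 'd f (fst q) (snd q))).
- exact: openXT.
- by move=> x [].
- apply: smooth_lin; first exact: openXT.
  apply: contlin_pair; first exact: contlin_fst.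
  by apply: contlin_pair; [exact: contlin_0|exact: contlin_snd].
- exact: smooth_tangent.
Qed.

End Smooth.

(** * Derivatives of curves, mean value inequalities, primitives *)

Notation der g u l := (is_derive (u : Real.sort _) (1 : Real.sort _) g l).

Section OneVariable.
Context {R : realType}.
Implicit Types U V W Z : normedModType R.

Lemma derive1_is_diff W (g : R -> W) u g' : der g u g' ->
  is_diff u g (fun h => h *: g').
Proof.
move=> [dg <-]; split; first by apply/derivable1_diffP.
by rewrite deriv1E// derive1E.
Qed.

Lemma is_diff_derive V W (f df : V -> W) x v : is_diff x f df -> is_derive x v f (df v).
Proof.
move=> [df1 <-]; split; first exact: diff_derivable.
by rewrite deriveE.
Qed.

Lemma is_diff_derive1 W (g : R -> W) u dg : is_diff u g dg -> der g u (dg 1).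
Proof. exact: is_diff_derive. Qed.

Lemma is_derive_diff_comp V W (g : R -> V) u g' (f df : V -> W) :
  der g u g' -> is_diff (g u) f df -> der (f \o g) u (df g').
Proof.
move=> /derive1_is_diff dg df1.
have H : is_diff u (f \o g) (df \o (fun h => h *: g')) by exact: is_diff_comp.
by have := is_diff_derive1 H; rewrite /= scale1r.
Qed.

Lemma is_derive_pair V W (f : R -> V) (g : R -> W) u f' g' :
  der f u f' -> der g u g' ->
  der (fun x => (f x, g x)) u (f', g').
Proof.
move=> /derive1_is_diff df /derive1_is_diff dg.
have H := is_diff_pair df dg.
by have := is_diff_derive1 H; rewrite /= !scale1r.
Qed.

Lemma is_derive_contlin V W (L : V -> W) (g : R -> V) u g' :
  contlin L -> der g u g' -> der (fun x => L (g x)) u (L g').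
Proof.
move=> cL dg; have := is_derive_diff_comp dg (contlin_is_diff (g u) cL).
exact.
Qed.

Lemma is_derive_bil U V W (B : U -> V -> W) (f : R -> U) (g : R -> V) u f' g' :
  contbil B -> der f u f' -> der g u g' ->
  der (fun x => B (f x) (g x)) u (B (f u) g' + B f' (g u)).
Proof.
move=> cB df dg.
have H := is_derive_diff_comp (is_derive_pair df dg) (contbil_is_diff (f u, g u) cB).
exact: H.
Qed.

Lemma is_derive_continuous W (g : R -> W) u g' : der g u g' ->
  {for u, continuous g}.
Proof.
by move=> /derive1_is_diff[dg _]; exact: differentiable_continuous.
Qed.

Lemma is_derive_derive1 W (g : R -> W) u g' : der g u g' -> derive1 g u = g'.
Proof. by move=> [_ <-]; rewrite derive1E. Qed.

Lemma der_cst W (w : W) u : der (fun=> w) u 0.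
Proof. by split; [exact: derivable_cst|exact: derive_cst]. Qed.

Lemma der_id u : der (fun x : R => x) u 1.
Proof. by split; [exact: derivable_id|exact: derive_id]. Qed.

Lemma derD W (f g : R -> W) u f' g' : der f u f' -> der g u g' ->
  der (fun x => f x + g x) u (f' + g').
Proof. by move=> df dg; exact: is_deriveD. Qed.

Lemma derB W (f g : R -> W) u f' g' : der f u f' -> der g u g' ->
  der (fun x => f x - g x) u (f' - g').
Proof. by move=> df dg; exact: is_deriveB. Qed.

Lemma derZ W (f : R -> W) a u f' : der f u f' -> der (fun x => a *: f x) u (a *: f').
Proof. by move=> df; exact: is_deriveZ. Qed.

Lemma mx_coord_le m n (M : 'M[R]_(m, n)) i j : `|M i j| <= `|M|.
Proof.
rewrite [leRHS]/Num.Def.normr/= mx_normrE.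
by apply: le_trans (le_bigmax _ _ (i, j)).
Qed.

Lemma mx_norm_le m n (M : 'M[R]_(m, n)) b : 0 <= b ->
  (forall i j, `|M i j| <= b) -> `|M| <= b.
Proof.
move=> b0 H; rewrite [leLHS]/Num.Def.normr/= mx_normrE.
by apply: bigmax_le => // i _; exact: H.
Qed.

Lemma is_derive_mx m n (M : R -> 'M[R]_(m, n)) u (M' : 'M[R]_(m, n)) :
  (forall i j, der (fun x => M x i j : R) u (M' i j)) -> der M u M'.
Proof.
move=> H; have D : derivable M u 1 by apply/derivable_mxP => i j; case: (H i j).
split=> //; rewrite derive_mx//; apply/matrixP => i j; rewrite mxE.
by case: (H i j).
Qed.

Lemma is_derive_coord m n (M : R -> 'M[R]_(m, n)) u M' i j :
  der M u M' -> der (fun x => M x i j : R) u (M' i j).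
Proof.
move=> dM; apply: (is_derive_contlin (L := fun M : 'M[R]_(m, n) => M i j : R)) => //.
by split=> [a v w|]; [rewrite !mxE|exact: coord_continuous].
Qed.

(** The norm of a matrix is the maximum of its entries, so the scalar mean value theorem is applied
    to each entry and to its opposite. *)
Lemma mean_value_le m n (f f' : R -> 'M[R]_(m, n)) (g g' : R -> R) a b : a <= b ->
  (forall u, a <= u <= b -> der f u (f' u)) ->
  (forall u, a <= u <= b -> der (g : R -> R) u (g' u)) ->
  (forall u, a <= u <= b -> `|f' u| <= g' u) ->
  `|f b - f a| <= g b - g a.
Proof.
move=> ab df dg fg.
have key (h h' : R -> R) : (forall u, a <= u <= b -> der (h : R -> R) u (h' u)) ->
    (forall u, a <= u <= b -> h' u <= g' u) -> h b - h a <= g b - g a.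
  move=> dh hg.
  have dk u : a <= u <= b -> der ((g : R -> R) - (h : R -> R)) u (g' u - h' u).
    by move=> uab; apply: is_deriveB; [exact: dg|exact: dh].
  have [| |c cab] := @MVT_segment _ (g - h) (fun u => g' u - h' u) a b ab.
    by move=> x /[!in_itv]/= /andP[ax xb]; apply: dk; rewrite !ltW.
    apply: continuous_in_subspaceT => x /[!inE]/= xab.
    apply: (is_derive_continuous (dk x _)).
    by move: xab; rewrite in_itv.
  rewrite -[(g - h) b]/(g b - h b) -[(g - h) a]/(g a - h a) => E.
  rewrite -subr_ge0 (_ : _ - _ = (g b - h b) - (g a - h a)); last by ring.
  rewrite E mulr_ge0 ?subr_ge0//; apply: hg.
  by move: cab; rewrite in_itv.
apply: mx_norm_le => [|i j].
  rewrite subr_ge0; have := key (fun=> 0) (fun=> 0); rewrite subrr subr_ge0; apply.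
  by move=> u uab; exact: le_trans (fg u uab).
rewrite !mxE ler_norml; apply/andP; split.
  rewrite lerNl opprB.
  have := key (fun x => - f x i j) (fun x => - f' x i j).
  rewrite opprK addrC; apply=> u uab.
    by apply: is_deriveN; apply: is_derive_coord; exact: df.
  apply: le_trans (fg u uab); apply: le_trans (mx_coord_le _ i j).
  by rewrite -normrN ler_norm.
apply: (key (fun x => f x i j) (fun x => f' x i j)) => u uab.
  by apply: is_derive_coord; exact: df.
apply: le_trans (fg u uab); apply: le_trans (mx_coord_le _ i j).
exact: ler_norm.
Qed.

Lemma mean_value_cst_le m n (f f' : R -> 'M[R]_(m, n)) (C a b : R) : a <= b ->
  (forall u, a <= u <= b -> der f u (f' u)) ->
  (forall u, a <= u <= b -> `|f' u| <= C) ->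
  `|f b - f a| <= C * (b - a).
Proof.
move=> ab df fC; rewrite mulrBr.
apply: (@mean_value_le _ _ f f' (fun u => C * u) (fun=> C)) => // u _.
by have := @is_deriveZ R R R id C u 1 1 (is_derive_id _ _); rewrite /GRing.scale /= mulr1.
Qed.

Lemma is_derive_cst_eq m n (f : R -> 'M[R]_(m, n)) a b : a <= b ->
  (forall u, a <= u <= b -> der f u 0) -> f b = f a.
Proof.
move=> ab df; apply/eqP; rewrite -subr_eq0 -normr_le0.
have := @mean_value_cst_le _ _ f (fun=> 0) 0 a b ab df.
by rewrite mul0r; apply => u _; rewrite normr0.
Qed.

Lemma unitIP (u : R) : unitI u <-> 0 <= u <= 1.
Proof. by rewrite /unitI /= in_itv. Qed.

Lemma clampI_lo (u : R) : u <= 0 -> clampI u = 0.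
Proof.
by move=> u0; rewrite /clampI min_r ?(le_trans u0)// max_l.
Qed.

Lemma clampI_hi (u : R) : 1 <= u -> clampI u = 1.
Proof. by move=> u1; rewrite /clampI min_l// max_r. Qed.

Lemma clampI_continuous : continuous (@clampI R).
Proof.
move=> u.
have c (w : R) : {for u, continuous (cst w : R -> R)} by exact: cvg_cst.
have i : {for u, continuous (id : R -> R)} by exact: cvg_id.
exact: (continuous_max (c 0) (continuous_min (c 1) i)).
Qed.

(** For [f] constant on the negative axis this is the primitive vanishing at 0. The integral starts
    at -1, with an integrand that vanishes up to 0, so that the fundamental theorem gives a
    two-sided derivative at 0 as well; the term [f 0 * u] restores what was subtracted. *)
Definition rprim (f : R -> R) (u : R) : R :=
  f 0 * u + (\int[lebesgue_measure]_(t in `[(-1)%R, u]) (f t - f 0))%R.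

Lemma rprim_derive (f : R -> R) u : continuous f -> (forall u, f u = f (clampI u)) ->
  der (rprim f : R -> R) u (f u).
Proof.
move=> cf ef.
have f0 t : t <= 0 -> f t - f 0 = 0 by move=> t0; rewrite ef clampI_lo// subrr.
suff H : is_derive u 1 ((fun u => \int[lebesgue_measure]_(t in `[(-1)%R, u]) (f t - f 0))%R : R -> R) (f u - f 0).
  rewrite (_ : f u = f 0 + (f u - f 0)); last by rewrite addrC subrK.
  apply: (@is_deriveD R R R (fun u => f 0 * u)) => //.
  by have := @is_deriveZ R R R id (f 0) u 1 1 (is_derive_id _ _); rewrite /GRing.scale /= mulr1.
have [u0|u0] := ltP u 0.
  rewrite f0 ?ltW//.
  apply: (@near_eq_is_derive _ R R (fun=> 0)).
  have : \forall v \near u, v < 0 by exact: lt_nbhsl.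
  apply: filterS => v v0.
  rewrite (_ : \int[_]_(_ in _) _ = \int[lebesgue_measure]_(t in `[(-1)%R, v]) (cst 0 t))%R.
    by rewrite Rintegral_cst// mul0r.
  apply: eq_Rintegral => t; rewrite inE/= in_itv/= => /andP[_ tv].
  by rewrite f0// (le_trans tv)// ltW.
have cg : continuous (fun t => f t - f 0).
  by move=> t; apply: cvgB; [exact: cf|exact: cvg_cst].
have m1 : (-1 < u)%R by apply: lt_le_trans u0; rewrite ltrN10.
have [|//|d1 d2] := @continuous_FTC1_closed R (fun t => f t - f 0) (-1) u (u + 1) _ _ m1 (cg u).
- by rewrite ltrDl.
- apply: continuous_compact_integrable; first exact: segment_compact.
  exact: continuous_subspaceT.
- by split; [exact: d1|rewrite -d2 derive1E].
Qed.

Lemma rprim0 (f : R -> R) : (forall u, f u = f (clampI u)) -> rprim f 0 = 0.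
Proof.
move=> ef; rewrite /rprim mulr0 add0r.
rewrite (_ : \int[_]_(_ in _) _ = \int[lebesgue_measure]_(t in `[(-1)%R, 0%R]) (cst 0 t))%R.
  by rewrite Rintegral_cst// mul0r.
apply: eq_Rintegral => t; rewrite inE/= in_itv/= => /andP[_ t0].
by rewrite ef clampI_lo// subrr.
Qed.

End OneVariable.

(** * Pointwise operations on C0 and C1 *)

Section C0C1.
Context {R : realType}.
Implicit Types U V W Z : normedModType R.

Lemma C0_ext W (f g : C0 W) : (forall u, unitI u -> f u = g u) -> f = g.
Proof.
move=> fg; apply/val_inj/funext => u /=.
by rewrite (C0_clamp f) (C0_clamp g) fg//; exact: clampI_in.
Qed.

Lemma C0_normE W (f : C0 W) : `|f| = supI f. Proof. by []. Qed.
Lemma C1_normE W (f : C1 W) : `|f| = supI f + supI (derive1 f). Proof. by []. Qed.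

Lemma C0_norm_ub W (f : C0 W) u : `|f u| <= `|f|.
Proof.
rewrite C0_clamp C0_normE; apply: supI_ub; first exact: C0_continuous.
exact: clampI_in.
Qed.

Lemma C0_norm_le W (f : C0 W) b : (forall u, unitI u -> `|f u| <= b) -> `|f| <= b.
Proof. by rewrite C0_normE; exact: supI_le. Qed.

Lemma C0_addE W (f g : C0 W) u : (f + g) u = f u + g u. Proof. by []. Qed.
Lemma C0_scaleE W a (f : C0 W) u : (a *: f) u = a *: f u. Proof. by []. Qed.
Lemma C0_subE W (f g : C0 W) u : (f - g) u = f u - g u. Proof. by []. Qed.
Lemma C1_addE W (f g : C1 W) u : (f + g) u = f u + g u. Proof. by []. Qed.
Lemma C1_scaleE W a (f : C1 W) u : (a *: f) u = a *: f u. Proof. by []. Qed.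
Lemma C1_subE W (f g : C1 W) u : (f - g) u = f u - g u. Proof. by []. Qed.

Lemma C0of_proof W (f : R -> W) :
  (if `[< continuous (f \o clampI) >] then f \o clampI else cst 0) \in @C0_pred R W.
Proof.
case: ifP => [/asboolP cf|_]; last exact: C0_pred_cst.
apply/asboolP; split=> // u /=; rewrite (clampI_id (clampI_in u))//.
Qed.

(* Junk value 0 when f is not continuous on [0, 1]. *)
Definition C0of W (f : R -> W) : C0 W := MkC0 (C0of_proof f).

Arguments C0of : simpl never.

Lemma C0ofE W (f : R -> W) : (forall u, unitI u -> {for u, continuous f}) ->
  forall u, C0of f u = f (clampI u).
Proof.
move=> cf u; rewrite -[LHS]/((if `[< continuous (f \o clampI) >] then f \o clampI else cst 0) u); case: ifPn => // /asboolP[] v.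
apply: continuous_comp; first exact: clampI_continuous.
by apply: cf; exact: clampI_in.
Qed.

Lemma C0of_id W (f : R -> W) : (forall u, unitI u -> {for u, continuous f}) ->
  forall u, unitI u -> C0of f u = f u.
Proof. by move=> cf u uI; rewrite C0ofE// clampI_id. Qed.

Lemma contbil_cont U V W (B : U -> V -> W) (f : R -> U) (g : R -> V) u :
  contbil B -> {for u, continuous f} -> {for u, continuous g} ->
  {for u, continuous (fun x => B (f x) (g x))}.
Proof.
move=> cB cf cg.
have := contbil_is_diff (f u, g u) cB => -[/differentiable_continuous H _].
have := @continuous_comp _ _ _ (fun x => (f x, g x)) (fun q => B q.1 q.2) u _ H.
by apply; exact: cvg_pair.
Qed.

Definition C0lin V W (L : V -> W) (f : C0 V) : C0 W := C0of (L \o f).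

Lemma C0linE V W (L : V -> W) (f : C0 V) u : contlin L -> C0lin L f u = L (f u).
Proof.
move=> [_ cL]; rewrite C0ofE /= ?(C0_clamp f u)// => v _.
by apply: continuous_comp; [exact: C0_continuous|exact: cL].
Qed.

Lemma C0lin_contlin V W (L : V -> W) : contlin L -> contlin (C0lin L).
Proof.
move=> cL; have [k k0 Hk] := contlin_bound cL.
have l : linear (C0lin L).
  move=> a f g; apply: C0_ext => u _.
  by rewrite C0_addE C0_scaleE !C0linE// cL.1.
split=> //; apply: (@lin_bound_continuous _ _ _ _ k) => // f.
apply: C0_norm_le => u _; rewrite C0linE//.
by apply: le_trans (Hk _) _; rewrite ler_wpM2l ?(ltW k0)// C0_norm_ub.
Qed.

Definition C0bil U V W (B : U -> V -> W) (f : C0 U) (g : C0 V) : C0 W :=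
  C0of (fun u => B (f u) (g u)).

Lemma C0bilE U V W (B : U -> V -> W) (f : C0 U) (g : C0 V) u : contbil B ->
  C0bil B f g u = B (f u) (g u).
Proof.
move=> cB; rewrite C0ofE /= ?(C0_clamp f u) ?(C0_clamp g u)// => v _.
by apply: contbil_cont => //; exact: C0_continuous.
Qed.

Lemma C0bil_contbil U V W (B : U -> V -> W) : contbil B -> contbil (C0bil B).
Proof.
move=> cB; have [C C00 HC] := contbil_bound cB; have [Br Bl _] := cB; split.
- move=> f a g h; apply: C0_ext => u _.
  by rewrite C0_addE C0_scaleE !C0bilE// Br.
- move=> h a f g; apply: C0_ext => u _.
  by rewrite C0_addE C0_scaleE !C0bilE// -Bl.
- exists C => f g; apply: C0_norm_le => u _; rewrite C0bilE//.
  apply: le_trans (HC _ _) _; apply: ler_pM; rewrite ?C0_norm_ub ?mulr_ge0 ?(ltW C00)//.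
  by rewrite ler_wpM2l ?(ltW C00)// C0_norm_ub.
Qed.

Lemma contlin_C0eval W (u : R) : contlin (fun f : C0 W => f u).
Proof.
have l : linear (fun f : C0 W => f u) by [].
split=> //; apply: (@lin_bound_continuous _ _ _ _ 1) => // f.
by rewrite mul1r C0_norm_ub.
Qed.

Definition C1C0 W (f : C1 W) : C0 W := C0of f.
Definition C1D W (f : C1 W) : C0 W := C0of (derive1 f).

Lemma C1C0E W (f : C1 W) u : C1C0 f u = f (clampI u).
Proof. by rewrite C0ofE// => v _; exact: C1_continuous. Qed.

Lemma C1DE W (f : C1 W) u : C1D f u = derive1 f (clampI u).
Proof. by rewrite C0ofE// => v _; exact: C1_deriv_continuous. Qed.

Lemma C1_der W (f : C1 W) u : unitI u -> der f u (C1D f u).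
Proof.
move=> uI; split; first exact: C1_derivable.
by rewrite C1DE clampI_id// derive1E.
Qed.

Lemma C1_norm_ub0 W (f : C1 W) u : unitI u -> `|f u| <= `|f|.
Proof.
move=> uI; rewrite C1_normE; apply: le_trans (supI_ub (@C1_continuous _ _ f) uI) _.
by rewrite lerDl; apply: supI_ge0; exact: C1_deriv_continuous.
Qed.

Lemma C1_norm_ub1 W (f : C1 W) u : unitI u -> `|derive1 f u| <= `|f|.
Proof.
move=> uI; rewrite C1_normE; apply: le_trans (supI_ub (@C1_deriv_continuous _ _ f) uI) _.
by rewrite lerDr; apply: supI_ge0; exact: C1_continuous.
Qed.

Lemma C1C0_contlin W : contlin (@C1C0 W).
Proof.
have l : linear (@C1C0 W).
  by move=> a f g; apply: C0_ext => u _; rewrite C0_addE C0_scaleE !C1C0E.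
split=> //; apply: (@lin_bound_continuous _ _ _ _ 1) => // f; rewrite mul1r.
by apply: C0_norm_le => u uI; rewrite C1C0E clampI_id// C1_norm_ub0.
Qed.

Lemma C1D_contlin W : contlin (@C1D W).
Proof.
have l : linear (@C1D W).
  move=> a f g; apply: C0_ext => u _; rewrite C0_addE C0_scaleE !C1DE.
  by rewrite derive1_lin// => v; exact: C1_derivable.
split=> //; apply: (@lin_bound_continuous _ _ _ _ 1) => // f; rewrite mul1r.
by apply: C0_norm_le => u uI; rewrite C1DE clampI_id// C1_norm_ub1.
Qed.

Lemma contlin_C1eval W (u : R) : unitI u -> contlin (fun f : C1 W => f u).
Proof.
move=> uI; have l : linear (fun f : C1 W => f u) by [].
split=> //; apply: (@lin_bound_continuous _ _ _ _ 1) => // f.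
by rewrite mul1r C1_norm_ub0.
Qed.

Lemma C1_val_ext W (f g : C1 W) : (forall u, unitI u -> f u = g u) ->
  (forall u, unitI u -> derive1 f u = derive1 g u) -> f = g.
Proof.
move=> fg dfg; apply/val_inj/funext => u /=.
have cI := clampI_in u.
by rewrite (C1_clamp f) (C1_clamp g) (fg _ cI) (dfg _ cI).
Qed.

End C0C1.

(** * Primitives as elements of C1 *)

Section Primitive.
Context {R : realType} {n : nat}.
Implicit Types f g : C0 'rV[R]_n.

Definition vprim f (u : R) : 'rV[R]_n := \row_i rprim (fun t => f t 0 i) u.

Lemma vprim_der f u : der (vprim f) u (f u).
Proof.
apply: is_derive_mx => i j; rewrite ord1.
rewrite (_ : (fun x => _) = rprim (fun t => f t 0 j)); last first.
  by apply/funext => x; rewrite mxE.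
apply: (@rprim_derive _ (fun t => f t 0 j)) => [v|v].
  by apply: (@continuous_comp _ _ _ f (fun M : 'rV[R]_n => M 0 j)); [exact: C0_continuous|exact: coord_continuous].
by rewrite (C0_clamp f).
Qed.

Lemma vprim0 f : vprim f 0 = 0.
Proof. by apply/rowP => i; rewrite !mxE rprim0// => u; rewrite (C0_clamp f). Qed.

(** Outside [unitI] the integrand is constant, so the primitive is affine there; this is the
    extension that [C1_pred] prescribes. *)
Lemma vprim_affine f u : vprim f u = vprim f (clampI u) + (u - clampI u) *: f (clampI u).
Proof.
have key a b (w : 'rV[R]_n) : a <= b -> (forall v, a <= v <= b -> f v = w) ->
    vprim f b = vprim f a + (b - a) *: w.
  move=> ab fw; pose h v := vprim f v - v *: w.
  have : h b = h a.
    apply: (is_derive_cst_eq ab) => v vab.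
    rewrite -(subrr w) -{1}(fw v vab) -[w in X in _ - X]scale1r.
    apply: is_deriveB; first exact: vprim_der.
    have cw : contlin (fun v : R => v *: w).
      by split=> [x y z|x]; [rewrite scalerDl scalerA|exact: scalel_continuous].
    exact: (is_derive_contlin cw (der_id v)).
  rewrite /h => /eqP; rewrite subr_eq => /eqP ->.
  by rewrite scalerBl addrAC addrA.
have [u0|u0] := leP u 0.
  rewrite clampI_lo// (key u 0 (f 0))// ?subr0 ?sub0r ?scaleNr ?subrK// => v /andP[_ v0].
  by rewrite C0_clamp clampI_lo.
have [u1|u1] := leP u 1; first by rewrite clampI_id ?subrr ?scale0r ?addr0//; apply/unitIP; rewrite ltW.
rewrite clampI_hi ?(ltW u1)//; apply: key; first exact: ltW.
by move=> v /andP[v1 _]; rewrite C0_clamp clampI_hi.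
Qed.

Lemma C1prim_proof (w : 'rV[R]_n) f : (fun u => w + vprim f u) \in @C1_pred R 'rV[R]_n.
Proof.
have d u : der (fun u => w + vprim f u) u (f u).
  rewrite -[f u]add0r; exact: (derD (der_cst w u) (vprim_der f u)).
have E : derive1 (fun u => w + vprim f u) = f by apply/funext => u; apply: is_derive_derive1.
apply/asboolP; split.
- by move=> u; case: (d u).
- by rewrite E; exact: C0_continuous.
- by move=> u; rewrite E vprim_affine addrA.
Qed.

Definition C1prim (p : 'rV[R]_n * C0 'rV[R]_n) : C1 'rV[R]_n := MkC1 (C1prim_proof p.1 p.2).

Lemma C1primE w f u : C1prim (w, f) u = w + vprim f u. Proof. by []. Qed.

Lemma C1prim_der w f u : der (C1prim (w, f)) u (f u).
Proof. by rewrite -[f u]add0r; exact: (derD (der_cst w u) (vprim_der f u)). Qed.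

Lemma C1prim_derive1 w f u : derive1 (C1prim (w, f)) u = f u.
Proof. exact: is_derive_derive1 (C1prim_der w f u). Qed.

Lemma C1prim0 w f : C1prim (w, f) 0 = w.
Proof. by rewrite C1primE vprim0 addr0. Qed.

Lemma C1D_prim w f : C1D (C1prim (w, f)) = f.
Proof. by apply: C0_ext => u uI; rewrite C1DE clampI_id// C1prim_derive1. Qed.

(** Curves given by an explicit formula are recognized as elements of [C1] through this: their
    derivative on [unitI] and their value at 0 suffice. *)
Lemma C1primP (h : R -> 'rV[R]_n) f : (forall u, unitI u -> der h u (f u)) ->
  forall u, unitI u -> h u = C1prim (h 0, f) u.
Proof.
move=> dh u /unitIP/andP[u0 u1].
have : (h \- C1prim (h 0, f)) u = (h \- C1prim (h 0, f)) 0.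
  apply: (is_derive_cst_eq u0) => v /andP[v0 vu].
  rewrite -(subrr (f v)); apply: is_deriveB; last exact: C1prim_der.
  by apply: dh; apply/unitIP; rewrite v0 (le_trans vu).
rewrite -[X in X = _]/(h u - C1prim (h 0, f) u) -[X in _ = X]/(h 0 - C1prim (h 0, f) 0).
by rewrite C1prim0 subrr => /eqP; rewrite subr_eq0 => /eqP.
Qed.

(** With [C1D_prim] and [C1prim0] this identifies [C1] with pairs of an initial value and a
    derivative in [C0]. *)
Lemma C1_prim_id (X : C1 'rV[R]_n) : X = C1prim (X 0, C1D X).
Proof.
have H u : unitI u -> der X u (C1D X u) by exact: C1_der.
apply: C1_val_ext => u uI; first exact: C1primP.
by rewrite C1prim_derive1; apply: is_derive_derive1; exact: H.
Qed.

Lemma vprim_le f (b : R) u : unitI u -> (forall v, unitI v -> `|f v| <= b) -> `|vprim f u| <= b.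
Proof.
move=> /unitIP/andP[u0 u1] fb.
have b0 : 0 <= b by apply: le_trans (fb 0 _); [exact: normr_ge0|apply/unitIP; rewrite lexx ler01].
rewrite -[vprim f u]subr0 -(vprim0 f).
apply: (le_trans (@mean_value_cst_le _ _ _ (vprim f) f b 0 u u0 _ _)).
- by move=> v _; exact: vprim_der.
- by move=> v /andP[v0 v1]; apply: fb; apply/unitIP; rewrite v0 (le_trans v1).
- by rewrite subr0 ler_piMr.
Qed.

Lemma vprim_norm f u : unitI u -> `|vprim f u| <= `|f|.
Proof. by move=> uI; apply: vprim_le => // v _; exact: C0_norm_ub. Qed.

Lemma vprim_lin a f g u : unitI u -> vprim (a *: f + g) u = a *: vprim f u + vprim g u.
Proof.
move=> uI; have := @C1primP (fun u => a *: vprim f u + vprim g u) (a *: f + g) _ u uI.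
rewrite !vprim0 scaler0 addr0 C1primE add0r => H; apply/esym/H => v _.
exact: (derD (derZ a (vprim_der f v)) (vprim_der g v)).
Qed.

Lemma C1prim_contlin : contlin C1prim.
Proof.
have l : linear C1prim.
  move=> a [w f] [w' f']; apply: C1_val_ext => u uI.
    by rewrite C1_addE C1_scaleE !C1primE /= vprim_lin// scalerDr addrACA.
  rewrite derive1_lin; try by move=> v; exact: C1_derivable.
  by rewrite C1prim_derive1 -[RHS]/(a *: derive1 _ u + derive1 _ u) !C1prim_derive1.
(* The factor 3 counts [w], the primitive of [f], and [f] itself; two copies would not cover the sup
   norm of the sum. *)
split=> //; apply: (@lin_bound_continuous _ _ _ _ 3) => // -[w f].
have hw : `|w| <= `|(w, f)| by rewrite le_max lexx.
have hf : `|f| <= `|(w, f)| by rewrite le_max lexx orbT.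
rewrite C1_normE (_ : 3 * _ = `|(w, f)| + `|(w, f)| + `|(w, f)|); last by ring.
apply: lerD.
  apply: supI_le => u uI; rewrite C1primE (le_trans (ler_normD _ _))// lerD//.
  exact: le_trans (vprim_norm f uI) hf.
by apply: supI_le => u uI; rewrite C1prim_derive1; apply: le_trans hf; exact: C0_norm_ub.
Qed.

Definition C0prim f : C0 'rV[R]_n := C1C0 (C1prim (0, f)).

Lemma C0primE f u : unitI u -> C0prim f u = vprim f u.
Proof. by move=> uI; rewrite C1C0E clampI_id// C1primE add0r. Qed.

Lemma C0prim_contlin : contlin C0prim.
Proof.
apply: (contlin_comp (f := fun f => C1prim (0, f)) (g := @C1C0 _ _)); last exact: C1C0_contlin.
apply: (contlin_comp (f := fun f => (0, f)) (g := C1prim)); last exact: C1prim_contlin.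
by apply: contlin_pair; [exact: contlin_0|exact: contlin_id].
Qed.

Lemma C0prim_norm f : `|C0prim f| <= `|f|.
Proof. by apply: C0_norm_le => u uI; rewrite C0primE// vprim_norm. Qed.

End Primitive.

(** * Matrices and linear maps between row spaces *)

Section FiniteDim.
Context {R : realType}.
Implicit Types U V W Z : normedModType R.

Lemma scale_contbil W : contbil (fun (c : R) (v : W) => c *: v).
Proof.
split=> [c a u v|v a c d|].
- by rewrite scalerDr !scalerA mulrC.
- by rewrite scalerDl scalerA.
- by exists 1 => c v; rewrite mul1r normrZ.
Qed.

Lemma mulmx_contbil m n p :
  contbil (fun (A : 'M[R]_(m, n)) (B : 'M[R]_(n, p)) => A *m B).
Proof.
split=> [A a B C|B a A C|].
- by rewrite mulmxDr -scalemxAr.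
- by rewrite mulmxDl -scalemxAl.
- exists n%:R => A B; apply: mx_norm_le => [|i j].
    by rewrite !mulr_ge0.
  rewrite mxE; apply: le_trans (ler_norm_sum _ _ _) _.
  rewrite -mulrA [leRHS](_ : _ = \sum_(k < n) `|A| * `|B|); last first.
    by rewrite sumr_const card_ord mulr_natl.
  by apply: ler_sum => k _; rewrite normrM ler_pM// mx_coord_le.
Qed.

Lemma delta_contlin m n i j : contlin (fun M : 'M[R]_(m, n) => M i j : R).
Proof. by split=> [a v w|]; [rewrite !mxE|exact: coord_continuous]. Qed.

Lemma smooth_mx V m n (A : set V) (M : V -> 'M[R]_(m, n)) : open A ->
  (forall i j, smooth_on A (fun x => M x i j : R)) -> smooth_on A M.
Proof.
move=> oA H.
have : smooth_on A (fun x => \sum_(i < m) \sum_(j < n) M x i j *: delta_mx i j : 'M[R]_(m, n)).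
  apply: smooth_sum => // i; apply: smooth_sum => // j.
  apply: (smooth_bil (@scale_contbil 'M[R]_(m, n))) => //; exact: smooth_cst.
by apply: smooth_ext => // x _; rewrite -matrix_sum_delta.
Qed.

Lemma smooth_coord V m n (A : set V) (M : V -> 'M[R]_(m, n)) i j : open A ->
  smooth_on A M -> smooth_on A (fun x => M x i j : R).
Proof.
move=> oA sM; apply: (smooth_comp (B := setT) (g := fun N : 'M[R]_(m, n) => N i j : R) oA _ sM) => //.
by apply: smooth_lin; [exact: openT|exact: delta_contlin].
Qed.

(** The sum of the norms of the images of the basis matrices is a bound. *)
Lemma mx_lin_contlin m n W (f : 'M[R]_(m, n) -> W) : linear f -> contlin f.
Proof.
move=> l; split=> //.
apply: (@lin_bound_continuous _ _ _ _ (\sum_(i < m) \sum_(j < n) `|f (delta_mx i j)|)) => // M.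
rewrite {1}(matrix_sum_delta M) -[f]/(mklin l : _ -> _) linear_sum.
rewrite mulr_suml; apply: le_trans (ler_norm_sum _ _ _) _; apply: ler_sum => i _.
rewrite linear_sum mulr_suml; apply: le_trans (ler_norm_sum _ _ _) _; apply: ler_sum => j _.
by rewrite linearZ normrZ mulrC ler_wpM2l// mx_coord_le.
Qed.

Definition mxof m n (f : 'rV[R]_m -> 'rV[R]_n) : 'M[R]_(m, n) :=
  \matrix_(i, j) f (delta_mx 0 i) 0 j.

Lemma mxofE m n (f : 'rV[R]_m -> 'rV[R]_n) v : linear f -> v *m mxof f = f v.
Proof.
move=> l; rewrite {2}(row_sum_delta v) -[f]/(mklin l : _ -> _) linear_sum.
apply/rowP => j; rewrite mxE summxE; apply: eq_bigr => i _.
by rewrite linearZ !mxE.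
Qed.

Lemma mx_eq_rV m n (M N : 'M[R]_(m, n)) : (forall v : 'rV_m, v *m M = v *m N) -> M = N.
Proof. by move=> H; apply/row_matrixP => i; rewrite !rowE H. Qed.

(** Evaluation at the basis vectors turns a family of linear maps, smooth jointly in parameter and
    vector, into a smooth matrix; products with it are then covered by [smooth_bil]. *)
Lemma smooth_mxof V m n (A : set V) (f : V -> 'rV[R]_m -> 'rV[R]_n) : open A ->
  smooth_on (A `*` setT) (fun p : V * 'rV[R]_m => f (fst p) (snd p)) ->
  smooth_on A (fun x => mxof (f x)).
Proof.
move=> oA sf; apply: smooth_mx => // i j.
have : smooth_on A (fun x => f x (delta_mx 0 i) 0 j : R).
  apply: (@smooth_coord _ 1 n A (fun x => f x (delta_mx 0 i)) 0 j oA).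
  apply: (smooth_comp (f := fun x => (x, delta_mx 0 i : 'rV[R]_m)) oA _ _ sf) => //.
  by apply: smooth_pair => //; [exact: smooth_id|exact: smooth_cst].
by apply: smooth_ext => // x _; rewrite mxE.
Qed.

End FiniteDim.

(** * Symmetry of second derivatives *)

Section Schwarz.
Context {R : realType}.
Implicit Types U V W Z : normedModType R.

Lemma mvtR (k k' : R -> R) (a b : R) : a <= b ->
  (forall u, a <= u <= b -> der (k : R -> R) u (k' u)) ->
  exists2 c, a <= c <= b & k b - k a = k' c * (b - a).
Proof.
move=> ab dk; have [| |c cs E] := @MVT_segment _ k k' a b ab.
- by move=> x /[!in_itv]/= /andP[x0 xs]; apply: dk; rewrite !ltW.
- apply: continuous_in_subspaceT => x /[!inE]/= xs.
  by apply: (is_derive_continuous (dk x _)); move: xs; rewrite in_itv.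
- by exists c; [move: cs; rewrite in_itv|].
Qed.

Lemma MVT0 (k k' : R -> R) (s : R) : 0 <= s ->
  (forall u, 0 <= u <= s -> der (k : R -> R) u (k' u)) ->
  exists2 c, 0 <= c <= s & k s - k 0 = k' c * s.
Proof. by move=> s0 dk; have [c cs] := mvtR s0 dk; rewrite subr0; exists c. Qed.

Lemma der_line V (p v : V) (r : R) : der (fun s : R => p + s *: v) r v.
Proof.
have H := derD (der_cst p r) (is_derive_bil (scale_contbil V) (der_id r) (der_cst v r)).
by move: H; rewrite scaler0 scale1r !add0r.
Qed.

Lemma near_line2 V (p v w : V) (P : set V) : nbhs p P ->
  exists2 s : R, 0 < s & forall c d, 0 <= c <= s -> 0 <= d <= s -> P (p + c *: v + d *: w).
Proof.
move=> /nbhs_ballP[e /= e0 pe]; have k0 : 0 < `|v| + `|w| + 1 by rewrite ltr_wpDl ?addr_ge0.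
exists (e / (`|v| + `|w| + 1)); first by rewrite divr_gt0.
move=> c d /andP[c0 cs] /andP[d0 ds]; apply: pe; rewrite -ball_normE /=.
rewrite !opprD !addrA subrr add0r -normrN opprD !opprK.
apply: le_lt_trans (ler_normD _ _) _; rewrite !normrZ !ger0_norm//.
set s := e / _ in cs ds.
have : c * `|v| + d * `|w| <= s * (`|v| + `|w|).
  by rewrite mulrDr lerD// ler_wpM2r.
move=> /le_lt_trans; apply; rewrite /s mulrAC ltr_pdivrMr// ltr_pM2l//.
by rewrite ltrDl.
Qed.

(** Divided by [s * s], the second difference of [F] over the parallelogram spanned by [s *: v] and
    [s *: w] is close to both iterated derivatives, since these are continuous at [p]. *)
Lemma schwarz_R V (A : set V) (F : V -> R) p v w : open A -> smooth_on A F -> A p ->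
  'd (fun x => 'd F x v) p w = 'd (fun x => 'd F x w) p v :> R.
Proof.
move=> oA sF Ap.
have sdF u : smooth_on A (fun x => 'd F x u : R).
  apply: (smooth_comp (f := fun x => (x, u)) oA _ _ (smooth_tangent sF)) => //.
  by apply: smooth_pair => //; [exact: smooth_id|exact: smooth_cst].
have sddF u u' : smooth_on A (fun x => 'd (fun x => 'd F x u : R) x u' : R).
  apply: (smooth_comp (f := fun x => (x, u')) oA _ _ (smooth_tangent (sdF u))) => //.
  by apply: smooth_pair => //; [exact: smooth_id|exact: smooth_cst].
have D u x : A x -> is_diff x (fun x => 'd F x u : R) ('d (fun x => 'd F x u : R) x).
  by move=> Ax; apply/differentiableP/(smooth_diff (sdF u) Ax).
have DF x : A x -> is_diff x F ('d F x).
  by move=> Ax; apply/differentiableP/(smooth_diff sF Ax).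
(* Two applications of the mean value theorem, along [a] and then along [b], express the second
   difference by the iterated derivative at some point of the parallelogram. *)
have key a b e s : 0 < s ->
   (forall c d, 0 <= c <= s -> 0 <= d <= s -> A (p + c *: a + d *: b) /\
     `|'d (fun x => 'd F x a : R) p b - 'd (fun x => 'd F x a : R) (p + c *: a + d *: b) b| <= e) ->
   `|'d (fun x => 'd F x a : R) p b * s * s -
     ((F (p + s *: a + s *: b) - F (p + s *: a)) - (F (p + s *: b) - F p))| <= e * s * s.
  move=> s0 H; have s1 := ltW s0.
  have z0 : 0 <= (0 : R) <= s by rewrite lexx.
  pose k r := F (p + r *: a + s *: b) - F (p + r *: a).
  have [|c cs Ek] := @MVT0 k (fun r => 'd F (p + r *: a + s *: b) a - 'd F (p + r *: a) a) s s1.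
    move=> u us; apply: derB.
      have A1 : A (p + u *: a + s *: b) by have [] := H u s us; rewrite // s1 lexx.
      have D1 := derD (der_line p a u) (der_cst (s *: b) u).
      by have := is_derive_diff_comp D1 (DF _ A1); rewrite addr0.
    have A1 : A (p + u *: a) by have [] := H u 0 us z0; rewrite scale0r addr0.
    exact: (is_derive_diff_comp (der_line p a u) (DF _ A1)).
  pose l r := 'd F (p + c *: a + r *: b) a.
  have [|d ds El] := @MVT0 l (fun r => 'd (fun x => 'd F x a : R) (p + c *: a + r *: b) b) s s1.
    move=> u us; have [A1 _] := H c u cs us.
    exact: (is_derive_diff_comp (der_line (p + c *: a) b u) (D a _ A1)).
  have -> : F (p + s *: a + s *: b) - F (p + s *: a) - (F (p + s *: b) - F p) = k s - k 0.
    by rewrite /k scale0r addr0.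
  rewrite Ek; have -> : 'd F (p + c *: a + s *: b) a - 'd F (p + c *: a) a = l s - l 0.
    by rewrite /l scale0r addr0.
  rewrite El -!mulrBl !normrM (ger0_norm s1) !ler_wpM2r//.
  by have [] := H c d cs ds.
apply/eqP; rewrite -subr_eq0 -normr_le0; apply/ler_addgt0Pl => e e0; rewrite addr0.
have e2 : 0 < e / 2 by rewrite divr_gt0.
pose P x := A x /\ (`|'d (fun x => 'd F x v : R) p w - 'd (fun x => 'd F x v : R) x w| <= e / 2 /\
   `|'d (fun x => 'd F x w : R) p v - 'd (fun x => 'd F x w : R) x v| <= e / 2).
have [s s0 Hs] : exists2 s : R, 0 < s & forall c d, 0 <= c <= s -> 0 <= d <= s -> P (p + c *: v + d *: w).
  apply: (@near_line2 _ p v w P); near=> x; split; [|split]; near: x.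
  - exact: nbhs_open.
  - by have := smooth_cont (sddF v w) Ap => /cvgrPdist_le; apply.
  - by have := smooth_cont (sddF w v) Ap => /cvgrPdist_le; apply.
have K1 := key v w (e / 2) s s0; have K2 := key w v (e / 2) s s0.
have {}K1 : `|'d (fun x => 'd F x v : R) p w * s * s -
     ((F (p + s *: v + s *: w) - F (p + s *: v)) - (F (p + s *: w) - F p))| <= e / 2 * s * s.
  by apply: K1 => c d cs ds; have [? [? ?]] := Hs c d cs ds.
have {}K2 : `|'d (fun x => 'd F x w : R) p v * s * s -
     ((F (p + s *: w + s *: v) - F (p + s *: w)) - (F (p + s *: v) - F p))| <= e / 2 * s * s.
  apply: K2 => c d cs ds; rewrite addrAC; by have [? [? ?]] := Hs d c ds cs.
have ss : 0 < s * s by rewrite mulr_gt0.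
rewrite -(ler_pM2r ss) -{1}(gtr0_norm ss) -normrM.
set X := 'd _ p w in K1 *; set Y := 'd _ p v in K2 *.
move: K1 K2; rewrite [p + s *: w + s *: v]addrAC.
set f1 := F _; set f2 := F _; set f3 := F _; set f4 := F _.
rewrite !ler_norml => /andP[K1 K1'] /andP[K2 K2'].
have E1 : (X - Y) * (s * s) = X * s * s - Y * s * s by ring.
have E2 : e * (s * s) = e / 2 * s * s + e / 2 * s * s by field.
rewrite E1 E2; apply/andP; split; lra.
Unshelve. all: by end_near. Qed.

Lemma schwarz V n (A : set V) (F : V -> 'rV[R]_n) p v w : open A -> smooth_on A F -> A p ->
  'd (fun x => 'd F x v) p w = 'd (fun x => 'd F x w) p v :> 'rV[R]_n.
Proof.
move=> oA sF Ap; apply/rowP => j.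
have sj : smooth_on A (fun x => F x 0 j : R) by exact: smooth_coord.
have E1 x u : A x -> 'd (fun x => F x 0 j : R) x u = 'd F x u 0 j :> R.
  move=> Ax; have DF : is_diff x F ('d F x) by apply/differentiableP/(smooth_diff sF Ax).
  have H := is_diff_comp DF (contlin_is_diff (F x) (delta_contlin (0 : 'I_1) j)).
  by have /= := @diff_val _ _ _ _ _ _ _ H => /(congr1 (fun f => f u)).
have E2 u u' : 'd (fun x => 'd F x u) p u' 0 j = 'd (fun x => 'd (fun x => F x 0 j : R) x u : R) p u' :> R.
  have sdF : smooth_on A (fun x => 'd F x u : 'rV[R]_n).
    apply: (smooth_comp (f := fun x => (x, u)) oA _ _ (smooth_tangent sF)) => //.
    by apply: smooth_pair => //; [exact: smooth_id|exact: smooth_cst].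
  have DF : is_diff p (fun x => 'd F x u) ('d (fun x => 'd F x u) p).
    by apply/differentiableP/(smooth_diff sdF Ap).
  have H := is_diff_comp DF (contlin_is_diff _ (delta_contlin (0 : 'I_1) j)).
  have /= <- := congr1 (fun f => f u') (@diff_val _ _ _ _ _ _ _ H).
  rewrite -[LHS]/('d (fun x => 'd F x u 0 j : R) p u'); apply/esym.
  congr (_ u'); apply: near_diff; last exact: ex_diff.
  by apply: filterS (nbhs_open oA Ap) => x Ax /=; rewrite E1.
by rewrite !E2; exact: (schwarz_R _ _ oA sj).
Qed.

End Schwarz.

(** * Curves in C0 and C1 *)

Section Curves.
Context {R : realType}.
Implicit Types U V W Z : normedModType R.

Lemma unitI_compact : compact (@unitI R).
Proof. exact: segment_compact. Qed.

(** The tube lemma for the compact interval: a filter in [s] becomes uniform in [u]. *)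
Lemma unitI_near (F : set_system R) (P : R -> R -> Prop) : Filter F ->
  (forall u, unitI u -> \forall u' \near u & s \near F, P s u') ->
  \forall s \near F, forall u, unitI u -> P s u.
Proof.
move=> FF H; have /compact_near_coveringP nc := unitI_compact.
by have := nc R F P FF H.
Qed.

(** Joint continuity is required along one slice only; compactness of that slice is what makes
    estimates uniform in [u]. *)
Definition jointc W (H : R -> R -> W) (s : R) :=
  forall u, unitI u -> {for (s, u), continuous (fun p => H p.1 p.2)}.

Lemma jointc_for W (H : R -> R -> W) s u : jointc H s -> unitI u ->
  {for u, continuous (H s)}.
Proof.
move=> cH uI; have := cH u uI => c.
apply: (@continuous_comp _ _ _ (fun u => (s, u)) (fun p => H p.1 p.2)); last exact: c.
move=> P [[A B] /= [As Bu] AB].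
by apply: filterS Bu => v Bv; apply: (AB (s, v)); split=> //; exact: nbhs_singleton.
Qed.

Lemma curve_near W (H : R -> R -> W) s0 (e : R) : jointc H s0 -> 0 < e ->
  \forall s \near s0, forall u, unitI u -> `|H s u - H s0 u| <= e.
Proof.
move=> cH e0.
suff K u : unitI u -> \forall u' \near u & s \near s0, `|H s u' - H s0 u'| <= e.
  exact: (@unitI_near (nbhs s0) (fun s u => `|H s u - H s0 u| <= e) _ K).
move=> uI.
have e2 : 0 < e / 2 by rewrite divr_gt0.
have /cvgrPdist_le/(_ _ e2) c := cH u uI.
have c' := c.
move: c => [[A B] /= [A0 Bu] AB].
exists (B, A) => //= -[u' s] /= [Bu' As].
have h1 := AB (s, u') (conj As Bu').
have h2 := AB (s0, u') (conj (nbhs_singleton A0) Bu').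
rewrite /= in h1 h2.
rewrite (_ : _ - _ = (H s0 u - H s0 u') - (H s0 u - H s u')); last first.
  by rewrite opprB [RHS]addrC addrA subrK.
by rewrite (le_trans (ler_normB _ _))// [leRHS](splitr e) lerD.
Qed.

Lemma curve_cont W (H : R -> R -> W) s0 : (\forall s \near s0, jointc H s) ->
  {for s0, continuous (fun s => C0of (H s))}.
Proof.
move=> cH; have cH0 := nbhs_singleton cH.
apply/cvgrPdist_le => e e0; near=> s.
have cs : jointc H s by near: s.
have hs : forall u, unitI u -> `|H s u - H s0 u| <= e by near: s; exact: curve_near.
apply: C0_norm_le => u uI; rewrite C0_subE !C0of_id//; last 2 first.
- by move=> v vI; exact: jointc_for cs vI.
- by move=> v vI; exact: jointc_for cH0 vI.
by rewrite distrC hs.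
Unshelve. all: by end_near. Qed.

Lemma mean_value_sym m n (f f' : R -> 'M[R]_(m, n)) (C s0 h : R) :
  (forall s, `|s - s0| <= `|h| -> der f s (f' s)) ->
  (forall s, `|s - s0| <= `|h| -> `|f' s| <= C) ->
  `|f (h + s0) - f s0| <= C * `|h|.
Proof.
move=> df fC; have [h0|h0] := leP 0 h.
  have inn u : s0 <= u <= h + s0 -> `|u - s0| <= `|h|.
    by move=> /andP[a b]; rewrite !ger0_norm ?subr_ge0// lerBlDr.
  rewrite [`|h|]ger0_norm// -[in leRHS](addrK s0 h).
  apply: (@mean_value_cst_le _ _ _ f f'); first by rewrite lerDr.
  - by move=> u /inn; exact: df.
  - by move=> u /inn; exact: fC.
have inn u : h + s0 <= u <= s0 -> `|u - s0| <= `|h|.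
  by move=> /andP[a b]; rewrite (ltr0_norm h0) ler0_norm ?subr_le0// opprB lerBlDr -lerBlDl opprK addrC.
rewrite distrC (ltr0_norm h0) (_ : - h = s0 - (h + s0)); last by rewrite opprD addrCA subrr addr0.
apply: (@mean_value_cst_le _ _ _ f f'); first by rewrite gerDr ltW.
- by move=> u /inn; exact: df.
- by move=> u /inn; exact: fC.
Qed.

(** Pointwise derivatives in [s] become a derivative for the sup norm: the curve
    [H s u - s *: H' s0 u] has derivative [H' s u - H' s0 u], which [curve_near] bounds by [e] for
    all [u] at once. *)
Lemma curve_der m n (H H' : R -> R -> 'M[R]_(m, n)) s0 :
  (\forall s \near s0, [/\ jointc H s, jointc H' s &
     forall u, unitI u -> der (H ^~ u) s (H' s u)]) ->
  der (fun s => C0of (H s)) s0 (C0of (H' s0)).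
Proof.
move=> A; have [c0 c0' _] := nbhs_singleton A.
suff : is_diff s0 (fun s => C0of (H s)) (fun h => h *: C0of (H' s0)).
  by move=> /is_diff_derive1; rewrite scale1r.
have [l c] := contlin_pair (W := R) (contlin_0 R R) (contlin_0 R R).
apply: is_diff_eps.
- by move=> a x y; rewrite scalerDl scalerA.
- exact: scalel_continuous.
move=> e e0.
have B := curve_near c0' e0.
have AB : \forall s \near s0, [/\ jointc H s, jointc H' s,
   forall u, unitI u -> der (H ^~ u) s (H' s u) &
   forall u, unitI u -> `|H' s u - H' s0 u| <= e].
  by move: B; apply: filterS2 A => s [? ? ?] ?.
move/nbhs_ballP: AB => [d /= d0 AB].
near=> h.
have hd : `|h| < d by near: h; exact: (@nbhs0_lt _ R _ d0).
have {}AB s : `|s - s0| <= `|h| -> [/\ jointc H s, jointc H' s,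
   forall u, unitI u -> der (H ^~ u) s (H' s u) &
   forall u, unitI u -> `|H' s u - H' s0 u| <= e].
  move=> sh; apply: AB; rewrite -ball_normE /= distrC; exact: le_lt_trans sh hd.
have [ch _ _ _] : [/\ jointc H (h + s0), jointc H' (h + s0),
   forall u, unitI u -> der (H ^~ u) (h + s0) (H' (h + s0) u) &
   forall u, unitI u -> `|H' (h + s0) u - H' s0 u| <= e] by apply: AB; rewrite addrK.
apply: C0_norm_le => u uI; rewrite !C0_subE C0_scaleE.
rewrite (C0of_id (fun v vI => jointc_for c0' vI) uI) (C0of_id (fun v vI => jointc_for c0 vI) uI).
rewrite (C0of_id (fun v vI => jointc_for ch vI) uI).
have := @mean_value_sym _ _ (fun s => H s u - s *: H' s0 u) (fun s => H' s u - H' s0 u) e s0 h.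
  rewrite (_ : _ - _ - _ = H (h + s0) u - (h + s0) *: H' s0 u - (H s0 u - s0 *: H' s0 u)); last first.
    by apply/matrixP => i j; rewrite !mxE; ring.
  apply=> s sh; have [_ _ D E] := AB s sh; last exact: E.
  apply: derB; first exact: D.
  have := is_derive_bil (scale_contbil _) (der_id s) (der_cst (H' s0 u) s).
  by rewrite scaler0 add0r scale1r.
Unshelve. all: by end_near. Qed.

End Curves.

(** * A C1 step function *)

Section Step.
Context {R : realType}.

Let bump (t : R) : R := Num.max 0 (t * (1 - t)).

Let bump_cont : continuous bump.
Proof.
move=> u.
have c (w : R) : {for u, continuous (cst w : R -> R)} by exact: cvg_cst.
have i : {for u, continuous (fun t : R => t * (1 - t))}.
  apply: cvgM; first exact: cvg_id.
  by apply: cvgB; [exact: cvg_cst|exact: cvg_id].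
exact: (continuous_max (c 0) i).
Qed.

Let bump_out t : t <= 0 \/ 1 <= t -> bump t = 0.
Proof. by move=> H; rewrite /bump max_l//; case: H => H; nra. Qed.

Let bump_clamp t : bump t = bump (clampI t).
Proof.
have [t0|t0] := leP t 0.
  by rewrite clampI_lo// !bump_out//; left.
have [t1|t1] := leP 1 t.
  by rewrite clampI_hi// !bump_out//; right.
by rewrite clampI_id//; apply/unitIP; rewrite !ltW.
Qed.

Let P := rprim bump.

Let Pd t : der P t (bump t).
Proof. exact: rprim_derive bump_cont bump_clamp. Qed.

Let Pmono a b : a <= b -> P a <= P b.
Proof.
move=> ab; rewrite -subr_ge0; have [|c _ ->] := @mvtR _ P bump a b ab; first by move=> u _.
by rewrite mulr_ge0 ?subr_ge0// /bump le_max lexx.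
Qed.

Let P1pos : 0 < P 1.
Proof.
(* On [1/4, 3/4] the bump is at least 3/16, and this interval has length 1/2. *)
have : P (1/4) <= P (3/4) - 3/32.
  have [||c cI E] := @mvtR _ P bump (1/4) (3/4); [by lra|by move=> u _|].
  rewrite lerBrDr -lerBrDl E /bump.
  have : 3/16 <= Num.max 0 (c * (1 - c)) by rewrite le_max; apply/orP; right; nra.
  nra.
have p0 : P 0 = 0 by rewrite /P rprim0// => u; rewrite bump_clamp.
have : P 0 <= P (1/4) by apply: Pmono; lra.
have : P (3/4) <= P 1 by apply: Pmono; lra.
rewrite p0; lra.
Qed.

(** The normalized primitive of the bump t(1 - t). Composition with it brings a curve to rest at
    both ends, so that curves can be glued in a C1 way and forms can be made to vanish at 0 and
    1. *)
Lemma step_exists : exists s s' : R -> R,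
  [/\ forall t, der s t (s' t), continuous s',
      forall t, t <= 0 -> s t = 0, forall t, 1 <= t -> s t = 1 &
      [/\ forall t, unitI (s t), s' 0 = 0 & s' 1 = 0]].
Proof.
have p0 : P 0 = 0 by rewrite /P rprim0// => u; rewrite bump_clamp.
have lo t : t <= 0 -> P t = 0.
  move=> t0; have [|c /andP[_ c0]] := @mvtR _ P bump t 0 t0; first by move=> u _.
  rewrite p0 bump_out; last by left.
  by rewrite mul0r sub0r => /eqP; rewrite oppr_eq0 => /eqP.
have hi t : 1 <= t -> P t = P 1.
  move=> t1; have [|c /andP[c1 _]] := @mvtR _ P bump 1 t t1; first by move=> u _.
  rewrite bump_out; last by right.
  by rewrite mul0r => /eqP; rewrite subr_eq0 => /eqP.
exists (fun t => (P 1)^-1 *: P t), (fun t => (P 1)^-1 *: bump t); split.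
- by move=> t; apply: derZ.
- by move=> t; apply: cvgZl_tmp; exact: bump_cont.
- by move=> t /lo ->; rewrite scaler0.
- by move=> t /hi ->; rewrite /GRing.scale /= mulVf// gt_eqF.
split.
- move=> t; apply/unitIP; rewrite /GRing.scale /=; apply/andP; split.
    rewrite mulr_ge0 ?invr_ge0 ?(ltW P1pos)//.
    have [/lo ->//|/ltW t0] := leP t 0; by rewrite -p0; exact: Pmono.
  rewrite ler_pdivrMl// mulr1; have [/hi ->//|/ltW t1] := leP 1 t; exact: Pmono.
- by rewrite bump_out ?scaler0//; left.
- by rewrite bump_out ?scaler0//; right.
Qed.

End Step.

(** * Local Lipschitz bounds for smooth maps *)

Section Lipschitz.
Context {R : realType}.

(** The tangent map is continuous at [(p, 0)], so ['d F x] is at most 1 on vectors of norm [r] for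
    all [x] near [p]; homogeneity makes this the operator bound [r^-1], and the mean value
    inequality on segments gives the Lipschitz constant. *)
Lemma smooth_lipschitz (V : normedModType R) m n (A : set V) (F : V -> 'M[R]_(m, n)) p :
  open A -> A p -> smooth_on A F ->
  exists r L : R, [/\ 0 < r, 0 < L, forall x, `|x - p| <= r -> A x &
    forall x y, `|x - p| <= r -> `|y - p| <= r -> `|F x - F y| <= L * `|x - y|].
Proof.
move=> oA Ap sF.
have c : {for (p, 0), continuous (fun q : V * V => 'd F (fst q) (snd q))}.
  exact: (smooth_cont (smooth_tangent sF)).
have /cvgrPdist_le/(_ 1 ltr01) := c; rewrite /= linear0.
move=> /nbhs_ballP[d /= d0 Hd].
have /nbhs_ballP[d' /= d'0 Hd'] := nbhs_open oA Ap.
pose r := Num.min d d' / 2.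
have dd : 0 < Num.min d d' by rewrite lt_min d0.
have r0 : 0 < r by rewrite divr_gt0.
have rd : r < d.
  rewrite /r; have : Num.min d d' <= d by rewrite ge_min lexx.
  by lra.
have rd' : r < d'.
  rewrite /r; have : Num.min d d' <= d' by rewrite ge_min lexx orbT.
  by lra.
have bd x : `|x - p| <= r -> forall v, `|'d F x v| <= r^-1 * `|v|.
  move=> xr v; have [->|v0] := eqVneq v 0; first by rewrite linear0 !normr0 mulr0.
  have nv : 0 < `|v| by rewrite normr_gt0.
  have := Hd (x, (r / `|v|) *: v); rewrite -ball_normE /= sub0r normrN.
  rewrite linearZ normrZ ger0_norm; last by rewrite divr_ge0// ltW.
  move=> H; rewrite -[leRHS]mulr1 (_ : r^-1 * `|v| = (r / `|v|)^-1); last by rewrite [RHS]invfM invrK.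
  rewrite ler_pdivlMl ?divr_gt0//; apply: H.
  rewrite gt_max /= sub0r normrN normrZ ger0_norm; last by rewrite divr_ge0// ltW.
  by rewrite divfK ?gt_eqF// rd andbT distrC; exact: le_lt_trans xr rd.
have rA x : `|x - p| <= r -> A x.
  move=> xr; apply: Hd'; rewrite -ball_normE /= distrC; exact: le_lt_trans xr rd'.
exists r, r^-1; split=> //; first by rewrite invr_gt0.
move=> x y xr yr.
have seg t : 0 <= t <= 1 -> `|y + t *: (x - y) - p| <= r.
  move=> /andP[t0 t1].
  have -> : y + t *: (x - y) - p = t *: (x - p) + (1 - t) *: (y - p).
    rewrite scalerBl scale1r addrCA -scalerBr opprB.
    by rewrite addrA subrK addrAC.
  rewrite (le_trans (ler_normD _ _))// !normrZ !ger0_norm ?subr_ge0//.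
  have : t * `|x - p| <= t * r by rewrite ler_wpM2l.
  have : (1 - t) * `|y - p| <= (1 - t) * r by rewrite ler_wpM2l// subr_ge0.
  lra.
pose f t := F (y + t *: (x - y)).
have := @mean_value_cst_le _ _ _ f (fun t => 'd F (y + t *: (x - y)) (x - y)) (r^-1 * `|x - y|) 0 1 ler01.
rewrite /f scale1r scale0r addr0 [y + _]addrC subrK subr0 mulr1; apply=> u uI.
  apply: (is_derive_diff_comp (der_line y (x - y) u)).
  by apply/differentiableP/(smooth_diff sF)/rA/seg.
by apply: bd; exact: seg.
Qed.

End Lipschitz.

(** * Ordinary differential equations *)

Section Picard.
Context {R : realType} {n : nat}.
Notation E := 'rV[R]_n.

(** Completeness of [C0] in quantitative form: a rate for the Cauchy condition is also a rate of
    convergence. *)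
Lemma C0_cauchy_limit (y : nat -> C0 E) (a : nat -> R) :
  (forall m k, (k <= m)%N -> `|y m - y k| <= a k) -> a @ \oo --> (0 : R) ->
  exists w : C0 E, forall k, `|w - y k| <= a k.
Proof.
move=> ya a0.
have lim u : exists l : E, forall k, `|l - y k u| <= a k.
  have cv : cvg ((fun k => y k u) @ \oo).
    apply/cauchy_cvgP/cauchy_exP => e e0.
    have /cvgrPdist_lt/(_ _ e0) [k _ Hk] := a0.
    exists (y k u); exists k => // m /= km; rewrite -ball_normE /= distrC.
    apply: le_lt_trans (_ : a k < e).
      by apply: le_trans (ya m k km); rewrite -C0_subE C0_norm_ub.
    have := Hk k (leqnn _); rewrite /= sub0r normrN => /(le_lt_trans _); apply.
    exact: ler_norm.
  exists (limn (fun k => y k u)) => k; apply/ler_addgt0Pl => e e0.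
  have /cvgrPdist_le/(_ _ e0) [m _ Hm] := cv.
  have := Hm (maxn m k) (leq_maxl _ _); rewrite /= => H.
  rewrite -(subrKA (y (maxn m k) u)); apply: le_trans (ler_normD _ _) _; apply: lerD => //.
  by apply: le_trans (ya _ _ (leq_maxr m k)); rewrite -C0_subE C0_norm_ub.
have [w Hw] := choice lim.
pose w' := w \o clampI.
have Hw' u k : `|w' u - y k u| <= a k by rewrite /w' /= (C0_clamp (y k)).
have cw : continuous w'.
  move=> u; apply/cvgrPdist_le => e e0.
  have e3 : 0 < e / 3 by rewrite divr_gt0.
  have /cvgrPdist_le/(_ _ e3) [k _ Hk] := a0.
  have ak : a k <= e / 3.
    by have := Hk k (leqnn _); rewrite /= sub0r normrN => /(le_trans (ler_norm _)).
  have /cvgrPdist_le/(_ _ e3) := @C0_continuous _ _ (y k) u.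
  apply: filterS => v Hv.
  rewrite -(subrKA (y k u)); apply: le_trans (ler_normD _ _) _.
  rewrite (_ : e = e / 3 + (e / 3 + e / 3)); last by field.
  apply: lerD; first exact: le_trans ak.
  rewrite -(subrKA (y k v)); apply: le_trans (ler_normD _ _) _; apply: lerD => //.
  by rewrite distrC; exact: le_trans ak.
have wP : w' \in @C0_pred R E.
  by apply/asboolP; split=> // u; rewrite /w' /= (clampI_id (clampI_in u)).
exists (MkC0 wP) => k; apply: C0_norm_le => u uI; exact: Hw'.
Qed.

(** Picard iteration from 0 for the equation z' = lam V(z). The interval is fixed, so it is the
    smallness of [lam] that makes the integral operator map the ball of radius [r] to itself and
    contract it by 1/2. *)
Lemma picard (V : E -> 'M[R]_n) (r L K : R) : 0 < r -> 0 <= L ->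
  (forall x y, `|x| <= r -> `|y| <= r -> `|V x - V y| <= L * `|x - y|) ->
  (forall x, `|x| <= r -> `|V x| <= K) ->
  forall lam : C0 E, n%:R * K * `|lam| <= r -> n%:R * L * `|lam| <= 1 / 2 ->
  exists z : C1 E, z 0 = 0 /\ forall u, unitI u ->
    `|z u| <= n%:R * K * `|lam| /\ der z u (lam u *m V (z u)).
Proof.
move=> r0 L0 VL VK lam lr lL.
have HM (A : E) (M : 'M[R]_n) : `|A *m M| <= n%:R * `|M| * `|A|.
  apply: mx_norm_le => [|i j]; first by rewrite !mulr_ge0.
  rewrite mxE; apply: le_trans (ler_norm_sum _ _ _) _.
  rewrite -mulrA [leRHS](_ : _ = \sum_(k < n) `|M| * `|A|); last first.
    by rewrite sumr_const card_ord mulr_natl.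
  by apply: ler_sum => k _; rewrite normrM mulrC ler_pM// mx_coord_le.
pose G (y : C0 E) u := lam u *m V (y u).
have Gc y u : `|y| <= r -> {for u, continuous (G y)}.
  move=> yr; apply: (contbil_cont (mulmx_contbil 1 n n)); first exact: C0_continuous.
  apply/cvgrPdist_le => e e0.
  have Le : 0 < e / (L + 1) by rewrite divr_gt0// ltr_wpDl.
  have /cvgrPdist_le/(_ _ Le) := @C0_continuous _ _ y u.
  apply: filterS => v Hv.
  apply: le_trans (VL _ _ _ _) _; try by apply: le_trans yr; exact: C0_norm_ub.
  apply: le_trans (_ : L * (e / (L + 1)) <= _); first by rewrite ler_wpM2l.
  rewrite mulrCA -[leRHS]mulr1 ler_wpM2l ?(ltW e0)//.
  by rewrite ler_pdivrMr ?ltr_wpDl// mul1r lerDl.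
have GE y : `|y| <= r -> forall u, unitI u -> C0of (G y) u = G y u.
  by move=> yr u uI; apply: C0of_id uI => v _; exact: Gc.
have [T TE] : exists T : C0 E -> C0 E, forall y, T y = C0prim (C0of (G y)) by exists (fun y => C0prim (C0of (G y))).
have Gn y : `|y| <= r -> `|C0of (G y)| <= n%:R * K * `|lam|.
  move=> yr; apply: C0_norm_le => u uI; rewrite (GE _ yr _ uI).
  apply: le_trans (HM _ _) _; rewrite -!mulrA ler_wpM2l//.
  apply: ler_pM => //; last exact: C0_norm_ub.
  by apply: VK; apply: le_trans yr; exact: C0_norm_ub.
have Tn y : `|y| <= r -> `|T y| <= n%:R * K * `|lam|.
  by move=> yr; rewrite TE; apply: le_trans (C0prim_norm _) _; exact: Gn.
have Tr y : `|y| <= r -> `|T y| <= r by move=> yr; exact: le_trans (Tn y yr) lr.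
have TL y y' : `|y| <= r -> `|y'| <= r -> `|T y - T y'| <= 1 / 2 * `|y - y'|.
  move=> yr yr'; rewrite !TE -[C0prim _ - C0prim _](linearB (mklin (@C0prim_contlin R n).1)).
  apply: le_trans (C0prim_norm _) _; apply: C0_norm_le => u uI.
  rewrite C0_subE (GE _ yr _ uI) (GE _ yr' _ uI).
  rewrite /G -mulmxBr; apply: le_trans (HM _ _) _.
  apply: le_trans (_ : n%:R * (L * `|y - y'|) * `|lam| <= _).
    apply: ler_pM; rewrite ?mulr_ge0//; last exact: C0_norm_ub.
    rewrite ler_wpM2l//; apply: le_trans (VL _ _ _ _) _.
    - by apply: le_trans yr; exact: C0_norm_ub.
    - by apply: le_trans yr'; exact: C0_norm_ub.
    - by rewrite ler_wpM2l// -C0_subE C0_norm_ub.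
  rewrite (_ : _ * _ = n%:R * L * `|lam| * `|y - y'|); last by ring.
  by rewrite ler_wpM2r.
have [y [y00 yS]] : exists y : nat -> C0 E, y 0%N = 0 /\ forall k, y k.+1 = T (y k).
  by exists (fun k => iter k T 0).
have yr k : `|y k| <= r by elim: k => [|k IH]; [rewrite y00 normr0 ltW|rewrite yS; exact: Tr].
have yd k : `|y k.+1 - y k| <= r * (1 / 2) ^+ k.
  elim: k => [|k IH]; first by rewrite expr0 mulr1 y00 subr0; exact: (yr 1%N).
  rewrite (yS k.+1) [in X in _ - X](yS k); apply: le_trans (TL _ _ (yr _) (yr _)) _; rewrite exprS mulrCA.
  by rewrite ler_wpM2l.
(* The tail from [k] on of the geometric series bounding the successive differences. *)
pose a k := 2 * r * (1 / 2) ^+ k.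
have ya m k : (k <= m)%N -> `|y m - y k| <= a k.
  move=> km; rewrite -(subnK km); move: (m - k)%N => d; elim: d k {km} => [|d IH] k.
    by rewrite add0n subrr normr0 /a !mulr_ge0 ?exprn_ge0// ltW.
  rewrite addSnnS -(subrKA (y k.+1)); apply: le_trans (ler_normD _ _) _.
  have := IH k.+1; have := yd k; rewrite /a exprS.
  set p := _ ^+ k; lra.
have a0 : a @ \oo --> (0 : R).
  rewrite -[0](mulr0 (2 * r)); apply: cvgM; first exact: cvg_cst.
  apply: cvg_expr; rewrite ger0_norm; lra.
have [w Hw] := C0_cauchy_limit ya a0.
have ak e : 0 < e -> exists k, a k <= e.
  move=> e0; have /cvgrPdist_le/(_ _ e0) [k _ Hk] := a0.
  by exists k; have := Hk k (leqnn _); rewrite /= sub0r normrN => /(le_trans (ler_norm _)).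
have wr : `|w| <= r.
  apply/ler_addgt0Pl => e /ak[k ke]; rewrite -[w](subrK (y k)).
  by apply: le_trans (ler_normD _ _) _; apply: lerD => //; exact: le_trans (Hw k) ke.
have Tw : T w = w.
  apply/eqP; rewrite -subr_eq0 -normr_le0; apply/ler_addgt0Pl => e e0; rewrite addr0.
  have e2 : 0 < e / 2 by rewrite divr_gt0.
  have [k ke] := ak _ e2.
  rewrite -(subrKA (T (y k))); apply: le_trans (ler_normD _ _) _.
  rewrite (splitr e); apply: lerD.
    apply: le_trans (TL _ _ wr (yr k)) _; have := Hw k; lra.
  rewrite -yS distrC; apply: le_trans (Hw k.+1) _; apply: le_trans ke.
  rewrite /a exprS; have : 0 <= (1 / 2 : R) ^+ k by apply: exprn_ge0.
  set p := _ ^+ k; nra.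
exists (C1prim (0, C0of (G w))); split; first by rewrite C1prim0.
move=> u uI; have E1 : C1prim (0, C0of (G w)) u = w u.
  by rewrite C1primE add0r -C0primE// -TE Tw.
rewrite E1; split.
  by apply: le_trans (C0_norm_ub w u) _; rewrite -Tw; exact: Tn.
by have := C1prim_der 0 (C0of (G w)) u; rewrite (GE _ wr _ uI).
Qed.

End Picard.

(** * Atlases and smooth maps *)

Section Manifold.
Context {R : realType} (F : normedModType R) (M : Type) (A : atlas F M).
Hypothesis mA : is_manifold A.
Implicit Types c d : chart F M.

Lemma chart_cod_open c : charts A c -> open (cod c).
Proof. by case: mA => H _ _ _ /H[]. Qed.

Lemma chart_fwdK c p : charts A c -> dom c p -> bwd c (fwd c p) = p.
Proof. by case: mA => H _ _ _ /H[_]; exact. Qed.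

Lemma chart_bwd_dom c y : charts A c -> cod c y -> dom c (bwd c y).
Proof. by move=> Ac [p cp <-]; rewrite chart_fwdK. Qed.

Lemma chart_bwdK c y : charts A c -> cod c y -> fwd c (bwd c y) = y.
Proof. by move=> Ac [p cp <-]; rewrite chart_fwdK. Qed.

Lemma chart_fwd_cod c p : dom c p -> cod c (fwd c p).
Proof. by move=> cp; exists p. Qed.

Lemma chart_at_charts p : charts A (chart_at A p).
Proof. by case: mA => _ H _ _; case: (H p). Qed.

Lemma chart_at_dom p : dom (chart_at A p) p.
Proof. by case: mA => _ H _ _; case: (H p). Qed.

Definition overlap c d : set F := cod c `&` (fun y => dom d (bwd c y)).

Lemma overlapE c d : charts A c -> overlap c d = fwd c @` (dom c `&` dom d).
Proof.
move=> Ac; rewrite predeqE => y; split=> [[[p cp <-]]|[p [cp dp] <-]].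
  by rewrite chart_fwdK// => dp; exists p.
by split; [exact: chart_fwd_cod|rewrite chart_fwdK].
Qed.

Lemma overlap_open c d : charts A c -> charts A d -> open (overlap c d).
Proof. by move=> Ac Ad; rewrite overlapE//; case: mA => _ _ /(_ c d Ac Ad)[]. Qed.

Lemma transition_smooth c d : charts A c -> charts A d ->
  smooth_on (overlap c d) (fun y => fwd d (bwd c y)).
Proof. by move=> Ac Ad; rewrite overlapE//; case: mA => _ _ /(_ c d Ac Ad)[]. Qed.

Lemma mspace_openE (U : set (mspace A)) : open U = mopen U.
Proof. by []. Qed.

Lemma dom_open c : charts A c -> open (dom c : set (mspace A)).
Proof.
move=> Ac; rewrite mspace_openE => d Ad x dx cx.
exists (overlap d c); split; first exact: overlap_open.
  by split; [exact: chart_fwd_cod|rewrite chart_fwdK].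
by move=> y dy [_]; rewrite chart_fwdK.
Qed.

(** Transition maps are continuous, so neighbourhoods for the topology of the whole atlas can be
    tested in any one chart around the point. *)
Lemma nbhs_chart c (p : M) (U : set M) : charts A c -> dom c p ->
  nbhs (p : mspace A) U <->
  exists W : set F, [/\ open W, W (fwd c p) & forall y, W y -> cod c y /\ U (bwd c y)].
Proof.
move=> Ac cp; split.
  rewrite nbhsE => -[B [oB Bp] BU].
  have [W [oW Wp WB]] := oB c Ac p cp Bp.
  exists (W `&` cod c); split.
  - by apply: openI => //; exact: chart_cod_open.
  - by split=> //; exact: chart_fwd_cod.
  move=> y [Wy cy]; split=> //; apply: BU; apply: WB; first exact: chart_bwd_dom.
  by rewrite chart_bwdK.
move=> [W [oW Wp WU]].
rewrite nbhsE; exists [set q | dom c q /\ W (fwd c q)]; last first.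
  by move=> q [cq Wq]; have [_] := WU _ Wq; rewrite chart_fwdK.
split; last by split.
rewrite mspace_openE => d Ad x dx [cx Wx].
have oO := overlap_open Ad Ac.
have Ox : overlap d c (fwd d x) by split; [exact: chart_fwd_cod|rewrite chart_fwdK].
have ct : {for fwd d x, continuous (fun y => fwd c (bwd d y))}.
  exact: (smooth_cont (transition_smooth Ad Ac)).
have : nbhs (fwd d x) (overlap d c `&` (fun y => W (fwd c (bwd d y)))).
  apply: filterI; first exact: nbhs_open.
  by apply: ct; apply: nbhs_open => //; rewrite chart_fwdK.
rewrite nbhsE => -[B [oB Bx] BO]; exists B; split=> // y dy /BO[[_]].
by rewrite chart_fwdK.
Qed.

Lemma fwd_continuous c (p : M) : charts A c -> dom c p ->
  {for p, continuous (fwd c : mspace A -> F)}.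
Proof.
move=> Ac cp P; rewrite nbhsE => -[B [oB Bp] BP].
apply/(nbhs_chart _ Ac cp); exists (B `&` cod c); split.
- by apply: openI => //; exact: chart_cod_open.
- by split=> //; exact: chart_fwd_cod.
by move=> y [By cy]; split=> //=; apply: BP; rewrite chart_bwdK.
Qed.

(** Families of points of a manifold with parameters in a normed space. Openness of the preimages of
    chart domains builds in continuity, and no charts of the source are involved. *)
Definition msmooth (V : normedModType R) (U : set V) (f : V -> M) :=
  forall c, charts A c -> open (U `&` f @^-1` dom c) /\
    smooth_on (U `&` f @^-1` dom c) (fun x => fwd c (f x)).

Lemma open_preim (V W : normedModType R) (U : set V) (f : V -> W) (O : set W) : open U ->
  (forall x, U x -> {for x, continuous f}) -> open O -> open (U `&` f @^-1` O).
Proof.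
move=> oU cf oO; rewrite openE => x [Ux Ox]; apply: filterI; first exact: nbhs_open.
by apply: cf => //; exact: nbhs_open.
Qed.

Lemma open_pointwise (V : normedModType R) (U : set V) :
  (forall x, U x -> exists O : set V, [/\ open O, O x & O `<=` U]) -> open U.
Proof.
move=> H; rewrite openE => x /H[Q [oO Ox OU]]; apply: filterS OU _; exact: nbhs_open.
Qed.

(** One chart around each value suffices, by smoothness of the transition maps. *)
Lemma msmooth_local (V : normedModType R) (U : set V) (f : V -> M) :
  (forall x, U x -> exists (c : chart F M) (O : set V), [/\ charts A c, open O, O x, O `<=` U &
     (forall y, O y -> dom c (f y)) /\ smooth_on O (fun y => fwd c (f y))]) ->
  msmooth U f.
Proof.
move=> H d Ad.
have key x : U x -> dom d (f x) -> exists O : set V, [/\ open O, O x,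
    O `<=` U `&` f @^-1` dom d & smooth_on O (fun y => fwd d (f y))].
  move=> Ux dx; have [c [Q [Ac oO Ox OU [Oc sO]]]] := H x Ux.
  pose O' := Q `&` (fun y => fwd c (f y)) @^-1` overlap c d.
  have oO' : open O'.
    by apply: open_preim => //; [move=> y Oy; exact: (smooth_cont sO)|exact: overlap_open].
  exists O'; split=> //.
  - by split=> //; split=> /=; [exact: chart_fwd_cod (Oc _ Ox)|rewrite chart_fwdK//; exact: Oc].
  - move=> y [Oy [_]] /=; rewrite chart_fwdK//; last exact: Oc.
    by move=> dy; split=> //; exact: OU.
  have s1 : smooth_on O' (fun y => fwd c (f y)) by apply: smooth_sub sO => y [].
  have := smooth_comp oO' _ s1 (transition_smooth Ac Ad) => /(_ (fun y O'y => O'y.2)).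
  by apply: smooth_ext => // y [Oy _]; rewrite chart_fwdK//; exact: Oc.
split.
  by apply: open_pointwise => x [Ux dx]; have [Q [? ? ? ?]] := key x Ux dx; exists Q.
by apply: smooth_local => x [Ux dx]; have [Q [? ? ? ?]] := key x Ux dx; exists Q.
Qed.

Lemma msmooth_at (V : normedModType R) (U : set V) (f : V -> M) c x : msmooth U f ->
  charts A c -> U x -> dom c (f x) -> differentiable (fun y => fwd c (f y)) x.
Proof. by move=> sf Ac Ux cx; have [_ /smooth_diff] := sf c Ac; apply. Qed.

Lemma msmooth_near (V : normedModType R) (U : set V) (f : V -> M) c x : msmooth U f ->
  charts A c -> U x -> dom c (f x) -> \forall y \near x, U y /\ dom c (f y).
Proof.
by move=> sf Ac Ux cx; have [op _] := sf c Ac; apply: filterS (nbhs_open op _) => // y [].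
Qed.

Lemma msmooth_continuous (V : normedModType R) (U : set V) (f : V -> M) x :
  msmooth U f -> U x -> {for x, continuous (f : V -> mspace A)}.
Proof.
move=> sf Ux P; have Ac := chart_at_charts (f x); have cx := chart_at_dom (f x).
rewrite (nbhs_chart _ Ac cx) => -[W [oW Wx WP]].
have [op s] := sf _ Ac.
have : nbhs x ((U `&` f @^-1` dom (chart_at A (f x))) `&` (fun y => fwd (chart_at A (f x)) (f y)) @^-1` W).
  apply: filterI; first by apply: nbhs_open.
  by apply: (smooth_cont s) => //; exact: nbhs_open.
apply: filterS => y [[Uy cy] /WP[_]] /=; by rewrite chart_fwdK.
Qed.

Lemma msmooth_comp (V W : normedModType R) (U : set V) (O : set W) (g : V -> W) (f : W -> M) :
  open U -> (forall x, U x -> O (g x)) -> smooth_on U g -> msmooth O f ->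
  msmooth U (fun x => f (g x)).
Proof.
move=> oU UO sg sf c Ac; have [op s] := sf c Ac.
have o' : open (U `&` (fun x => f (g x)) @^-1` dom c).
  have -> : U `&` (fun x => f (g x)) @^-1` dom c = U `&` g @^-1` (O `&` f @^-1` dom c).
    rewrite predeqE => x; split=> [[Ux cx]|[Ux [_ cx]]]; last by split.
    by split=> //; split=> //=; exact: UO.
  by apply: open_preim => // x Ux; exact: (smooth_cont sg).
split=> //; apply: (smooth_comp o' _ _ s) => [x [Ux cx]|].
  by split=> //=; exact: UO.
by apply: smooth_sub sg => x [].
Qed.

Lemma msmooth_cst (V : normedModType R) (U : set V) p : open U -> msmooth U (fun=> p).
Proof.
move=> oU; apply: msmooth_local => x Ux; exists (chart_at A p), U; split=> //.
  exact: chart_at_charts.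
by split=> [y _|]; [exact: chart_at_dom|exact: smooth_cst].
Qed.

Lemma msmooth_bwd c : charts A c -> msmooth (cod c) (bwd c).
Proof.
move=> Ac; apply: msmooth_local => y cy; exists c, (cod c); split=> //; first exact: chart_cod_open.
split=> [z cz|]; first exact: chart_bwd_dom.
have oc := chart_cod_open Ac.
by apply: smooth_ext (smooth_id oc) => // z cz; rewrite chart_bwdK.
Qed.

Lemma mspace_hausdorff : hausdorff_space (mspace A).
Proof. by case: mA. Qed.

End Manifold.

Section SmoothMaps.
Context {R : realType} (F F' : normedModType R) (M N : Type).
Variables (A : atlas F M) (B : atlas F' N).
Hypotheses (mA : is_manifold A) (mB : is_manifold B).

Lemma msmooth_map (V : normedModType R) (U : set V) (f : V -> M) (h : M -> N) : open U ->
  smooth_map A B h -> msmooth A U f -> msmooth B U (fun x => h (f x)).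
Proof.
move=> oU sh sf; apply: msmooth_local => // x Ux.
have Ac := chart_at_charts mA (f x); have cx := chart_at_dom mA (f x).
have Ad := chart_at_charts mB (h (f x)); have dx := chart_at_dom mB (h (f x)).
set c := chart_at A _ in Ac cx *; set d := chart_at B _ in Ad dx *.
have [W [oW Wx Wc Wd sW]] := sh c d (f x) Ac Ad cx dx.
have [op s] := sf c Ac.
pose O := (U `&` f @^-1` dom c) `&` (fun y => fwd c (f y)) @^-1` W.
have oO : open O by apply: open_preim => // y Oy; exact: (smooth_cont s).
exists d, O; split=> //; first by move=> y [[]].
split=> [y [[Uy cy] Wy]|].
  by have := Wd _ Wy; rewrite (chart_fwdK mA).
have s' : smooth_on O (fun y => fwd c (f y)) by apply: smooth_sub s => y [].
have := smooth_comp oO _ s' sW => /(_ (fun y Oy => Oy.2)).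
by apply: smooth_ext => // y [[Uy cy] _] /=; rewrite (chart_fwdK mA).
Qed.

Lemma smooth_mapP (h : M -> N) :
  (forall c, charts A c -> msmooth B (cod c) (fun y => h (bwd c y))) -> smooth_map A B h.
Proof.
move=> H c d p Ac Bd cp dp; have [op s] := H c Ac d Bd.
exists (cod c `&` (fun y => h (bwd c y)) @^-1` dom d); split=> //.
- by split; [exact: chart_fwd_cod|rewrite /= (chart_fwdK mA)].
- by move=> y [].
Qed.

End SmoothMaps.

Local Open Scope group_scope.
Local Open Scope ring_scope.

(** * Partial derivatives and the chain rule *)

Section Partial.
Context {R : realType}.
Implicit Types U V W Z : normedModType R.

Lemma diff_partial1 V W Z (F : V * W -> Z) a b v : differentiable F (a, b) ->
  'd F (a, b) (v, 0) = 'd (fun x => F (x, b)) a v :> Z.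
Proof.
move=> dF.
have D : is_diff a (fun x : V => (x, b)) (fun v => (v, 0 : W)).
  exact: (is_diff_pair (contlin_is_diff a (contlin_id V)) (is_diff_cst b a)).
have H := @is_diff_comp _ _ _ _ _ _ _ _ a D (differentiableP dF).
by have := @diff_val _ _ _ _ _ _ _ H => /(congr1 (fun f => f v)).
Qed.

Lemma diff_partial2 V W Z (F : V * W -> Z) a b w : differentiable F (a, b) ->
  'd F (a, b) (0, w) = 'd (fun y => F (a, y)) b w :> Z.
Proof.
move=> dF.
have D : is_diff b (fun y : W => (a, y)) (fun w => (0 : V, w)).
  exact: (is_diff_pair (is_diff_cst a b) (contlin_is_diff b (contlin_id W))).
have H := @is_diff_comp _ _ _ _ _ _ _ _ b D (differentiableP dF).
by have := @diff_val _ _ _ _ _ _ _ H => /(congr1 (fun f => f w)).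
Qed.

Lemma diff_pairD V W Z (F : V * W -> Z) p v w : differentiable F p ->
  'd F p (v, w) = 'd F p (v, 0) + 'd F p (0, w) :> Z.
Proof. by move=> dF; rewrite -linearD; congr ('d F p _); congr (_, _); rewrite /= ?addr0 ?add0r. Qed.

Lemma smooth_dir V W (A : set V) (F : V -> W) v : open A -> smooth_on A F ->
  smooth_on A (fun x => 'd F x v).
Proof.
move=> oA sF; apply: (smooth_comp (f := fun x => (x, v)) oA _ _ (smooth_tangent sF)) => //.
by apply: smooth_pair => //; [exact: smooth_id|exact: smooth_cst].
Qed.

Lemma is_diffE V W (f df : V -> W) x v : is_diff x f df -> 'd f x v = df v.
Proof. by case=> _ ->. Qed.

Lemma is_diff_ex V W (f df : V -> W) x : is_diff x f df -> differentiable f x.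
Proof. by case. Qed.

(** The base point of the outer differential is a variable tied to [f x] by an equation, so that it
    can be given in reduced form, such as 0. *)
Lemma diff_chain V W Z (f : V -> W) (g : W -> Z) x y v : differentiable f x ->
  f x = y -> differentiable g y -> 'd (fun y => g (f y)) x v = 'd g y ('d f x v) :> Z.
Proof. by move=> df <- dg; have -> := @diff_comp _ _ _ _ f g x df dg. Qed.

Lemma differentiable_chain V W Z (f : V -> W) (g : W -> Z) x y : differentiable f x ->
  f x = y -> differentiable g y -> differentiable (fun y => g (f y)) x.
Proof. by move=> df <- dg; exact: differentiable_comp. Qed.

Lemma diff_id V (x v : V) : 'd (fun y : V => y) x v = v.
Proof. by have -> := @diff_val _ _ _ _ _ _ _ (is_diff_id x). Qed.

Lemma differentiable_id V (x : V) : differentiable (fun y : V => y) x.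
Proof. exact: (@ex_diff _ _ _ _ _ _ _ (is_diff_id x)). Qed.

(** Many differentials of group operations are computed this way: after cancellation in the group,
    the map in the chart is the identity near the point. *)
Lemma near_diff_id V (f : V -> V) x v : {near x, f =1 id} -> 'd f x v = v.
Proof.
move=> H; rewrite -[RHS](diff_id x v); congr (_ v); apply: near_diff; last exact: differentiable_id.
by apply: filterS H => y ->.
Qed.

Lemma near_diffE V W (f g : V -> W) x v : {near x, f =1 g} ->
  differentiable f x -> 'd g x v = 'd f x v.
Proof. by move=> H D; rewrite (near_diff H D). Qed.

Lemma differentiable_pairl V W (x : V) (y : W) : differentiable (fun z => (z, y)) x.
Proof. by apply: differentiable_pair; [exact: differentiable_id|exact: differentiable_cst]. Qed.

Lemma differentiable_pairr V W (x : V) (y : W) : differentiable (fun z => (x, z)) y.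
Proof. by apply: differentiable_pair; [exact: differentiable_cst|exact: differentiable_id]. Qed.

Lemma contlin_affine_diff V W (L : V -> W) (c : W) x : contlin L ->
  is_diff x (fun y => c + L y) L.
Proof.
move=> cL; have H := is_diffD (f := cst c) (is_diff_cst c x) (contlin_is_diff x cL).
by move: H; rewrite add0r.
Qed.

End Partial.

Record lie_setup (R : realType) (n : nat) := LieSetup {
  lbr : 'rV[R]_n -> 'rV[R]_n -> 'rV[R]_n;
  lG :> groupType;
  lA : atlas 'rV[R]_n lG;
  lth : {linear 'rV[R]_n -> 'rV[R]_n};
  lth' : {linear 'rV[R]_n -> 'rV[R]_n};
  lbrP : is_lie_bracket lbr;
  lGP : is_lie_group lA;
  lthP : is_lie_algebra_of lA lbr lth lth' }.

(** * Lie groups in a chart at the unit *)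

Section LieGroup.
Context {R : realType} {n : nat} (S : lie_setup R n).
Notation A := (lA S).
Notation th := (lth S).
Notation th' := (lth' S).
Notation E := 'rV[R]_n.
Implicit Types (V W : normedModType R) (g h k : S).

Lemma mA : is_manifold A. Proof. by case: (lGP S). Qed.

Lemma msmooth_mul V (U : set V) (f g : V -> S) : open U -> msmooth A U f ->
  msmooth A U g -> msmooth A U (fun x => f x * g x)%g.
Proof.
move=> oU sf sg; apply: (msmooth_local mA) => x Ux.
have Ac := chart_at_charts mA (f x); have cx := chart_at_dom mA (f x).
have Ad := chart_at_charts mA (g x); have dx := chart_at_dom mA (g x).
have Ae := chart_at_charts mA (f x * g x)%g; have ex := chart_at_dom mA (f x * g x)%g.
set c := chart_at A (f x) in Ac cx; set d := chart_at A (g x) in Ad dx; set e := chart_at A _ in Ae ex.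
have [_ _ sm _] := lGP S.
have [|//|||W [oW Wx Wc We sW]] := sm (prod_chart c d) e (f x, g x).
- by exists c, d.
- by split.
- exact: ex.
have [op1 s1] := sf c Ac; have [op2 s2] := sg d Ad.
pose Q1 := (U `&` f @^-1` dom c) `&` (U `&` g @^-1` dom d).
have oQ1 : open Q1 by exact: openI.
have sp : smooth_on Q1 (fun y => (fwd c (f y), fwd d (g y))).
  by apply: smooth_pair => //; [apply: smooth_sub s1 => y []|apply: smooth_sub s2 => y []].
pose Q := Q1 `&` (fun y => (fwd c (f y), fwd d (g y))) @^-1` W.
have oQ : open Q by apply: open_preim => // y Qy; exact: (smooth_cont sp).
have Qx : Q x by exact: (conj (conj (conj Ux cx) (conj Ux dx)) Wx).
exists e, Q; split=> //; first by move=> y [[[]]].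
split=> [y [[[Uy cy] [_ dy]] Wy]|].
  by have := We _ Wy; rewrite /= !(chart_fwdK mA).
have sp' : smooth_on Q (fun y => (fwd c (f y), fwd d (g y))) by apply: smooth_sub sp => y [].
have := smooth_comp oQ _ sp' sW => /(_ (fun y Qy => Qy.2)).
by apply: smooth_ext => // y [[[Uy cy] [_ dy]] _] /=; rewrite !(chart_fwdK mA).
Qed.

Lemma msmooth_inv V (U : set V) (f : V -> S) : open U -> msmooth A U f ->
  msmooth A U (fun x => (f x)^-1)%g.
Proof. by move=> oU sf; have [_ _ _ si] := lGP S; exact: (msmooth_map mA mA oU si sf). Qed.

Definition le : chart E S := chart_at A 1%g.
Definition lo : E := fwd le 1%g.
Definition phi (g : S) : E := th' (fwd le g - lo).
(* psi is a chart at the unit, normalized so that psi 0 = 1 and that its derivative at 0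
   identifies the model space with the Lie algebra. *)
Definition psi (y : E) : S := bwd le (lo + th y).
Definition D0 : set E := (fun y => lo + th y) @^-1` cod le.
Definition Ge : set S := dom le.

Lemma leA : charts A le. Proof. exact: (chart_at_charts mA). Qed.
Lemma thK : cancel th th'. Proof. by case: (lthP S). Qed.
Lemma thK' : cancel th' th. Proof. by case: (lthP S). Qed.
Lemma th_contlin : contlin th. Proof. by apply: mx_lin_contlin; exact: linearP. Qed.
Lemma th'_contlin : contlin th'. Proof. by apply: mx_lin_contlin; exact: linearP. Qed.

Lemma Ge1 : Ge 1%g. Proof. exact: (chart_at_dom mA). Qed.

Lemma phi1 : phi 1%g = 0. Proof. by rewrite /phi subrr linear0. Qed.
Lemma psi0 : psi 0 = 1%g.
Proof. by rewrite /psi linear0 addr0 (chart_fwdK mA leA Ge1). Qed.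

Lemma phiK g : Ge g -> psi (phi g) = g.
Proof. by move=> eg; rewrite /psi /phi thK' addrC subrK (chart_fwdK mA leA eg). Qed.

Lemma psi_Ge y : D0 y -> Ge (psi y).
Proof. exact: (chart_bwd_dom mA leA). Qed.

Lemma psiK y : D0 y -> phi (psi y) = y.
Proof. by move=> Dy; rewrite /phi /psi (chart_bwdK mA leA Dy) addrC addKr thK. Qed.

Lemma phi_D0 g : Ge g -> D0 (phi g).
Proof. by move=> eg; rewrite /D0 /= /phi thK' addrC subrK; exact: chart_fwd_cod. Qed.

Lemma D00 : D0 0. Proof. by rewrite -phi1; exact: phi_D0 Ge1. Qed.

Lemma affine_th_smooth (U : set E) : open U -> smooth_on U (fun y => lo + th y).
Proof.
by move=> oU; apply: smooth_add => //; [exact: smooth_cst|apply: smooth_lin => //; exact: th_contlin].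
Qed.

Lemma D0_open : open D0.
Proof.
rewrite -[D0]setTI; apply: open_preim; [exact: openT| |exact: (chart_cod_open mA leA)].
by move=> x _; exact: (smooth_cont (affine_th_smooth openT)).
Qed.

Lemma msmooth_psi : msmooth A D0 psi.
Proof.
apply: (msmooth_comp D0_open _ (affine_th_smooth D0_open) (msmooth_bwd mA leA)).
by [].
Qed.

Lemma smooth_phi V (U : set V) (f : V -> S) : msmooth A U f ->
  open (U `&` f @^-1` Ge) /\ smooth_on (U `&` f @^-1` Ge) (fun x => phi (f x)).
Proof.
move=> sf; have [op s] := sf le leA; split=> //.
apply: (smooth_comp (B := setT) (g := fun y => th' (y - lo)) op _ s) => //.
apply: (smooth_comp (B := setT) (g := th')) => //; first exact: openT.
  apply: smooth_add; [exact: openT|apply: smooth_id; exact: openT|apply: smooth_cst; exact: openT].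
apply: smooth_lin; [exact: openT|exact: th'_contlin].
Qed.

Lemma phi_diff V (U : set V) (f : V -> S) x : msmooth A U f -> U x -> Ge (f x) ->
  differentiable (fun y => phi (f y)) x.
Proof. by move=> sf Ux ex; have [op s] := smooth_phi sf; apply: (smooth_diff s). Qed.

Lemma msmooth_cst1 V (U : set V) g : open U -> msmooth A U (fun=> g).
Proof. exact: (msmooth_cst mA). Qed.

Lemma near_D0 : \forall y \near (0 : E), D0 y.
Proof. exact: nbhs_open D0_open D00. Qed.

Lemma near_Ge V (U : set V) (f : V -> S) x : msmooth A U f -> U x -> Ge (f x) ->
  \forall y \near x, U y /\ Ge (f y).
Proof. by move=> sf; exact: (msmooth_near sf leA). Qed.

Lemma msmooth_psi_comp V (U : set V) (f : V -> E) : open U -> smooth_on U f ->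
  (forall x, U x -> D0 (f x)) -> msmooth A U (fun x => psi (f x)).
Proof. by move=> oU sf H; exact: (msmooth_comp oU H sf msmooth_psi). Qed.

Lemma msmooth_conj g : msmooth A D0 (fun y => g * psi y * g^-1)%g.
Proof.
by apply: msmooth_mul; [exact: D0_open|apply: msmooth_mul; [exact: D0_open| |exact: msmooth_psi]|];
  apply: msmooth_cst1; exact: D0_open.
Qed.

Definition Ad g (v : E) : E := 'd (fun y => phi (g * psi y * g^-1)%g) (0 : E) v.

Lemma Ad_linear g : linear (Ad g). Proof. by move=> a u v; rewrite /Ad linearP. Qed.

Lemma conj_at0 g : Ge (g * psi 0 * g^-1)%g.
Proof. by rewrite psi0 mulg1 mulgV; exact: Ge1. Qed.

Lemma conj_diff g : differentiable (fun y => phi (g * psi y * g^-1)%g) (0 : E).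
Proof. exact: phi_diff (msmooth_conj g) D00 (conj_at0 g). Qed.

Lemma phi_conj0 g : phi (g * psi 0 * g^-1)%g = 0.
Proof. by rewrite psi0 mulg1 mulgV phi1. Qed.

(** Conjugation by [g * h] is conjugation by [h] followed by that by [g], and conjugations fix the
    unit, so the chain rule applies at 0. *)
Lemma Ad_mul g h v : Ad (g * h)%g v = Ad g (Ad h v).
Proof.
have d1 := conj_diff h; have d2 := conj_diff g; have e0 := phi_conj0 h.
have X := diff_chain v d1 e0 d2; apply: etrans; last exact: X.
have D := differentiable_chain d1 e0 d2.
have H : {near (0 : E), (fun y => phi (g * psi (phi (h * psi y * h^-1)) * g^-1)%g) =1 (fun y => phi ((g * h) * psi y * (g * h)^-1)%g)}.
  have := near_Ge (msmooth_conj h) D00 (conj_at0 h); apply: filterS => y [Dy ey] /=.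
  by rewrite phiK// invgM !mulgA.
exact: near_diffE H D.
Qed.

Lemma Ad1 v : Ad 1%g v = v.
Proof.
apply: near_diff_id; apply: filterS near_D0 => y Dy.
by rewrite /= mul1g invg1 mulg1 psiK.
Qed.

Lemma AdK g : cancel (Ad g) (Ad g^-1%g).
Proof. by move=> v; rewrite -Ad_mul mulVg Ad1. Qed.
Lemma AdVK g : cancel (Ad g^-1%g) (Ad g).
Proof. by move=> v; rewrite -Ad_mul mulgV Ad1. Qed.

(** Ad is the partial derivative at [y = 0] of a smooth map of the parameter and [y]. *)
Lemma Ad_smooth V (U : set V) (f : V -> S) : open U -> msmooth A U f ->
  smooth_on (U `*` [set: E]) (fun p : V * E => Ad (f (fst p)) (snd p)).
Proof.
move=> oU sf.
pose F (p : V * E) := (f p.1 * psi p.2 * (f p.1)^-1)%g.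
have oUD : open (U `*` D0).
  rewrite openE => -[x y] [/= Ux Dy]; exists (U, D0) => /=; last by [].
  by split; [exact: nbhs_open|apply: nbhs_open => //; exact: D0_open].
have s1 : msmooth A (U `*` D0) (fun p => f p.1).
  apply: (msmooth_comp (g := fst) oUD _ _ sf); first by move=> p [].
  by apply: smooth_lin => //; exact: contlin_fst.
have s2 : msmooth A (U `*` D0) (fun p => psi p.2).
  apply: (msmooth_comp (g := snd) oUD _ _ msmooth_psi); first by move=> p [].
  by apply: smooth_lin => //; exact: contlin_snd.
have sF : msmooth A (U `*` D0) F.
  by apply: msmooth_mul => //; [exact: msmooth_mul|exact: msmooth_inv].
have [op s] := smooth_phi sF.
have H x : U x -> ((U `*` D0) `&` F @^-1` Ge) (x, 0).
  move=> Ux; split; first by split=> //=; exact: D00.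
  by rewrite /F /= psi0 mulg1 mulgV; exact: Ge1.
have oT : open (U `*` [set: E]) by exact: openXT.
pose G (p : V * E) : (V * E) * E := ((p.1, 0), p.2).
have sG : smooth_on (U `*` [set: E]) G.
  apply: smooth_pair => //; [apply: smooth_pair => //|].
  - by apply: smooth_lin => //; exact: contlin_fst.
  - exact: smooth_cst.
  - by apply: smooth_lin => //; exact: contlin_snd.
have mG p : (U `*` [set: E]) p -> (((U `*` D0) `&` F @^-1` Ge) `*` [set: E]) (G p).
  by move=> [Ux _]; split=> //; exact: H.
have := smooth_comp oT mG sG (smooth_partial op s).
apply: smooth_ext => // -[x v] [/= Ux _].
by rewrite diff_partial2//; exact: smooth_diff s (H x Ux).
Qed.

Definition mul0 (p : E * E) : E := phi (psi p.1 * psi p.2)%g.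
Definition Om : set (E * E) := (D0 `*` D0) `&` (fun p => psi p.1 * psi p.2)%g @^-1` Ge.

Lemma D0D0_open : open (D0 `*` D0).
Proof.
rewrite openE => -[x y] [/= Dx Dy]; exists (D0, D0) => //=.
by split; apply: nbhs_open => //; exact: D0_open.
Qed.

Lemma msmooth_psi1 : msmooth A (D0 `*` D0) (fun p => psi p.1).
Proof.
apply: (msmooth_psi_comp (f := fst) D0D0_open); last by move=> p [].
by apply: smooth_lin; [exact: D0D0_open|exact: contlin_fst].
Qed.

Lemma msmooth_psi2 : msmooth A (D0 `*` D0) (fun p => psi p.2).
Proof.
apply: (msmooth_psi_comp (f := snd) D0D0_open); last by move=> p [].
by apply: smooth_lin; [exact: D0D0_open|exact: contlin_snd].
Qed.

Lemma mul0_smooth : open Om /\ smooth_on Om mul0.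
Proof. by apply: smooth_phi; apply: msmooth_mul; [exact: D0D0_open|exact: msmooth_psi1|exact: msmooth_psi2]. Qed.

Lemma Om1 x : D0 x -> Om (x, 0).
Proof.
by move=> Dx; split; [split=> //=; exact: D00|rewrite /= psi0 mulg1; exact: psi_Ge].
Qed.
Lemma Om2 x : D0 x -> Om (0, x).
Proof.
by move=> Dx; split; [split=> //=; exact: D00|rewrite /= psi0 mul1g; exact: psi_Ge].
Qed.

Lemma mul0_diff p : Om p -> differentiable mul0 p.
Proof. by have [_ s] := mul0_smooth; exact: smooth_diff. Qed.

Lemma dmul01 v : 'd mul0 (0, 0) (v, 0) = v.
Proof.
apply: (etrans (diff_partial1 v (mul0_diff (Om1 D00)))).
apply: near_diff_id; apply: filterS near_D0 => y Dy.
by rewrite /mul0 /= psi0 mulg1 psiK.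
Qed.

Lemma dmul02 v : 'd mul0 (0, 0) (0, v) = v.
Proof.
apply: (etrans (diff_partial2 v (mul0_diff (Om1 D00)))).
apply: near_diff_id; apply: filterS near_D0 => y Dy.
by rewrite /mul0 /= psi0 mul1g psiK.
Qed.

(* Left- and right-invariant vector fields in the chart psi. *)
Definition lvf (w x : E) : E := 'd mul0 (x, 0) (0, w).
Definition rvf (w x : E) : E := 'd mul0 (0, x) (w, 0).

(** Differentiates xy = (x y x^-1) x in y at the unit. *)
Lemma lvf_Ad w x : D0 x -> lvf w x = rvf (Ad (psi x) w) x.
Proof.
move=> Dx; apply: (etrans (diff_partial2 w (mul0_diff (Om1 Dx)))).
apply: (etrans _ (esym (diff_partial1 (Ad (psi x) w) (mul0_diff (Om2 Dx))))).
have d1 := conj_diff (psi x).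
have d2 : differentiable (fun y => mul0 (y, x)) 0.
  exact: differentiable_chain (differentiable_pairl 0 x) (erefl _) (mul0_diff (Om2 Dx)).
have e0 := phi_conj0 (psi x).
have X := diff_chain w d1 e0 d2; apply: etrans; last exact: X.
have D := differentiable_chain d1 e0 d2.
have H : {near (0 : E), (fun y => mul0 (phi (psi x * psi y * (psi x)^-1)%g, x)) =1 (fun y => mul0 (x, y))}.
  have := near_Ge (msmooth_conj (psi x)) D00 (conj_at0 (psi x)); apply: filterS => y [Dy ey].
  by rewrite /mul0 /= phiK// mulgVK.
exact: near_diffE H D.
Qed.

End LieGroup.

Arguments D0_open {R n} S.
Arguments msmooth_psi {R n} S.
Arguments D0D0_open {R n} S.
Arguments msmooth_psi1 {R n} S.
Arguments msmooth_psi2 {R n} S.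

(** * The bracket as the derivative of Ad *)

Section LieBracket.
Context {R : realType} {n : nat} (S : lie_setup R n).
Notation A := (lA S).
Notation th := (lth S).
Notation th' := (lth' S).
Notation E := 'rV[R]_n.
Notation mA := (mA S).
Notation leA := (leA S).
Notation D0 := (D0 S).
Notation le := (le S).
Notation lo := (lo S).
Notation psi := (psi S).
Notation mul0 := (mul0 S).
Notation Om := (Om S).
Notation lvf := (lvf S).
Notation rvf := (rvf S).
Implicit Types (V W : normedModType R) (g h k : S).

Lemma lvf_smooth w : smooth_on D0 (lvf w).
Proof.
have [op s] := mul0_smooth S.
have o0 := D0_open S; have H x : D0 x -> Om (x, 0) by exact: Om1.
have sp := smooth_pair o0 (smooth_id o0) (smooth_cst (0 : E) o0).
exact: (smooth_comp o0 H sp (smooth_dir (0, w) op s)).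
Qed.

Lemma rvf_smooth w : smooth_on D0 (rvf w).
Proof.
have [op s] := mul0_smooth S.
have o0 := D0_open S; have H x : D0 x -> Om (0, x) by exact: Om2.
have sp := smooth_pair o0 (smooth_cst (0 : E) o0) (smooth_id o0).
exact: (smooth_comp o0 H sp (smooth_dir (w, 0) op s)).
Qed.

Definition rvf2 (p : E * E) := rvf p.2 p.1.

Lemma rvf2_smooth : smooth_on (D0 `*` [set: E]) rvf2.
Proof.
have [op s] := mul0_smooth S.
have oT : open (D0 `*` [set: E]) by apply: openXT; exact: D0_open.
have H (p : E * E) : (D0 `*` [set: E]) p -> (Om `*` [set: E * E]) ((0, p.1), (p.2, 0)).
  by move=> [Dp _]; split=> //; exact: Om2.
suff sp : smooth_on (D0 `*` [set: E]) (fun p : E * E => ((0 : E, p.1), (p.2, 0 : E))).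
  exact: (smooth_comp oT H sp (smooth_tangent s)).
apply: smooth_pair => //; apply: smooth_pair => //.
- exact: smooth_cst.
- by apply: smooth_lin => //; exact: contlin_fst.
- by apply: smooth_lin => //; exact: contlin_snd.
- exact: smooth_cst.
Qed.

(** Both sides are the mixed second derivative of the multiplication [mul0] at the unit. *)
Lemma lvf_rvf_sym v w : 'd (lvf w) 0 v = 'd (rvf v) 0 w.
Proof.
have [op s] := mul0_smooth S.
have O0 := Om1 (D00 S).
have X := schwarz (0, w) (v, 0) op s O0.
have d1 : differentiable (fun z => 'd mul0 z (0, w)) (0, 0) by exact: (smooth_diff (smooth_dir (0, w) op s)).
have d2 : differentiable (fun z => 'd mul0 z (v, 0)) (0, 0) by exact: (smooth_diff (smooth_dir (v, 0) op s)).
have Y1 := diff_partial1 v d1; have Y2 := diff_partial2 w d2.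
exact: etrans (esym Y1) (etrans X Y2).
Qed.

Lemma Ad_psi_diff w : differentiable (fun y => Ad (psi y) w) (0 : E).
Proof.
have s := Ad_smooth (D0_open S) (msmooth_psi S).
have o0 := D0_open S; have H x : D0 x -> (D0 `*` [set: E]) (x, w) by [].
have sp := smooth_pair o0 (smooth_id o0) (smooth_cst w o0).
exact: (smooth_diff (smooth_comp o0 H sp s) (D00 S)).
Qed.

(** Differentiation of [lvf_Ad] at the unit: the right side varies through Ad, which is the term
    sought, and through the base point of the right invariant field, which [lvf_rvf_sym]
    rewrites. *)
Lemma dAd_lvf v w : 'd (fun y => Ad (psi y) w) (0 : E) v = 'd (lvf w) 0 v - 'd (lvf v) 0 w.
Proof.
pose a := 'd (fun y => Ad (psi y) w) (0 : E) v.
have dA := Ad_psi_diff w.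
have dN : differentiable rvf2 (0, w) by apply: (smooth_diff rvf2_smooth); split=> //; exact: D00.
pose f y := (y, Ad (psi y) w).
have df : differentiable f 0 by apply: differentiable_pair => //; exact: differentiable_id.
have f0 : f 0 = (0, w) by rewrite /f psi0 Ad1.
have Ef : 'd f 0 v = (v, a).
  have := diff_pair (differentiable_id (0 : E)) dA => /(congr1 (fun f => f v)) /= ->.
  by congr (_, _); exact: diff_id.
have X := diff_chain v df f0 dN; rewrite Ef in X.
have Y := diff_pairD v a dN.
have Z1 : 'd rvf2 (0, w) (v, 0) = 'd (lvf v) 0 w.
  exact: etrans (diff_partial1 v dN) (esym (lvf_rvf_sym w v)).
have Z2 : 'd rvf2 (0, w) (0, a) = a.
  apply: (etrans (diff_partial2 a dN)); apply: near_diff_id.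
  by apply: filterE => u; exact: dmul01.
have H : {near (0 : E), (fun y => rvf2 (f y)) =1 lvf w}.
  by apply: filterS (near_D0 S) => y Dy; rewrite /= lvf_Ad.
have L := near_diffE v H (differentiable_chain df f0 dN).
have fin (x y z : E) : x = y + z -> z = x - y by move=> ->; rewrite addrC addKr.
apply: fin; apply: (etrans L); apply: (etrans X); apply: (etrans Y).
exact: (congr2 +%R Z1 Z2).
Qed.

Lemma psi_is_diff W (h : S -> W) : differentiable (fun y => h (bwd le y)) lo ->
  is_diff (0 : E) (fun y => h (psi y)) (fun v => 'd (fun y => h (bwd le y)) lo (th v)).
Proof.
move=> dh; have Da := contlin_affine_diff lo (0 : E) (th_contlin S).
have e0 : lo + th 0 = lo by rewrite linear0 addr0.
have dh' : is_diff (lo + th 0) (fun y => h (bwd le y)) ('d (fun y => h (bwd le y)) lo).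
  by rewrite e0; exact: differentiableP.
exact: (is_diff_comp Da dh').
Qed.

Lemma phi_is_diff V (f : V -> S) x : differentiable (fun y => fwd le (f y)) x ->
  is_diff x (fun y => phi (f y)) (fun v => th' ('d (fun y => fwd le (f y)) x v)).
Proof.
move=> df; have D1 := is_diffB (is_diff_cst lo x) (differentiableP df).
have D2 := is_diff_comp (is_diffB (differentiableP df) (is_diff_cst lo x)) (contlin_is_diff _ (th'_contlin S)).
by apply: is_diff_eq D2 _; apply/funext => v /=; rewrite subr0.
Qed.

Lemma bwd_smooth_mul g c : charts A c -> dom c g ->
  differentiable (fun y => fwd c (g * bwd le y)%g) lo.
Proof.
move=> Ac cg; have oc := chart_cod_open mA leA.
have sf : msmooth A (cod le) (fun y => g * bwd le y)%g.
  by apply: msmooth_mul => //; [exact: msmooth_cst1|exact: (msmooth_bwd mA leA)].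
apply: (msmooth_at sf Ac); first exact: chart_fwd_cod (Ge1 S).
by rewrite /lo (chart_fwdK mA leA (Ge1 S)) mulg1.
Qed.

Lemma transition_diff (c d : chart E S) p : charts A c -> charts A d -> dom c p -> dom d p ->
  differentiable (fun y => fwd d (bwd c y)) (fwd c p).
Proof.
move=> Ac Ad cp dp; apply: (smooth_diff (transition_smooth mA Ac Ad)).
by split; [exact: chart_fwd_cod|rewrite (chart_fwdK mA Ac cp)].
Qed.

(** Translates the left invariant field, given by components in the preferred chart at each point,
    to the fixed chart at the unit. *)
Lemma lfield_tcoord x w : D0 x ->
  tcoord A le (psi x) (left_invariant_field A (th w) (psi x)) = th (lvf w x).
Proof.
move=> Dx; set g := psi x; have eg : dom le g := psi_Ge Dx.
pose c := chart_at A g; have Ac : charts A c := chart_at_charts mA g; have cg : dom c g := chart_at_dom mA g.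
rewrite /tcoord /left_invariant_field /mdiff /ltrans mulg1.
pose f1 (y : E) := fwd c (g * bwd le y)%g.
have d1 : differentiable f1 lo by exact: bwd_smooth_mul.
have e1 : f1 lo = fwd c g by rewrite /f1 /lo (chart_fwdK mA leA (Ge1 S)) mulg1.
have d2 := transition_diff Ac leA cg eg.
have X := diff_chain (th w) d1 e1 d2.
apply: (etrans (esym X)).
have D := differentiable_chain d1 e1 d2.
have H : {near lo, (fun y => fwd le (bwd c (f1 y))) =1 (fun y => fwd le (g * bwd le y)%g)}.
  have sf : msmooth A (cod le) (fun y => g * bwd le y)%g.
    have oc := chart_cod_open mA leA.
    by apply: msmooth_mul => //; [exact: msmooth_cst1|exact: (msmooth_bwd mA leA)].
  have := msmooth_near sf Ac (chart_fwd_cod (Ge1 S)); rewrite (chart_fwdK mA leA (Ge1 S)) mulg1 => /(_ cg).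
  by apply: filterS => y [_ cy]; rewrite /f1 (chart_fwdK mA Ac).
apply: (etrans (esym (near_diffE (th w) H D))).
have d3 := bwd_smooth_mul leA eg.
have D3 := psi_is_diff (h := fun k => fwd le (g * k)%g) d3.
have D4 := phi_is_diff (f := fun y => (g * psi y)%g) (is_diff_ex D3).
have L : lvf w x = 'd (fun y => phi (g * psi y)%g) (0 : E) w.
  exact: diff_partial2 (mul0_diff (Om1 Dx)).
have M := is_diffE w D3; have K := is_diffE w D4.
apply: esym; apply: (etrans (congr1 th (etrans L K))); rewrite thK'.
exact: M.
Qed.

Lemma lfield1 w : left_invariant_field A (th w) 1%g = th w.
Proof.
have := lfield_tcoord w (D00 S); rewrite psi0.
have -> : lvf w 0 = w by exact: dmul02.
rewrite /tcoord near_diff_id//.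
have oc := chart_cod_open mA leA.
by apply: filterS (nbhs_open oc (chart_fwd_cod (Ge1 S))) => y cy; rewrite /= (chart_bwdK mA leA).
Qed.

(** The hypothesis on the bracket is transferred to the chart [psi], where the constant affine
    change of coordinates by [theta] passes through both differentials. *)
Lemma lbr_lvf v w : lbr S v w = 'd (lvf w) 0 v - 'd (lvf v) 0 w.
Proof.
have [_ _ H] := lthP S; apply: (can_inj (thK S)); rewrite H linearB.
have key u u' : 'd (vfield_rep A le (left_invariant_field A (th u))) lo (th u') = th ('d (lvf u) 0 u').
  pose aff (y : E) := th' (y - lo).
  have Da : is_diff lo aff th'.
    have X := is_diff_comp (is_diffB (is_diff_id lo) (is_diff_cst lo lo)) (contlin_is_diff _ (th'_contlin S)).
    by apply: is_diff_eq X _; apply/funext => z /=; rewrite subr0.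
  have a0 : aff lo = 0 by rewrite /aff subrr linear0.
  have dl := smooth_diff (lvf_smooth u) (D00 S).
  have dt : differentiable th ('d (lvf u) 0 u') by exact: (@ex_diff _ _ _ _ _ _ _ (contlin_is_diff _ (th_contlin S))).
  have dtl : is_diff (0 : E) (fun x => th (lvf u x)) (fun z => th ('d (lvf u) 0 z)).
    exact: (is_diff_comp (differentiableP dl) (contlin_is_diff _ (th_contlin S))).
  have dtl' := dtl; rewrite -a0 in dtl'.
  have D : is_diff lo (fun y => th (lvf u (aff y))) (fun z => th ('d (lvf u) 0 (th' z))).
    have := @is_diff_comp _ _ _ _ _ _ _ _ lo Da dtl'; rewrite a0; exact.
  have Hn : {near lo, (fun y => th (lvf u (aff y))) =1 vfield_rep A le (left_invariant_field A (th u))}.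
    have oc := chart_cod_open mA leA.
    apply: filterS (nbhs_open oc (chart_fwd_cod (Ge1 S))) => y cy.
    have Ey : psi (aff y) = bwd le y by rewrite /psi /aff thK' addrC subrK.
    rewrite /vfield_rep -Ey lfield_tcoord//.
    by rewrite /D0 /= /aff thK' addrC subrK.
  have X := near_diffE (th u') Hn (is_diff_ex D).
  apply: (etrans X); apply: (etrans (is_diffE (th u') D)).
  by rewrite /= thK.
by rewrite /vfield_bracket !lfield1; congr (_ - _); exact: key.
Qed.

Lemma dAd v w : 'd (fun y => Ad (psi y) w) (0 : E) v = lbr S v w.
Proof. by rewrite dAd_lvf lbr_lvf. Qed.

End LieBracket.

(** * A Gronwall inequality *)

Section Gronwall.
Context {R : realType}.

Lemma der_sum (I : Type) (r : seq I) (f f' : I -> R -> R) u :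
  (forall i, der (f i : R -> R) u (f' i u)) ->
  der (fun x => \sum_(i <- r) f i x : R) u (\sum_(i <- r) f' i u).
Proof.
move=> df; elim: r => [|i r IH].
  rewrite big_nil (_ : (fun x => _) = fun=> 0); first exact: der_cst.
  by apply/funext => x; rewrite big_nil.
rewrite big_cons (_ : (fun x => _) = fun x => f i x + \sum_(j <- r) f j x); last first.
  by apply/funext => x; rewrite big_cons.
exact: derD.
Qed.

Lemma der_mulR (f g : R -> R) u f' g' : der (f : R -> R) u f' -> der (g : R -> R) u g' ->
  der (fun x => f x * g x : R) u (f u * g' + f' * g u).
Proof. exact: (is_derive_bil (scale_contbil R)). Qed.

(** The sum [f] of the squares of the entries satisfies f' <= k f, so [f u * expR (- (k * u))] does
    not increase. The bound obtained is on the square of the norm, and x <= x^2 + 1 removes the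
    square; what matters is that [K] is the same for all [F]. *)
Lemma gronwall m n (c : R) : 0 <= c -> exists K : R, forall F F' : R -> 'M[R]_(m, n),
  (forall u, unitI u -> der F u (F' u)) -> (forall u, unitI u -> `|F' u| <= c * `|F u|) ->
  forall u, unitI u -> `|F u| <= K * `|F 0| ^+ 2 + 1.
Proof.
move=> c0; pose N : R := \sum_(i < m) \sum_(j < n) 1.
have N0 : 0 <= N by apply: sumr_ge0 => i _; exact: sumr_ge0.
pose k := 2 * N * c; have k0 : 0 <= k by rewrite !mulr_ge0.
exists (N * expR k) => F F' dF bF.
pose f u := \sum_(i < m) \sum_(j < n) F u i j * F u i j.
pose f' u := \sum_(i < m) \sum_(j < n) (F u i j * F' u i j + F' u i j * F u i j).
have df u : unitI u -> der (f : R -> R) u (f' u).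
  move=> uI; apply: (@der_sum _ _ (fun i u => \sum_(j < n) F u i j * F u i j)
    (fun i u => \sum_(j < n) (F u i j * F' u i j + F' u i j * F u i j))) => i.
  apply: (@der_sum _ _ (fun j u => F u i j * F u i j) (fun j u => F u i j * F' u i j + F' u i j * F u i j)) => j.
  by apply: der_mulR; apply: is_derive_coord; exact: dF.
have fF u : `|F u| ^+ 2 <= f u.
  have f0 : 0 <= f u by apply: sumr_ge0 => i _; apply: sumr_ge0 => j _; rewrite -expr2 sqr_ge0.
  have : `|F u| <= Num.sqrt (f u).
    apply: mx_norm_le => [|i j]; first exact: sqrtr_ge0.
    rewrite -sqrtr_sqr; apply: ler_wsqrtr; rewrite /f (bigD1 i)//= (bigD1 j)//= expr2.
    rewrite -addrA lerDl addr_ge0//.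
      by apply: sumr_ge0 => j' _; rewrite -expr2 sqr_ge0.
    by apply: sumr_ge0 => i' _; apply: sumr_ge0 => j' _; rewrite -expr2 sqr_ge0.
  by move=> H; rewrite -[leRHS]sqr_sqrtr// ler_pXn2r// ?nnegrE ?sqrtr_ge0.
have f'f u : unitI u -> f' u <= k * f u.
  move=> uI; apply: (@le_trans _ _ (\sum_(i < m) \sum_(j < n) (2 * c * `|F u| ^+ 2))).
    apply: ler_sum => i _; apply: ler_sum => j _.
    have H : F u i j * F' u i j <= `|F u| * (c * `|F u|).
      apply: le_trans (ler_norm _) _; rewrite normrM; apply: ler_pM => //.
        exact: mx_coord_le.
      by apply: le_trans (bF u uI); exact: mx_coord_le.
    rewrite [F' u i j * _]mulrC; move: H; rewrite expr2; lra.
  apply: (@le_trans _ _ (N * (2 * c * `|F u| ^+ 2))).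
    rewrite /N mulr_suml; apply: ler_sum => i _; rewrite mulr_suml; apply: ler_sum => j _.
    by rewrite mul1r.
  rewrite /k; have := fF u; have : 0 <= N * (2 * c) by rewrite !mulr_ge0.
  nra.
have f00 : f 0 <= N * `|F 0| ^+ 2.
  rewrite /f /N mulr_suml; apply: ler_sum => i _; rewrite mulr_suml; apply: ler_sum => j _.
  by rewrite mul1r -expr2 -real_normK ?num_real// ler_pXn2r// ?nnegrE ?mx_coord_le.
move=> u /unitIP/andP[u0 u1].
pose g s := f s * expR (- (k * s)).
have dg s : unitI s -> der (g : R -> R) s (f s * (- k * expR (- (k * s))) + f' s * expR (- (k * s))).
  move=> sI; have d1 : der (fun s => - (k * s) : R) s (- k).
    have := derZ (- k) (der_id s); rewrite /GRing.scale /= mulr1.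
    by under eq_fun do rewrite mulNr.
  have d2 : der (fun s => expR (- (k * s)) : R) s (- k * expR (- (k * s))).
    have := @is_derive1_comp R expR (fun s => - (k * s)) s (expR (- (k * s))) (- k) (is_derive_expR _) d1.
    by rewrite mulrC.
  exact: (der_mulR (df s sI) d2).
have inI s : 0 <= s <= u -> unitI s.
  by move=> /andP[s0 su]; apply/unitIP; rewrite s0 (le_trans su).
have [s /inI sI E] := @mvtR _ g _ 0 u u0 (fun s us => dg s (inI s us)).
have : g u <= g 0.
  rewrite -subr_le0 E subr0; apply: mulr_le0_ge0 => //.
  have := f'f s sI; have := expR_gt0 (- (k * s)); nra.
rewrite /g mulr0 oppr0 expR0 mulr1 expRN => H.
have e0 := expR_gt0 (k * u).
have {}H : f u <= f 0 * expR (k * u) by rewrite -ler_pdivrMr.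
have ek : expR (k * u) <= expR k by rewrite ler_expR ler_piMr.
have f0 : 0 <= f 0 by apply: le_trans (fF 0); exact: sqr_ge0.
have : `|F u| ^+ 2 <= N * expR k * `|F 0| ^+ 2.
  apply: le_trans (fF u) _; apply: le_trans H _.
  apply: (@le_trans _ _ (f 0 * expR k)); first by rewrite ler_wpM2l.
  by rewrite mulrAC ler_wpM2r// ltW// expR_gt0.
have := normr_ge0 (F u); set X := `|F u|; set Y := N * _ * _; nra.
Qed.

End Gronwall.

(** * Logarithmic derivatives and paths in the group *)

Section Paths.
Context {R : realType} {n : nat} (S : lie_setup R n).
Notation A := (lA S).
Notation E := 'rV[R]_n.
Notation mA := (mA S).
Notation D0 := (D0 S).
Notation Ge := (@Ge _ _ S).
Notation psi := (psi S).
Notation lvf := (lvf S).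
Implicit Types (V W : normedModType R) (g h k : R -> S).

(* v is the left logarithmic derivative of g at u, expressed in the chart psi at the unit. *)
Definition gder g u v := (\forall s \near u, Ge ((g u)^-1 * g s)%g) /\
  der (fun s => phi ((g u)^-1 * g s)%g) u v.

(** Near [u] the path is [g u * psi y], where [y] is the coordinate of the increment
    [(g u)^-1 * g s]; the rest is the chain rule. *)
Lemma gder_push W (K : S -> W) (L : E -> W) g u v : gder g u v ->
  is_diff (0 : E) (fun x => K (g u * psi x)%g) L -> der (fun s => K (g s)) u (L v).
Proof.
move=> [ng dg] dK.
have e0 : phi ((g u)^-1 * g u)%g = 0 by rewrite mulVg phi1.
have dK' := dK; rewrite -e0 in dK'.
have D := is_derive_diff_comp dg dK'.
apply: near_eq_is_derive D; apply: filterS ng => s es.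
by rewrite /= phiK// mulVKg.
Qed.

(** Common to the product and quotient rules: the increment of the path is a smooth function [Psi]
    of the increments of two others. *)
Lemma gder_mk2 f g k u v w (Psi : E * E -> S) : gder g u v -> gder k u w ->
  msmooth A (D0 `*` D0) Psi -> Psi (0, 0) = 1%g ->
  (\forall s \near u, (f u)^-1 * f s = Psi (phi ((g u)^-1 * g s), phi ((k u)^-1 * k s)))%g ->
  gder f u ('d (fun p => phi (Psi p)) (0, 0) (v, w)).
Proof.
move=> [ng dg] [nk dk] sP P0 H.
have O0 : (D0 `*` D0) (0, 0) by split; exact: D00.
have e0 : (phi ((g u)^-1 * g u), phi ((k u)^-1 * k u))%g = (0, 0) by rewrite !mulVg phi1.
have G0 : Ge (Psi (0, 0)) by rewrite P0; exact: Ge1.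
have dP := phi_diff sP O0 G0; have dP' := differentiableP dP; rewrite -e0 in dP'.
have dp := is_derive_pair dg dk.
have D := is_derive_diff_comp dp dP'.
split; last first.
  rewrite e0 in D; apply: near_eq_is_derive D; apply: filterS H => s ->.
  by [].
have c : {for u, continuous (fun s => (phi ((g u)^-1 * g s), phi ((k u)^-1 * k s)))%g}.
  exact: is_derive_continuous dp.
have X := near_Ge sP O0 G0; rewrite -e0 in X.
have Y : \forall s \near u, (D0 `*` D0) (phi ((g u)^-1 * g s), phi ((k u)^-1 * k s))%g /\
  Ge (Psi (phi ((g u)^-1 * g s), phi ((k u)^-1 * k s)))%g := c _ X.
by move: Y; apply: filterS2 H => s -> [].
Qed.

Lemma msmooth_prod2 (Psi : S -> S -> S) : (forall V (U : set V) (f1 f2 : V -> S), open U ->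
    msmooth A U f1 -> msmooth A U f2 -> msmooth A U (fun x => Psi (f1 x) (f2 x))) ->
  msmooth A (D0 `*` D0) (fun p => Psi (psi p.1) (psi p.2)).
Proof. by apply; [exact: (D0D0_open S)|exact: (msmooth_psi1 S)|exact: (msmooth_psi2 S)]. Qed.

(** The increment of the product is the increment of [g] conjugated by [(k u)^-1], times the
    increment of [k]; the first factor contributes Ad, the second the identity. *)
Lemma gder_mul g k u v w : gder g u v -> gder k u w ->
  gder (fun s => g s * k s)%g u (Ad (k u)^-1%g v + w).
Proof.
move=> dg dk.
pose Psi (p : E * E) : S := ((k u)^-1 * psi p.1 * (k u)^-1^-1 * psi p.2)%g.
have sP : msmooth A (D0 `*` D0) Psi.
  apply: (msmooth_prod2 (Psi := fun x y => (k u)^-1 * x * (k u)^-1^-1 * y)%g) => V U f1 f2 oU s1 s2.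
  do 2 ?[apply: msmooth_mul => //]; try exact: (msmooth_cst1 _ oU).
  by apply: msmooth_mul => //; exact: (msmooth_cst1 _ oU).
have P0 : Psi (0, 0) = 1%g by rewrite /Psi /= psi0 mulg1 invgK mulg1 mulVg.
have O0 : (D0 `*` D0) (0, 0) by split; exact: D00.
have G0 : Ge (Psi (0, 0)) by rewrite P0; exact: Ge1.
have dP := phi_diff sP O0 G0.
have := @gder_mk2 (fun s => g s * k s)%g g k u v w Psi dg dk sP P0.
have -> : 'd (fun p => phi (Psi p)) (0, 0) (v, w) = Ad (k u)^-1%g v + w.
  apply: (etrans (diff_pairD v w dP)); congr (_ + _).
    apply: (etrans (diff_partial1 v dP)).
    apply: near_diffE (conj_diff _); apply: filterE => y.
    by rewrite /Psi /= psi0 mulg1.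
  apply: (etrans (diff_partial2 w dP)); apply: near_diff_id.
  apply: filterS (near_D0 S) => y Dy.
  by rewrite /Psi /= psi0 mulg1 invgK mulVg mul1g psiK.
apply; have [ng _] := dg; have [nk _] := dk; move: ng nk; apply: filterS2 => s gs ks.
by rewrite /Psi /= !phiK// invgM invgK !mulgA mulgK.
Qed.

(** The increment is [k u * (a * b^-1) * (k u)^-1] in the two increments [a] and [b]. As the two
    velocities agree, only the restriction to the diagonal matters, and there the expression is
    constant. *)
Lemma gder_quot g k u v : gder g u v -> gder k u v ->
  gder (fun s => g s * (k s)^-1)%g u 0.
Proof.
move=> dg dk.
pose Psi (p : E * E) : S := (k u * (psi p.1 * (psi p.2)^-1) * (k u)^-1)%g.
have sP : msmooth A (D0 `*` D0) Psi.
  apply: (msmooth_prod2 (Psi := fun x y => k u * (x * y^-1) * (k u)^-1)%g) => V U f1 f2 oU s1 s2.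
  apply: msmooth_mul => //; last exact: (msmooth_cst1 _ oU).
  apply: msmooth_mul => //; first exact: (msmooth_cst1 _ oU).
  by apply: msmooth_mul => //; exact: msmooth_inv.
have P0 : Psi (0, 0) = 1%g by rewrite /Psi /= psi0 invg1 !mulg1 mulgV.
have O0 : (D0 `*` D0) (0, 0) by split; exact: D00.
have G0 : Ge (Psi (0, 0)) by rewrite P0; exact: Ge1.
have dP := phi_diff sP O0 G0.
have := @gder_mk2 (fun s => g s * (k s)^-1)%g g k u v v Psi dg dk sP P0.
have -> : 'd (fun p => phi (Psi p)) (0, 0) (v, v) = 0.
  have dd : is_diff (0 : E) (fun y : E => (y, y)) (fun v => (v, v)).
    exact: (is_diff_pair (is_diff_id _) (is_diff_id _)).
  have X := diff_chain v (is_diff_ex dd) (erefl _) dP.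
  have Y := is_diffE v dd; rewrite /= in Y.
  apply: (etrans (esym (etrans X (congr1 _ Y)))).
  have D0' : differentiable (fun _ : E => 0 : E) 0 by exact: differentiable_cst.
  apply: (etrans (near_diffE v _ D0')); last by rewrite diff_cst.
  by apply: filterE => y; rewrite /Psi /= mulgV mulg1 mulgV phi1.
apply; have [ng _] := dg; have [nk _] := dk; move: ng nk; apply: filterS2 => s gs ks.
by rewrite /Psi /= !phiK// !invgM !invgK !mulgA mulgK.
Qed.

Lemma chart_mul_diff (c : chart E S) (x : S) : charts A c -> dom c x ->
  differentiable (fun y => fwd c (x * psi y)%g) (0 : E).
Proof.
move=> Ac cx; have sf : msmooth A D0 (fun y => x * psi y)%g.
  by apply: msmooth_mul; [exact: D0_open|exact: (msmooth_cst1 _ (D0_open S))|exact: msmooth_psi].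
by apply: (msmooth_at sf Ac (D00 S)); rewrite psi0 mulg1.
Qed.

Lemma gder_chart (c : chart E S) g u v : charts A c -> dom c (g u) -> gder g u v ->
  der (fun s => fwd c (g s)) u ('d (fun y => fwd c (g u * psi y)%g) (0 : E) v).
Proof.
by move=> Ac cg dg; apply: (gder_push dg); apply: differentiableP; exact: chart_mul_diff.
Qed.

Lemma gder_near_chart (c : chart E S) g u v : charts A c -> dom c (g u) -> gder g u v ->
  \forall s \near u, dom c (g s).
Proof.
move=> Ac cg [ng dg].
have sf : msmooth A D0 (fun y => g u * psi y)%g.
  by apply: msmooth_mul; [exact: D0_open|exact: (msmooth_cst1 _ (D0_open S))|exact: msmooth_psi].
have c0 : dom c (g u * psi 0)%g by rewrite psi0 mulg1.
have X := msmooth_near sf Ac (D00 S) c0.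
have e0 : phi ((g u)^-1 * g u)%g = 0 by rewrite mulVg phi1.
rewrite -e0 in X.
have Y : \forall s \near u, D0 (phi ((g u)^-1 * g s)%g) /\
  dom c (g u * psi (phi ((g u)^-1 * g s)))%g := is_derive_continuous dg X.
by move: Y; apply: filterS2 ng => s gs [_]; rewrite phiK// mulVKg.
Qed.

(** In a chart the path has zero derivative, so it is locally constant on [unitI]; this has then to
    be globalized. *)
Lemma gder_zero_const g : (forall u, unitI u -> gder g u 0) -> forall u, unitI u -> g u = g 0.
Proof.
move=> dg.
have loc u : unitI u -> \forall s \near u, unitI s -> g s = g u.
  move=> uI; have Ac := chart_at_charts mA (g u); have cu := chart_at_dom mA (g u).
  set c := chart_at A (g u) in Ac cu.
  have /nbhs_ballP[d /= d0 nd] := gder_near_chart Ac cu (dg u uI).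
  exists d => //= s sd sI.
  have key a b : a <= b -> unitI a -> unitI b -> `|u - a| < d -> `|u - b| < d ->
      fwd c (g b) = fwd c (g a).
    move=> ab /unitIP/andP[a0 _] /unitIP/andP[_ b1] ad bd.
    apply: (@is_derive_cst_eq _ _ _ (fun s => fwd c (g s)) a b ab) => t /andP[at_ tb].
    have tI : unitI t by apply/unitIP; rewrite (le_trans a0)// (le_trans tb).
    have ct : dom c (g t).
      apply: nd; rewrite -ball_normE /=; move: ad bd; rewrite !ltr_norml => /andP[? ?] /andP[? ?].
      by apply/andP; split; lra.
    have := gder_chart Ac ct (dg t tI); rewrite linear0; exact.
  have sd' : `|u - s| < d by [].
  have ud : `|u - u| < d by rewrite subrr normr0.
  have E1 : fwd c (g s) = fwd c (g u).
    have [su|/ltW us] := leP s u; last exact: key.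
    by apply: esym; exact: key.
  have cs : dom c (g s) by apply: nd; rewrite -ball_normE.
  by rewrite -(chart_fwdK mA Ac cs) E1 (chart_fwdK mA Ac cu).
(* The indicator of having left the value [g 0] is locally constant, hence a real function with zero
   derivative, hence constant. *)
pose k (s : R) : R := if `[< g (clampI s) = g 0 >] then 0 else 1.
have dk s : der (k : R -> R) s 0.
  have H : \forall t \near s, k s = k t.
    have X : \forall t \near s, unitI (clampI t) -> g (clampI t) = g (clampI s) :=
      clampI_continuous (x := s) (loc _ (clampI_in s)).
    by apply: filterS X => t /(_ (clampI_in t)) E1; rewrite /k E1.
  by apply: near_eq_is_derive (der_cst (k s) s); exact: H.
move=> u uI; have : k u = k 0 by apply: is_derive_0_is_cst.
rewrite /k (clampI_id uI) clampI_lo//; case: asboolP => // _; case: asboolP => // _ /eqP.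
by rewrite oner_eq0.
Qed.

Definition lifts (eta : R -> E) g := g 0 = 1%g /\ forall u, unitI u -> gder g u (eta u).

Lemma lifts_unique eta g k : lifts eta g -> lifts eta k -> forall u, unitI u -> g u = k u.
Proof.
move=> [g0 dg] [k0 dk] u uI.
have H v : unitI v -> gder (fun s => g s * (k s)^-1)%g v 0.
  by move=> vI; apply: gder_quot; [exact: dg|exact: dk].
have := gder_zero_const H uI; rewrite g0 k0 invg1 mulg1 => E1.
by rewrite -[g u](mulgVK (k u)) E1 mul1g.
Qed.

Lemma lifts_mul eta lam g k : lifts eta g -> lifts lam k ->
  lifts (fun u => Ad (g u)^-1%g (lam u) + eta u) (fun u => k u * g u)%g.
Proof.
move=> [g0 dg] [k0 dk]; split; first by rewrite g0 k0 mulg1.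
by move=> u uI; apply: gder_mul; [exact: dk|exact: dg].
Qed.

Lemma lifts_ext eta eta' g : (forall u, unitI u -> eta u = eta' u) -> lifts eta g -> lifts eta' g.
Proof. by move=> H [g0 dg]; split=> // u uI; rewrite -H//; exact: dg. Qed.

(* The left velocity of psi z is lform z (z'). *)
Definition lform (x w : E) : E := 'd (fun y => phi ((psi x)^-1 * psi y)%g) x w.

Lemma msmooth_lpsi x : msmooth A D0 (fun y => (psi x)^-1 * psi y)%g.
Proof. by apply: msmooth_mul; [exact: D0_open|exact: (msmooth_cst1 _ (D0_open S))|exact: msmooth_psi]. Qed.

Lemma lpsi_Ge x : Ge ((psi x)^-1 * psi x)%g.
Proof. by rewrite mulVg; exact: Ge1. Qed.

Lemma gder_psi (z : R -> E) u z' : der z u z' -> D0 (z u) ->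
  gder (fun s => psi (z s)) u (lform (z u) z').
Proof.
move=> dz Dz; have sf := @msmooth_lpsi (z u).
have Dd := phi_diff sf Dz (lpsi_Ge (z u)).
split; last exact: (is_derive_diff_comp dz (differentiableP Dd)).
have X := near_Ge sf Dz (lpsi_Ge (z u)).
have Y : \forall s \near u, D0 (z s) /\ Ge ((psi (z u))^-1 * psi (z s))%g := is_derive_continuous dz X.
by apply: filterS Y => s [].
Qed.

(** A solution of the equation z' = [lvf lam z] therefore has left velocity [lam]. *)
Lemma lform_lvf x w : D0 x -> lform x (lvf w x) = w.
Proof.
move=> Dx; have Dm := mul0_diff (Om1 Dx).
have E1 : lvf w x = 'd (fun y => mul0 S (x, y)) 0 w by exact: diff_partial2 w Dm.
have dm : differentiable (fun y => mul0 S (x, y)) 0.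
  exact: differentiable_chain (differentiable_pairr x 0) (erefl _) Dm.
have e0 : mul0 S (x, 0) = x by rewrite /mul0 /= psi0 mulg1 psiK.
have Dd := phi_diff (@msmooth_lpsi x) Dx (lpsi_Ge x).
have X := diff_chain w dm e0 Dd.
rewrite /lform E1; apply: (etrans (esym X)); apply: near_diff_id.
have sf : msmooth A D0 (fun y => psi x * psi y)%g.
  by apply: msmooth_mul; [exact: D0_open|exact: (msmooth_cst1 _ (D0_open S))|exact: msmooth_psi].
have g0 : Ge (psi x * psi 0)%g by rewrite psi0 mulg1; exact: psi_Ge.
apply: filterS (near_Ge sf (D00 S) g0) => y [Dy ey].
by rewrite /mul0 /= phiK// mulKg psiK.
Qed.

End Paths.

(** * Existence of paths with a given logarithmic derivative *)

Section Existence.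
Context {R : realType} {n : nat} (S : lie_setup R n).
Notation A := (lA S).
Notation E := 'rV[R]_n.
Notation D0 := (D0 S).
Notation psi := (psi S).
Notation lvf := (lvf S).
Implicit Types (V W : normedModType R) (g h k : R -> S).

Lemma mulmx_norm m p q (M : 'M[R]_(m, p)) (N : 'M[R]_(p, q)) : `|M *m N| <= p%:R * `|M| * `|N|.
Proof.
apply: mx_norm_le => [|i j]; first by rewrite !mulr_ge0.
rewrite mxE; apply: le_trans (ler_norm_sum _ _ _) _.
rewrite -mulrA [leRHS](_ : _ = \sum_(k < p) `|M| * `|N|); last first.
  by rewrite sumr_const card_ord mulr_natl.
by apply: ler_sum => k _; rewrite normrM ler_pM// mx_coord_le.
Qed.

Lemma lbr_anti v w : lbr S w v = - lbr S v w.
Proof. by rewrite !lbr_lvf opprB. Qed.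

Lemma lbr_lin1 w : linear (lbr S ^~ w).
Proof. by move=> a u v; case: (lbrP S) => H _ _; exact: H. Qed.

Lemma lbr_lin2 v : linear (lbr S v).
Proof.
move=> a u w; rewrite lbr_anti lbr_lin1 (lbr_anti u) (lbr_anti w) scalerN.
by rewrite opprD.
Qed.

(** Matrices act on row vectors from the right, whence the reversed order in [AdMM]. *)
Definition AdM (x : S) : 'M[R]_n := mxof (@Ad _ _ S x).
Definition adM v : 'M[R]_n := mxof (lbr S v).

Lemma AdME (x : S) v : v *m AdM x = Ad x v. Proof. by apply: mxofE; exact: Ad_linear. Qed.
Lemma adME v w : w *m adM v = lbr S v w. Proof. by apply: mxofE; exact: lbr_lin2. Qed.

Lemma AdMM (x y : S) : AdM (x * y)%g = AdM y *m AdM x.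
Proof. apply: mx_eq_rV => v; apply: (etrans (AdME _ _)); apply: (etrans (Ad_mul x y v)).
by rewrite mulmxA (AdME y v) (AdME x (Ad y v)). Qed.

Lemma AdM1 : AdM 1%g = 1%:M.
Proof. by apply: mx_eq_rV => v; rewrite (AdME 1%g v) (Ad1 S v) mulmx1. Qed.

Lemma adM_lin : linear adM.
Proof.
move=> a u v; apply: mx_eq_rV => w.
by rewrite mulmxDr -scalemxAr !adME lbr_lin1.
Qed.

Lemma adM_contlin : contlin adM. Proof. exact: mx_lin_contlin adM_lin. Qed.

Lemma lbr_contbil : contbil (lbr S).
Proof.
split; [exact: lbr_lin2|exact: lbr_lin1|].
have [k k0 Hk] := contlin_bound adM_contlin.
exists (n%:R * k) => v w; rewrite -adME; apply: le_trans (mulmx_norm _ _) _.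
rewrite -!mulrA ler_wpM2l// mulrC [leRHS]mulrA ler_wpM2r//.
Qed.

Lemma AdM_smooth V (U : set V) (f : V -> S) : open U -> msmooth A U f ->
  smooth_on U (fun y => AdM (f y)).
Proof. by move=> oU sf; apply: smooth_mxof => //; exact: Ad_smooth. Qed.

Lemma AdM_psi_smooth : smooth_on D0 (fun y : E => AdM (psi y)).
Proof. by apply: AdM_smooth; [exact: D0_open|exact: msmooth_psi]. Qed.

Lemma AdM_psiV_smooth : smooth_on D0 (fun y : E => AdM (psi y)^-1%g).
Proof. by apply: AdM_smooth; [exact: D0_open|apply: msmooth_inv; [exact: D0_open|exact: msmooth_psi]]. Qed.

Lemma mulmxl_contlin m p q (M : 'M[R]_(m, p)) : contlin (fun N : 'M[R]_(p, q) => M *m N).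
Proof. by apply: mx_lin_contlin => a u v; rewrite mulmxDr -scalemxAr. Qed.

Lemma mulmxr_contlin m p q (N : 'M[R]_(p, q)) : contlin (fun M : 'M[R]_(m, p) => M *m N).
Proof. by apply: mx_lin_contlin => a u v; rewrite mulmxDl -scalemxAl. Qed.

Lemma AdM_psi_diff : is_diff (0 : E) (fun y : E => AdM (psi y)) adM.
Proof.
have D := smooth_diff AdM_psi_smooth (D00 S).
split=> //; apply/funext => v; apply: mx_eq_rV => w; rewrite adME -dAd.
have X := is_diff_comp (differentiableP D) (contlin_is_diff (AdM (psi 0)) (mulmxl_contlin n w)).
apply: (etrans (esym (is_diffE v X))); apply: near_diffE; last first.
  exact: Ad_psi_diff.
by apply: filterE => y; rewrite /= AdME.
Qed.

(** Differentiates the product of [AdM (psi y)^-1] and [AdM (psi y)], which is the identity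
    matrix. *)
Lemma AdM_psiV_diff : is_diff (0 : E) (fun y : E => AdM (psi y)^-1%g) (fun v => - adM v).
Proof.
have D := differentiableP (smooth_diff AdM_psiV_smooth (D00 S)).
split; first exact: is_diff_ex D.
apply/funext => v.
have P := is_diff_pair D AdM_psi_diff.
have Q : is_diff (AdM (psi 0)^-1%g, AdM (psi 0)) (fun q : 'M[R]_n * 'M[R]_n => q.1 *m q.2)
   (fun q => AdM (psi 0)^-1%g *m q.2 + q.1 *m AdM (psi 0)) by exact: (contbil_is_diff (AdM (psi 0)^-1%g, AdM (psi 0)) (mulmx_contbil n n n)).
have X := is_diffE v (is_diff_comp P Q).
have Z : 'd ((fun q : 'M[R]_n * 'M[R]_n => q.1 *m q.2) \o (fun y => (AdM (psi y)^-1%g, AdM (psi y)))) (0 : E) v = 0.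
  have dc : differentiable (fun _ : E => 1%:M : 'M[R]_n) 0 by exact: differentiable_cst.
  apply: (etrans (near_diffE v _ dc)); last by rewrite diff_cst.
  by apply: filterE => y; rewrite /= -AdMM mulgV AdM1.
move: (etrans (esym X) Z); rewrite /= psi0 invg1 AdM1 mul1mx mulmx1 => /eqP.
by rewrite addrC addr_eq0 => /eqP.
Qed.

Lemma AdM_der g u v : gder g u v -> der (fun s => AdM (g s)) u (adM v *m AdM (g u)).
Proof.
move=> dg; apply: (gder_push (L := fun v => adM v *m AdM (g u)) dg).
have X := is_diff_comp AdM_psi_diff (contlin_is_diff (AdM (psi 0)) (mulmxr_contlin n (AdM (g u)))).
by apply: near_is_diff X; apply: filterE => y; rewrite /= -AdMM.
Qed.

Lemma AdMV_der g u v : gder g u v ->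
  der (fun s => AdM (g s)^-1%g) u (- (AdM (g u)^-1%g *m adM v)).
Proof.
move=> dg; rewrite -mulmxN.
apply: (gder_push (K := fun x => AdM x^-1%g) (L := fun v => AdM (g u)^-1%g *m - adM v) dg).
have X := is_diff_comp AdM_psiV_diff (contlin_is_diff (AdM (psi 0)^-1%g) (mulmxl_contlin n (AdM (g u)^-1%g))).
by apply: near_is_diff X; apply: filterE => y; rewrite /= invgM -AdMM.
Qed.

(** Differentiates Ad(x y x^-1) = Ad(x) Ad(y) Ad(x)^-1 in y at the unit and applies both sides to
    [Ad x w]. *)
Lemma Ad_lbr (x : S) v w : Ad x (lbr S v w) = lbr S (Ad x v) (Ad x w).
Proof.
have D := AdM_psi_diff.
pose c y := phi (x * psi y * x^-1)%g.
have dc := conj_diff x.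
have D' : is_diff (c 0) (fun y : E => AdM (psi y)) adM by rewrite /c phi_conj0.
have X1 := is_diffE v (is_diff_comp (differentiableP dc) D').
pose L (M : 'M[R]_n) := AdM x^-1%g *m M *m AdM x.
have cL : contlin L.
  by apply: mx_lin_contlin => a M N; rewrite /L mulmxDr mulmxDl -scalemxAr -scalemxAl.
have DL := is_diff_comp D (contlin_is_diff (AdM (psi 0)) cL).
have H : {near (0 : E), L \o (fun y : E => AdM (psi y)) =1 (fun y : E => AdM (psi y)) \o c}.
  apply: filterS (near_Ge (msmooth_conj x) (D00 S) (conj_at0 x)) => y [Dy ey].
  by rewrite /L /c /= phiK// !AdMM mulmxA.
have X2 := etrans (near_diffE v H (is_diff_ex DL)) (is_diffE v DL).
have : adM (Ad x v) = L (adM v) by exact: etrans (esym X1) X2.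
move=> /(congr1 (fun M => Ad x w *m M)); rewrite adME => ->.
by rewrite /L !mulmxA (AdME x^-1%g (Ad x w)) (AdK x w) (adME v w) (AdME x (lbr S v w)).
Qed.

(** Along a lift, [AdM] and its inverse solve linear equations whose coefficients depend only on the
    form, so [gronwall] bounds them uniformly over all forms of size at most [M]. This uniformity is
    what allows continuation by steps of fixed size. *)
Lemma Ad_bound (M : R) : exists2 K, 0 < K & forall (eta : R -> E) g,
  (forall u, unitI u -> `|eta u| <= M) -> lifts eta g ->
  forall u, unitI u -> `|AdM (g u)| <= K /\ `|AdM (g u)^-1%g| <= K.
Proof.
have [k k0 Hk] := contlin_bound adM_contlin.
have c0 : 0 <= n%:R * (k * `|M|) by rewrite !mulr_ge0// ltW.
have [K HK] := gronwall n n c0.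
exists (`|K| * `|1%:M : 'M[R]_n| ^+ 2 + 1); first by rewrite ltr_wpDl// mulr_ge0// sqr_ge0.
move=> eta g etaM [g0 dg] u uI.
have KK : K * `|1%:M : 'M[R]_n| ^+ 2 + 1 <= `|K| * `|1%:M : 'M[R]_n| ^+ 2 + 1.
  by rewrite lerD2r ler_wpM2r ?sqr_ge0// ler_norm.
have bad v : unitI v -> `|adM (eta v)| <= k * `|M|.
  move=> vI; apply: le_trans (Hk _) _; rewrite ler_wpM2l ?(ltW k0)//.
  by apply: le_trans (etaM v vI) _; exact: ler_norm.
split; apply: le_trans KK.
  have := HK (fun s => AdM (g s)) (fun s => adM (eta s) *m AdM (g s)) _ _ u uI.
  rewrite g0 AdM1; apply=> v vI; first by apply: AdM_der; exact: dg.
  apply: le_trans (mulmx_norm _ _) _; rewrite ler_wpM2r// ler_wpM2l//.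
  exact: bad.
have := HK (fun s => AdM (g s)^-1%g) (fun s => - (AdM (g s)^-1%g *m adM (eta s))) _ _ u uI.
rewrite g0 invg1 AdM1; apply=> v vI; first by apply: AdMV_der; exact: dg.
rewrite normrN; apply: le_trans (mulmx_norm _ _) _.
by rewrite [leRHS]mulrAC; apply: ler_wpM2l; [rewrite mulr_ge0|exact: bad].
Qed.

Definition lvM (y : E) : 'M[R]_n := mxof (fun w => lvf w y).

Lemma lvf_lin y : linear (fun w => lvf w y).
Proof.
move=> a u v; rewrite /lvf -linearP; congr ('d _ _ _).
by congr (_, _); rewrite /= ?scaler0 ?addr0.
Qed.

Lemma lvME y w : w *m lvM y = lvf w y. Proof. by apply: mxofE; exact: lvf_lin. Qed.

Lemma lvM0 : lvM 0 = 1%:M.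
Proof. by apply: mx_eq_rV => w; rewrite lvME mulmx1; exact: dmul02. Qed.

Lemma lvM_smooth : smooth_on D0 lvM.
Proof.
apply: smooth_mxof; first exact: D0_open.
have [op s] := mul0_smooth S.
have oT : open (D0 `*` [set: E]) by apply: openXT; exact: D0_open.
have H (p : E * E) : (D0 `*` [set: E]) p -> (Om S `*` [set: E * E]) ((p.1, 0), (0, p.2)).
  by move=> [Dp _]; split=> //; exact: Om1.
suff sp : smooth_on (D0 `*` [set: E]) (fun p : E * E => ((p.1, 0 : E), (0 : E, p.2))).
  exact: (smooth_comp oT H sp (smooth_tangent s)).
apply: smooth_pair => //; apply: smooth_pair => //.
- by apply: smooth_lin => //; exact: contlin_fst.
- exact: smooth_cst.
- exact: smooth_cst.
- by apply: smooth_lin => //; exact: contlin_snd.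
Qed.

(** A small form has its whole path inside the chart [psi], by [picard]. The last estimate says that
    the path in coordinates is the primitive of the form up to second order; it yields the
    derivative of the holonomy at 0. *)
Lemma local_lift : exists e C : R, [/\ 0 < e, 0 < C & forall lam : C0 E, `|lam| <= e ->
  exists z : C1 E, [/\ z 0 = 0,
    forall u, unitI u -> [/\ D0 (z u), `|z u| <= C * `|lam| &
       `|z u - vprim lam u| <= C * `|lam| ^+ 2] &
    lifts lam (fun u => psi (z u))]].
Proof.
have [r [L [r0 L0 rD rL]]] := smooth_lipschitz (D0_open S) (D00 S) lvM_smooth.
pose K := `|lvM 0| + L * r.
have K0 : 0 <= K by rewrite addr_ge0// mulr_ge0// ltW.
have HL x y : `|x| <= r -> `|y| <= r -> `|lvM x - lvM y| <= L * `|x - y|.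
  by move=> xr yr; apply: rL; rewrite subr0.
have HK x : `|x| <= r -> `|lvM x| <= K.
  move=> xr; rewrite -[lvM x](subrK (lvM 0)) /K addrC.
  apply: le_trans (ler_normD _ _) _; rewrite lerD2l.
  apply: le_trans (HL x 0 xr _) _; first by rewrite normr0 ltW.
  by rewrite subr0 ler_wpM2l// ltW.
pose c1 := n%:R * K; pose c2 := n%:R * L.
have c10 : 0 <= c1 by rewrite mulr_ge0.
have c20 : 0 <= c2 by rewrite mulr_ge0// ltW.
have p1 : 0 < c1 + 1 by rewrite ltr_wpDl.
have rr (a b c d : R) : a * b * (c * (d * b)) = a * c * d * b ^+ 2 by ring.
have p2 : 0 < 2 * c2 + 1 by rewrite ltr_wpDl// mulr_ge0.
pose C := c1 + c2 * c1 + 1.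
have Cp : 0 < C by rewrite ltr_wpDl// addr_ge0// mulr_ge0.
(* The two bounds on [lam] give the two smallness conditions of [picard]; the added 1 keeps the
   denominators positive. *)
exists (Num.min (r / (c1 + 1)) (1 / (2 * c2 + 1))), C; split=> //.
  by rewrite lt_min !divr_gt0.
move=> lam; rewrite le_min => /andP[h1 h2].
have l0 : 0 <= `|lam| by [].
have H1 : c1 * `|lam| <= r.
  move: h1; rewrite ler_pdivlMr// => h1; nra.
have H2 : c2 * `|lam| <= 1 / 2.
  move: h2; rewrite ler_pdivlMr// => h2; nra.
have [z [z0 Hz]] := picard r0 (ltW L0) HL HK H1 H2.
have cC : c1 <= C by rewrite /C -addrA lerDl addr_ge0// mulr_ge0.
have zr u : unitI u -> `|z u| <= r by move=> uI; have [h _] := Hz u uI; exact: le_trans H1.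
exists z; split=> //.
  move=> u uI; have [h d] := Hz u uI; split.
  - by apply: rD; rewrite subr0 zr.
  - by apply: le_trans h _; rewrite ler_wpM2r.
  have /unitIP/andP[u0 u1] := uI.
  (* Since [lvM 0] is the identity, the derivative of [f] is [lam] times [lvM (z s) - lvM 0], where
     the second factor is Lipschitz in [z s] and so of first order in [lam]. *)
  pose f s := z s - vprim lam s.
  have df s : 0 <= s <= u -> der f s (lam s *m lvM (z s) - lam s).
    move=> /andP[s0 su]; apply: derB; last exact: vprim_der.
    by have [|_ ?] := Hz s _; first by apply/unitIP; rewrite s0 (le_trans su).
  have := mean_value_cst_le (C := C * `|lam| ^+ 2) u0 df.
  rewrite /f z0 vprim0 subrr subr0 subr0 => X; apply: le_trans (X _) _.
    move=> s /andP[s0 su]; have sI : unitI s by apply/unitIP; rewrite s0 (le_trans su).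
    rewrite -[X in _ - X]mulmx1 -lvM0 -mulmxBr.
    apply: le_trans (mulmx_norm _ _) _.
    apply: (@le_trans _ _ (n%:R * `|lam| * (L * (c1 * `|lam|)))).
      apply: ler_pM; rewrite ?mulr_ge0//; first by rewrite ler_wpM2l// C0_norm_ub.
      apply: le_trans (HL _ _ (zr s sI) _) _; first by rewrite normr0 ltW.
      by rewrite subr0 ler_wpM2l ?(ltW L0)//; have [] := Hz s sI.
    have -> : n%:R * `|lam| * (L * (c1 * `|lam|)) = c2 * c1 * `|lam| ^+ 2.
      exact: rr.
    rewrite ler_wpM2r ?sqr_ge0// /C -addrA [leRHS]addrCA lerDl.
    by rewrite addr_ge0.
  by rewrite ler_piMr// mulr_ge0 ?sqr_ge0// ltW.
split; first by rewrite z0 psi0.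
move=> u uI; have [_ d] := Hz u uI.
have Dz : D0 (z u) by apply: rD; rewrite subr0 zr.
have := gder_psi d Dz; rewrite lvME lform_lvf//.
Qed.

Lemma AdM_path_cont eta g : lifts eta g -> forall u, unitI u -> {for u, continuous (fun s => AdM (g s))}.
Proof. by move=> [_ dg] u uI; exact: is_derive_continuous (AdM_der (dg u uI)). Qed.

Lemma AdMV_path_cont eta g : lifts eta g -> forall u, unitI u -> {for u, continuous (fun s => AdM (g s)^-1%g)}.
Proof. by move=> [_ dg] u uI; exact: is_derive_continuous (AdMV_der (dg u uI)). Qed.

(** For the path of [eta'] to be [psi z * g], the factor [psi z] must have as left velocity the
    difference of the forms transformed by Ad of [g]; this is small, and [local_lift] applies. By
    [Ad_bound], [d] depends on [M] and [r] only. *)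
Lemma close_lift (M r : R) : 0 < r -> exists2 d : R, 0 < d & forall (eta eta' : C0 E) g,
  `|eta| <= M -> `|eta' - eta| <= d -> lifts eta g ->
  exists z : C1 E, [/\ z 0 = 0, forall u, unitI u -> D0 (z u) /\ `|z u| <= r &
    lifts eta' (fun u => psi (z u) * g u)%g].
Proof.
move=> r0; have [e [C [e0 Cp HC]]] := local_lift.
have [K K0 HK] := Ad_bound M.
pose m := Num.min e (r / C).
have m0 : 0 < m by rewrite lt_min e0 divr_gt0.
have rr (a b c d : R) : a * (b / c) * d = b * (a * d) / c by ring.
have p : 0 < n%:R * K + 1 by rewrite ltr_wpDl// mulr_ge0// ltW.
exists (m / (n%:R * K + 1)); first by rewrite divr_gt0.
move=> eta eta' g etaM ee lg.
pose G := C0of (fun s => AdM (g s)).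
have GE u : unitI u -> G u = AdM (g u) by move=> uI; apply: (C0of_id (AdM_path_cont lg) uI).
have Gn : `|G| <= K.
  apply: C0_norm_le => u uI; rewrite (GE u uI).
  have H v : unitI v -> `|eta v| <= M by move=> vI; apply: le_trans etaM; exact: C0_norm_ub.
  exact: proj1 (HK eta g H lg u uI).
pose lam : C0 E := C0bil (fun v (N : 'M[R]_n) => v *m N) (eta' - eta) G.
have lamE u : lam u = (eta' - eta) u *m G u by apply: C0bilE; exact: mulmx_contbil.
have lm : `|lam| <= m.
  apply: C0_norm_le => u uI; rewrite lamE; apply: le_trans (mulmx_norm _ _) _.
  apply: (@le_trans _ _ (n%:R * (m / (n%:R * K + 1)) * K)).
    apply: ler_pM; rewrite ?mulr_ge0//.
      by rewrite ler_wpM2l//; apply: le_trans ee; exact: C0_norm_ub.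
    by apply: le_trans Gn; exact: C0_norm_ub.
  have -> : n%:R * (m / (n%:R * K + 1)) * K = m * (n%:R * K) / (n%:R * K + 1).
    exact: rr.
  by rewrite ler_pdivrMr// ler_wpM2l ?(ltW m0)// lerDl.
have me : m <= e by rewrite ge_min lexx.
have mr : m <= r / C by rewrite ge_min lexx orbT.
have [z [z0 Hz lz]] := HC lam (le_trans lm me).
exists z; split=> //.
  move=> u uI; have [h1 h2 _] := Hz u uI; split=> //.
  apply: le_trans h2 _; rewrite -ler_pdivlMl// mulrC; exact: le_trans mr.
apply: lifts_ext (lifts_mul lg lz) => u uI.
rewrite -[LHS]/(Ad (g u)^-1%g (lam u) + eta u) lamE (GE u uI) -(AdME (g u)^-1%g) -mulmxA -(AdMM (g u)^-1%g) (mulVg (g u)) AdM1 mulmx1.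
by rewrite C0_subE subrK.
Qed.

(** The form is scaled up from 0 in [N] equal steps of size at most [d]. All intermediate forms have
    norm at most that of [eta], so the same [d] serves at every step. *)
Lemma lift_exists (eta : C0 E) : exists g, lifts eta g.
Proof.
have [d d0 Hd] := close_lift `|eta| ltr01.
pose N := (Num.truncn (`|eta| / d)).+1.
have Nd : `|eta| <= N%:R * d.
  rewrite -ler_pdivrMr// ltW//; exact: (real_truncnS_gt (num_real _)).
have N0 : 0 < N%:R :> R by rewrite ltr0n.
have key j : (j <= N)%N -> exists g, lifts ((j%:R / N%:R) *: eta) g.
  elim: j => [|j IH] jN.
    exists (fun=> 1%g); split=> // u uI.
    have := gder_psi (z := fun=> 0) (u := u) (z' := 0) (der_cst (0 : E) u) (D00 S).
    rewrite /lform linear0 mul0r scale0r psi0; exact.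
  have [g lg] := IH (ltnW jN).
  have [|| z [_ _ lz]] := Hd ((j%:R / N%:R) *: eta) ((j.+1%:R / N%:R) *: eta) g _ _ lg.
  - rewrite normrZ ger0_norm ?divr_ge0// ler_piMl//.
    by rewrite ler_pdivrMr// mul1r ler_nat ltnW.
  - rewrite -scalerBl normrZ -mulrBl -natrB// subSnn ger0_norm ?divr_ge0//.
    by rewrite div1r ler_pdivrMl.
  by exists (fun u => psi (z u) * g u)%g.
have [g lg] := key N (leqnn N); exists g; apply: lifts_ext lg => u _.
by rewrite divff ?gt_eqF// scale1r.
Qed.

Definition hpath (eta : C0 E) : R -> S := sval (cid (lift_exists eta)).

Lemma hpath_lifts (eta : C0 E) : lifts eta (hpath eta).
Proof. exact: (svalP (cid (lift_exists eta))). Qed.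

Lemma hpathE (eta : C0 E) g : lifts eta g -> forall u, unitI u -> hpath eta u = g u.
Proof. by move=> lg; exact: lifts_unique (hpath_lifts eta) lg. Qed.

Definition Hol (eta : C0 E) : S := hpath eta 1.

Lemma unitI1 : unitI (1 : R). Proof. by apply/unitIP; rewrite lexx ler01. Qed.
Lemma unitI0 : unitI (0 : R). Proof. by apply/unitIP; rewrite lexx ler01. Qed.

Lemma HolE (eta : C0 E) g : lifts eta g -> Hol eta = g 1.
Proof. by move=> lg; apply: (hpathE lg); exact: unitI1. Qed.

(** Ad along the path, and its inverse, as elements of [C0], so that their dependence on the form
    can be differentiated in the sup norm. *)
Definition AdC (eta : C0 E) : C0 'M[R]_n := C0of (fun u => AdM (hpath eta u)).
Definition AdVC (eta : C0 E) : C0 'M[R]_n := C0of (fun u => AdM (hpath eta u)^-1%g).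

Lemma ACE (eta : C0 E) u : unitI u -> AdC eta u = AdM (hpath eta u).
Proof. by move=> uI; exact: (C0of_id (AdM_path_cont (hpath_lifts eta)) uI). Qed.

Lemma BCE (eta : C0 E) u : unitI u -> AdVC eta u = AdM (hpath eta u)^-1%g.
Proof. by move=> uI; exact: (C0of_id (AdMV_path_cont (hpath_lifts eta)) uI). Qed.

Lemma AdMK (x : S) : AdM x *m AdM x^-1%g = 1%:M.
Proof. by have := AdMM x^-1%g x; rewrite mulVg AdM1 => <-. Qed.

Lemma AdMVK (x : S) : AdM x^-1%g *m AdM x = 1%:M.
Proof. by have := AdMM x x^-1%g; rewrite mulgV AdM1 => <-. Qed.

Lemma ABC (eta : C0 E) u : unitI u -> AdC eta u *m AdVC eta u = 1%:M.
Proof. by move=> uI; exact: (etrans (congr2 mulmx (ACE eta uI) (BCE eta uI)) (AdMK _)). Qed.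

Lemma BAC (eta : C0 E) u : unitI u -> AdVC eta u *m AdC eta u = 1%:M.
Proof. by move=> uI; exact: (etrans (congr2 mulmx (BCE eta uI) (ACE eta uI)) (AdMVK _)). Qed.

Lemma AC_der (eta : C0 E) u : unitI u -> der (fun s => AdM (hpath eta s)) u (adM (eta u) *m AdC eta u).
Proof.
move=> uI; have := AdM_der ((hpath_lifts eta).2 u uI); by rewrite -(ACE eta uI).
Qed.

Lemma BC_der (eta : C0 E) u : unitI u -> der (fun s => AdM (hpath eta s)^-1%g) u (- (AdVC eta u *m adM (eta u))).
Proof.
move=> uI; have := AdMV_der ((hpath_lifts eta).2 u uI); by rewrite -(BCE eta uI).
Qed.

Lemma AC_lbr (eta : C0 E) u v w : unitI u -> lbr S v w *m AdC eta u = lbr S (v *m AdC eta u) (w *m AdC eta u).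
Proof.
move=> uI; have E1 := ACE eta uI; rewrite E1.
rewrite (AdME (hpath eta u) v) (AdME (hpath eta u) w) (AdME (hpath eta u) (lbr S v w)).
exact: Ad_lbr.
Qed.

End Existence.

(** * Smoothness of the holonomy *)

Section Dependence.
Context {R : realType} {n : nat} (S : lie_setup R n).
Notation A := (lA S).
Notation E := 'rV[R]_n.
Notation M_n := 'M[R]_n.
Notation mA := (mA S).
Notation D0 := (D0 S).
Notation Ge := (@Ge _ _ S).
Notation psi := (psi S).
Notation hpath := (hpath S).
Notation Hol := (Hol S).
Notation AdC := (AdC S).
Notation AdVC := (AdVC S).
Notation adM := (adM S).
Notation AdM := (@AdM _ _ S).
Implicit Types (U V W Z : normedModType R) (eta lam zeta : C0 E).

Definition vC : C0 E -> C0 M_n -> C0 E := C0bil (fun (v : E) (M : M_n) => v *m M).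
Definition mC : C0 M_n -> C0 M_n -> C0 M_n := C0bil (fun M N : M_n => M *m N).
Definition adC : C0 E -> C0 M_n := C0lin adM.

Lemma vC_contbil : contbil vC. Proof. exact: C0bil_contbil (mulmx_contbil 1 n n). Qed.
Lemma mC_contbil : contbil mC. Proof. exact: C0bil_contbil (mulmx_contbil n n n). Qed.
Lemma adC_contlin : contlin adC. Proof. exact: C0lin_contlin (adM_contlin S). Qed.
Lemma vCE v M u : vC v M u = v u *m M u. Proof. exact: C0bilE (mulmx_contbil 1 n n). Qed.
Lemma mCE M N u : mC M N u = M u *m N u. Proof. exact: C0bilE (mulmx_contbil n n n). Qed.
Lemma adCE v u : adC v u = adM (v u). Proof. exact: C0linE (adM_contlin S). Qed.

Lemma contbil_r U V W (B : U -> V -> W) u : contbil B -> contlin (B u).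
Proof.
move=> cB; have [C C0 HC] := contbil_bound cB; have [Br _ _] := cB.
by split; [exact: Br|apply: (@lin_bound_continuous _ _ _ _ (C * `|u|))].
Qed.

Lemma contbil_l U V W (B : U -> V -> W) v : contbil B -> contlin (B ^~ v).
Proof.
move=> cB; have [C C0 HC] := contbil_bound cB; have [_ Bl _] := cB.
split; [exact: Bl|apply: (@lin_bound_continuous _ _ _ _ (C * `|v|)); first exact: Bl].
by move=> x; rewrite mulrAC; exact: HC.
Qed.

(** The addition formula: an increment [zeta] of the form becomes a left factor of the path, whose
    own form is [zeta] transformed by Ad along the path of [eta]. *)
Lemma lifts_add eta zeta : lifts (zeta + eta) (fun u => hpath (vC zeta (AdC eta)) u * hpath eta u)%g.
Proof.
apply: lifts_ext (lifts_mul (hpath_lifts S eta) (hpath_lifts S (vC zeta (AdC eta)))) => u uI.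
rewrite vCE (ACE S eta uI) C0_addE; congr (_ + _).
have := AdME (hpath eta u)^-1%g (zeta u *m AdM (hpath eta u)) => <-.
by rewrite -mulmxA AdMK mulmx1.
Qed.

Lemma hpath_add eta zeta u : unitI u ->
  hpath (zeta + eta) u = (hpath (vC zeta (AdC eta)) u * hpath eta u)%g.
Proof. by move=> uI; exact: (hpathE (lifts_add eta zeta) uI). Qed.

Lemma AC_add eta zeta : AdC (zeta + eta) = mC (AdC eta) (AdC (vC zeta (AdC eta))).
Proof.
apply: C0_ext => u uI; rewrite mCE.
have E1 := ACE S (zeta + eta) uI; have E2 := ACE S eta uI; have E3 := ACE S (vC zeta (AdC eta)) uI.
apply: (etrans E1); apply: etrans (esym (congr2 mulmx E2 E3)).
exact: (etrans (congr1 AdM (hpath_add eta zeta uI)) (AdMM _ _)).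
Qed.

Lemma BC_add eta zeta : AdVC (zeta + eta) = mC (AdVC (vC zeta (AdC eta))) (AdVC eta).
Proof.
apply: C0_ext => u uI; rewrite mCE.
have E1 := BCE S (zeta + eta) uI; have E2 := BCE S eta uI; have E3 := BCE S (vC zeta (AdC eta)) uI.
apply: (etrans E1); apply: etrans (esym (congr2 mulmx E3 E2)).
apply: (etrans (congr1 (fun x => AdM x^-1%g) (hpath_add eta zeta uI))).
have E4 := invgM (hpath (vC zeta (AdC eta)) u) (hpath eta u).
exact: (etrans (congr1 AdM E4) (AdMM _ _)).
Qed.

Lemma hpath0 u : unitI u -> hpath 0 u = 1%g.
Proof.
move=> uI; apply: (hpathE (g := fun=> 1%g) _ uI); split=> // v vI.
have := gder_psi (z := fun=> 0) (u := v) (z' := 0) (der_cst (0 : E) v) (D00 S).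
rewrite /lform linear0 psi0; exact.
Qed.

Lemma AC_zero u : unitI u -> AdC 0 u = 1%:M.
Proof. by move=> uI; rewrite (ACE S 0 uI) (hpath0 uI) AdM1. Qed.

Lemma BC_zero u : unitI u -> AdVC 0 u = 1%:M.
Proof. by move=> uI; rewrite (BCE S 0 uI) (hpath0 uI) invg1 AdM1. Qed.

(** The first-order expansion at the zero form, uniform along the path. Half of the error comes from
    the differentiability of [N] in the chart, half from the quadratic estimate of [local_lift]. *)
Lemma path_taylor W (N : S -> W) (L : E -> W) : is_diff (0 : E) (fun y => N (psi y)) L ->
  forall e, 0 < e -> \forall lam \near (0 : C0 E), forall u, unitI u ->
    `|N (hpath lam u) - N 1%g - L (vprim lam u)| <= e * `|lam|.
Proof.
move=> dN e e0.
have [r [C [r0 Cp H]]] := local_lift S.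
have DN := is_diff_ex dN; have LE : 'd (fun y => N (psi y)) (0 : E) = L :> (E -> W) by case: dN.
have cL : contlin L by rewrite -LE; exact: contlin_diff.
have [k k0 Hk] := contlin_bound cL.
have e2 : 0 < e / 2 / C by rewrite !divr_gt0.
have := diff_eps DN e2; rewrite LE => /nbhs_ballP[d /= d0 Hd].
have Hd' y : `|y| < d -> `|N (psi y) - N 1%g - L y| <= e / 2 / C * `|y|.
  move=> yd; have := Hd y; rewrite -ball_normE /= sub0r normrN addr0 psi0; exact.
have p1 : 0 < d / C by rewrite divr_gt0.
have p2 : 0 < e / 2 / (k * C) by rewrite !divr_gt0// mulr_gt0.
near=> lam => u uI.
have lr : `|lam| <= r by near: lam; exact: nbhs0_le.
have ld : `|lam| < d / C by near: lam; exact: (@nbhs0_lt _ (C0 E) _ p1).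
have le : `|lam| <= e / 2 / (k * C) by near: lam; exact: nbhs0_le.
have [z [z0 Hz lz]] := H lam lr.
have [Dz h1 h2] := Hz u uI.
rewrite (hpathE lz uI).
have zd : `|z u| < d by apply: le_lt_trans h1 _; rewrite mulrC -ltr_pdivlMr.
have l0 : 0 <= `|lam| by [].
rewrite (_ : _ - _ - _ = (N (psi (z u)) - N 1%g - L (z u)) + L (z u - vprim lam u)); last first.
  by have /= -> := linearB (mklin cL.1) (z u) (vprim lam u); rewrite addrA subrK.
apply: le_trans (ler_normD _ _) _.
rewrite (_ : e * `|lam| = e / 2 * `|lam| + e / 2 * `|lam|); last by field.
apply: lerD.
  apply: le_trans (Hd' _ zd) _; apply: le_trans (ler_wpM2l (ltW e2) h1) _.
  by rewrite mulrA divfK// gt_eqF.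
apply: le_trans (Hk _) _; apply: le_trans (ler_wpM2l (ltW k0) h2) _.
rewrite mulrA expr2 mulrA ler_wpM2r// mulrC -ler_pdivlMr// mulr_gt0//.
Unshelve. all: by end_near. Qed.

Lemma contlin_opp V : contlin (fun w : V => - w).
Proof. by split=> [a u v|x]; [rewrite scalerN opprD|apply: cvgN; exact: cvg_id]. Qed.

(** With an addition formula as hypothesis, differentiation at [x] moves to 0. *)
Lemma is_diff_translate V W (f F L : V -> W) x : (forall h, f (h + x) = F h) ->
  is_diff (0 : V) F L -> is_diff x f L.
Proof.
move=> fF dF; have DF := is_diff_ex dF; have LE : 'd F (0 : V) = L :> (V -> W) by case: dF.
have cL : contlin L by rewrite -LE; exact: contlin_diff.
apply: is_diff_eps; [exact: cL.1|exact: cL.2|] => e e0.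
have := diff_eps DF e0; rewrite LE; apply: filterS => h.
by rewrite addr0 fF -[in f x](add0r x) fF.
Qed.

(* The derivative of hpath at eta in the direction zeta, translated to the unit from the right. *)
Definition kap eta zeta : C0 E := C0prim (vC zeta (AdC eta)).

Lemma kapE eta zeta u : unitI u -> kap eta zeta u = vprim (vC zeta (AdC eta)) u.
Proof. by move=> uI; exact: C0primE. Qed.

Lemma AC_is_diff0 : is_diff (0 : C0 E) AdC (fun lam => adC (C0prim lam)).
Proof.
have cl := contlin_comp (@C0prim_contlin R n) adC_contlin.
apply: is_diff_eps; [exact: cl.1|exact: cl.2|] => e e0.
have := path_taylor (AdM_psi_diff S) e0; apply: filterS => lam H; rewrite addr0.
apply: C0_norm_le => u uI.
have -> : (AdC lam - AdC 0 - adC (C0prim lam)) u = AdM (hpath lam u) - AdM 1%g - adM (vprim lam u).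
  rewrite !C0_subE; congr (_ - _ - _); first exact: (ACE S lam uI).
    by apply: (etrans (AC_zero uI)); rewrite AdM1.
  by apply: (etrans (adCE _ _)); congr (adM _); exact: C0primE.
exact: H.
Qed.

Lemma BC_is_diff0 : is_diff (0 : C0 E) AdVC (fun lam => - adC (C0prim lam)).
Proof.
have cl := contlin_comp (@C0prim_contlin R n) adC_contlin.
have cl' := contlin_comp cl (contlin_opp _).
apply: is_diff_eps; [exact: cl'.1|exact: cl'.2|] => e e0.
have := path_taylor (N := fun x => AdM x^-1%g) (AdM_psiV_diff S) e0; apply: filterS => lam H; rewrite addr0.
apply: C0_norm_le => u uI.
have -> : (AdVC lam - AdVC 0 - - adC (C0prim lam)) u =
    AdM (hpath lam u)^-1%g - AdM 1^-1%g - - adM (vprim lam u).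
  rewrite !C0_subE; congr (_ - _ - - _); first exact: (BCE S lam uI).
    by apply: (etrans (BC_zero uI)); rewrite invg1 AdM1.
  by apply: (etrans (adCE _ _)); congr (adM _); exact: C0primE.
exact: H.
Qed.

Lemma AC_is_diff eta : is_diff eta AdC (fun zeta => mC (AdC eta) (adC (kap eta zeta))).
Proof.
apply: is_diff_translate (AC_add eta) _.
have c1 := contbil_l (AdC eta) vC_contbil.
have D1 := contlin_is_diff (0 : C0 E) c1.
have e0 : vC 0 (AdC eta) = 0 by exact: (linear0 (mklin c1.1)).
have D2 : is_diff (vC 0 (AdC eta)) AdC (fun lam => adC (C0prim lam)) by rewrite e0; exact: AC_is_diff0.
have D3 := is_diff_comp D1 D2.
exact: (is_diff_comp D3 (contlin_is_diff _ (contbil_r (AdC eta) mC_contbil))).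
Qed.

Lemma BC_is_diff eta : is_diff eta AdVC (fun zeta => mC (- adC (kap eta zeta)) (AdVC eta)).
Proof.
apply: is_diff_translate (BC_add eta) _.
have c1 := contbil_l (AdC eta) vC_contbil.
have D1 := contlin_is_diff (0 : C0 E) c1.
have e0 : vC 0 (AdC eta) = 0 by exact: (linear0 (mklin c1.1)).
have D2 : is_diff (vC 0 (AdC eta)) AdVC (fun lam => - adC (C0prim lam)) by rewrite e0; exact: BC_is_diff0.
have D3 := is_diff_comp D1 D2.
exact: (is_diff_comp D3 (contlin_is_diff _ (contbil_l (AdVC eta) mC_contbil))).
Qed.

Lemma Ck_neg k V W (U : set V) (f : V -> W) : open U -> Ck k U f -> Ck k U (fun x => - f x).
Proof.
move=> oU cf; by have := Ck_comp (B := setT) oU _ cf (Ck_lin k openT (contlin_opp W)); apply.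
Qed.

Lemma Ck_contlin k U V W (A : set U) (L : V -> W) (f : U -> V) : open A -> contlin L ->
  Ck k A f -> Ck k A (fun x => L (f x)).
Proof. by move=> oA cL cf; have := Ck_comp (B := setT) oA _ cf (Ck_lin k openT cL); apply. Qed.

Lemma Ck_kap k V (U : set V) (f g : V -> C0 E) : open U -> Ck k U (fun x => AdC (f x)) -> Ck k U g ->
  Ck k U (fun x => kap (f x) (g x)).
Proof.
move=> oU cf cg; apply: (Ck_contlin oU (@C0prim_contlin R n)).
exact: (Ck_bil vC_contbil oU cg cf).
Qed.

(** The differentials of [AdC] and [AdVC] are built from [AdC], [AdVC] and the direction by
    continuous bilinear maps and primitives, so order [k] implies order [k.+1]. The two are treated
    together because that of [AdVC] involves both. *)
Lemma Ck_AC_BC k : Ck k [set: C0 E] AdC /\ Ck k [set: C0 E] AdVC.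
Proof.
elim: k => [|k [IA IB]].
  split=> eta _; apply: differentiable_continuous.
    exact: is_diff_ex (AC_is_diff eta).
  exact: is_diff_ex (BC_is_diff eta).
have oT : open ([set: C0 E] `*` [set: C0 E]) by apply: openXT; exact: openT.
have cf : Ck k ([set: C0 E] `*` [set: C0 E]) fst by apply: Ck_lin => //; exact: contlin_fst.
have cs : Ck k ([set: C0 E] `*` [set: C0 E]) snd by apply: Ck_lin => //; exact: contlin_snd.
have cA : Ck k ([set: C0 E] `*` [set: C0 E]) (fun p => AdC p.1) by exact: (Ck_comp oT _ cf IA).
have cB : Ck k ([set: C0 E] `*` [set: C0 E]) (fun p => AdVC p.1) by exact: (Ck_comp oT _ cf IB).
have ck := Ck_contlin oT adC_contlin (Ck_kap oT cA cs).
split.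
- split=> [eta _|]; first exact: is_diff_ex (AC_is_diff eta).
  apply: Ck_ext (Ck_bil mC_contbil oT cA ck) => // p _.
  exact: esym (is_diffE p.2 (AC_is_diff p.1)).
- split=> [eta _|]; first exact: is_diff_ex (BC_is_diff eta).
  apply: Ck_ext (Ck_bil mC_contbil oT (Ck_neg oT ck) cB) => // p _.
  exact: esym (is_diffE p.2 (BC_is_diff p.1)).
Qed.

Lemma AC_smooth : smooth_on [set: C0 E] AdC. Proof. by move=> k; case: (Ck_AC_BC k). Qed.
Lemma BC_smooth : smooth_on [set: C0 E] AdVC. Proof. by move=> k; case: (Ck_AC_BC k). Qed.

(* rho is the right trivialization of the tangent bundle in the chart c, and sig its inverse. *)
Definition rho (c : chart E S) (q v : E) : E := 'd (fun y => fwd c (psi y * bwd c q)%g) (0 : E) v.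
Definition sig (c : chart E S) (q w : E) : E := 'd (fun z => phi (bwd c z * (bwd c q)^-1)%g) q w.

Lemma open_prod V W (U : set V) (U' : set W) : open U -> open U' -> open (U `*` U').
Proof.
move=> oU oU'; rewrite openE => -[x y] [/= Ux Uy]; exists (U, U') => //=.
by split; exact: nbhs_open.
Qed.

Lemma rho_smooth c : charts A c ->
  smooth_on (cod c `*` [set: E]) (fun p : E * E => rho c (fst p) (snd p)).
Proof.
move=> Ac; have oc := chart_cod_open mA Ac.
pose F (p : E * E) := (psi p.2 * bwd c p.1)%g.
have oP : open (cod c `*` D0) by apply: open_prod => //; exact: D0_open.
have s1 : msmooth A (cod c `*` D0) (fun p => bwd c p.1).
  apply: (msmooth_comp (g := fst) oP _ _ (msmooth_bwd mA Ac)); first by move=> p [].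
  by apply: smooth_lin => //; exact: contlin_fst.
have s2 : msmooth A (cod c `*` D0) (fun p => psi p.2).
  apply: (msmooth_comp (g := snd) oP _ _ (msmooth_psi S)); first by move=> p [].
  by apply: smooth_lin => //; exact: contlin_snd.
have sF : msmooth A (cod c `*` D0) F by exact: msmooth_mul.
have [op s] := sF c Ac.
have H q : cod c q -> ((cod c `*` D0) `&` F @^-1` dom c) (q, 0).
  move=> cq; split; first by split=> //=; exact: D00.
  by rewrite /F /= psi0 mul1g; exact: (chart_bwd_dom mA Ac).
have oT := openXT (W := E) oc.
pose G (p : E * E) : (E * E) * E := ((p.1, 0), p.2).
have sG : smooth_on (cod c `*` [set: E]) G.
  apply: smooth_pair => //; [apply: smooth_pair => //|].
  - by apply: smooth_lin => //; exact: contlin_fst.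
  - exact: smooth_cst.
  - by apply: smooth_lin => //; exact: contlin_snd.
have mG p : (cod c `*` [set: E]) p -> (((cod c `*` D0) `&` F @^-1` dom c) `*` [set: E]) (G p).
  by move=> [Ux _]; split=> //; exact: H.
have := smooth_comp oT mG sG (smooth_partial op s).
apply: smooth_ext => // -[q v] [/= cq _].
exact: (diff_partial2 v (smooth_diff s (H q cq))).
Qed.

Lemma sig_smooth c : charts A c ->
  smooth_on (cod c `*` [set: E]) (fun p : E * E => sig c (fst p) (snd p)).
Proof.
move=> Ac; have oc := chart_cod_open mA Ac.
pose F (p : E * E) := (bwd c p.2 * (bwd c p.1)^-1)%g.
have oP : open (cod c `*` cod c) by exact: open_prod.
have s1 : msmooth A (cod c `*` cod c) (fun p => bwd c p.1).
  apply: (msmooth_comp (g := fst) oP _ _ (msmooth_bwd mA Ac)); first by move=> p [].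
  by apply: smooth_lin => //; exact: contlin_fst.
have s2 : msmooth A (cod c `*` cod c) (fun p => bwd c p.2).
  apply: (msmooth_comp (g := snd) oP _ _ (msmooth_bwd mA Ac)); first by move=> p [].
  by apply: smooth_lin => //; exact: contlin_snd.
have sF : msmooth A (cod c `*` cod c) F by apply: msmooth_mul => //; exact: msmooth_inv.
have [op s] := smooth_phi sF.
have H q : cod c q -> ((cod c `*` cod c) `&` F @^-1` Ge) (q, q).
  by move=> cq; split; [split|rewrite /F /= mulgV; exact: Ge1].
have oT := openXT (W := E) oc.
pose G (p : E * E) : (E * E) * E := ((p.1, p.1), p.2).
have sG : smooth_on (cod c `*` [set: E]) G.
  apply: smooth_pair => //; [apply: smooth_pair => //|].
  - by apply: smooth_lin => //; exact: contlin_fst.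
  - by apply: smooth_lin => //; exact: contlin_fst.
  - by apply: smooth_lin => //; exact: contlin_snd.
have mG p : (cod c `*` [set: E]) p -> (((cod c `*` cod c) `&` F @^-1` Ge) `*` [set: E]) (G p).
  by move=> [Ux _]; split=> //; exact: H.
have := smooth_comp oT mG sG (smooth_partial op s).
apply: smooth_ext => // -[q v] [/= cq _].
exact: (diff_partial2 v (smooth_diff s (H q cq))).
Qed.

Lemma rmul_msmooth (g : S) : msmooth A D0 (fun y => psi y * g)%g.
Proof. by apply: msmooth_mul; [exact: D0_open|exact: msmooth_psi|exact: (msmooth_cst1 _ (D0_open S))]. Qed.

Lemma bwd_mulV_msmooth c (g : S) : charts A c -> msmooth A (cod c) (fun z => bwd c z * g^-1)%g.
Proof.
move=> Ac; have oc := chart_cod_open mA Ac.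
by apply: msmooth_mul => //; [exact: (msmooth_bwd mA Ac)|exact: (msmooth_cst1 _ oc)].
Qed.

Lemma rmul_diff c g : charts A c -> dom c g -> differentiable (fun y => fwd c (psi y * g)%g) (0 : E).
Proof. by move=> Ac cg; apply: (msmooth_at (rmul_msmooth g) Ac (D00 S)); rewrite psi0 mul1g. Qed.

Lemma bwd_mulV_diff c q : charts A c -> cod c q ->
  differentiable (fun z => phi (bwd c z * (bwd c q)^-1)%g) q.
Proof.
by move=> Ac cq; apply: (phi_diff (bwd_mulV_msmooth (bwd c q) Ac) cq); rewrite mulgV; exact: Ge1.
Qed.

Lemma sig_rho c q v : charts A c -> cod c q -> sig c q (rho c q v) = v.
Proof.
move=> Ac cq; have dq := chart_bwd_dom mA Ac cq.
have d1 := rmul_diff Ac dq; have d2 := bwd_mulV_diff Ac cq.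
have e1 : fwd c (psi 0 * bwd c q)%g = q by rewrite psi0 mul1g (chart_bwdK mA Ac).
have X := diff_chain v d1 e1 d2; apply: (etrans (esym X)); apply: near_diff_id.
have c0 : dom c (psi 0 * bwd c q)%g by rewrite psi0 mul1g.
apply: filterS (msmooth_near (rmul_msmooth (bwd c q)) Ac (D00 S) c0) => y [Dy cy].
by rewrite (chart_fwdK mA Ac cy) mulgK psiK.
Qed.

Lemma rho_sig c q w : charts A c -> cod c q -> rho c q (sig c q w) = w.
Proof.
move=> Ac cq; have dq := chart_bwd_dom mA Ac cq.
have d1 := rmul_diff Ac dq; have d2 := bwd_mulV_diff Ac cq.
have e2 : phi (bwd c q * (bwd c q)^-1)%g = 0 by rewrite mulgV phi1.
have X := diff_chain w d2 e2 d1; apply: (etrans (esym X)); apply: near_diff_id.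
have g0 : Ge (bwd c q * (bwd c q)^-1)%g by rewrite mulgV; exact: Ge1.
apply: filterS (near_Ge (bwd_mulV_msmooth (bwd c q) Ac) cq g0) => z [cz ez].
by rewrite (phiK ez) mulgVK (chart_bwdK mA Ac).
Qed.

Lemma Hol_add eta zeta : Hol (zeta + eta) = (Hol (vC zeta (AdC eta)) * Hol eta)%g.
Proof. exact: (hpath_add eta zeta unitI1). Qed.

Lemma Hol0 : Hol 0 = 1%g. Proof. exact: (hpath0 unitI1). Qed.

Definition kap1 eta zeta : E := kap eta zeta 1.

(** By the addition formula a variation of [eta] multiplies the holonomy on the left by [psi y],
    with [y] equal to [kap1 eta zeta] to first order. *)
Lemma Hol_push W (N : S -> W) (L : E -> W) eta : is_diff (0 : E) (fun y => N (psi y * Hol eta)%g) L ->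
  is_diff eta (fun x => N (Hol x)) (fun zeta => L (kap1 eta zeta)).
Proof.
move=> dN.
have D0' : is_diff (0 : C0 E) (fun lam => N (Hol lam * Hol eta)%g) (fun lam => L (vprim lam 1)).
  have cl : contlin (fun lam : C0 E => vprim lam 1).
    have X := contlin_comp (@C0prim_contlin R n) (contlin_C0eval E 1).
    suff -> : (fun lam : C0 E => vprim lam 1) = (fun f : C0 E => f 1) \o @C0prim R n by [].
    by apply/funext => lam; exact: (esym (C0primE lam unitI1)).
  have cr : contlin L by case: (dN) => d <-; exact: contlin_diff.
  have cc := contlin_comp cl cr.
  apply: is_diff_eps; [exact: cc.1|exact: cc.2|] => e e0.
  have := path_taylor (N := fun x => N (x * Hol eta)%g) dN e0; apply: filterS => lam /(_ 1 unitI1).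
  by rewrite addr0 -Hol0.
apply: (is_diff_translate (F := fun zeta => N (Hol (vC zeta (AdC eta)) * Hol eta)%g)).
  by move=> zeta; rewrite Hol_add.
have c1 := contbil_l (AdC eta) vC_contbil.
have D1 := contlin_is_diff (0 : C0 E) c1.
have e0 : vC 0 (AdC eta) = 0 by exact: (linear0 (mklin c1.1)).
have D2 : is_diff (vC 0 (AdC eta)) (fun lam => N (Hol lam * Hol eta)%g) (fun lam => L (vprim lam 1)) by rewrite e0.
have D3 := is_diff_comp D1 D2.
apply: is_diff_eq D3 _; apply/funext => zeta.
by rewrite /= /kap1 /kap (C0primE _ unitI1).
Qed.

Lemma Hol_is_diff c eta : charts A c -> dom c (Hol eta) ->
  is_diff eta (fun x => fwd c (Hol x)) (fun zeta => rho c (fwd c (Hol eta)) (kap1 eta zeta)).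
Proof.
move=> Ac cH; apply: (Hol_push (N := fwd c) (L := rho c (fwd c (Hol eta)))).
by rewrite /rho (chart_fwdK mA Ac cH); apply: differentiableP; exact: rmul_diff.
Qed.

(** A nearby form changes the holonomy by a left factor [psi (z 1)], and [local_lift] bounds [z 1]
    by a multiple of the distance. *)
Lemma Hol_open c : charts A c -> open (Hol @^-1` dom c).
Proof.
move=> Ac; rewrite openE => eta cH.
have c0 : dom c (psi 0 * Hol eta)%g by rewrite psi0 mul1g.
have := msmooth_near (rmul_msmooth (Hol eta)) Ac (D00 S) c0.
move=> /nbhs_ballP[d /= d0 Hd].
have [e [C [e0 Cp H]]] := local_lift S.
have c1 := contbil_l (AdC eta) vC_contbil.
have [k k0 Hk] := contlin_bound c1.
have p : 0 < Num.min e (d / C) / (2 * k) by rewrite divr_gt0 ?mulr_gt0// lt_min e0 divr_gt0.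
have X : \forall eta' \near eta, `|eta - eta'| <= Num.min e (d / C) / (2 * k).
  by have := nbhsx_ballx eta _ p; apply: filterS => eta'; rewrite -ball_normE /= => /ltW.
apply: filterS X => eta' Heta.
have : `|vC (eta' - eta) (AdC eta)| <= Num.min e (d / C) / 2.
  apply: le_trans (Hk _) _; rewrite mulrC -ler_pdivlMr// -mulrA -invfM distrC; exact: Heta.
move=> L; have l2 : `|vC (eta' - eta) (AdC eta)| < Num.min e (d / C).
  apply: le_lt_trans L _; rewrite ltr_pdivrMr// ltr_pMr ?ltr1n// lt_min e0 divr_gt0//.
move: l2; rewrite lt_min => /andP[le1 le2].
have [z [z0 Hz lz]] := H _ (ltW le1).
have [Dz h1 _] := Hz 1 unitI1.
rewrite /= -[eta'](subrK eta) Hol_add (HolE lz).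
apply: (proj2 (Hd (z 1) _)); rewrite -ball_normE /= sub0r normrN.
by apply: le_lt_trans h1 _; rewrite mulrC -ltr_pdivlMr.
Qed.

(** In a chart the tangent map of [Hol] is [rho] evaluated at [Hol] and [kap1]; as [kap1] inherits
    its smoothness from [AdC], the order rises by one at each step. *)
Lemma Hol_msmooth : msmooth A [set: C0 E] Hol.
Proof.
move=> c Ac; rewrite setTI; split; first exact: Hol_open.
have oH := Hol_open Ac; elim=> [|k IH].
  move=> eta cH; apply: differentiable_continuous; exact: is_diff_ex (Hol_is_diff Ac cH).
split=> [eta cH|]; first exact: is_diff_ex (Hol_is_diff Ac cH).
have oT := openXT (W := C0 E) oH.
have cf : Ck k ((Hol @^-1` dom c) `*` [set: C0 E]) fst by apply: Ck_lin => //; exact: contlin_fst.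
have cs : Ck k ((Hol @^-1` dom c) `*` [set: C0 E]) snd by apply: Ck_lin => //; exact: contlin_snd.
have c1 : Ck k ((Hol @^-1` dom c) `*` [set: C0 E]) (fun p => fwd c (Hol p.1)).
  by apply: (Ck_comp oT _ cf IH) => p [].
have cA : Ck k ((Hol @^-1` dom c) `*` [set: C0 E]) (fun p => AdC p.1).
  by apply: (Ck_comp oT _ cf (AC_smooth k)).
have c2 : Ck k ((Hol @^-1` dom c) `*` [set: C0 E]) (fun p => kap1 p.1 p.2).
  exact: (Ck_contlin oT (contlin_C0eval E 1) (Ck_kap oT cA cs)).
have H p : ((Hol @^-1` dom c) `*` [set: C0 E]) p -> (cod c `*` [set: E]) (fwd c (Hol p.1), kap1 p.1 p.2).
  by move=> [/= cH _]; split=> //=; exact: chart_fwd_cod.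
have := Ck_comp oT H (Ck_pair oT c1 c2) (rho_smooth Ac k).
apply: Ck_ext => // p [/= cH _].
exact: esym (is_diffE p.2 (Hol_is_diff Ac cH)).
Qed.

End Dependence.

(** * The phase space as a Banach manifold *)

Section Pairing.
Context {R : realType}.

Lemma is_diff_unique (V W : normedModType R) (f L L' : V -> W) x : is_diff x f L -> is_diff x f L' ->
  forall v, L v = L' v.
Proof. by move=> d d' v; rewrite -(is_diffE v d) (is_diffE v d'). Qed.

Lemma contlin_map0 (V W : normedModType R) (f : V -> W) : contlin f -> f 0 = 0.
Proof. by move=> [l _]; exact: (linear0 (mklin l)). Qed.

Lemma pairingE n (a v : 'rV[R]_n) : pairing a v = (a *m v^T) 0 0.
Proof. by rewrite mxE; apply: eq_bigr => i _; rewrite mxE. Qed.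

Lemma pairing_delta n (a : 'rV[R]_n) i : pairing a (delta_mx 0 i) = a 0 i.
Proof.
rewrite /pairing (bigD1 i)//= mxE !eqxx mulr1 big1 ?addr0// => j ji.
by rewrite mxE eqxx /= (negbTE ji) mulr0.
Qed.

Lemma pairing_tr n m (a : 'rV[R]_n) (M : 'M[R]_(m, n)) w : pairing (a *m M^T) w = pairing a (w *m M).
Proof. by rewrite !pairingE trmx_mul mulmxA. Qed.

Lemma pairing_contbil n : contbil (fun a v : 'rV[R]_n => pairing a v : R).
Proof.
have [Br Bl [C HC]] := mulmx_contbil (R := R) 1 n 1; split.
- by move=> a k u v; rewrite !pairingE linearP /= mulmxDr -scalemxAr !mxE.
- by move=> v k a b; rewrite !pairingE mulmxDl -scalemxAl !mxE.
- exists C => a v; rewrite pairingE; apply: le_trans (mx_coord_le _ 0 0) _.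
  apply: le_trans (HC _ _) _; have [k Hk] : `|v^T| = `|v| /\ True.
    split=> //; apply/eqP; rewrite eq_le; apply/andP; split.
      by apply: mx_norm_le => // i j; rewrite mxE mx_coord_le.
    by apply: mx_norm_le => // i j; have := mx_coord_le v^T j i; rewrite mxE.
  by rewrite k.
Qed.

Lemma pairingDl n (a b v : 'rV[R]_n) : pairing (a + b) v = pairing a v + pairing b v.
Proof. by have [_ + _] := pairing_contbil n => /(_ v 1 a b); rewrite !scale1r. Qed.
Lemma pairingDr n (a u v : 'rV[R]_n) : pairing a (u + v) = pairing a u + pairing a v.
Proof. by have [+ _ _] := pairing_contbil n => /(_ a 1 u v); rewrite !scale1r. Qed.
Lemma pairingZl n k (a v : 'rV[R]_n) : pairing (k *: a) v = k * pairing a v.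
Proof. by rewrite /pairing mulr_sumr; apply: eq_bigr => i _; rewrite mxE mulrA. Qed.
Lemma pairingZr n k (a v : 'rV[R]_n) : pairing a (k *: v) = k * pairing a v.
Proof. by rewrite /pairing mulr_sumr; apply: eq_bigr => i _; rewrite mxE mulrCA. Qed.
Lemma pairing_ext n (a b : 'rV[R]_n) : (forall v, pairing a v = pairing b v) -> a = b.
Proof. by move=> H; apply/rowP => i; rewrite -!pairing_delta H. Qed.

Lemma dual_mapE n (L : 'rV[R]_n -> 'rV[R]_n) a : dual_map L a = a *m (mxof L)^T.
Proof.
by apply/rowP => i; rewrite !mxE /pairing; apply: eq_bigr => j _; rewrite !mxE.
Qed.

Lemma pairing_dual n (L : 'rV[R]_n -> 'rV[R]_n) a v : linear L ->
  pairing (dual_map L a) v = pairing a (L v).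
Proof. by move=> l; rewrite dual_mapE pairing_tr mxofE. Qed.

Lemma dual_map_ext n (L L' : 'rV[R]_n -> 'rV[R]_n) a : (forall v, L v = L' v) ->
  dual_map L a = dual_map L' a.
Proof. by move=> H; apply/rowP => i; rewrite !mxE H. Qed.

Lemma dual_map_comp n (L K : 'rV[R]_n -> 'rV[R]_n) a : linear L -> linear K ->
  dual_map K (dual_map L a) = dual_map (L \o K) a.
Proof.
move=> lL lK; apply: pairing_ext => v; rewrite !pairing_dual// => b u w /=.
by rewrite lK lL.
Qed.

Lemma dual_map_id n (L : 'rV[R]_n -> 'rV[R]_n) a : (forall v, L v = v) -> dual_map L a = a.
Proof.
by move=> H; apply: pairing_ext => v; rewrite pairing_dual ?H// => b u w; rewrite !H.
Qed.

End Pairing.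

(** * Solutions in terms of their initial value and form *)

Section Solutions.
Context {R : realType} {n : nat} (S : lie_setup R n).
Notation E := 'rV[R]_n.
Notation M_n := 'M[R]_n.
Notation hpath := (hpath S).
Notation AdC := (AdC S).
Notation AdVC := (AdVC S).
Notation adM := (adM S).
Notation AdM := (@AdM _ _ S).
Notation adC := (adC S).
Notation kap := (kap S).
Implicit Types (U V W Z : normedModType R) (eta lam zeta : C0 E) (X : C1 E).

(** The row [x *m (adM y)^T] is the covector w |-> x([y, w]), the infinitesimal coadjoint action;
    the sign comes from antisymmetry of the bracket. *)
Lemma kk_sum (x y : E) i : \sum_j kirillov_kostant (lbr S) x i j * y 0 j = - (x *m (adM y)^T) 0 i.
Proof.
rewrite -(pairing_delta (x *m _)) pairing_tr adME lbr_anti -adME.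
have -> : y *m adM (delta_mx 0 i) = \row_k \sum_j struct_const (lbr S) i j k * y 0 j.
  rewrite {1}(row_sum_delta y) mulmx_suml; apply/rowP => k; rewrite summxE mxE.
  by apply: eq_bigr => j _; rewrite -scalemxAl mxE adME mulrC.
rewrite /pairing -sumrN.
under eq_bigr do rewrite /kirillov_kostant mulr_suml.
rewrite exchange_big /=; apply: eq_bigr => k _.
rewrite !mxE mulrN opprK mulr_sumr; apply: eq_bigr => j _.
by rewrite mulrCA mulrA.
Qed.

Lemma sc_sum (y z : E) i : \sum_j \sum_k struct_const (lbr S) j k i * y 0 j * z 0 k = (z *m adM y) 0 i.
Proof.
rewrite adME {2}(row_sum_delta y) {2}(row_sum_delta z).
have [_ l1 _] := lbr_contbil S.
rewrite -[lbr S _ _]/(mklin (l1 _) _) linear_sum summxE; apply: eq_bigr => j _.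
rewrite linearZ /= mxE -[lbr S _ _]/(mklin (lbr_lin2 S (delta_mx 0 j)) _) linear_sum summxE mulr_sumr.
by apply: eq_bigr => k _; rewrite linearZ /= mxE /struct_const; ring.
Qed.

Lemma solutionP (c : C1 E * C0 E) : is_solution (lbr S) c <->
  forall u, unitI u -> derive1 c.1 u = c.1 u *m (adM (c.2 u))^T.
Proof.
split=> H u uI; last by move=> i; rewrite kk_sum H// subrr.
by apply/rowP => i; have /eqP := H u uI i; rewrite kk_sum subr_eq0 => /eqP.
Qed.

Lemma gaugeP (c v : C1 E * C0 E) : is_gauge (lbr S) c v <->
  exists beta : C1 E, [/\ beta 0 = 0, beta 1 = 0 & forall u, unitI u ->
    v.1 u = c.1 u *m (adM (beta u))^T /\ v.2 u = derive1 beta u + beta u *m adM (c.2 u)].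
Proof.
split=> -[beta [b0 b1 H]]; exists beta; split=> // u uI.
  split; apply/rowP => i; have [h1 h2] := H u uI i; first by rewrite h1 kk_sum opprK.
  by rewrite h2 sc_sum [RHS]mxE.
by move=> i; have [-> ->] := H u uI; rewrite kk_sum opprK sc_sum [X in _ /\ X = _]mxE.
Qed.

Definition tmul (v : E) (M : M_n) : E := v *m M^T.
Lemma tmul_contbil : contbil tmul.
Proof.
have [Br Bl [C HC]] := mulmx_contbil (R := R) 1 n n; split.
- by move=> a k u v; rewrite /tmul linearP /= mulmxDr -scalemxAr.
- by move=> v k a b; rewrite /tmul mulmxDl -scalemxAl.
- exists C => a v; apply: le_trans (HC _ _) _; have -> // : `|v^T| = `|v|.
  apply/eqP; rewrite eq_le; apply/andP; split.
    by apply: mx_norm_le => // i j; rewrite mxE mx_coord_le.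
  by apply: mx_norm_le => // i j; have := mx_coord_le v^T j i; rewrite mxE.
Qed.

Definition tmC : C0 E -> C0 M_n -> C0 E := C0bil tmul.
Lemma tmC_contbil : contbil tmC. Proof. exact: C0bil_contbil tmul_contbil. Qed.
Lemma tmCE v M u : tmC v M u = v u *m (M u)^T. Proof. exact: C0bilE tmul_contbil. Qed.

Definition C0cst W (w : W) : C0 W := MkC0 (C0_pred_cst w).
Lemma C0cst_contlin W : contlin (@C0cst W).
Proof.
have l : linear (@C0cst W) by move=> a u v; apply: C0_ext.
split=> //; apply: (@lin_bound_continuous _ _ _ _ 1) => // w; rewrite mul1r.
by apply: C0_norm_le.
Qed.

Definition XC (p : E * C0 E) : C0 E := tmC (C0cst p.1) (AdC p.2).
(** The curve [XC p] rebuilt from its initial value and its derivative. In this form it is an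
    element of [C1] and depends smoothly on [p] for the C1 norm. *)
Definition Xi (p : E * C0 E) : C1 E := C1prim (p.1, tmC (XC p) (adC p.2)).

Lemma XCE p u : XC p u = p.1 *m (AdC p.2 u)^T. Proof. exact: tmCE. Qed.

Lemma Xi_XC p u : unitI u -> Xi p u = XC p u.
Proof.
move=> uI; pose h s := p.1 *m (AdM (hpath p.2 s))^T.
have hE s : unitI s -> h s = XC p s.
  by move=> sI; rewrite XCE; congr (_ *m _^T); exact: esym (ACE S p.2 sI).
have dh s : unitI s -> der h s (tmC (XC p) (adC p.2) s).
  move=> sI; have cl := contbil_r p.1 tmul_contbil.
  have := is_derive_contlin cl (AC_der S p.2 sI).
  by rewrite tmCE XCE adCE /tmul trmx_mul mulmxA.
rewrite -(hE u uI) (C1primP dh uI); congr (C1prim (_, _) u).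
rewrite /h -[LHS]mulmx1; congr (_ *m _).
rewrite -[LHS]trmx1; congr (_^T).
by rewrite (hpath_lifts S p.2).1 AdM1.
Qed.

Lemma XiE p u : unitI u -> Xi p u = p.1 *m (AdC p.2 u)^T.
Proof. by move=> uI; rewrite Xi_XC// XCE. Qed.

Lemma Xi0 p : Xi p 0 = p.1. Proof. exact: C1prim0. Qed.

Lemma Xi_derive1 p u : unitI u -> derive1 (Xi p) u = Xi p u *m (adM (p.2 u))^T.
Proof. by move=> uI; rewrite C1prim_derive1 tmCE Xi_XC// adCE. Qed.

Lemma Xi_solution p : is_solution (lbr S) (Xi p, p.2).
Proof. by apply/solutionP => u uI; exact: Xi_derive1. Qed.

(** Transporting a solution back to time 0 by the inverse coadjoint action along the path gives a
    curve with zero derivative. *)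
Lemma Xi_unique c : is_solution (lbr S) c -> c.1 = Xi (c.1 0, c.2).
Proof.
move=> /solutionP H; case: c H => X eta /= H.
have HX u : unitI u -> X u = Xi (X 0, eta) u.
  move=> uI; rewrite XiE//=.
  pose f s := X s *m (AdM (hpath eta s)^-1%g)^T.
  have df s : unitI s -> der f s 0.
    move=> sI; have d1 : der X s (X s *m (adM (eta s))^T).
      by rewrite -H// -(clampI_id sI) -C1DE clampI_id//; exact: C1_der.
    have D := is_derive_bil tmul_contbil d1 (BC_der S eta sI).
    have Z : tmul (X s) (- (AdVC eta s *m adM (eta s))) +
        tmul (X s *m (adM (eta s))^T) (AdM (hpath eta s)^-1%g) = 0.
      rewrite -(BCE S eta sI) /tmul -mulmxA -trmx_mul -mulmxDr.
      have tN (M : M_n) : (- M)^T + M^T = 0 by rewrite linearN addNr.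
      by rewrite tN mulmx0.
    by move: D; rewrite Z.
  have fu : f u = f 0.
    have /unitIP/andP[u0 u1] := uI; apply: (is_derive_cst_eq u0) => s /andP[s0 su].
    by apply: df; apply/unitIP; rewrite s0 (le_trans su).
  have f0 : f 0 = X 0.
    rewrite /f (hpath_lifts S eta).1 invg1 AdM1 trmx1 mulmx1//.
  rewrite -f0 -fu /f -mulmxA -trmx_mul -(BCE S eta uI) (ABC S eta uI) trmx1 mulmx1//.
rewrite /Xi [LHS]C1_prim_id; congr (C1prim (_, _)); apply: C0_ext => u uI.
by rewrite C1DE clampI_id// H// tmCE adCE -Xi_XC// -HX.
Qed.

Lemma XC_smooth : smooth_on [set: E * C0 E] XC.
Proof.
have oT := @openT (E * C0 E)%type.
apply: (smooth_bil tmC_contbil) => //.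
  apply: smooth_lin => //; exact: (contlin_comp (contlin_fst _ _) (C0cst_contlin _)).
apply: (smooth_comp (B := setT)) (AC_smooth S) => //.
by apply: smooth_lin => //; exact: contlin_snd.
Qed.

Lemma Xi_smooth : smooth_on [set: E * C0 E] Xi.
Proof.
have oT := @openT (E * C0 E)%type.
apply: (smooth_comp (B := setT) oT _ _ (smooth_lin openT (@C1prim_contlin R n))) => //.
apply: smooth_pair => //; first by apply: smooth_lin => //; exact: contlin_fst.
apply: (smooth_bil tmC_contbil) => //; first exact: XC_smooth.
apply: smooth_lin => //; exact: (contlin_comp (contlin_snd _ _) (adC_contlin S)).
Qed.

Lemma Xi_diff p v u : unitI u ->
  'd Xi p v u = v.1 *m (AdC p.2 u)^T + p.1 *m (AdC p.2 u *m adM (kap p.2 v.2 u))^T.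
Proof.
move=> uI.
have dX : differentiable Xi p by exact: smooth_diff Xi_smooth I.
have dc : is_diff p (fun q => Xi q u) (fun v => 'd Xi p v u).
  exact: (is_diff_comp (differentiableP dX) (contlin_is_diff (Xi p) (contlin_C1eval E uI))).
have d1 := is_diff_comp (contlin_is_diff p (contlin_snd E (C0 E))) (AC_is_diff S p.2).
have d2 := is_diff_comp d1 (contlin_is_diff _ (contlin_C0eval M_n u)).
have d3 := is_diff_pair (contlin_is_diff p (contlin_fst E (C0 E))) d2.
have d4 : is_diff p (fun q : E * C0 E => tmul q.1 (AdC q.2 u))
    (fun v : E * C0 E => tmul p.1 (mC (AdC p.2) (adC (kap p.2 v.2)) u) + tmul v.1 (AdC p.2 u)).
  exact: (is_diff_comp d3 (contbil_is_diff (p.1, AdC p.2 u) tmul_contbil)).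
have e : {near p, (fun q => Xi q u) =1 (fun q : E * C0 E => tmul q.1 (AdC q.2 u))}.
  by apply: filterE => q; exact: XiE.
have d5 := near_is_diff e dc.
rewrite (is_diff_unique d5 d4 v).
rewrite [LHS]addrC; congr (_ + tmul p.1 _); apply: (etrans (mCE _ _ _)).
by congr (_ *m _); exact: adCE.
Qed.

Notation PS := (phase_space (lbr S)).

(** A single chart covers the phase space, initial value and form being arbitrary. *)
Definition PSchart : chart (E * C0 E)%type PS :=
  Chart setT (fun c : PS => ((sval c).1 0, (sval c).2))
    (fun p => exist _ _ (Xi_solution p) : PS).
Definition PSatlas : atlas (E * C0 E)%type PS := Atlas [set PSchart] (fun=> PSchart).

Lemma PS_fwdK c : bwd PSchart (fwd PSchart c) = c.
Proof.
case: c => -[X eta] s; apply: eq_exist => /=.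
by rewrite -(Xi_unique s).
Qed.

Lemma PS_bwdK p : fwd PSchart (bwd PSchart p) = p.
Proof. by case: p => x eta; rewrite -[LHS]/(Xi (x, eta) 0, eta); congr (_, _); exact: Xi0. Qed.

Lemma PS_cod : cod PSchart = setT.
Proof. by rewrite predeqE => p; split=> // _; exists (bwd PSchart p) => //; exact: PS_bwdK. Qed.

Lemma PS_manifold : is_manifold PSatlas.
Proof.
split.
- by move=> _ ->; rewrite PS_cod; split=> [|x _]; [exact: openT|exact: PS_fwdK].
- by move=> x; split.
- move=> _ _ -> ->; have -> : fwd PSchart @` (dom PSchart `&` dom PSchart) = setT.
    by rewrite /= setIT; exact: PS_cod.
  split; first exact: openT.
  by apply: smooth_ext (smooth_id openT) => [|p _]; [exact: openT|rewrite [RHS]PS_bwdK].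
- move=> p q H; have : fwd PSchart p = fwd PSchart q.
    have oP (W : set (E * C0 E)) : open W -> open (fwd PSchart @^-1` W : set (mspace PSatlas)).
      by move=> oW; move=> c -> x _ Wx; exists W; split.
    apply: (@norm_hausdorff R (E * C0 E)%type) => B1 B2.
    rewrite !nbhsE => -[V1 [] V1o V1p s1] [V2 [] V2o V2q s2].
    have n1 : nbhs (p : mspace PSatlas) (fwd PSchart @^-1` V1).
      by apply: open_nbhs_nbhs; split=> //; exact: oP.
    have n2 : nbhs (q : mspace PSatlas) (fwd PSchart @^-1` V2).
      by apply: open_nbhs_nbhs; split=> //; exact: oP.
    by have [z [z1 z2]] := H _ _ n1 n2; exists (fwd PSchart z); split; [exact: s1|exact: s2].
  by move=> /(congr1 (bwd PSchart)); rewrite !PS_fwdK.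
Qed.

(** The solutions form the graph X = Xi(X(0), eta). It is straightened by recording the derivative
    of X - Xi(X(0), eta), a curve that vanishes at 0 and is therefore determined by its derivative;
    hence the complement [C0 E]. *)
Lemma PS_submanifold : is_submanifold PSatlas.
Proof.
split; first exact: PS_manifold.
move=> p; pose ph (c : C1 E * C0 E) := ((c.1 0, c.2), C1D (c.1 - Xi (c.1 0, c.2))).
pose ps (q : (E * C0 E) * C0 E) := (Xi q.1 + C1prim (0, q.2), q.1.2).
exists (C0 E), ph, ps, setT.
have phK q : ph (ps q) = q.
  have key (Y : C1 E) x eta f : Y 0 = x -> Y = Xi (x, eta) + C1prim (0, f) -> ph (Y, eta) = (x, eta, f).
    move=> h1 h2; rewrite /ph /= h1; congr (_, _, _).
    by rewrite h2 addrAC subrr add0r C1D_prim.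
  case: q => -[x eta] f; apply: key => //.
  by rewrite C1_addE (Xi0 (x, eta)) C1prim0 addr0.
have psK c : ps (ph c) = c.
  case: c => X eta; rewrite /ph /ps /=; congr (_, _).
  have e0 : (X - Xi (X 0, eta)) 0 = 0 by rewrite C1_subE Xi0 subrr.
  have := C1_prim_id (X - Xi (X 0, eta)); rewrite e0 => <-.
  by rewrite addrC subrK.
have im : ph @` setT = setT by rewrite predeqE => q; split=> // _; exists (ps q).
have oT := @openT (C1 E * C0 E)%type; have oT' := @openT ((E * C0 E) * C0 E)%type.
have I0 : unitI (0 : R) by exact: unitI0.
split.
- split; [exact: openT|by []|by rewrite im; exact: openT| |by move=> x _; exact: psK].
  rewrite im; split.
    have c0 : contlin (fun c : C1 E * C0 E => (c.1 0, c.2)).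
      by apply: contlin_pair; [exact: (contlin_comp (contlin_fst _ _) (contlin_C1eval E I0))|exact: contlin_snd].
    apply: smooth_pair => //; first exact: smooth_lin.
    apply: (smooth_comp (B := setT) oT _ _ (smooth_lin openT (@C1D_contlin R E))) => //.
    apply: smooth_add => //; first by apply: smooth_lin => //; exact: contlin_fst.
    apply: (smooth_comp (B := setT) oT _ _ (smooth_lin openT (contlin_opp _))) => //.
    exact: (smooth_comp oT _ (smooth_lin oT c0) Xi_smooth).
  apply: smooth_pair => //; last first.
    by apply: smooth_lin => //; exact: (contlin_comp (contlin_fst _ _) (contlin_snd _ _)).
  apply: smooth_add => //.
    by apply: (smooth_comp oT' _ _ Xi_smooth) => //; apply: smooth_lin => //; exact: contlin_fst.
  have cz : contlin (fun q : (E * C0 E) * C0 E => (0 : E, q.2)).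
    by apply: contlin_pair; [exact: contlin_0|exact: contlin_snd].
  by apply: smooth_lin => //; exact: (contlin_comp cz (@C1prim_contlin R n)).
- split.
  + move=> [X eta] _; split=> [/Xi_unique /= XE|E0].
      by rewrite /ph /= -XE subrr; exact: (linear0 (mklin (@C1D_contlin R E).1)).
    have := psK (X, eta); rewrite /ps; move: E0 => /= ->.
    have -> : C1prim (0, 0) = 0 := contlin_map0 (@C1prim_contlin R n).
    by rewrite addr0 => <-; exact: Xi_solution.
  + by exists PSchart; split=> //; rewrite predeqE.
Qed.

End Solutions.

(** * The cotangent bundle *)

Section Atlases.
Context {R : realType} (F : normedModType R).

(** Separation is reduced to open sets of the model space in two charts, so that building an atlas
    involves no topology on [M]. *)
Lemma manifold_intro (M : Type) (A : atlas F M) :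
  (forall c, charts A c -> open (cod c) /\ (forall x, dom c x -> bwd c (fwd c x) = x)) ->
  (forall x, charts A (chart_at A x) /\ dom (chart_at A x) x) ->
  (forall c d, charts A c -> charts A d -> open (fwd c @` (dom c `&` dom d)) /\
     smooth_on (fwd c @` (dom c `&` dom d)) (fwd d \o bwd c)) ->
  (forall p q : M, p <> q -> exists (c d : chart F M) (W W' : set F),
     [/\ charts A c /\ charts A d, dom c p /\ dom d q, open W /\ open W',
       W (fwd c p) /\ W' (fwd d q) &
       forall x, dom c x -> dom d x -> W (fwd c x) -> W' (fwd d x) -> False]) ->
  is_manifold A.
Proof.
move=> H1 H2 H3 H4; split=> // p q pq; apply: contrapT => npq.
have [c [d [W [W' [[Ac Ad] [cp dq] [oW oW'] [Wp W'q] WW]]]]] := H4 p q npq.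
have oD (e : chart F M) (V : set F) : charts A e -> open V ->
    open ([set x | dom e x /\ V (fwd e x)] : set (mspace A)).
  move=> Ae oV; rewrite mspace_openE => c' Ac' x c'x [ex Vx]; have [op s] := H3 c' e Ac' Ae.
  have [_ cK] := H1 c' Ac'.
  exists ((fwd c' @` (dom c' `&` dom e)) `&` (fun y => fwd e (bwd c' y)) @^-1` V); split.
  - by apply: open_preim => // y Hy; exact: (smooth_cont s Hy).
  - by split; [exists x|rewrite /= cK].
  - by move=> y c'y [[z [c'z ez] zy]]; rewrite /= -zy cK// => Vz; rewrite -(cK y c'y) -zy cK.
have n1 : nbhs (p : mspace A) ([set x | dom c x /\ W (fwd c x)] : set (mspace A)).
  by apply: open_nbhs_nbhs; split=> //; exact: oD.
have n2 : nbhs (q : mspace A) ([set x | dom d x /\ W' (fwd d x)] : set (mspace A)).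
  by apply: open_nbhs_nbhs; split=> //; exact: oD.
by have [x [[cx Wx] [dx W'x]]] := pq _ _ n1 n2; exact: (WW x).
Qed.

Lemma open_separation (T : topologicalType) : hausdorff_space T -> forall p q : T, p <> q ->
  exists U U' : set T, [/\ open U /\ open U', U p /\ U' q & forall x, U x -> U' x -> False].
Proof.
move=> hT p q pq; apply: contrapT => H; apply: pq; apply: hT => P Q.
rewrite !nbhsE => -[U [oU Up] UP] [V [oV Vq] VQ]; apply: contrapT => PQ; apply: H.
exists U, V; split=> // x Ux Vx; apply: PQ; exists x; split; [exact: UP|exact: VQ].
Qed.

Lemma manifold_separation (M : Type) (A : atlas F M) : is_manifold A -> forall p q : M, p <> q ->
  exists (c d : chart F M) (W W' : set F),
     [/\ charts A c /\ charts A d, dom c p /\ dom d q, open W /\ open W',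
       W (fwd c p) /\ W' (fwd d q) &
       forall x, dom c x -> dom d x -> W (fwd c x) -> W' (fwd d x) -> False].
Proof.
move=> mA p q pq.
have [U [U' [[oU oU'] [Up U'q] UU]]] := open_separation (mspace_hausdorff mA) (p := p) (q := q) pq.
have Ac := chart_at_charts mA p; have cp := chart_at_dom mA p.
have Ad := chart_at_charts mA q; have dq := chart_at_dom mA q.
have n1 : nbhs (p : mspace A) U by exact: open_nbhs_nbhs.
have n2 : nbhs (q : mspace A) U' by exact: open_nbhs_nbhs.
have [W [oW Wp HW]] := iffLR (nbhs_chart mA _ Ac cp) n1.
have [W' [oW' Wq HW']] := iffLR (nbhs_chart mA _ Ad dq) n2.
exists (chart_at A p), (chart_at A q), W, W'; split=> // x cx dx Wx W'x.
have [_] := HW _ Wx; have [_] := HW' _ W'x.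
by rewrite (chart_fwdK mA Ac cx) (chart_fwdK mA Ad dx) => h1 h2; exact: UU h2 h1.
Qed.

Section Transport.
Variables (M N : Type) (B : atlas F M) (Phi : N -> M) (Psi : M -> N).
Hypotheses (mB : is_manifold B) (PhiK : cancel Phi Psi) (PsiK : cancel Psi Phi).

(** Composition of charts with a bijection leaves all transition maps unchanged, hence also the
    components of tangent vectors. *)
Definition transport_chart (c : chart F M) : chart F N :=
  Chart (Phi @^-1` dom c) (fwd c \o Phi) (Psi \o bwd c).

Definition transport_atlas : atlas F N :=
  Atlas (transport_chart @` charts B) (fun p => transport_chart (chart_at B (Phi p))).

Lemma transport_overlap c d : fwd (transport_chart c) @` (dom (transport_chart c) `&` dom (transport_chart d)) =
  fwd c @` (dom c `&` dom d).
Proof.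
rewrite predeqE => y; split=> [[p [cp dp] <-]|[p [cp dp] <-]]; first by exists (Phi p).
by exists (Psi p); rewrite /= PsiK.
Qed.

Lemma transport_cod c : cod (transport_chart c) = cod c.
Proof.
by have := transport_overlap c c; rewrite !setIid.
Qed.

Lemma transport_transition c d : fwd (transport_chart d) \o bwd (transport_chart c) = fwd d \o bwd c.
Proof. by apply/funext => y /=; rewrite PsiK. Qed.

Lemma transport_manifold : is_manifold transport_atlas.
Proof.
apply: manifold_intro.
- move=> _ [c Bc <-]; rewrite transport_cod; split; first exact: (chart_cod_open mB).
  by move=> p cp /=; rewrite (chart_fwdK mB).
- by move=> p; split; [exists (chart_at B (Phi p)) => //; exact: (chart_at_charts mB)|exact: (chart_at_dom mB)].
- move=> _ _ [c Bc <-] [d Bd <-]; rewrite transport_overlap transport_transition.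
  by case: mB => _ _ + _; exact.
- move=> p q pq; have npq : Phi p <> Phi q by move=> /(congr1 Psi); rewrite !PhiK.
  have [c [d [W [W' [[Ac Ad] [cp dq] [oW oW'] [Wp W'q] WW]]]]] := manifold_separation mB npq.
  exists (transport_chart c), (transport_chart d), W, W'; split=> //; first by split; [exists c|exists d].
  by move=> x; exact: WW.
Qed.

Lemma transport_open (U : set M) : open (U : set (mspace B)) <-> open (Phi @^-1` U : set (mspace transport_atlas)).
Proof.
split=> oU.
- move=> _ [c Bc <-] p cp Up; have [W [oW Wp HW]] := oU c Bc (Phi p) cp Up.
  by exists W; split=> // q cq Wq; exact: HW.
- move=> c Bc p cp Up; have tc : charts transport_atlas (transport_chart c) by exists c.
  have [||W [oW Wp HW]] := oU _ tc (Psi p); rewrite /= ?PsiK//.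
  exists W; split=> //; first by move: Wp; rewrite /= PsiK.
  by move=> q cq Wq; have := HW (Psi q); rewrite /= PsiK; exact.
Qed.

Lemma transport_smooth : smooth_map transport_atlas B Phi.
Proof.
apply: (smooth_mapP transport_manifold) => _ [c Bc <-]; rewrite transport_cod.
have := msmooth_bwd mB Bc; rewrite (_ : (fun y => Phi _) = bwd c)//.
by apply/funext => y /=; rewrite PsiK.
Qed.

Lemma transport_smooth_inv : smooth_map B transport_atlas Psi.
Proof.
apply: (smooth_mapP mB) => c Bc _ [d Bd <-] /=.
have := msmooth_bwd mB Bc Bd.
have -> : (fun y => Psi (bwd c y)) @^-1` (Phi @^-1` dom d) = bwd c @^-1` dom d.
  by rewrite predeqE => y /=; rewrite PsiK.
have -> // : (fun x => fwd d (Phi (Psi (bwd c x)))) = (fun x => fwd d (bwd c x)).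
by apply/funext => y /=; rewrite PsiK.
Qed.

Lemma transport_diffeo : diffeomorphism transport_atlas B Phi.
Proof.
by split; [exact: transport_smooth|exists Psi; split=> //; exact: transport_smooth_inv].
Qed.

Lemma transport_tvec c y : tvec transport_atlas (transport_chart c) y = tvec B c y.
Proof.
rewrite /tvec -[bwd (transport_chart c) y]/(Psi (bwd c y)).
rewrite -[chart_at transport_atlas _]/(transport_chart (chart_at B (Phi (Psi (bwd c y))))) PsiK.
by rewrite transport_transition.
Qed.

Lemma transport_mdiff p v : mdiff transport_atlas B Phi p v = v.
Proof.
rewrite /mdiff -[chart_at transport_atlas p]/(transport_chart (chart_at B (Phi p))).
set c := chart_at B (Phi p); have Bc := chart_at_charts mB (Phi p); have cp := chart_at_dom mB (Phi p).
apply: near_diff_id; have cc := chart_fwd_cod cp.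
apply: filterS (nbhs_open (chart_cod_open mB Bc) cc) => y cy /=.
by rewrite PsiK (chart_bwdK mB Bc cy).
Qed.

End Transport.

End Atlases.

(** * The atlas of the cotangent bundle *)

Section CotangentAtlas.
Context {R : realType} {n : nat} (M : Type) (A : atlas 'rV[R]_n M) (mA : is_manifold A).
Notation E := 'rV[R]_n.
Implicit Types (c d e : chart E M).

(** The differential of a transition map; [tvec] and [tcoord] are the cases in which one of the
    charts is the preferred one. *)
Definition trd c d (y : E) : E -> E := 'd (fun z => fwd d (bwd c z)) y.

Lemma trd_linear c d y : linear (trd c d y). Proof. exact: linearP. Qed.

Lemma overlap_fwd c d p : dom c p -> dom d p -> charts A c -> overlap c d (fwd c p).
Proof. by move=> cp dp Ac; split; [exact: chart_fwd_cod|rewrite /= (chart_fwdK mA)]. Qed.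

Lemma trd_diff c d y : charts A c -> charts A d -> overlap c d y ->
  differentiable (fun z => fwd d (bwd c z)) y.
Proof. by move=> Ac Ad; exact: smooth_diff (transition_smooth mA Ac Ad). Qed.

Lemma trd_comp c d e p v : charts A c -> charts A d -> charts A e -> dom c p -> dom d p -> dom e p ->
  trd d e (fwd d p) (trd c d (fwd c p) v) = trd c e (fwd c p) v.
Proof.
move=> Ac Ad Ae cp dp ep.
have o1 := overlap_fwd cp dp Ac; have o2 := overlap_fwd dp ep Ad.
have e1 : fwd d (bwd c (fwd c p)) = fwd d p by rewrite (chart_fwdK mA).
have X := diff_chain v (trd_diff Ac Ad o1) e1 (trd_diff Ad Ae o2).
apply: (etrans (esym X)).
have H : {near fwd c p, (fun z => fwd e (bwd c z)) =1
    (fun z => fwd e (bwd d (fwd d (bwd c z))))}.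
  apply: filterS (nbhs_open (overlap_open mA Ac Ad) o1) => z [cz dz] /=.
  by rewrite (chart_fwdK mA).
exact: (near_diffE v H (trd_diff Ac Ae (overlap_fwd cp ep Ac))).
Qed.

Lemma trd_id c p v : charts A c -> dom c p -> trd c c (fwd c p) v = v.
Proof.
move=> Ac cp; apply: near_diff_id.
apply: filterS (nbhs_open (chart_cod_open mA Ac) (chart_fwd_cod cp)) => y cy /=.
by rewrite (chart_bwdK mA Ac cy).
Qed.

Lemma cot_fwdE c (q : cotangent R n M) : charts A c -> dom c q.1 ->
  fwd (cot_chart A c) q = (fwd c q.1, dual_map (trd c (chart_at A q.1) (fwd c q.1)) q.2).
Proof. by move=> Ac cq; rewrite /= /tvec (chart_fwdK mA Ac cq). Qed.

Lemma cot_bwdE c (y : E * E) :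
  bwd (cot_chart A c) y =
  (bwd c y.1, dual_map (trd (chart_at A (bwd c y.1)) c (fwd (chart_at A (bwd c y.1)) (bwd c y.1))) y.2).
Proof. by []. Qed.

Lemma cot_fwdK c (q : cotangent R n M) : charts A c -> dom c q.1 ->
  bwd (cot_chart A c) (fwd (cot_chart A c) q) = q.
Proof.
move=> Ac cq; rewrite cot_fwdE// cot_bwdE /= (chart_fwdK mA Ac cq).
have Ap := chart_at_charts mA q.1; have pq := chart_at_dom mA q.1.
case: q cq Ap pq => p a cp Ap pp /=; congr (_, _).
rewrite dual_map_comp; [|exact: trd_linear|exact: trd_linear].
by apply: dual_map_id => v /=; rewrite trd_comp// trd_id.
Qed.

(** Covectors transform by the transpose of the differential of the inverse transition; the
    preferred chart, through which [cot_chart] passes, cancels by [trd_comp]. *)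
Lemma cot_transition c d (y b : E) : charts A c -> charts A d -> overlap c d y ->
  fwd (cot_chart A d) (bwd (cot_chart A c) (y, b)) =
  (fwd d (bwd c y), dual_map (trd d c (fwd d (bwd c y))) b).
Proof.
move=> Ac Ad [cy dy].
have Ap := chart_at_charts mA (bwd c y); have pq := chart_at_dom mA (bwd c y).
have cp := chart_bwd_dom mA Ac cy.
apply: (etrans (cot_fwdE (q := bwd (cot_chart A c) (y, b)) Ad dy)).
set p := chart_at A (bwd c y) in Ap pq.
have E1 : dual_map (trd d p (fwd d (bwd c y))) (dual_map (trd p c (fwd p (bwd c y))) b) =
    dual_map (trd d c (fwd d (bwd c y))) b.
  apply: (etrans (dual_map_comp b (@trd_linear p c _) (@trd_linear d p _))).
  by apply: dual_map_ext => v; exact: (trd_comp v Ad Ap Ac dy pq cp).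
exact: (congr1 (pair (fwd d (bwd c y))) E1).
Qed.

Lemma cot_overlap c d : charts A c ->
  fwd (cot_chart A c) @` (dom (cot_chart A c) `&` dom (cot_chart A d)) = overlap c d `*` [set: E].
Proof.
move=> Ac; rewrite predeqE => -[y b]; split.
  by move=> [q [cq dq]]; rewrite cot_fwdE// => -[<- _]; split=> //; exact: overlap_fwd.
move=> [/= [cy dy] _]; exists (bwd (cot_chart A c) (y, b)).
  by split=> //; exact: (chart_bwd_dom mA).
have oc : overlap c c y by split=> //; exact: (chart_bwd_dom mA).
apply: (etrans (cot_transition b Ac Ac oc)); rewrite (chart_bwdK mA Ac cy); congr (_, _).
apply: dual_map_id => v.
have := trd_id v Ac (chart_bwd_dom mA Ac cy); rewrite (chart_bwdK mA Ac cy); exact.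
Qed.

Lemma cot_cod c : charts A c -> cod (cot_chart A c) = cod c `*` [set: E].
Proof.
move=> Ac; have := cot_overlap c Ac; rewrite setIid /cod => ->; congr (_ `*` _).
by rewrite predeqE => y; split=> [[]//|cy]; split=> //; exact: (chart_bwd_dom mA).
Qed.

Lemma cot_transition_smooth c d : charts A c -> charts A d ->
  smooth_on (overlap c d `*` [set: E]) (fwd (cot_chart A d) \o bwd (cot_chart A c)).
Proof.
move=> Ac Ad; have oO := openXT (W := E) (overlap_open mA Ac Ad).
have s1 : smooth_on (overlap c d `*` [set: E]) (fun p : E * E => fwd d (bwd c p.1)).
  apply: (smooth_comp oO _ _ (transition_smooth mA Ac Ad)); first by move=> p [].
  by apply: smooth_lin => //; exact: contlin_fst.
have m1 (p : E * E) : (overlap c d `*` [set: E]) p -> overlap d c (fwd d (bwd c p.1)).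
  move=> [[cp dp] _]; apply: overlap_fwd => //; exact: (chart_bwd_dom mA).
have sM : smooth_on (overlap d c) (fun y => mxof (trd d c y)).
  apply: smooth_mxof; first exact: (overlap_open mA Ad Ac).
  exact: (smooth_tangent (transition_smooth mA Ad Ac)).
have s2 : smooth_on (overlap c d `*` [set: E]) (fun p : E * E => tmul p.2 (mxof (trd d c (fwd d (bwd c p.1))))).
  apply: (smooth_bil (@tmul_contbil R n)) => //.
    by apply: smooth_lin => //; exact: contlin_snd.
  exact: (smooth_comp oO m1 s1 sM).
apply: smooth_ext (smooth_pair oO s1 s2) => // -[y b] [oy _].
apply: esym; apply: (etrans (cot_transition b Ac Ad oy)); congr (_, _); exact: dual_mapE.
Qed.

Lemma cot_manifold : is_manifold (cot_atlas A).
Proof.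
apply: manifold_intro.
- move=> _ [c Ac <-]; rewrite cot_cod//; split; first by apply: openXT; exact: (chart_cod_open mA).
  by move=> q cq; exact: cot_fwdK.
- move=> q; split; [|exact: (chart_at_dom mA)].
  by exists (chart_at A q.1) => //; exact: (chart_at_charts mA).
- move=> _ _ [c Ac <-] [d Ad <-]; rewrite cot_overlap//; split; last exact: cot_transition_smooth.
  by apply: openXT; exact: (overlap_open mA Ac Ad).
(* Covectors at different points are separated in the base, covectors at the same point in one
   cotangent chart. *)
- move=> q q' qq; have [e|ne] := pselect (q.1 = q'.1); last first.
    have [c [d [W [W' [[Ac Ad] [cp dq] [oW oW'] [Wp W'q] WW]]]]] := manifold_separation mA ne.
    exists (cot_chart A c), (cot_chart A d), (W `*` setT), (W' `*` setT); split=> //.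
    + by split; [exists c|exists d].
    + by split; exact: openXT.
    + by move=> x cx dx [/= Wx _] [/= W'x _]; exact: (WW x.1).
  have Ac := chart_at_charts mA q.1; have cq := chart_at_dom mA q.1.
  set c := chart_at A q.1 in Ac cq; have cq' : dom c q'.1 by rewrite -e.
  have nf : fwd (cot_chart A c) q <> fwd (cot_chart A c) q'.
    move=> E2; apply: qq.
    exact: (etrans (esym (cot_fwdK Ac cq)) (etrans (congr1 (bwd (cot_chart A c)) E2) (cot_fwdK Ac cq'))).
  have [U [U' [[oU oU'] [Up U'q] UU]]] := open_separation (@norm_hausdorff R (E * E)%type) nf.
  have AC : charts (cot_atlas A) (cot_chart A c) by exists c.
  exists (cot_chart A c), (cot_chart A c), U, U'.
  apply: And5 (conj AC AC) (conj cq cq') (conj oU oU') (conj Up U'q) _.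
  by move=> x _ _; exact: UU.
Qed.

End CotangentAtlas.

(** * The canonical form in charts *)

Section CanonicalForm.
Context {R : realType} {n : nat}.
Notation E := 'rV[R]_n.

(* The canonical form in the charts of cot_chart has constant coefficients om0. *)
Definition om0 (v w : E * E) : R := pairing v.2 w.1 - pairing w.2 v.1.

Lemma pairing_l_contlin (w : E) : contlin (fun y : E * E => pairing y.2 w : R).
Proof. exact: (contlin_comp (contlin_snd E E) (contbil_l w (@pairing_contbil R n))). Qed.

Lemma om0_smooth (V : normedModType R) (U : set V) (f g : V -> E * E) : open U ->
  smooth_on U f -> smooth_on U g -> smooth_on U (fun x => om0 (f x) (g x) : R^o).
Proof.
move=> oU sf sg.
have s1 (h : V -> E * E) : smooth_on U h -> smooth_on U (fun x => (h x).1).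
  by move=> sh; apply: (smooth_comp (B := setT) oU _ sh (smooth_lin openT (contlin_fst E E))).
have s2 (h : V -> E * E) : smooth_on U h -> smooth_on U (fun x => (h x).2).
  by move=> sh; apply: (smooth_comp (B := setT) oU _ sh (smooth_lin openT (contlin_snd E E))).
apply: (smooth_add oU); first exact: (smooth_bil (@pairing_contbil R n) oU (s2 _ sf) (s1 _ sg)).
apply: (smooth_comp (B := setT) oU _ _ (smooth_lin openT (contlin_opp R))) => //.
exact: (smooth_bil (@pairing_contbil R n) oU (s2 _ sg) (s1 _ sf)).
Qed.

Lemma near_derive_cst (V : normedModType R) (f : V -> R^o) (k : R) (x v : V) :
  {near x, f =1 cst k} -> 'D_v f x = 0.
Proof.
move=> H; have D : is_derive x v f 0.
  apply: near_eq_is_derive (is_derive_cst (k : R^o) x v).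
  by apply: filterS H => y ->.
by case: D.
Qed.

Context (M : Type) (A : atlas 'rV[R]_n M) (mA : is_manifold A).
Implicit Types (c d : chart E M).
Notation Th c d := (fwd (cot_chart A d) \o bwd (cot_chart A c)).

Lemma Th_diff c d (y : E * E) : charts A c -> charts A d -> overlap c d y.1 -> differentiable (Th c d) y.
Proof. by move=> Ac Ad oy; apply: (smooth_diff (cot_transition_smooth mA Ac Ad)). Qed.

Lemma Th_fst c d (y w : E * E) : charts A c -> charts A d -> overlap c d y.1 ->
  ('d (Th c d) y w).1 = trd c d y.1 w.1.
Proof.
move=> Ac Ad oy; have D1 := differentiableP (Th_diff Ac Ad oy).
have D2 : is_diff y (fun z => (Th c d z).1) (fun w => ('d (Th c d) y w).1).
  exact: (is_diff_comp D1 (contlin_is_diff _ (contlin_fst E E))).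
have D3 : is_diff y (fun z : E * E => fwd d (bwd c z.1)) (fun w : E * E => trd c d y.1 w.1).
  exact: (is_diff_comp (contlin_is_diff y (contlin_fst E E)) (differentiableP (trd_diff mA Ac Ad oy))).
have H : {near y, (fun z => (Th c d z).1) =1 (fun z : E * E => fwd d (bwd c z.1))}.
  by apply: filterE => z.
exact: (is_diff_unique (near_is_diff H D2) D3 w).
Qed.

(** The pairing of covectors with vectors is independent of the chart, which is the invariance of
    the tautological form. *)
Lemma Th_pairing c d (y : E * E) u : charts A c -> charts A d -> overlap c d y.1 ->
  pairing (Th c d y).2 (trd c d y.1 u) = pairing y.2 u.
Proof.
case: y => y b Ac Ad oy; have [/= cy dy] := oy.
have E1 : Th c d (y, b) = _ := cot_transition mA b Ac Ad oy.
apply: (etrans (congr1 (fun q : E * E => pairing q.2 _) E1)).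
apply: (etrans (pairing_dual b _ (@trd_linear _ _ _ d c _))).
have cp := chart_bwd_dom mA Ac cy.
have := trd_comp mA u Ac Ad Ac cp dy cp; rewrite (chart_bwdK mA Ac cy) => ->.
by have := trd_id mA u Ac cp; rewrite (chart_bwdK mA Ac cy) => ->.
Qed.

Lemma overlap_near c d (y : E * E) : charts A c -> charts A d -> overlap c d y.1 ->
  \forall z \near y, overlap c d z.1.
Proof.
move=> Ac Ad oy.
have o' := openXT (W := E) (overlap_open mA Ac Ad).
have : nbhs y (overlap c d `*` [set: E]) by apply: nbhs_open => //; split.
by apply: filterS => z [].
Qed.

(* Differentiating the invariance of the tautological form. *)
Lemma Th_pairing_diff c d (y v w : E * E) : charts A c -> charts A d -> overlap c d y.1 ->
  pairing (Th c d y).2 ('d (fun z : E => trd c d z w.1) (fst y) (fst v)) +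
  pairing ('d (Th c d) y v).2 (trd c d y.1 w.1) = pairing v.2 w.1.
Proof.
move=> Ac Ad oy.
have D1 : is_diff y (fun z => (Th c d z).2) (fun v => ('d (Th c d) y v).2).
  exact: (is_diff_comp (differentiableP (Th_diff Ac Ad oy)) (contlin_is_diff _ (contlin_snd E E))).
have oO := overlap_open mA Ac Ad.
have sT : smooth_on (overlap c d) (fun z => trd c d z w.1).
  exact: (smooth_dir w.1 oO (transition_smooth mA Ac Ad)).
have D2 : is_diff y (fun z : E * E => trd c d z.1 w.1) (fun v : E * E => 'd (fun z : E => trd c d z w.1) (fst y) (fst v)).
  exact: (is_diff_comp (contlin_is_diff y (contlin_fst E E)) (differentiableP (smooth_diff sT oy))).
have D3 := is_diff_comp (is_diff_pair D1 D2) (contbil_is_diff _ (@pairing_contbil R n)).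
have D4 := contlin_is_diff y (pairing_l_contlin w.1).
have H : {near y, (fun z : E * E => pairing z.2 w.1 : R) =1
   (fun q : E * E => pairing q.1 q.2 : R) \o (fun z => ((Th c d z).2, trd c d z.1 w.1))}.
  by apply: filterS (overlap_near Ac Ad oy) => z oz; rewrite [RHS]Th_pairing.
exact: (esym (is_diff_unique (near_is_diff H D4) D3 v)).
Qed.

(** [Th_pairing_diff] is used for [(v, w)] and for [(w, v)]; on subtraction the terms with second
    derivatives of the transition map cancel by symmetry. *)
Lemma om0_inv c d (y v w : E * E) : charts A c -> charts A d -> overlap c d y.1 ->
  om0 ('d (Th c d) y v) ('d (Th c d) y w) = om0 v w.
Proof.
move=> Ac Ad oy; have F1 := Th_fst v Ac Ad oy; have F2 := Th_fst w Ac Ad oy.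
have P1 := Th_pairing_diff v w Ac Ad oy; have P2 := Th_pairing_diff w v Ac Ad oy.
have sch := schwarz w.1 v.1 (overlap_open mA Ac Ad) (transition_smooth mA Ac Ad) oy.
have rr (a b k l m : R) : a + b = k -> a + l = m -> b - l = k - m.
  by move=> <- <-; rewrite opprD addrACA subrr add0r.
rewrite /om0 F1 F2; apply: rr P1 _; rewrite -P2; congr (pairing _ _ + _); exact: sch.
Qed.

Lemma tautE (q : cotangent R n M) v : tautological A q v = pairing q.2 v.1.
Proof.
rewrite /tautological; congr (pairing _ _).
have Ac := chart_at_charts mA q.1; have cq := chart_at_dom mA q.1.
rewrite /mdiff; set c := chart_at A q.1 in Ac cq *.
rewrite -[chart_at (cot_atlas A) q]/(cot_chart A c).
set x := fwd (cot_chart A c) q.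
have cx : cod c x.1 by exact: chart_fwd_cod.
have H : {near x, (fun z : E * E => z.1) =1 fwd c \o (fun q : cotangent R n M => q.1) \o bwd (cot_chart A c)}.
  have : nbhs x (cod c `*` [set: E]).
    by apply: nbhs_open; [apply: openXT; exact: (chart_cod_open mA)|split].
  by apply: filterS => z [cz _]; rewrite [RHS](chart_bwdK mA Ac cz).
exact: (is_diffE v (near_is_diff H (contlin_is_diff x (contlin_fst E E)))).
Qed.

Lemma taut_rep c (y w : E * E) : charts A c -> cod c y.1 ->
  form1_rep (cot_atlas A) (cot_chart A c) (tautological A) y w = pairing y.2 w.1.
Proof.
move=> Ac cy; rewrite /form1_rep tautE.
have Ap := chart_at_charts mA (bwd c y.1); have pp := chart_at_dom mA (bwd c y.1).
set p := chart_at A (bwd c y.1) in Ap pp.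
have oy : overlap c p y.1 by split.
have cp := chart_bwd_dom mA Ac cy.
have -> : (tvec (cot_atlas A) (cot_chart A c) y w).1 = trd c p y.1 w.1 := Th_fst w Ac Ap oy.
have -> : (bwd (cot_chart A c) y).2 = dual_map (trd p c (fwd p (bwd c y.1))) y.2 by [].
rewrite pairing_dual; last exact: trd_linear.
have := trd_comp mA w.1 Ac Ap Ac cp pp cp; rewrite (chart_bwdK mA Ac cy) => ->.
by have := trd_id mA w.1 Ac cp; rewrite (chart_bwdK mA Ac cy) => ->.
Qed.

(** In a cotangent chart the tautological form is [pairing y.2 w.1], whose coefficients are linear
    in [y.2], so its exterior derivative is constant. *)
Lemma canonical_formE (q : cotangent R n M) v w : canonical_form A q v w = om0 v w.
Proof.
have Ac := chart_at_charts mA q.1; have cq := chart_at_dom mA q.1.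
rewrite /canonical_form /ext_d -[chart_at (cot_atlas A) q]/(cot_chart A (chart_at A q.1)).
set c := chart_at A q.1 in Ac cq *; set x := fwd (cot_chart A c) q.
have nx : nbhs x (cod c `*` [set: E]).
  by apply: nbhs_open; [apply: openXT; exact: (chart_cod_open mA)|split=> //; exact: chart_fwd_cod].
have D u w' : 'D_u (fun y => form1_rep (cot_atlas A) (cot_chart A c) (tautological A) y w') x = pairing u.2 w'.1.
  have D1 : is_derive x u (fun y : E * E => pairing y.2 w'.1 : R) (pairing u.2 w'.1).
    exact: (is_diff_derive u (contlin_is_diff x (pairing_l_contlin w'.1))).
  have D2 : is_derive x u (fun y => form1_rep (cot_atlas A) (cot_chart A c) (tautological A) y w') (pairing u.2 w'.1).
    by apply: near_eq_is_derive D1; apply: filterS nx => z [cz _]; rewrite taut_rep.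
  by case: D2.
by rewrite !D.
Qed.

Section TransportedForm.
Variables (N : Type) (Phi : N -> cotangent R n M) (Psi : cotangent R n M -> N).
Hypotheses (PhiK : cancel Phi Psi) (PsiK : cancel Psi Phi).
Notation B := (transport_atlas (cot_atlas A) Phi Psi).

Lemma om0_rep C y v w : charts (cot_atlas A) C -> cod C y ->
  form2_rep B (transport_chart Phi Psi C) (fun _ => om0) y v w = om0 v w.
Proof.
move=> [c Ac <-]; rewrite cot_cod// => -[cy _].
rewrite /form2_rep !transport_tvec//.
have Ap := chart_at_charts mA (bwd c y.1); have pp := chart_at_dom mA (bwd c y.1).
by apply: om0_inv => //; split.
Qed.

(** By [om0_rep] the form has the same constant coefficients in every chart; smoothness and
    closedness follow, and nondegeneracy is that of the pairing. *)
Lemma transport_symplectic : symplectic B (fun _ => om0).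
Proof.
have mC := cot_manifold mA.
split.
- move=> x a v v' w; rewrite /om0 /= pairingDl pairingDr pairingZl pairingZr.
  by rewrite opprD addrACA mulrBr.
- by move=> x v; rewrite /om0 subrr.
- move=> _ [C BC <-]; rewrite transport_cod//.
  have oC := openXT (W := ((E * E) * (E * E))%type) (chart_cod_open mC BC).
  have sl (f : (E * E) * ((E * E) * (E * E)) -> E * E) : contlin f -> smooth_on (cod C `*` setT) f.
    by move=> cf; exact: smooth_lin.
  have c2 := contlin_snd (E * E)%type ((E * E) * (E * E))%type.
  have := om0_smooth oC (sl _ (contlin_comp c2 (contlin_fst _ _))) (sl _ (contlin_comp c2 (contlin_snd _ _))).
  by apply: smooth_ext => // p [cp _]; rewrite om0_rep.
- move=> x u v w; rewrite -[chart_at B x]/(transport_chart Phi Psi (chart_at (cot_atlas A) (Phi x))).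
  set C := chart_at (cot_atlas A) (Phi x).
  have BC : charts (cot_atlas A) C := chart_at_charts mC (Phi x).
  have cC := chart_fwd_cod (chart_at_dom mC (Phi x)).
  have Z (a b u' : E * E) : 'D_u' (fun y => form2_rep B (transport_chart Phi Psi C) (fun _ => om0) y a b)
     (fwd (transport_chart Phi Psi C) x) = 0.
    apply: (@near_derive_cst _ _ (om0 a b)).
    by apply: filterS (nbhs_open (chart_cod_open mC BC) cC) => y cy; rewrite om0_rep.
  by rewrite /= !Z !addr0.
- move=> x [v1 v2] H.
  have -> : v2 = 0.
    apply: pairing_ext => w; have := H (w, 0); rewrite /om0 /= => /eqP; rewrite subr_eq0 => /eqP ->.
    by rewrite /pairing !big1// => i _; rewrite mxE mul0r.
  congr (_, _); apply: pairing_ext => w; have := H (0, w); rewrite /om0 /= => /eqP.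
  rewrite subr_eq0 => /eqP; rewrite /pairing => Hw.
  have : \sum_i w 0 i * v1 0 i = 0.
    by rewrite -Hw big1// => i _; rewrite mxE mulr0.
  by under eq_bigr do rewrite mulrC; move=> ->; rewrite big1// => i _; rewrite mxE mul0r.
Qed.

End TransportedForm.

End CanonicalForm.

(** * Right trivialization and the Maurer--Cartan equation *)

Section Trivialization.
Context {R : realType} {n : nat} (S : lie_setup R n).
Notation A := (lA S).
Notation th := (lth S).
Notation th' := (lth' S).
Notation E := 'rV[R]_n.
Notation mA := (mA S).
Notation D0 := (D0 S).
Notation Ge := (@Ge _ _ S).
Notation psi := (psi S).
Notation rho := (@rho _ _ S).
Notation sig := (@sig _ _ S).
Notation AdM := (@AdM _ _ S).
Notation le := (le S).
Notation lo := (lo S).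
Implicit Types (U V W Z : normedModType R) (c d : chart E S) (g h k : S).

Lemma sig_linear c q : linear (sig c q). Proof. exact: linearP. Qed.
Lemma rho_linear c q : linear (rho c q). Proof. exact: linearP. Qed.

Lemma bwd_mulr_msmooth c h : charts A c -> msmooth A (cod c) (fun z => bwd c z * h)%g.
Proof.
move=> Ac; have oc := chart_cod_open mA Ac.
by apply: msmooth_mul => //; [exact: (msmooth_bwd mA Ac)|exact: (msmooth_cst1 _ oc)].
Qed.

Lemma bwd_mull_msmooth c k : charts A c -> msmooth A (cod c) (fun z => k * bwd c z)%g.
Proof.
move=> Ac; have oc := chart_cod_open mA Ac.
by apply: msmooth_mul => //; [exact: (msmooth_cst1 _ oc)|exact: (msmooth_bwd mA Ac)].
Qed.

(** From (zh)(ph)^-1 = z p^-1: the right Maurer--Cartan form is invariant under right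
    translations. *)
Lemma sig_rpush c d (p : S) h w : charts A c -> charts A d -> dom c p -> dom d (p * h)%g ->
  sig d (fwd d (p * h)%g) ('d (fun z => fwd d (bwd c z * h)%g) (fwd c p) w) = sig c (fwd c p) w.
Proof.
move=> Ac Ad cp dp; have cq := chart_fwd_cod cp; have dq := chart_fwd_cod dp.
have dp' : dom d (bwd c (fwd c p) * h)%g by rewrite (chart_fwdK mA Ac cp).
have d1 := msmooth_at (bwd_mulr_msmooth h Ac) Ad cq dp'.
have e1 : fwd d (bwd c (fwd c p) * h)%g = fwd d (p * h)%g by rewrite (chart_fwdK mA Ac cp).
have d2 := bwd_mulV_diff Ad dq.
have X := diff_chain w d1 e1 d2; apply: (etrans (esym X)).
have N := msmooth_near (bwd_mulr_msmooth h Ac) Ad cq dp'.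
have H : {near fwd c p, (fun z => phi (bwd c z * (bwd c (fwd c p))^-1)%g) =1
   (fun z => phi (bwd d (fwd d (bwd c z * h)) * (bwd d (fwd d (p * h)))^-1)%g)}.
  apply: filterS N => z [_ dz].
  by rewrite (chart_fwdK mA Ad dz) (chart_fwdK mA Ac cp) (chart_fwdK mA Ad dp) invgM mulgA mulgK.
exact: (near_diffE w H (bwd_mulV_diff Ac cq)).
Qed.

(** From (kz)(kp)^-1 = k (z p^-1) k^-1: left translations act on the right Maurer--Cartan form by
    Ad. *)
Lemma sig_lpush c d (p : S) k w : charts A c -> charts A d -> dom c p -> dom d (k * p)%g ->
  sig d (fwd d (k * p)%g) ('d (fun z => fwd d (k * bwd c z)%g) (fwd c p) w) = Ad k (sig c (fwd c p) w).
Proof.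
move=> Ac Ad cp dp; have cq := chart_fwd_cod cp; have dq := chart_fwd_cod dp.
have dp' : dom d (k * bwd c (fwd c p))%g by rewrite (chart_fwdK mA Ac cp).
have d1 := msmooth_at (bwd_mull_msmooth k Ac) Ad cq dp'.
have e1 : fwd d (k * bwd c (fwd c p))%g = fwd d (k * p)%g by rewrite (chart_fwdK mA Ac cp).
have d2 := bwd_mulV_diff Ad dq.
have X := diff_chain w d1 e1 d2; apply: (etrans (esym X)).
have d3 := bwd_mulV_diff Ac cq.
have e3 : phi (bwd c (fwd c p) * (bwd c (fwd c p))^-1)%g = 0 by rewrite mulgV phi1.
have Y := diff_chain w d3 e3 (conj_diff k).
apply: esym; apply: (etrans (esym Y)).
have N := msmooth_near (bwd_mull_msmooth k Ac) Ad cq dp'.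
have g0 : Ge (bwd c (fwd c p) * (bwd c (fwd c p))^-1)%g by rewrite mulgV; exact: Ge1.
have N2 := near_Ge (bwd_mulV_msmooth (bwd c (fwd c p)) Ac) cq g0.
have H : {near fwd c p, (fun z => phi (bwd d (fwd d (k * bwd c z)) * (bwd d (fwd d (k * p)))^-1)%g) =1
   (fun z => phi (k * psi (phi (bwd c z * (bwd c (fwd c p))^-1)) * k^-1)%g)}.
  move: N N2; apply: filterS2 => z [_ dz] [_ gz]; rewrite (phiK gz).
  by rewrite (chart_fwdK mA Ad dz) (chart_fwdK mA Ac cp) (chart_fwdK mA Ad dp) invgM !mulgA.
exact: (near_diffE w H (differentiable_chain d1 e1 d2)).
Qed.

Lemma sig_trd c d (p : S) w : charts A c -> charts A d -> dom c p -> dom d p ->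
  sig d (fwd d p) (trd c d (fwd c p) w) = sig c (fwd c p) w.
Proof.
move=> Ac Ad cp dp; have dp1 : dom d (p * 1)%g by rewrite mulg1.
have := sig_rpush w Ac Ad cp dp1.
have E1 : (fun z => fwd d (bwd c z * 1)%g) = (fun z => fwd d (bwd c z)).
  by apply/funext => z; rewrite mulg1.
by rewrite E1 mulg1.
Qed.

(* The right trivialization of the cotangent bundle; trV q is the covector at the unit. *)
Definition tr (q : S * E) : cotangent R n S :=
  (q.1, dual_map (sig (chart_at A q.1) (fwd (chart_at A q.1) q.1)) q.2).

Definition trV (q : cotangent R n S) : E :=
  dual_map (rho (chart_at A q.1) (fwd (chart_at A q.1) q.1)) q.2.

Lemma chart_atA (g : S) : charts A (chart_at A g). Proof. exact: (chart_at_charts mA). Qed.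
Lemma chart_at_in (g : S) : dom (chart_at A g) g. Proof. exact: (chart_at_dom mA). Qed.
Lemma chart_at_cod (g : S) : cod (chart_at A g) (fwd (chart_at A g) g).
Proof. exact: chart_fwd_cod (chart_at_in g). Qed.

Lemma trK g x : trV (tr (g, x)) = x.
Proof.
rewrite /trV /tr /=; apply: (etrans (dual_map_comp x (sig_linear _ _) (rho_linear _ _))).
by apply: dual_map_id => v; exact: (sig_rho v (chart_atA g) (chart_at_cod g)).
Qed.

Lemma trVK (q : cotangent R n S) : tr (q.1, trV q) = q.
Proof.
case: q => g a; rewrite /trV /tr; congr (_, _).
apply: (etrans (dual_map_comp a (rho_linear _ _) (sig_linear _ _))).
by apply: dual_map_id => v; exact: (rho_sig v (chart_atA g) (chart_at_cod g)).
Qed.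

Lemma tr_inj g x h y : tr (g, x) = tr (h, y) -> g = h /\ x = y.
Proof.
move=> H; have xy := etrans (esym (trK g x)) (etrans (congr1 trV H) (trK h y)).
exact: conj (congr1 fst H) xy.
Qed.

Lemma fwd_tr c g x : charts A c -> dom c g ->
  fwd (cot_chart A c) (tr (g, x)) = (fwd c g, dual_map (sig c (fwd c g)) x).
Proof.
move=> Ac cg; apply: (etrans (cot_fwdE mA (q := tr (g, x)) Ac cg)).
have Ap := chart_atA g; have pg := chart_at_in g.
set p := chart_at A g in Ap pg.
have E1 : dual_map (trd c p (fwd c g)) (dual_map (sig p (fwd p g)) x) = dual_map (sig c (fwd c g)) x.
  apply: (etrans (dual_map_comp x (sig_linear _ _) (@trd_linear _ _ _ c p _))).
  by apply: dual_map_ext => v; exact: sig_trd.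
exact: (congr1 (pair (fwd c g)) E1).
Qed.

Lemma mdiff_rtrans1 g v : mdiff A A (rtrans g) 1%g (th v) = rho (chart_at A g) (fwd (chart_at A g) g) v.
Proof.
rewrite /mdiff /rtrans mul1g.
have Ac := chart_atA g; have cg := chart_at_in g; set c := chart_at A g in Ac cg *.
have cl := chart_fwd_cod (Ge1 S).
have c1 : dom c (bwd le (fwd le 1%g) * g)%g by rewrite (chart_fwdK mA (leA S) (Ge1 S)) mul1g.
have d1 : differentiable (fun y => fwd c (bwd le y * g)%g) lo.
  exact: (msmooth_at (bwd_mulr_msmooth g (leA S)) Ac cl c1).
have D := psi_is_diff (h := fun k => fwd c (k * g)%g) d1.
by rewrite /rho (chart_fwdK mA Ac cg); exact: esym (is_diffE v D).
Qed.

Lemma mdiff_ltrans1 g v : mdiff A A (ltrans g) 1%g (th v) =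
  rho (chart_at A g) (fwd (chart_at A g) g) (Ad g v).
Proof.
rewrite /mdiff /ltrans mulg1.
have Ac := chart_atA g; have cg := chart_at_in g; set c := chart_at A g in Ac cg *.
have cq := chart_fwd_cod cg.
apply: (can_inj (fun v => rho_sig v Ac cq)); rewrite (sig_rho _ Ac cq).
have cg1 : dom c (g * 1)%g by rewrite mulg1.
have := sig_lpush (th v) (leA S) Ac (Ge1 S) cg1; rewrite mulg1 => X.
apply: (etrans X); congr (Ad g _).
have cl := chart_fwd_cod (Ge1 S).
have d2 := bwd_mulV_diff (leA S) cl.
have := psi_is_diff (h := fun k => phi (k * (bwd le (fwd le 1)) ^-1)%g) d2 => D.
have Y := is_diffE v D; apply: (etrans (esym Y)); apply: near_diff_id.
apply: filterS (near_D0 S) => y Dy.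
by rewrite (chart_fwdK mA (leA S) (Ge1 S)) invg1 mulg1; exact: psiK.
Qed.

Lemma sig_le1 w : sig le lo w = th' w.
Proof.
have := rho_sig w (leA S) (chart_fwd_cod (Ge1 S)).
have E1 : chart_at A (1%g : S) = le by [].
have := mdiff_rtrans1 1%g (sig le lo w); rewrite E1 => <- H.
have := lfield1 S (sig le lo w).
have e : ltrans (1%g : S) = rtrans 1%g by apply/funext => k; rewrite /ltrans /rtrans mul1g mulg1.
have X : left_invariant_field A (th (sig le lo w)) 1%g = mdiff A A (rtrans 1%g) 1%g (th (sig le lo w)).
  exact: (congr1 (fun f => mdiff A A f 1%g (th (sig le lo w))) e).
by rewrite X H => /(congr1 th'); rewrite thK => ->.
Qed.

Lemma th_linear : linear th. Proof. exact: linearP. Qed.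
Lemma mdiff_linear (f : S -> S) g : linear (mdiff A A f g). Proof. exact: linearP. Qed.

Lemma cot_lE (q : cotangent R n S) : cot_l A th q = trV q.
Proof.
rewrite /cot_l; apply: (etrans (dual_map_comp _ (mdiff_linear _ _) th_linear)).
by apply: dual_map_ext => v; exact: mdiff_rtrans1.
Qed.

Lemma cot_l_tr g x : cot_l A th (tr (g, x)) = x.
Proof. by rewrite cot_lE trK. Qed.

Lemma cot_r_tr g x : cot_r A th (tr (g, x)) = x *m (AdM g)^T.
Proof.
rewrite /cot_r; apply: (etrans (dual_map_comp _ (mdiff_linear _ _) th_linear)).
apply: (etrans (dual_map_ext _ (mdiff_ltrans1 g))).
rewrite -dual_mapE -[in RHS](trK g x) /trV.
apply: esym; apply: dual_map_comp; [exact: rho_linear|exact: Ad_linear].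
Qed.

Lemma cot_unit_tr x : cot_unit th' x = tr (1%g, x).
Proof.
rewrite /cot_unit /tr; congr (_, _); apply: dual_map_ext => w.
exact: esym (sig_le1 w).
Qed.

(** Right translations preserve the trivialized covector and left translations act on it by Ad
    transposed, so the product keeps the covector of the first factor, and composability relates the
    two covectors by the coadjoint action. *)
Lemma cot_mulP g x h y k z : cot_mul A th (tr (g, x)) (tr (h, y)) (tr (k, z)) <->
  [/\ y = x *m (AdM g)^T, k = (g * h)%g & z = x].
Proof.
rewrite /cot_mul cot_l_tr cot_r_tr.
have key1 z' : dual_map (mdiff A A (rtrans h) g) (tr ((g * h)%g, z')).2 = (tr (g, z')).2.
  rewrite /tr; apply: (etrans (dual_map_comp z' (sig_linear _ _) (mdiff_linear _ _))).
  apply: dual_map_ext => w.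
  exact: (sig_rpush w (chart_atA g) (chart_atA (g * h)%g) (chart_at_in g) (chart_at_in (g * h)%g)).
have key2 z' : dual_map (mdiff A A (ltrans g) h) (tr ((g * h)%g, z')).2 = (tr (h, z' *m (AdM g)^T)).2.
  rewrite /tr -dual_mapE; apply: (etrans (dual_map_comp z' (sig_linear _ _) (mdiff_linear _ _))).
  apply: esym; apply: (etrans (dual_map_comp z' (Ad_linear g) (sig_linear _ _))).
  apply: dual_map_ext => w; apply: esym.
  exact: (sig_lpush w (chart_atA h) (chart_atA (g * h)%g) (chart_at_in h) (chart_at_in (g * h)%g)).
have tr2 (g' : S) x' y' : (tr (g', x')).2 = (tr (g', y')).2 -> x' = y'.
  move=> H; have : tr (g', x') = tr (g', y') by rewrite /tr; congr (_, _); exact: H.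
  by move=> /tr_inj[].
split=> [[H1 H2 H3 H4]|[-> -> ->]].
  have kE : k = (g * h)%g by exact: H2.
  move: H3; rewrite kE => H3; split; [by rewrite H1|by []|].
  exact: (tr2 g _ _ (etrans (esym (key1 z)) H3)).
exact: (And4 erefl erefl (key1 x) (key2 x)).
Qed.

Lemma rV_rat_ball (v : E) (U : set E) : nbhs v U -> exists (q : 'rV[rat]_n) (k : nat),
  `|v - map_mx ratr q| < k.+1%:R^-1 /\ forall w : E, `|w - map_mx ratr q| < k.+1%:R^-1 -> U w.
Proof.
move=> /nbhs_ballP[e /= e0 He].
have e2 : 0 < e / 2 by rewrite divr_gt0.
have [k Hk] := filter_ex (near_infty_natSinv_lt (PosNum e2)).
have {}Hk : k.+1%:R^-1 < e / 2 by [].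
set r : R := k.+1%:R^-1 in Hk *.
have r0 : 0 < r by rewrite /r invr_gt0.
have r2 : 0 < r / 2 by rewrite divr_gt0.
have cq i : exists q : rat, `|v 0 i - ratr q| <= r / 2.
  have /rat_in_itvoo[q] : v 0 i - r / 2 < v 0 i + r / 2 by lra.
  rewrite in_itv /= => /andP[a b]; exists q.
  by rewrite ler_norml; apply/andP; split; lra.
pose q := \row_i sval (cid (cq i)).
have vq : `|v - map_mx ratr q| < r.
  apply: (@le_lt_trans _ _ (r / 2)); last by lra.
  apply: mx_norm_le => [|i j]; first exact: ltW.
  by rewrite !mxE ord1; exact: (svalP (cid (cq j))).
exists q, k; split=> // w wq; apply: He; rewrite -ball_normE /=.
have -> : v - w = (v - map_mx ratr q) - (w - map_mx ratr q).
  by rewrite opprB addrA subrK.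
apply: le_lt_trans (ler_normB _ _) _.
have e3 : e = e / 2 + e / 2 by field.
rewrite e3; exact: ltrD (lt_trans vq Hk) (lt_trans wq Hk).
Qed.

Lemma trV_bwd c (y b : E) : charts A c -> cod c y ->
  trV (bwd (cot_chart A c) (y, b)) = dual_map (rho c y) b.
Proof.
move=> Ac cy; have cp := chart_bwd_dom mA Ac cy.
set q := bwd (cot_chart A c) (y, b).
have E1 : fwd (cot_chart A c) q = (y, b).
  have BC : charts (cot_atlas A) (cot_chart A c) by exists c.
  apply: (chart_bwdK (cot_manifold mA) BC); rewrite (cot_cod mA Ac).
  by split.
have E2 : fwd (cot_chart A c) q = (fwd c q.1, dual_map (sig c (fwd c q.1)) (trV q)).
  by rewrite -{1}(trVK q); exact: (fwd_tr (trV q) Ac cp).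
have E3 := etrans (esym E2) E1.
have y1 : fwd c q.1 = y := congr1 fst E3.
have b1 : dual_map (sig c (fwd c q.1)) (trV q) = b := congr1 snd E3.
rewrite -b1 y1; apply: esym; apply: (etrans (dual_map_comp _ (sig_linear _ _) (rho_linear _ _))).
by apply: dual_map_id => v; exact: sig_rho.
Qed.

Lemma dual_map_smooth V (U : set V) (f : V -> E) (g : V -> E) c (L : E -> E -> E) : open U ->
  open (cod c) -> (forall x, U x -> cod c (f x)) -> smooth_on U f -> smooth_on U g ->
  smooth_on (cod c `*` [set: E]) (fun p : E * E => L (fst p) (snd p)) ->
  smooth_on U (fun x => dual_map (L (f x)) (g x)).
Proof.
move=> oU oc Uc sf sg sL.
have sM := smooth_mxof oc sL.
apply: smooth_ext oU _ (smooth_bil (@tmul_contbil R n) oU sg (smooth_comp oU Uc sf sM)).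
by move=> x _; rewrite dual_mapE.
Qed.

(** In the right trivialization, products of sets of a countable basis of the group with balls of
    rational centre and radius 1/(k+1) form a basis. Smoothness of [rho] makes these sets open,
    smoothness of [sig] makes them fine enough. *)
Lemma cot_second_countable : @second_countable (mspace A) -> @second_countable (mspace (cot_atlas A)).
Proof.
have mC := cot_manifold mA.
move=> [B cB [oB bB]].
pose f (p : set (mspace A) * ('rV[rat]_n * nat)) : set (mspace (cot_atlas A)) :=
  [set q : cotangent R n S | p.1 q.1 /\ `|trV q - map_mx ratr p.2.1| < p.2.2.+1%:R^-1].
exists (f @` (B `*` setT)).
  apply: sub_countable (card_image_le _ _) _; apply: countableX => //.
split.
- move=> _ [[U [r k]] [BU _] <-]; rewrite mspace_openE => _ [c Ac <-] q cq [Uq tq].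
  have oc := chart_cod_open mA Ac.
  have [W [oW Wq HW]] := oB U BU c Ac q.1 cq Uq.
  pose F (y : E * E) := dual_map (rho c y.1) y.2.
  have oT := openXT (W := E) oc.
  have sF : smooth_on (cod c `*` [set: E]) F.
    apply: (dual_map_smooth oT oc _ _ _ (rho_smooth Ac)); first by move=> p [].
      by apply: smooth_lin => //; exact: contlin_fst.
    by apply: smooth_lin => //; exact: contlin_snd.
  have oW' := openXT (W := E) (openI oc oW).
  pose O := ((cod c `&` W) `*` [set: E]) `&` F @^-1` [set x | `|x - map_mx ratr r| < k.+1%:R^-1].
  have FE (p : cotangent R n S) : dom c p.1 -> F (fwd (cot_chart A c) p) = trV p.
    move=> cp; have cy := chart_fwd_cod cp.
    have X := trV_bwd (fwd (cot_chart A c) p).2 Ac cy.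
    apply: (etrans (esym X)); congr (trV _).
    exact: (cot_fwdK mA Ac cp).
  exists O; split.
  + apply: open_preim oW' _ _; first by move=> y [[cy _] _]; apply: (smooth_cont sF).
    have -> : [set x : E | `|x - map_mx ratr r| < k.+1%:R^-1] = ball (map_mx ratr r : E) k.+1%:R^-1.
      by rewrite -ball_normE predeqE => x /=; rewrite distrC.
    exact: ball_open.
  + split; first by split=> //; split=> //; exact: chart_fwd_cod.
    by rewrite /preimage /= (FE q cq).
  + move=> p cp [[[_ Wp] _] Op]; split; first exact: HW.
    by move: Op; rewrite /preimage /= (FE p cp).
- move=> q N nN; set g : S := q.1; set x := trV q.
  have Ac := chart_atA g; have cg := chart_at_in g; set c := chart_at A g in Ac cg.
  have oc := chart_cod_open mA Ac.
  have BC : charts (cot_atlas A) (cot_chart A c) by exists c.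
  have [W [oW Wq HW]] := iffLR (nbhs_chart mC _ BC (p := q) cg) nN.
  pose F (y : E * E) := (y.1, dual_map (sig c y.1) y.2).
  have oT := openXT (W := E) oc.
  have sF : smooth_on (cod c `*` [set: E]) F.
    apply: smooth_pair => //; first by apply: smooth_lin => //; exact: contlin_fst.
    apply: (dual_map_smooth oT oc _ _ _ (sig_smooth Ac)); first by move=> p [].
      by apply: smooth_lin => //; exact: contlin_fst.
    by apply: smooth_lin => //; exact: contlin_snd.
  have FE (p : cotangent R n S) : dom c p.1 -> F (fwd c p.1, trV p) = fwd (cot_chart A c) p.
    by move=> cp; rewrite -[in RHS](trVK p); exact: esym (fwd_tr (trV p) Ac cp).
  have WF : nbhs (fwd c g, x) (F @^-1` W).
    apply: (smooth_cont sF); first by split=> //; exact: chart_fwd_cod.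
    by rewrite FE//; exact: nbhs_open.
  have [[W1 W2] /= [n1 n2] W12] := WF.
  have [r [k [xr rW]]] := rV_rat_ball n2.
  have nV : nbhs (g : mspace A) (dom c `&` fwd c @^-1` W1).
    apply: filterI; first by apply: open_nbhs_nbhs; split=> //; exact: (dom_open mA Ac).
    exact: (fwd_continuous mA Ac cg).
  have [U [BU Ug] UV] := bB g _ nV.
  exists (f (U, (r, k))); first by split; [exists (U, (r, k))|].
  move=> p [/= Up pr]; have [cp W1p] := UV _ Up.
  have Wp : W (fwd (cot_chart A c) p).
    have WF' : W (F (fwd c p.1, trV p)) := W12 (fwd c p.1, trV p) (conj W1p (rW _ pr)).
    by move: WF'; rewrite (FE p cp).
  have [_] := HW _ Wp; rewrite (cot_fwdK mA Ac cp); exact.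
Qed.

(* The right Maurer--Cartan form in the chart [psi], and its derivative at the unit. *)
Definition rform (y u : E) : E := 'd (fun y' => phi (psi y' * (psi y)^-1)%g) y u.

Lemma rform_smooth : smooth_on (D0 `*` [set: E]) (fun p : E * E => rform (fst p) (snd p)).
Proof.
pose F (p : E * E) := (psi p.2 * (psi p.1)^-1)%g.
have oP := D0D0_open S.
have sF : msmooth A (D0 `*` D0) F.
  by apply: msmooth_mul => //; [exact: (msmooth_psi2 S)|apply: msmooth_inv => //; exact: (msmooth_psi1 S)].
have [op s] := smooth_phi sF.
have H x : D0 x -> ((D0 `*` D0) `&` F @^-1` Ge) (x, x).
  by move=> Dx; split; [split|rewrite /F /= mulgV; exact: Ge1].
have oT := openXT (W := E) (D0_open S).
pose G (p : E * E) : (E * E) * E := ((p.1, p.1), p.2).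
have sG : smooth_on (D0 `*` [set: E]) G.
  apply: smooth_pair => //; [apply: smooth_pair => //|].
  - by apply: smooth_lin => //; exact: contlin_fst.
  - by apply: smooth_lin => //; exact: contlin_fst.
  - by apply: smooth_lin => //; exact: contlin_snd.
have mG p : (D0 `*` [set: E]) p -> (((D0 `*` D0) `&` F @^-1` Ge) `*` [set: E]) (G p).
  by move=> [Ux _]; split=> //; exact: H.
have := smooth_comp oT mG sG (smooth_partial op s).
apply: smooth_ext => // -[q v] [/= cq _].
exact: (diff_partial2 v (smooth_diff s (H q cq))).
Qed.

Lemma rpsi_msmooth (g : S) : msmooth A D0 (fun y => psi y * g)%g.
Proof. exact: rmul_msmooth. Qed.

Lemma rform_diff y : D0 y -> differentiable (fun y' => phi (psi y' * (psi y)^-1)%g) y.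
Proof. by move=> Dy; apply: (phi_diff (rpsi_msmooth (psi y)^-1%g) Dy); rewrite mulgV; exact: Ge1. Qed.

Lemma rform_rvf y a : D0 y -> rform y (rvf S a y) = a.
Proof.
move=> Dy; have Dm := mul0_diff (Om2 Dy).
have E1 : rvf S a y = 'd (fun z => mul0 S (z, y)) 0 a by exact: diff_partial1 a Dm.
have dm : differentiable (fun z => mul0 S (z, y)) 0.
  exact: differentiable_chain (differentiable_pairl 0 y) (erefl _) Dm.
have e0 : mul0 S (0, y) = y by rewrite /mul0 /= psi0 mul1g psiK.
have X := diff_chain a dm e0 (rform_diff Dy).
rewrite /rform E1; apply: (etrans (esym X)); apply: near_diff_id.
have g0 : Ge (psi 0 * psi y)%g by rewrite psi0 mul1g; exact: psi_Ge.
apply: filterS (near_Ge (rpsi_msmooth (psi y)) (D00 S) g0) => z [Dz ez].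
by rewrite /mul0 /= phiK// mulgK psiK.
Qed.

Lemma rform0 u : rform 0 u = u.
Proof.
apply: near_diff_id; apply: filterS (near_D0 S) => y Dy.
by rewrite psi0 invg1 mulg1 psiK.
Qed.

Lemma rform_linear y : linear (rform y). Proof. exact: linearP. Qed.

(** Differentiates the constant [rform y (rvf S a y)], using that [rform 0] is the identity. *)
Lemma drform a b : 'd (fun y => rform y a) (0 : E) b = - 'd (rvf S a) 0 b.
Proof.
pose rf (p : E * E) := rform p.1 p.2.
have dr : differentiable rf (0, a) by apply: (smooth_diff rform_smooth); split=> //; exact: D00.
have dv : differentiable (rvf S a) 0 := smooth_diff (rvf_smooth S a) (D00 S).
have r0 : rvf S a 0 = a by exact: dmul01.
have df : differentiable (fun y => (y, rvf S a y)) (0 : E).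
  by apply: differentiable_pair => //; exact: differentiable_id.
have f0 : (fun y => (y, rvf S a y)) (0 : E) = (0, a) by rewrite r0.
have Ef : 'd (fun y => (y, rvf S a y)) (0 : E) b = (b, 'd (rvf S a) 0 b).
  have P := is_diff_pair (contlin_is_diff (0 : E) (contlin_id E)) (differentiableP dv).
  exact: is_diffE b P.
have X := diff_chain b df f0 dr; rewrite Ef in X.
have Y := diff_pairD b ('d (rvf S a) 0 b) dr.
have Z1 : 'd rf (0, a) (b, 0) = 'd (fun y => rform y a) (0 : E) b by exact: diff_partial1 b dr.
have Z2 : 'd rf (0, a) (0, 'd (rvf S a) 0 b) = 'd (rvf S a) 0 b.
  apply: (etrans (diff_partial2 _ dr)).
  have cl : contlin (rform 0) by exact: mx_lin_contlin (rform_linear 0).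
  by apply: (etrans (is_diffE _ (contlin_is_diff a cl))); exact: rform0.
have C : 'd (fun y => rf (y, rvf S a y)) (0 : E) b = 0.
  have dc : differentiable (fun _ : E => a) 0 by exact: differentiable_cst.
  apply: (etrans (near_diffE b _ dc)); last by rewrite diff_cst.
  by apply: filterS (near_D0 S) => y Dy; rewrite /rf /= rform_rvf.
have W := etrans (esym C) (etrans X (etrans Y (congr2 +%R Z1 Z2))).
by apply/eqP; rewrite -addr_eq0; apply/eqP; exact: esym W.
Qed.

(** Antisymmetrizing [drform] leaves derivatives of right invariant fields; exchanging them by
    [lvf_rvf_sym] for those of left invariant fields produces the sign of the equation. *)
Lemma drform_lbr a b : 'd (fun y => rform y b) (0 : E) a - 'd (fun y => rform y a) (0 : E) b = lbr S a b.
Proof.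
apply: (etrans (congr2 (fun x y => x - y) (drform b a) (drform a b))).
apply: esym; apply: (etrans (lbr_lvf S a b)).
apply: (etrans (congr2 (fun x y => x - y) (lvf_rvf_sym S a b) (lvf_rvf_sym S b a))).
have rr (x y : E) : x - y = - y - - x by rewrite opprK addrC.
exact: rr.
Qed.

(** Near [q], right invariance makes [sig] the pullback of [rform] by [f], which sends [q] to 0. The
    second derivatives of [f] cancel by symmetry, and the equation is needed at the unit only, where
    it is [drform_lbr]. *)
Lemma sig_maurer_cartan c q v w : charts A c -> cod c q ->
  'd (fun z => sig c z w) q v - 'd (fun z => sig c z v) q w = lbr S (sig c q v) (sig c q w).
Proof.
move=> Ac cq; have oc := chart_cod_open mA Ac.
pose g := bwd c q; pose f z := phi (bwd c z * g^-1)%g.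
have ms := bwd_mulV_msmooth g Ac.
have Gq : Ge (bwd c q * g^-1)%g by rewrite /g mulgV; exact: Ge1.
have [oO sf] := smooth_phi ms.
set U := cod c `&` _ in oO sf.
have Uq : U q by split.
have fq : f q = 0 by rewrite /f /g mulgV phi1.
have UD z : U z -> D0 (f z) by move=> [_ Gz]; exact: phi_D0.
have sigE z u : U z -> sig c z u = rform (f z) ('d f z u).
  move=> Uz; have [cz Gz] := Uz.
  have X := diff_chain u (smooth_diff sf Uz) (erefl (f z)) (rform_diff (UD z Uz)).
  apply: esym; apply: (etrans (esym X)).
  have H : {near z, (fun z' => phi (bwd c z' * (bwd c z)^-1)%g) =1
      (fun z' => phi (psi (f z') * (psi (f z))^-1)%g)}.
    apply: filterS (nbhs_open oO Uz) => z' [_ Gz'].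
    by rewrite /f !phiK// invgM invgK mulgA mulgVK.
  exact: (near_diffE u H (bwd_mulV_diff Ac cz)).
pose rf (p : E * E) := rform p.1 p.2.
have dsig u u' a : 'd f q u = a -> 'd (fun z => sig c z u) q u' =
    'd (fun y => rform y a) (0 : E) ('d f q u') + 'd (fun z => 'd f z u) q u'.
  move=> ua.
  have dr : differentiable rf (0, a) by apply: (smooth_diff rform_smooth); split=> //; exact: D00.
  have d1 := smooth_diff sf Uq.
  have d2 : differentiable (fun z => 'd f z u) q := smooth_diff (smooth_dir u oO sf) Uq.
  have P := is_diff_pair (differentiableP d1) (differentiableP d2).
  have P0 : (f q, 'd f q u) = (0, a) := congr2 pair fq ua.
  have X := diff_chain u' (is_diff_ex P) P0 dr.
  rewrite (is_diffE u' P) in X.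
  have Y := diff_pairD ('d f q u') ('d (fun z => 'd f z u) q u') dr.
  have Z1 : 'd rf (0, a) ('d f q u', 0) = 'd (fun y => rform y a) (0 : E) ('d f q u') by exact: diff_partial1.
  have Z2 : 'd rf (0, a) (0, 'd (fun z => 'd f z u) q u') = 'd (fun z => 'd f z u) q u'.
    apply: (etrans (diff_partial2 _ dr)).
    have cl : contlin (rform 0) by exact: mx_lin_contlin (rform_linear 0).
    by apply: (etrans (is_diffE _ (contlin_is_diff a cl))); exact: rform0.
  have H : {near q, (fun z => rf (f z, 'd f z u)) =1 (fun z => sig c z u)}.
    by apply: filterS (nbhs_open oO Uq) => z Uz; rewrite sigE.
  have N := near_diffE u' H (differentiable_chain (is_diff_ex P) P0 dr).
  exact: (etrans N (etrans X (etrans Y (congr2 +%R Z1 Z2)))).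
have s1 u : sig c q u = 'd f q u by apply: (etrans (sigE q u Uq)); rewrite fq; exact: rform0.
have sch := schwarz v w oO sf Uq.
have rr (a b k l : E) : k = l -> (a + k) - (b + l) = a - b.
  by move=> ->; rewrite opprD addrACA subrr addr0.
apply: (etrans (congr2 (fun x y => x - y) (dsig w v _ erefl) (dsig v w _ erefl))).
apply: (etrans (rr _ _ _ _ (esym sch))); apply: (etrans (drform_lbr _ _)).
exact: (congr2 (lbr S) (esym (s1 v)) (esym (s1 w))).
Qed.

End Trivialization.

Local Opaque AdC AdVC vC mC adC kap Hol hpath.

(** * Gauge paths and holonomy *)

Section Gauge.
Context {R : realType} {n : nat} (S : lie_setup R n).
Notation A := (lA S).
Notation E := 'rV[R]_n.
Notation Ge := (@Ge _ _ S).
Notation psi := (psi S).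
Notation hpath := (hpath S).
Notation Hol := (Hol S).
Notation AdC := (AdC S).
Notation AdVC := (AdVC S).
Notation adM := (adM S).
Notation AdM := (@AdM _ _ S).
Notation adC := (adC S).
Notation kap := (kap S).
Notation kap1 := (kap1 S).
Notation Xi := (Xi S).
Implicit Types (U V W Z : normedModType R) (eta lam zeta : C0 E) (X : C1 E).

Lemma Ad_lin_contlin g : contlin (@Ad _ _ S g). Proof. exact: mx_lin_contlin (Ad_linear g). Qed.

(** The derivative of the holonomy is naturally translated from the right, while [gder] is a left
    velocity; hence the factor Ad of the inverse. *)
Lemma Hol_curve (gamma : R -> C0 E) t gamma' : der gamma t gamma' ->
  gder (fun s => Hol (gamma s)) t (Ad (Hol (gamma t))^-1%g (kap1 (gamma t) gamma')).
Proof.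
move=> dg; set g0 := Hol (gamma t).
have D : is_diff (0 : E) (fun y => phi (g0^-1 * (psi y * g0))%g) (@Ad _ _ S g0^-1%g).
  have D := differentiableP (conj_diff g0^-1%g).
  apply: near_is_diff D; apply: filterE => y; by rewrite invgK mulgA.
have oT := @openT (C0 E).
have sf : msmooth A [set: C0 E] (fun x => g0^-1 * Hol x)%g.
  by apply: msmooth_mul => //; [exact: msmooth_cst1|exact: Hol_msmooth].
have g1 : Ge (g0^-1 * Hol (gamma t))%g by rewrite mulVg; exact: Ge1.
split.
  have X := near_Ge sf I g1.
  have Y : \forall s \near t, [set: C0 E] (gamma s) /\ Ge (g0^-1 * Hol (gamma s))%g := is_derive_continuous dg X.
  by apply: filterS Y => s [].
exact: (is_derive_diff_comp dg (Hol_push (N := fun x => phi (g0^-1 * x)%g) D)).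
Qed.

Lemma gder_unique (g : R -> S) u v w : gder g u v -> gder g u w -> v = w.
Proof. by move=> [_ [_ <-]] [_ [_ <-]]. Qed.

Lemma kap1_zero (gamma : R -> C0 E) t gamma' : der gamma t gamma' ->
  (\forall s \near t, Hol (gamma s) = Hol (gamma t)) -> kap1 (gamma t) gamma' = 0.
Proof.
move=> dg H; have G := Hol_curve dg.
have G0 : gder (fun s => Hol (gamma s)) t 0.
  split; first by apply: filterS H => s ->; rewrite mulVg; exact: Ge1.
  apply: near_eq_is_derive (der_cst (0 : E) t).
  by apply: filterS H => s /= ->; rewrite mulVg phi1.
rewrite -(AdVK (Hol (gamma t)) (kap1 (gamma t) gamma')) -[RHS](linear0 (mklin (Ad_linear (Hol (gamma t))))).
by rewrite (gder_unique G G0).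
Qed.

(** The gauge parameter is the left velocity of the path under the variation [zeta], that is, [kap]
    brought back by Ad of the inverse path ([gauge_fieldE]). It is given by its derivative in order
    to lie in [C1]. *)
Definition gauge_field eta zeta : C1 E := C1prim (0, zeta - vC (vC (kap eta zeta) (AdVC eta)) (adC eta)).

Lemma vC_adCE (k zeta : C0 E) (M : C0 'M[R]_n) eta s :
  (zeta - vC (vC k M) (adC eta)) s = zeta s - k s *m M s *m adM (eta s).
Proof.
rewrite C0_subE; congr (_ - _); apply: (etrans (vCE _ _ _)).
by congr (_ *m _); [exact: vCE|exact: adCE].
Qed.

Lemma gauge_fieldE eta zeta u : unitI u -> gauge_field eta zeta u = kap eta zeta u *m AdVC eta u.
Proof.
move=> uI.
pose h s := vprim (vC zeta (AdC eta)) s *m AdM (hpath eta s)^-1%g.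
have kE s : unitI s -> vprim (vC zeta (AdC eta)) s = kap eta zeta s.
  by move=> sI; exact: esym (kapE S eta zeta sI).
have dh s : unitI s -> der h s ((zeta - vC (vC (kap eta zeta) (AdVC eta)) (adC eta)) s).
  move=> sI; have D := is_derive_bil (mulmx_contbil 1 n n) (vprim_der (vC zeta (AdC eta)) s) (BC_der S eta sI).
  have Z : vprim (vC zeta (AdC eta)) s *m (- (AdVC eta s *m adM (eta s))) +
      vC zeta (AdC eta) s *m AdM (hpath eta s)^-1%g = (zeta - vC (vC (kap eta zeta) (AdVC eta)) (adC eta)) s.
    have alg (B A' M : 'M[R]_n) (k z : E) : A' *m B = 1%:M ->
        k *m (- (B *m M)) + z *m A' *m B = z - k *m B *m M.
      by move=> AB; rewrite -(mulmxA z) AB mulmx1 mulmxN mulmxA addrC.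
    by rewrite vC_adCE (kE s sI) vCE -(BCE S eta sI); exact: alg (ABC S eta sI).
  by move: D; rewrite Z.
have h0 : h 0 = 0 by rewrite /h vprim0 mul0mx.
have := C1primP dh uI; rewrite h0 => E1.
by rewrite /gauge_field -E1 /h (kE u uI) -(BCE S eta uI).
Qed.

(** The condition [kap1 eta zeta = 0], constancy of the holonomy to first order, is exactly the
    vanishing of the gauge parameter at 1. *)
Lemma gauge_field_gauge x eta zeta (v : C1 E * C0 E) : kap1 eta zeta = 0 ->
  (forall u, unitI u -> v.1 u = x *m (AdC eta u *m adM (kap eta zeta u))^T) -> v.2 = zeta ->
  is_gauge (lbr S) (Xi (x, eta), eta) v.
Proof.
move=> k1 v1 v2; apply/gaugeP; exists (gauge_field eta zeta); split.
- exact: C1prim0.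
- have -> := gauge_fieldE eta zeta (@unitI1 R).
  by rewrite -[kap eta zeta 1]/(kap1 eta zeta) k1 mul0mx.
move=> u uI; have bE := gauge_fieldE eta zeta uI; split.
  rewrite (v1 u uI) [(Xi _, _).1]/= XiE// [(_, eta).1]/= [(_, eta).2]/= bE -mulmxA -trmx_mul; congr (_ *m _^T).
  apply: mx_eq_rV => w; rewrite !mulmxA !adME AC_lbr// -mulmxA (BAC S eta uI) mulmx1//.
rewrite v2 bE [derive1 _ _]C1prim_derive1 [(Xi _, _).2]/= vC_adCE.
by rewrite subrK.
Qed.

(* A C1 homotopy of forms with constant holonomy is what a gauge path amounts to on the
   second component; the first component is then determined by X(0). *)
Definition homeq eta eta' := exists gamma gamma' : R -> C0 E,
  [/\ forall t, der gamma t (gamma' t), continuous gamma',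
      forall t, t <= 0 -> gamma t = eta, forall t, 1 <= t -> gamma t = eta' &
      [/\ gamma' 0 = 0, gamma' 1 = 0 & forall t, Hol (gamma t) = Hol eta]].

(** The homotopy of forms is lifted to solutions by the smooth map F(eta) = (Xi(x, eta), eta) with
    [x] fixed. *)
Lemma homeq_gauge x eta eta' (c c' : phase_space (lbr S)) : homeq eta eta' ->
  sval c = (Xi (x, eta), eta) -> sval c' = (Xi (x, eta'), eta') -> gauge_equiv c c'.
Proof.
move=> [gamma [gamma' [dg cg lo hi [g0 g1 Hg]]]] cE cE'.
pose F eta := (Xi (x, eta), eta).
have oT := @openT (C0 E).
have sp : smooth_on [set: C0 E] (fun eta => (x, eta)).
  by apply: smooth_pair => //; [exact: smooth_cst|exact: smooth_id].
have sX : smooth_on [set: C0 E] (fun eta => Xi (x, eta)) by exact: (smooth_comp oT _ sp (Xi_smooth S)).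
have sF : smooth_on [set: C0 E] F by apply: smooth_pair => //; exact: smooth_id.
pose f t := F (gamma t); pose f' t := 'd F (gamma t) (gamma' t).
have df t : der f t (f' t) by exact: (is_derive_diff_comp (dg t) (differentiableP (smooth_diff sF I))).
have cf : continuous f'.
  move=> t; have H := smooth_cont (x := (gamma t, gamma' t)) (smooth_tangent sF) (conj I I).
  have H2 : {for t, continuous (fun s => (gamma s, gamma' s))}.
    have c1 := is_derive_continuous (dg t); have c2 := cg t.
    exact: (cvg_pair c1 c2).
  exact: (continuous_comp H2 H).
have f'0 : f' 0 = 0 by rewrite /f' g0 linear0.
have f'1 : f' 1 = 0 by rewrite /f' g1 linear0.
have fE : derive1 f = f' by apply/funext => t; exact: is_derive_derive1 (df t).
(* As [gamma'] vanishes at 0 and 1, the constant extension of the curve is the affine one required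
   by [C1_pred]. *)
have P : f \in @C1_pred R (C1 E * C0 E)%type.
  apply/asboolP; split.
  - by move=> t; case: (df t).
  - by rewrite fE.
  - move=> t; rewrite fE; have [t0|t0] := leP t 0.
      by rewrite clampI_lo// f'0 scaler0 addr0 /f !lo.
    have [t1|t1] := leP 1 t; first by rewrite clampI_hi// f'1 scaler0 addr0 /f !hi.
    by rewrite clampI_id ?subrr ?scale0r ?addr0//; apply/unitIP; rewrite !ltW.
exists (MkC1 P); split.
- by rewrite /= /f lo// cE.
- by rewrite /= /f hi// cE'.
move=> t tI; rewrite [MkC1 P t]/= /f; split; first exact: Xi_solution.
rewrite [derive1 _ t](_ : _ = f' t); last by rewrite -fE.
have ff' : f' t = ('d (fun eta => Xi (x, eta)) (gamma t) (gamma' t), gamma' t).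
  have d1 := is_diff_pair (differentiableP (smooth_diff sX (I : [set: C0 E] (gamma t)))) (contlin_is_diff (gamma t) (contlin_id _)).
  exact: (is_diffE (gamma' t) d1).
rewrite ff'; apply: gauge_field_gauge (erefl _).
  by apply: (kap1_zero (dg t)); apply: filterE => s; rewrite !Hg.
move=> u uI; rewrite [(_, _).1]/=.
have dXi : differentiable Xi (x, gamma t) by exact: (smooth_diff (Xi_smooth S) I).
have -> : 'd (fun eta => Xi (x, eta)) (gamma t) (gamma' t) = 'd Xi (x, gamma t) (0, gamma' t).
  exact: esym (diff_partial2 (gamma' t) dXi).
by rewrite Xi_diff// mul0mx add0r.
Qed.

(** The velocity of X(0) contains the factor [beta 0], which is 0. For the holonomy, [beta] times Ad
    along the path is a primitive of the integrand of [kap], so [kap1] vanishes with [beta 1]. *)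
Lemma gauge_inv (c c' : phase_space (lbr S)) : gauge_equiv c c' ->
  (sval c).1 0 = (sval c').1 0 /\ Hol (sval c).2 = Hol (sval c').2.
Proof.
move=> [gamma [g0 g1 H]].
have dg t : unitI t -> der gamma t (derive1 gamma t).
  by move=> tI; have := C1_der gamma tI; rewrite C1DE clampI_id.
have gg t : unitI t -> exists beta : C1 E, [/\ beta 0 = 0, beta 1 = 0 & forall u, unitI u ->
    (derive1 gamma t).1 u = (gamma t).1 u *m (adM (beta u))^T /\
    (derive1 gamma t).2 u = derive1 beta u + beta u *m adM ((gamma t).2 u)].
  by move=> tI; have [_ /gaugeP] := H t tI.
have I0 := @unitI0 R; have I1 := @unitI1 R.
split.
- have d t : unitI t -> der (fun s => (gamma s).1 0) t 0.
    move=> tI; have cl := contlin_comp (contlin_fst (C1 E) (C0 E)) (contlin_C1eval E I0).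
    have D := is_derive_contlin cl (dg t tI).
    have [beta [b0 _ bE]] := gg t tI; have [E0 _] := bE 0 I0.
    have Z : (derive1 gamma t).1 0 = 0.
      by rewrite E0 b0 (contlin_map0 (adM_contlin S)) trmx0 mulmx0.
    by move: D; rewrite /= Z.
  rewrite -g0 -g1; apply: esym.
  by apply: (@is_derive_cst_eq _ _ _ (fun s => (gamma s).1 0) 0 1 ler01) => t /unitIP; exact: d.
- have d t : unitI t -> gder (fun s => Hol (gamma s).2) t 0.
    move=> tI; have D := is_derive_contlin (contlin_snd (C1 E) (C0 E)) (dg t tI).
    have := Hol_curve D; set k := kap1 _ _.
    have -> : k = 0; last by rewrite (contlin_map0 (Ad_lin_contlin _)).
    rewrite /k; have [beta [b0 b1 bE]] := gg t tI.
    set eta := (gamma t).2; set zeta := (derive1 gamma t).2.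
    pose h s := beta s *m AdM (hpath eta s).
    have dh s : unitI s -> der h s (vC zeta (AdC eta) s).
      move=> sI; have [_ E2] := bE s sI.
      have db : der beta s (derive1 beta s) by have := C1_der beta sI; rewrite C1DE clampI_id.
      have D2 := is_derive_bil (mulmx_contbil 1 n n) db (AC_der S eta sI).
      have Z : beta s *m (adM (eta s) *m AdC eta s) + derive1 beta s *m AdM (hpath eta s) = vC zeta (AdC eta) s.
        by rewrite vCE E2 mulmxDl -(ACE S eta sI) addrC mulmxA.
      by move: D2; rewrite Z.
    have h0 : h 0 = 0 by rewrite /h b0 mul0mx.
    have := C1primP dh I1; rewrite h0 /h b1 mul0mx C1primE add0r => Z.
    by rewrite /kap1 (kapE S _ _ I1).
  have := gder_zero_const d I1; rewrite /= g0 g1; exact: esym.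
Qed.

End Gauge.

(** * Deformations of forms with constant holonomy *)

Section Covering.
Context {R : realType} {n : nat} (S : lie_setup R n).
Notation A := (lA S).
Notation E := 'rV[R]_n.
Notation mA := (mA S).
Notation D0 := (D0 S).
Notation Ge := (@Ge _ _ S).
Notation psi := (psi S).
Notation Hol := (Hol S).
Notation AdVC := (AdVC S).
Notation mul0 := (mul0 S).
Notation Om := (Om S).
Notation lform := (lform S).
Notation homeq := (homeq S).
Implicit Types (U V W Z : normedModType R) (eta lam zeta : C0 E) (z : C1 E).

(** Reparametrization by a step function supplies the flat ends required by [homeq]. *)
Lemma homeq_curve (d d' : R -> C0 E) : (forall s, unitI s -> der d s (d' s)) ->
  (forall s, unitI s -> {for s, continuous d'}) -> (forall s, unitI s -> Hol (d s) = Hol (d 0)) ->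
  homeq (d 0) (d 1).
Proof.
move=> dd cd Hd; have [s [s' [ds cs slo shi [sI s0 s1]]]] := @step_exists R.
exists (fun t => d (s t)), (fun t => s' t *: d' (s t)); split.
- move=> t; exact: (is_derive_diff_comp (ds t) (derive1_is_diff (dd _ (sI t)))).
- move=> t; have c1 : {for t, continuous (fun x => d' (s x))}.
    by apply: continuous_comp; [exact: (is_derive_continuous (ds t))|exact: cd].
  exact: (cvgZ (cs t) c1).
- by move=> t t0; rewrite slo.
- by move=> t t1; rewrite shi.
by split; [rewrite s0 scale0r|rewrite s1 scale0r|move=> t; exact: Hd].
Qed.

Lemma homeq_refl eta : homeq eta eta.
Proof.
apply: (@homeq_curve (fun=> eta) (fun=> 0)) => // s _; exact: cvg_cst.
Qed.

Lemma homeq_sym eta eta' : homeq eta eta' -> homeq eta' eta.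
Proof.
move=> [g [g' [dg cg lo hi [g0 g1 Hg]]]].
have H1 : Hol eta' = Hol eta by rewrite -(Hg 1) hi.
have d1 t : der (fun s : R => 1 - s) t (-1 : R).
  by have := derB (der_cst (1 : R) t) (der_id t); rewrite sub0r.
exists (fun t => g (1 - t)), (fun t => (-1 : R) *: g' (1 - t)); split.
- move=> t; exact: (is_derive_diff_comp (d1 t) (derive1_is_diff (dg _))).
- move=> t; have c1 : {for t, continuous (fun x : R => g' (1 - x))}.
    by apply: continuous_comp; [exact: (is_derive_continuous (d1 t))|exact: cg].
  exact: (cvgZ (cvg_cst _) c1).
- by move=> t t0; apply: hi; rewrite lerBrDr gerDl.
- by move=> t t1; apply: lo; rewrite subr_le0.
by split=> [||t]; rewrite ?subr0 ?subrr ?g0 ?g1 ?scaler0// Hg.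
Qed.

Lemma homeq_trans eta eta' eta'' : homeq eta eta' -> homeq eta' eta'' -> homeq eta eta''.
Proof.
move=> [g [g' [dg cg lo hi [g0 g1 Hg]]]] [k [k' [dk ck klo khi [k0 k1 Hk]]]].
have H1 : Hol eta' = Hol eta by rewrite -(Hg 1) hi.
have d1 t : der (fun s : R => 2 * s) t (2 : R).
  by have := derZ 2 (der_id t); rewrite /GRing.scale /= mulr1.
have d2 t : der (fun s : R => 2 * s - 1) t (2 : R).
  by have := derB (d1 t) (der_cst (1 : R) t); rewrite subr0.
(* Outside its own half each of the two curves rests at [eta'], so subtracting [eta'] once leaves
   the concatenation, written as a single differentiable formula. *)
have E1 t : t <= 2^-1 -> g (2 * t) + k (2 * t - 1) - eta' = g (2 * t).
  by move=> th; rewrite klo ?addrK//; lra.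
have E2 t : 2^-1 <= t -> g (2 * t) + k (2 * t - 1) - eta' = k (2 * t - 1).
  by move=> th; rewrite hi ?[eta' + _]addrC ?addrK//; lra.
have gz t : t < 0 -> g' t = 0.
  move=> t0; have D : der g t 0.
    apply: near_eq_is_derive (der_cst eta t); near=> s; rewrite lo// ltW//.
    by near: s; exact: lt_nbhsl.
  by rewrite -(is_derive_derive1 (dg t)) (is_derive_derive1 D).
have kz t : 1 < t -> k' t = 0.
  move=> t1; have D : der k t 0.
    apply: near_eq_is_derive (der_cst eta'' t); near=> s; rewrite khi// ltW//.
    by near: s; exact: lt_nbhsr.
  by rewrite -(is_derive_derive1 (dk t)) (is_derive_derive1 D).
have gz1 t : 1 < t -> g' t = 0.
  move=> t1; have D : der g t 0.
    apply: near_eq_is_derive (der_cst eta' t); near=> s; rewrite hi// ltW//.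
    by near: s; exact: lt_nbhsr.
  by rewrite -(is_derive_derive1 (dg t)) (is_derive_derive1 D).
have kz0 t : t < 0 -> k' t = 0.
  move=> t0; have D : der k t 0.
    apply: near_eq_is_derive (der_cst eta' t); near=> s; rewrite klo// ltW//.
    by near: s; exact: lt_nbhsl.
  by rewrite -(is_derive_derive1 (dk t)) (is_derive_derive1 D).
exists (fun t => g (2 * t) + k (2 * t - 1) - eta'),
  (fun t => (2 : R) *: g' (2 * t) + (2 : R) *: k' (2 * t - 1) - 0); split.
- move=> t; apply: derB (der_cst _ _); apply: derD.
    exact: (is_derive_diff_comp (d1 t) (derive1_is_diff (dg _))).
  exact: (is_derive_diff_comp (d2 t) (derive1_is_diff (dk _))).
- move=> t; have c1 : {for t, continuous (fun x : R => g' (2 * x))}.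
    by apply: continuous_comp; [exact: (is_derive_continuous (d1 t))|exact: cg].
  have c2 : {for t, continuous (fun x : R => k' (2 * x - 1))}.
    by apply: continuous_comp; [exact: (is_derive_continuous (d2 t))|exact: ck].
  exact: (cvgB (cvgD (cvgZ (cvg_cst _) c1) (cvgZ (cvg_cst _) c2)) (cvg_cst _)).
- by move=> t t0; rewrite E1 ?lo//; lra.
- by move=> t t1; rewrite E2 ?khi//; lra.
split.
- by rewrite mulr0 g0 sub0r kz0 ?ltrN10// !scaler0 addr0 subr0.
- by rewrite mulr1 gz1 ?ltr1n// (_ : 2 - 1 = 1 :> R) ?k1 ?scaler0 ?addr0 ?subr0//; lra.
- move=> t; have [th|/ltW th] := leP t 2^-1; first by rewrite E1.
  by rewrite E2// Hk H1.
Unshelve. all: by end_near. Qed.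

Lemma C0_ext_open (f g : C0 E) : (forall u, 0 < u < 1 -> f u = g u) -> f = g.
Proof.
move=> fg; apply: C0_ext => u uI; apply: contrapT => fgu.
have p : 0 < `|f u - g u| by rewrite normr_gt0 subr_eq0; apply/eqP.
have c : {for u, continuous (fun v => f v - g v)} by exact: (cvgB (@C0_continuous _ _ f u) (@C0_continuous _ _ g u)).
have /cvgrPdist_lt/(_ _ p) := c => /nbhs_ballP[d /= d0 Hd].
have /unitIP/andP[u0 u1] := uI.
have [v [v0 v1 uv]] : exists v : R, [/\ 0 < v, v < 1 & `|u - v| < d].
  pose m := Num.min (d / 2) (1 / 2).
  have m1 : m <= d / 2 by rewrite ge_min lexx.
  have m2 : m <= 1 / 2 by rewrite ge_min lexx orbT.
  have m0 : 0 < m by rewrite lt_min !divr_gt0.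
  have [uh|uh] := leP u (1 / 2).
    exists (u + m / 2); split; [lra|lra|].
    by rewrite opprD addrA subrr sub0r normrN gtr0_norm; lra.
  exists (u - m / 2); split; [lra|lra|].
  by rewrite opprB addrC subrK gtr0_norm; lra.
have := Hd v; rewrite -ball_normE /= => /(_ uv).
rewrite (fg v) ?v0//; set a := f u - g u; set b := g v.
by rewrite (subrr b) (subr0 a) ltxx.
Qed.

Lemma gder_near_ext (g k : R -> S) u v : (\forall s \near u, g s = k s) -> gder g u v -> gder k u v.
Proof.
move=> gk [ng dg]; have E0 := nbhs_singleton gk; split.
  by move: ng; apply: filterS2 gk => s gs; rewrite gs E0.
by apply: near_eq_is_derive dg; apply: filterS gk => s gs; rewrite gs E0.
Qed.

(** The paths are compared on [unitI] only, which gives two-sided derivatives in the interior; at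
    the end points the forms agree by continuity. *)
Lemma lifts_form eta eta' (g g' : R -> S) : lifts eta g -> lifts eta' g' ->
  (forall u, unitI u -> g u = g' u) -> eta = eta'.
Proof.
move=> [_ dg] [_ dg'] gg; apply: C0_ext_open => u /andP[u0 u1].
have uI : unitI u by apply/unitIP; rewrite !ltW.
apply: gder_unique (dg' u uI); apply: gder_near_ext (dg u uI); near=> s; apply: gg.
apply/unitIP/andP; split; apply: ltW; near: s; [exact: lt_nbhsr|exact: lt_nbhsl].
Unshelve. all: by end_near. Qed.

Lemma lform_smooth : smooth_on (D0 `*` [set: E]) (fun p : E * E => lform (fst p) (snd p)).
Proof.
pose F (p : E * E) := ((psi p.1)^-1 * psi p.2)%g.
have oP := @D0D0_open _ _ S.
have sF : msmooth A (D0 `*` D0) F.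
  by apply: msmooth_mul => //; [apply: msmooth_inv => //; exact: msmooth_psi1|exact: msmooth_psi2].
have [op s] := smooth_phi sF.
have H x : D0 x -> ((D0 `*` D0) `&` F @^-1` Ge) (x, x).
  by move=> Dx; split; [split|rewrite /F /= mulVg; exact: Ge1].
have oT := openXT (W := E) (D0_open S).
pose G (p : E * E) : (E * E) * E := ((p.1, p.1), p.2).
have sG : smooth_on (D0 `*` [set: E]) G.
  apply: smooth_pair => //; [apply: smooth_pair => //|].
  - by apply: smooth_lin => //; exact: contlin_fst.
  - by apply: smooth_lin => //; exact: contlin_fst.
  - by apply: smooth_lin => //; exact: contlin_snd.
have mG p : (D0 `*` [set: E]) p -> (((D0 `*` D0) `&` F @^-1` Ge) `*` [set: E]) (G p).
  by move=> [Ux _]; split=> //; exact: H.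
have := smooth_comp oT mG sG (smooth_partial op s).
apply: smooth_ext => // -[q v] [/= cq _].
exact: (diff_partial2 v (smooth_diff s (H q cq))).
Qed.

(* The form whose path is that of eta multiplied on the left by psi z. *)
Definition act z eta : C0 E := vC (C0of (fun u => lform (z u) (C1D z u))) (AdVC eta) + eta.

Lemma lform_path_cont z : (forall u, unitI u -> D0 (z u)) ->
  forall u, unitI u -> {for u, continuous (fun u => lform (z u) (C1D z u))}.
Proof.
move=> Dz u uI.
have c : {for u, continuous (fun s => (z s, C1D z s))}.
  exact: (cvg_pair (@C1_continuous _ _ z u) (@C0_continuous _ _ (C1D z) u)).
exact: (continuous_comp c (smooth_cont (x := (z u, C1D z u)) lform_smooth (conj (Dz u uI) I))).
Qed.

Lemma lifts_act z eta g : z 0 = 0 -> (forall u, unitI u -> D0 (z u)) -> lifts eta g ->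
  lifts (act z eta) (fun u => psi (z u) * g u)%g.
Proof.
move=> z0 Dz lg.
have lz : lifts (fun u => lform (z u) (C1D z u)) (fun u => psi (z u)).
  by split=> [|u uI]; [rewrite z0 psi0|apply: gder_psi; [exact: C1_der|exact: Dz]].
apply: lifts_ext (lifts_mul lg lz) => u uI.
rewrite /act C0_addE vCE (C0of_id (lform_path_cont Dz) uI) (BCE S eta uI) (hpathE lg uI).
by congr (_ + _); exact: esym (AdME _ _).
Qed.

Lemma Hol_act z eta : z 0 = 0 -> (forall u, unitI u -> D0 (z u)) ->
  Hol (act z eta) = (psi (z (1 : R)%R) * Hol eta)%g.
Proof. by move=> z0 Dz; exact: (HolE (lifts_act z0 Dz (hpath_lifts S eta))). Qed.

(** For fixed [z] the action is smooth in the form, by smoothness of [AdVC], and it multiplies the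
    holonomy by the constant [psi (z 1)]. *)
Lemma act_homeq z eta eta' : z 0 = 0 -> (forall u, unitI u -> D0 (z u)) ->
  homeq eta eta' -> homeq (act z eta) (act z eta').
Proof.
move=> z0 Dz [g [g' [dg cg lo hi [g0 g1 Hg]]]].
set L := C0of (fun u => lform (z u) (C1D z u)).
pose F eta := act z eta.
have oT := @openT (C0 E).
have sF : smooth_on [set: C0 E] F.
  apply: smooth_add => //; last exact: smooth_id.
  apply: (smooth_comp (B := setT) oT _ (BC_smooth S) (smooth_lin openT (contbil_r L (@vC_contbil R n)))) => //.
exists (fun t => F (g t)), (fun t => 'd F (g t) (g' t)); split.
- move=> t; exact: (is_derive_diff_comp (dg t) (differentiableP (smooth_diff sF I))).
- move=> t; have H := smooth_cont (x := (g t, g' t)) (smooth_tangent sF) (conj I I).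
  exact: (continuous_comp (cvg_pair (is_derive_continuous (dg t)) (cg t)) H).
- by move=> t t0; rewrite lo.
- by move=> t t1; rewrite hi.
split; [by rewrite g0 linear0|by rewrite g1 linear0|].
by move=> t; rewrite /F !Hol_act// Hg.
Qed.

(** The straight homotopy between two C1 paths in the chart with common ends. Unlike a homotopy
    taken from simple connectedness it is C1, and [curve_der] turns it into a C1 curve of forms. *)
Lemma homotopy (r : R) (z0 z1 : C1 E) eta : (forall x : E, `|x| <= 2 * r -> D0 x) ->
  (forall u, unitI u -> `|z0 u| <= r) -> (forall u, unitI u -> `|z1 u| <= r) ->
  z0 0 = 0 -> z1 0 = 0 -> z0 1 = z1 1 -> homeq (act z0 eta) (act z1 eta).
Proof.
move=> rD z0r z1r z00 z10 z01.
pose w := z1 - z0; pose zs (s : R) := z0 + s *: w.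
have C1Dzs s u : C1D (zs s) u = C1D z0 u + s *: C1D w u.
  have [l _] := @C1D_contlin R E.
  by rewrite /zs addrC l addrC.
have zsE s u : zs s u = (1 - s) *: z0 u + s *: z1 u.
  by rewrite /zs /w C1_addE C1_scaleE C1_subE scalerBr scalerBl scale1r addrA addrAC.
(* The parameter ranges slightly beyond [0, 1] to give two-sided derivatives at both ends; there |1
   - s| + |s| <= 2, whence the radius [2 * r]. *)
have zsD (s u : R) : - (1/2) <= s <= 3/2 -> unitI u -> D0 (zs s u).
  move=> /andP[s0 s1] uI; apply: rD; rewrite zsE; apply: le_trans (ler_normD _ _) _.
  rewrite !normrZ; have r0 : 0 <= r by apply: le_trans (z0r u uI).
  have h0 := z0r u uI; have h1 := z1r u uI.
  have e1 : `|1 - s| * `|z0 u| <= `|1 - s| * r by rewrite ler_wpM2l.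
  have e2 : `|s| * `|z1 u| <= `|s| * r by rewrite ler_wpM2l.
  have e3 : `|1 - s| + `|s| <= 2.
    have [sp|sn] := leP 0 s; have [tp|tn] := leP 0 (1 - s);
    rewrite ?(ger0_norm sp) ?(ltr0_norm sn) ?(ger0_norm tp) ?(ltr0_norm tn); lra.
  nra.
pose lf (p : E * E) := lform p.1 p.2.
pose cv (p : R * R) : E * E := (zs p.1 p.2, C1D z0 p.2 + p.1 *: C1D w p.2).
pose H s u := lf (cv (s, u)).
pose H' s u := 'd lf (cv (s, u)) (w u, C1D w u).
have zsc p : {for p, continuous (fun p : R * R => zs p.1 p.2)}.
  have c1 : {for p, continuous (fun p : R * R => z0 p.2)}.
    exact: (continuous_comp (@cvg_snd _ _ (nbhs p.1) (nbhs p.2) _) (@C1_continuous _ _ z0 p.2)).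
  have c2 : {for p, continuous (fun p : R * R => w p.2)}.
    exact: (continuous_comp (@cvg_snd _ _ (nbhs p.1) (nbhs p.2) _) (@C1_continuous _ _ w p.2)).
  exact: (cvgD c1 (cvgZ (@cvg_fst _ _ (nbhs p.1) (nbhs p.2) _) c2)).
have dzc p : {for p, continuous (fun p : R * R => C1D z0 p.2 + p.1 *: C1D w p.2)}.
  have c1 : {for p, continuous (fun p : R * R => C1D z0 p.2)}.
    exact: (continuous_comp (@cvg_snd _ _ (nbhs p.1) (nbhs p.2) _) (@C0_continuous _ _ (C1D z0) p.2)).
  have c2 : {for p, continuous (fun p : R * R => C1D w p.2)}.
    exact: (continuous_comp (@cvg_snd _ _ (nbhs p.1) (nbhs p.2) _) (@C0_continuous _ _ (C1D w) p.2)).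
  exact: (cvgD c1 (cvgZ (@cvg_fst _ _ (nbhs p.1) (nbhs p.2) _) c2)).
have cvc p : {for p, continuous cv} by exact: (cvg_pair (zsc p) (dzc p)).
have wc p : {for p, continuous (fun p : R * R => (w p.2, C1D w p.2))}.
  exact: (cvg_pair (continuous_comp (@cvg_snd _ _ (nbhs p.1) (nbhs p.2) _) (@C1_continuous _ _ w p.2))
    (continuous_comp (@cvg_snd _ _ (nbhs p.1) (nbhs p.2) _) (@C0_continuous _ _ (C1D w) p.2))).
have cD (s u : R) : - (1/2) <= s <= 3/2 -> unitI u -> (D0 `*` [set: E]) (cv (s, u)).
  by move=> si uI; split=> //; exact: zsD.
have jH (s : R) : - (1/2) <= s <= 3/2 -> jointc H s.
  move=> si u uI.
  exact: (continuous_comp (cvc (s, u)) (smooth_cont lform_smooth (cD s u si uI))).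
have jH' (s : R) : - (1/2) <= s <= 3/2 -> jointc H' s.
  move=> si u uI.
  have c := smooth_cont (x := (cv (s, u), (w u, C1D w u))) (smooth_tangent lform_smooth) (conj (cD s u si uI) I).
  exact: (continuous_comp (cvg_pair (cvc (s, u)) (wc (s, u))) c).
have dH (s u : R) : - (1/2) <= s <= 3/2 -> unitI u -> der (H ^~ u) s (H' s u).
  move=> si uI.
  have d1 := is_derive_pair (der_line (z0 u) (w u) s) (der_line (C1D z0 u) (C1D w u) s).
  exact: (is_derive_diff_comp d1 (differentiableP (smooth_diff lform_smooth (cD s u si uI)))).
have nI (s0 : R) : unitI s0 -> \forall s \near s0, - (1/2) <= s <= 3/2.
  move=> /unitIP/andP[a b]; near=> s; apply/andP; split; apply: ltW; near: s.
    by apply: lt_nbhsr; lra.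
  by apply: lt_nbhsl; lra.
pose d s := vC (C0of (H s)) (AdVC eta) + eta.
pose d' s := vC (C0of (H' s)) (AdVC eta) + 0.
have cl := contbil_l (AdVC eta) (@vC_contbil R n).
have dE s : d s = act (zs s) eta.
  have e : H s = (fun u => lform (zs s u) (C1D (zs s) u)).
    by apply/funext => u; exact: (congr1 (lform (zs s u)) (esym (C1Dzs s u))).
  exact: (congr1 (fun f => vC (C0of f) (AdVC eta) + eta) e).
have E0 : zs 0 = z0 by rewrite /zs scale0r addr0.
have E1 : zs 1 = z1 by rewrite /zs scale1r addrC subrK.
have zs0 s : zs s 0 = 0 by rewrite zsE z00 z10 !scaler0 addr0.
have zs1 s : zs s 1 = z0 1 by rewrite zsE -z01 -scalerDl subrK scale1r.
have si (s : R) : unitI s -> - (1/2) <= s <= 3/2 by move=> /unitIP/andP[a b]; lra.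
suff : homeq (d 0) (d 1) by rewrite !dE E0 E1.
apply: (@homeq_curve d d') => s sI.
- have N : \forall t \near s, [/\ jointc H t, jointc H' t & forall u, unitI u -> der (H ^~ u) t (H' t u)].
    move: (nI s sI); apply: filterS => t tI; split; [exact: jH|exact: jH'|].
    by move=> u uI; exact: dH.
  exact: (derD (is_derive_contlin cl (curve_der N)) (der_cst _ _)).
- have c : {for s, continuous (fun s => C0of (H' s))}.
    by apply: curve_cont; apply: filterS (nI s sI) => t tI; exact: jH'.
  exact: (cvgD (continuous_comp c (cl.2 _)) (cvg_cst _)).
- have HdE (t : R) : unitI t -> Hol (d t) = (psi (z0 (1 : R)%R) * Hol eta)%g.
    move=> tI; have HD u (uI : unitI u) : D0 (zs t u) := zsD t u (si t tI) uI.
    apply: (etrans (congr1 Hol (dE t))); apply: (etrans (Hol_act eta (zs0 t) HD)).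
    by rewrite (zs1 t).
  exact: (etrans (HdE s sI) (esym (HdE 0 unitI0))).
Unshelve. all: by end_near. Qed.

(** Continuity of the division map at [(g0, g0)], in a form that treats the two points alike. *)
Lemma nbhs_div g0 (r : R) : 0 < r -> exists2 V : set (mspace A), nbhs (g0 : mspace A) V &
  forall a b : S, V a -> V b -> Ge (a * b^-1)%g /\ `|phi (a * b^-1)%g| <= r.
Proof.
move=> r0; have Ac := chart_at_charts mA g0; have c0 := chart_at_dom mA g0.
set c := chart_at A g0 in Ac c0; have oc := chart_cod_open mA Ac; set q := fwd c g0.
have cq : cod c q by exact: chart_fwd_cod.
pose F (p : E * E) := (bwd c p.2 * (bwd c p.1)^-1)%g.
have oP : open (cod c `*` cod c) by exact: open_prod.
have s1 : msmooth A (cod c `*` cod c) (fun p => bwd c p.1).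
  apply: (msmooth_comp (g := fst) oP _ _ (msmooth_bwd mA Ac)); first by move=> p [].
  by apply: smooth_lin => //; exact: contlin_fst.
have s2 : msmooth A (cod c `*` cod c) (fun p => bwd c p.2).
  apply: (msmooth_comp (g := snd) oP _ _ (msmooth_bwd mA Ac)); first by move=> p [].
  by apply: smooth_lin => //; exact: contlin_snd.
have sF : msmooth A (cod c `*` cod c) F by apply: msmooth_mul => //; exact: msmooth_inv.
have [op s] := smooth_phi sF.
have Hq : ((cod c `*` cod c) `&` F @^-1` Ge) (q, q).
  by split; [split|rewrite /F /= mulgV; exact: Ge1].
have /cvgrPdist_le/(_ _ r0) N1 := smooth_cont s Hq.
have N2 := nbhs_open op Hq.
have [[B1 B2] /= [b1 b2] HB] := filterI N1 N2.
have cv := fwd_continuous mA Ac c0.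
exists ((fwd c @^-1` (B1 `&` B2)) `&` dom c).
  by apply: filterI; [apply: cv; exact: filterI|apply: open_nbhs_nbhs; split=> //; exact: (dom_open mA Ac)].
move=> a b [[a1 a2] ca] [[b1' b2'] cb].
have [/= h1 [_ /= h2]] := HB (fwd c b, fwd c a) (conj b1' a2).
move: h1 h2; rewrite /F /= !(chart_fwdK mA) // mulgV phi1 sub0r normrN => h1 h2.
by split.
Qed.

(** The straight path from 0 to [x] in the chart, with which the edges of the grid are realized. *)
Definition ray (x : E) : C1 E := C1prim (0, C0cst x).

Lemma rayE x u : unitI u -> ray x u = u *: x.
Proof.
move=> uI; have d (s : R) : unitI s -> der (fun s : R => s *: x) s (C0cst x s).
  by move=> _; have := derD (der_cst 0 s) (der_line (0 : E) x s); rewrite !add0r;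
     under eq_fun do rewrite !add0r.
by have := C1primP d uI; rewrite scale0r => ->.
Qed.

Lemma ray0 x : ray x 0 = 0. Proof. by rewrite rayE ?scale0r//; exact: unitI0. Qed.
Lemma ray1 x : ray x 1 = x. Proof. by rewrite rayE ?scale1r//; exact: unitI1. Qed.

Lemma ray_norm x (r : R) u : `|x| <= r -> unitI u -> `|ray x u| <= r.
Proof.
move=> xr uI; rewrite rayE// normrZ; have /unitIP/andP[u0 u1] := uI.
by apply: le_trans xr; rewrite ger0_norm// ler_piMl.
Qed.

Lemma act_ray0 eta : act (ray 0) eta = eta.
Proof.
have Z u : unitI u -> ray 0 u = 0 by move=> uI; rewrite rayE// scaler0.
have D u : unitI u -> D0 (ray 0 u) by move=> uI; rewrite Z//; exact: D00.
apply: (lifts_form (lifts_act (ray0 0) D (hpath_lifts S eta)) (hpath_lifts S eta)) => u uI.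
by rewrite Z// psi0 mul1g.
Qed.

(** The radius [r'] leaves the room that [homotopy] asks for, and [r] is so small that products of
    two elements of radius [r] have radius at most [r']. *)
Lemma small_balls : exists r r' : R, [/\ 0 < r, r <= r', forall x : E, `|x| <= 2 * r' -> D0 x &
  forall x y : E, `|x| <= r -> `|y| <= r -> Om (x, y) /\ `|mul0 (x, y)| <= r'].
Proof.
have /nbhs_ballP[d /= d0 Hd] := near_D0 S.
pose r' := d / 4; have r'0 : 0 < r' by rewrite divr_gt0.
have [oOm sm] := mul0_smooth S.
have O0 : Om (0, 0) := Om1 (D00 S).
have N1 : nbhs (0 : E * E) (fun t => `|mul0 (0, 0) - mul0 t| <= r').
  by have /cvgrPdist_le/(_ _ r'0) := smooth_cont sm O0.
have N3 : nbhs (0 : E * E) ((fun t => `|mul0 (0, 0) - mul0 t| <= r') `&` Om).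
  by apply: filterI => //; exact: (nbhs_open oOm O0).
have [e /= e0 He] := iffLR (nbhs_ballP (0 : E * E) _) N3.
pose m := Num.min (e / 2) r'.
have m1 : m <= e / 2 by rewrite ge_min lexx.
have m2 : m <= r' by rewrite ge_min lexx orbT.
have m0 : 0 < m by rewrite lt_min r'0 divr_gt0.
exists m, r'; split=> //.
  move=> x xr; apply: Hd; rewrite -ball_normE /= sub0r normrN.
  by apply: le_lt_trans xr _; rewrite /r'; lra.
move=> x y xm ym.
have B : ball (0 : E * E) e (x, y).
  rewrite -ball_normE /= sub0r normrN gt_max /=.
  by apply/andP; split; lra.
have [/= h1 h2] := He _ B; split=> //.
move: h1; rewrite /mul0 /= psi0 mulg1 phi1 sub0r normrN; exact.
Qed.

(** Acting by two rays in succession is acting by their pointwise product, a path in the chart with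
    the same ends as the ray to the product, to which [homotopy] deforms it. *)
Lemma act_act (r r' : R) x y eta : 0 < r -> r <= r' -> (forall x : E, `|x| <= 2 * r' -> D0 x) ->
  (forall x y : E, `|x| <= r -> `|y| <= r -> Om (x, y) /\ `|mul0 (x, y)| <= r') ->
  `|x| <= r -> `|y| <= r ->
  homeq (act (ray y) (act (ray x) eta)) (act (ray (mul0 (y, x))) eta).
Proof.
move=> r0 rr rD rO xr yr.
have D (w : E) : `|w| <= r' -> forall u, unitI u -> D0 (ray w u).
  move=> wr u uI; apply: rD; apply: le_trans (ray_norm wr uI) _.
  by have := le_trans (ltW r0) rr; lra.
have Dx := D x (le_trans xr rr); have Dy := D y (le_trans yr rr).
have [_ mr] := rO y x yr xr.
pose f (u : R) : E * E := (u *: y, u *: x).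
have sc (u : R) (w : E) : unitI u -> `|w| <= r -> `|u *: w| <= r.
  by move=> uI wr; rewrite -(rayE w uI); exact: ray_norm.
have fO (u : R) : unitI u -> Om (f u) /\ `|mul0 (f u)| <= r'.
  by move=> uI; apply: rO; exact: sc.
pose h (u : R) : E := 'd mul0 (f u) (y, x).
have [oOm sm] := mul0_smooth S.
have df (u : R) : der f u (y, x).
  have X (w : E) : der (fun s : R => s *: w) u w.
    by have := der_line (0 : E) w u; under eq_fun do rewrite add0r.
  exact: is_derive_pair (X y) (X x).
have ch (u : R) : unitI u -> {for u, continuous h}.
  move=> uI; have c1 : {for u, continuous (fun s => (f s, (y, x)))}.
    exact: (cvg_pair (is_derive_continuous (df u)) (cvg_cst _)).
  exact: (continuous_comp c1 (smooth_cont (x := (f u, (y, x))) (smooth_tangent sm) (conj (proj1 (fO u uI)) I))).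
have dm (u : R) : unitI u -> der (fun s => mul0 (f s)) u (C0of h u).
  move=> uI; rewrite (C0of_id ch uI).
  exact: (is_derive_diff_comp (df u) (differentiableP (smooth_diff sm (proj1 (fO u uI))))).
pose z := C1prim (0, C0of h).
have zE u : unitI u -> z u = mul0 (f u).
  move=> uI; have := C1primP dm uI; rewrite /f !scale0r.
  have -> : mul0 (0, 0) = 0 by rewrite /mul0 /= psi0 mulg1 phi1.
  by [].
have I0 := @unitI0 R; have I1 := @unitI1 R.
have z0 : z 0 = 0 by exact: C1prim0.
have z1 : z 1 = mul0 (y, x) by rewrite zE// /f !scale1r.
have zr u : unitI u -> `|z u| <= r' by move=> uI; rewrite zE//; exact: (proj2 (fO u uI)).
have Dz u : unitI u -> D0 (z u).
  by move=> uI; apply: rD; apply: le_trans (zr u uI) _; have := le_trans (ltW r0) rr; lra.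
have -> : act (ray y) (act (ray x) eta) = act z eta.
  have l1 := lifts_act (ray0 y) Dy (lifts_act (ray0 x) Dx (hpath_lifts S eta)).
  apply: (lifts_form l1 (lifts_act z0 Dz (hpath_lifts S eta))) => u uI.
  have [Of _] := fO u uI; have [_ Gf] := Of.
  by rewrite (rayE y uI) (rayE x uI) zE// /mul0 phiK// mulgA.
apply: (homotopy (r := r')) => //.
- by move=> u uI; exact: ray_norm.
- exact: ray0.
- by rewrite ray1.
Qed.

End Covering.

Local Opaque act.

(** * Surjectivity and injectivity of the holonomy *)

Section Holonomy.
Context {R : realType} {n : nat} (S : lie_setup R n).
Notation A := (lA S).
Notation E := 'rV[R]_n.
Notation mA := (mA S).
Notation D0 := (D0 S).
Notation Ge := (@Ge _ _ S).
Notation Hol := (Hol S).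
Notation mul0 := (mul0 S).
Notation Om := (Om S).
Notation homeq := (homeq S).
Notation act := (act S).
Notation near1 r g := (Ge g%g /\ `|phi g%g| <= r).
Implicit Types (U V W Z : normedModType R) (eta lam zeta : C0 E) (z : C1 E).

Lemma ray_D0 (r : R) x : (forall x : E, `|x| <= r -> D0 x) -> `|x| <= r -> forall u, unitI u -> D0 (ray x u).
Proof. by move=> rD xr u uI; apply: rD; exact: ray_norm. Qed.

(** The set of holonomies is stable under small left factors, because acting by a ray realizes them;
    it is therefore open and closed. *)
Lemma Hol_surj : connected [set: mspace A] -> forall g, exists eta, Hol eta = g.
Proof.
move=> hc; have [r [r' [r0 rr rD rO]]] := small_balls S.
have rD1 x : `|x| <= r -> D0 x.
  by move=> xr; apply: rD; have r'0 := le_trans (ltW r0) rr; lra.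
have move1 a b : near1 r (a * b^-1) -> (exists eta, Hol eta = b) -> exists eta, Hol eta = a.
  move=> [Gab nab] [eta Hb]; exists (act (ray (phi (a * b^-1)%g)) eta).
  rewrite Hol_act; [|exact: ray0|exact: (ray_D0 rD1)].
  by rewrite ray1 phiK// Hb mulgVK.
pose B : set (mspace A) := [set g | exists eta, Hol eta = g].
have Vg (g : S) := nbhs_div (S := S) g r0.
have oB : open B.
  rewrite openE => g [eta Hg]; have [V nV HV] := Vg g.
  have Vg0 := nbhs_singleton nV.
  apply: filterS nV => b Vb; apply: (@move1 b g); last by exists eta.
  exact: HV.
have cB : closed B.
  move=> g cg; have [V nV HV] := Vg g; have [b [Bb Vb]] := cg V nV.
  apply: (@move1 g b) => //; apply: HV => //; exact: nbhs_singleton nV.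
have BT : B = setT.
  apply: hc; first by exists 1%g; exists 0; exact: Hol0.
    by exists B; rewrite ?setTI.
  by exists B; rewrite ?setTI.
by move=> g; have : B g by rewrite BT.
Qed.

(** Uniform continuity of [H] on the compact square, measured by quotients in the group; [nbhs_div]
    provides the local statement. *)
Lemma uniform_div (H : R * R -> mspace A) (r : R) : 0 < r ->
  {within unitI `*` unitI, continuous H} ->
  \forall N \near \oo, forall p q : R * R, (unitI `*` unitI) p -> (unitI `*` unitI) q ->
    `|p - q| <= N.+1%:R^-1 -> near1 r (H p * (H q)^-1).
Proof.
move=> r0 /subspace_continuousP cH.
have cK := @compact_setX R R (unitI : set R) (unitI : set R) (@unitI_compact R) (@unitI_compact R).
have /compact_near_coveringP nc := cK.
pose P N (p : R * R) := (unitI `*` unitI) p -> forall q, (unitI `*` unitI) q ->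
    `|p - q| <= N.+1%:R^-1 -> near1 r (H p * (H q)^-1).
have HP (p0 : R * R) : (unitI `*` unitI) p0 -> \forall p \near p0 & N \near \oo, P N p.
  move=> Kp0; have [V nV HV] := nbhs_div (S := S) (H p0) r0.
  have N1 : nbhs (p0 : R * R) (fun p => (unitI `*` unitI) p -> V (H p)) := cH p0 Kp0 V nV.
  have [e /= e0 He] := iffLR (nbhs_ballP (p0 : R * R) _) N1.
  have e2 : 0 < e / 2 by rewrite divr_gt0.
  exists (ball p0 (e / 2), [set N | N.+1%:R^-1 < e / 2]).
    split; first exact: nbhsx_ballx.
    exact: near_infty_natSinv_lt (PosNum e2).
  move=> [p N] /= [pb Ne] Kp q Kq pq; apply: HV.
    by apply: He Kp; apply: le_ball pb; lra.
  apply: He Kq; move: pb; rewrite -!ball_normE /= => pb.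
  rewrite -(subrK p p0) -addrA; apply: le_lt_trans (ler_normD _ _) _.
  have e3 : e = e / 2 + e / 2 by field.
  by rewrite e3; exact: ltrD pb (le_lt_trans pq Ne).
have FF : Filter (\oo : set_system nat) by exact: _.
have := nc nat \oo P FF HP; apply: filterS => N HN p q Kp; exact: HN.
Qed.

(** The bottom row carries the given forms, and passing to the next row acts on the form in column
    [i] by the ray of the vertical edge. In every row, neighbouring forms remain related by the ray
    of the horizontal edge. The outer columns and the top row are constant, so the extreme forms
    never change and on the top row the relation becomes [homeq]. *)
Lemma grid_homeq (r r' : R) (m : nat) (h : nat -> nat -> S) (g : S) (th0 : nat -> C0 E) :
  0 < r -> r <= r' -> (forall x : E, `|x| <= 2 * r' -> D0 x) ->
  (forall x y : E, `|x| <= r -> `|y| <= r -> Om (x, y) /\ `|mul0 (x, y)| <= r') ->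
  (forall i j, (i < m)%N -> (j <= m)%N -> near1 r (h i.+1 j * (h i j)^-1)) ->
  (forall i j, (i <= m)%N -> (j < m)%N -> near1 r (h i j.+1 * (h i j)^-1)) ->
  (forall j, (j <= m)%N -> h 0%N j = g /\ h m j = g) -> (forall i, (i <= m)%N -> h i m = g) ->
  (forall i, (i < m)%N -> homeq (th0 i.+1) (act (ray (phi (h i.+1 0%N * (h i 0%N)^-1)%g)) (th0 i))) ->
  homeq (th0 0%N) (th0 m).
Proof.
move=> r0 rr rD rO xN yN hg hm th0S.
have rD1 x : `|x| <= r -> D0 x.
  by move=> xr; apply: rD; have r'0 := le_trans (ltW r0) rr; lra.
pose x i j := phi (h i.+1 j * (h i j)^-1)%g.
pose y i j := phi (h i j.+1 * (h i j)^-1)%g.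
have row j : (j <= m)%N -> exists th : nat -> C0 E, [/\ th 0%N = th0 0%N, homeq (th m) (th0 m) &
    forall i, (i < m)%N -> homeq (th i.+1) (act (ray (x i j)) (th i))].
  elim: j => [_|j IH jm].
    by exists th0; split; [by []|exact: homeq_refl|exact: th0S].
  have [th [th_0 th_m thS]] := IH (ltnW jm).
  have D1 i j' : (i <= m)%N -> (j' < m)%N -> forall u, unitI u -> D0 (ray (y i j') u).
    by move=> im jm'; apply: (ray_D0 rD1); have [] := yN i j' im jm'.
  have y0 i : (i == 0%N) || (i == m) -> y i j = 0.
    have [a1 a2] := hg _ jm; have [b1 b2] := hg _ (ltnW jm).
    by move=> /orP[]/eqP ->; rewrite /y ?a1 ?a2 ?b1 ?b2 mulgV phi1.
  exists (fun i => act (ray (y i j)) (th i)); split=> [||i im].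
  - by rewrite y0 // act_ray0.
  - by rewrite y0 ?eqxx ?orbT// act_ray0.
  have a1 := act_homeq (ray0 _) (D1 _ _ im jm) (thS i im).
  have [G1 n1] := yN i.+1 j im jm; have [G2 n2] := xN i j im (ltnW jm).
  have [G3 n3] := xN i j.+1 im jm; have [G4 n4] := yN i j (ltnW im) jm.
  have a2 := act_act (th i) r0 rr rD rO n2 n1.
  have a3 := act_act (th i) r0 rr rD rO n4 n3.
  (* Both ways round the cell give the quotient of its opposite corners, so the two composite rays
     coincide. *)
  have e : mul0 (y i.+1 j, x i j) = mul0 (x i j.+1, y i j).
    by rewrite /mul0 /y /x /= !phiK// !mulgA !mulgVK.
  apply: homeq_trans a1 _; apply: homeq_trans a2 _; apply: homeq_sym; move: a3; rewrite -e.
  exact.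
have [th [th_0 th_m thS]] := row m (leqnn m).
(* On the top row the horizontal rays are trivial, and neighbouring forms are related by [homeq]
   itself. *)
have xm i : (i < m)%N -> x i m = 0.
  by move=> im; rewrite /x (hm _ im) (hm _ (ltnW im)) mulgV phi1.
have key i : (i <= m)%N -> homeq (th0 0%N) (th i).
  elim: i => [_|i IH im]; first by rewrite th_0; exact: homeq_refl.
  apply: homeq_trans (IH (ltnW im)) _; apply: homeq_sym.
  by have := thS i im; rewrite xm// act_ray0.
exact: homeq_trans (key m (leqnn m)) th_m.
Qed.

Lemma grid_unit (i m : nat) : (i <= m)%N -> (0 < m)%N -> unitI (i%:R / m%:R : R).
Proof.
move=> im m0; apply/unitIP; rewrite divr_ge0//= ler_pdivrMr ?ltr0n//.
by rewrite mul1r ler_nat.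
Qed.

Lemma grid_step (i m : nat) : i.+1%:R / m%:R - i%:R / m%:R = m%:R^-1 :> R.
Proof. by rewrite -mulrBl -natrB// subSnn mul1r. Qed.

Lemma norm_pair1 (a b c : R) : `|(a, c) - (b, c)| = `|a - b| :> R.
Proof.
have -> : `|(a, c) - (b, c)| = Num.max `|a - b| `|c - c| :> R by [].
by rewrite subrr normr0 max_l.
Qed.

Lemma norm_pair2 (a b c : R) : `|(c, a) - (c, b)| = `|a - b| :> R.
Proof.
have -> : `|(c, a) - (c, b)| = Num.max `|c - c| `|a - b| :> R by [].
by rewrite subrr normr0 max_r.
Qed.

Lemma line_norm V (a b : V) (t : R) : unitI t -> `|a + t *: b| <= `|a| + `|b|.
Proof.
move=> /unitIP/andP[t0 t1]; apply: le_trans (ler_normD _ _) _.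
by rewrite lerD2l normrZ ger0_norm// ler_piMl.
Qed.

Lemma line_step V (a b : V) (s t : R) : `|(a + s *: b) - (a + t *: b)| = `|s - t| * `|b|.
Proof. by rewrite opprD addrACA subrr add0r -scalerBl normrZ. Qed.

(** The holonomies of the segment from [eta0] to [eta1] form a loop; a contraction of it, sampled at
    the points [(s i, s j)], feeds [grid_homeq]. *)
Lemma Hol_inj eta0 eta1 : @simply_connected R (mspace A) -> Hol eta0 = Hol eta1 -> homeq eta0 eta1.
Proof.
move=> hsc H01; have [r [r' [r0 rr rD rO]]] := small_balls S.
have rr1 : r <= 2 * r' by have := le_trans (ltW r0) rr; lra.
have rD1 x : `|x| <= r -> D0 x by move=> xr; apply: rD; exact: le_trans rr1.
pose th0 (s : R) := eta0 + s *: (eta1 - eta0).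
pose gam (s : R) : mspace A := Hol (th0 s).
have th01 : th0 1 = eta1 by rewrite /th0 scale1r addrC subrK.
have th00 : th0 0 = eta0 by rewrite /th0 scale0r addr0.
have cg : {within unitI, continuous gam}.
  apply: continuous_subspaceT => s.
  have c1 : {for s, continuous th0} by exact: (is_derive_continuous (der_line eta0 (eta1 - eta0) s)).
  have c2 : {for th0 s, continuous (Hol : C0 E -> mspace A)}.
    exact: (@msmooth_continuous R E S A mA (C0 E) setT Hol (th0 s) (@Hol_msmooth R n S) I).
  exact: (continuous_comp c1 c2).
have g01 : gam 0 = gam 1 by rewrite /gam th00 th01.
have [H [cH H0 H1 Hs]] := hsc gam cg g01.
(* A bound for all forms of the segment, so that [close_lift] gives one step size for the whole of
   it. *)
pose M := `|eta0| + `|eta1 - eta0|.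
have [d d0 Hd] := close_lift S M r0.
have NF := uniform_div r0 cH.
have Nd : \forall N \near \oo, N.+1%:R^-1 * `|eta1 - eta0| <= d.
  have p : 0 < d / (`|eta1 - eta0| + 1) by rewrite divr_gt0// ltr_wpDl.
  apply: filterS (near_infty_natSinv_lt (PosNum p)) => N /= /ltW h.
  apply: le_trans (_ : N.+1%:R^-1 * (`|eta1 - eta0| + 1) <= _).
    have aux (a q : R) : 0 <= a -> a * q <= a * (q + 1) by move=> a0; nra.
    by apply: aux; rewrite invr_ge0.
  by rewrite -ler_pdivlMr// ltr_wpDl.
have [N [HN Nd']] := filter_ex (filterI NF Nd); clear NF Nd.
have sS i := grid_step i N.+1; have sI i im := @grid_unit i N.+1 im isT.
pose s (i : nat) : R := i%:R / N.+1%:R.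
have s0 : s 0%N = 0 by exact: mul0r.
have sm : s N.+1 = 1 by rewrite /s divff// pnatr_eq0.
have im1 : 0 <= N.+1%:R^-1 :> R by rewrite invr_ge0.
have d1 i j : `|(s i.+1, s j) - (s i, s j)| <= N.+1%:R^-1.
  by rewrite norm_pair1 sS; rewrite ger0_norm; [exact: lexx|exact: im1].
have d2 i j : `|(s i, s j.+1) - (s i, s j)| <= N.+1%:R^-1.
  by rewrite norm_pair2 sS; rewrite ger0_norm; [exact: lexx|exact: im1].
have KI i j : (i <= N.+1)%N -> (j <= N.+1)%N -> (unitI `*` unitI) (s i, s j).
  by move=> im jm; split; [exact: (sI i im)|exact: (sI j jm)].
suff G0 : homeq (th0 (s 0%N)) (th0 (s N.+1)) by move: G0; rewrite s0 sm th00 th01.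
apply: (grid_homeq (m := N.+1) (h := fun i j => H (s i, s j)) (g := gam 0) (th0 := fun i => th0 (s i)) r0 rr rD rO).
- move=> i j im jm; exact: (HN _ _ (KI _ _ im jm) (KI _ _ (ltnW im) jm) (d1 i j)).
- move=> i j im jm; exact: (HN _ _ (KI _ _ im jm) (KI _ _ im (ltnW jm)) (d2 i j)).
- move=> j jm; rewrite s0 sm; exact: (Hs _ (sI j jm)).
- move=> i im; rewrite sm; exact: (H1 _ (sI i im)).
move=> i im; clear HN.
have b1 : `|th0 (s i)| <= M.
  exact: (line_norm eta0 (eta1 - eta0) (sI i (ltnW im))).
have b2 : `|th0 (s i.+1) - th0 (s i)| <= d.
  have := line_step eta0 (eta1 - eta0) (s i.+1) (s i); rewrite sS (ger0_norm im1).
  by rewrite -/(th0 _) -/(th0 _) => ->.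
(* Consecutive forms of the segment differ by the action of a short path [z]; [homotopy] straightens
   it to the ray with the same end, which is the bottom edge of the grid. *)
have [z [z0 Hz lz]] := Hd _ _ _ b1 b2 (hpath_lifts S (th0 (s i))).
have Dz u : unitI u -> D0 (z u) by move=> /Hz[].
have zr u : unitI u -> `|z u| <= r by move=> /Hz[].
clear Hd.
have zE : th0 (s i.+1) = act z (th0 (s i)).
  exact: (lifts_form lz (lifts_act z0 Dz (hpath_lifts S (th0 (s i))))).
have I1 := @unitI1 R.
have xE : phi (H (s i.+1, s 0%N) * (H (s i, s 0%N))^-1 : S)%g = z 1.
  rewrite s0 (H0 _ (sI _ im)) (H0 _ (sI _ (ltnW im))) /gam zE.
  apply: (etrans (congr1 (fun x => phi (x * (Hol (th0 (s i)))^-1)%g) (Hol_act (th0 (s i)) z0 Dz))).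
  by rewrite mulgK; exact: (psiK (Dz 1 I1)).
rewrite zE xE; apply: (homotopy (r := r') _ rD _ _ z0).
- by move=> u uI; exact: (le_trans (zr u uI) rr).
- by move=> u uI; exact: (ray_norm (le_trans (zr 1 I1) rr) uI).
- exact: ray0.
- by rewrite ray1.
Qed.

End Holonomy.

Local Opaque rho sig.

(** * The leaf space *)

Section Leaves.
Context {R : realType} {n : nat} (S : lie_setup R n).
Hypotheses (hc : connected [set: mspace (lA S)]) (hsc : @simply_connected R (mspace (lA S))).
Notation A := (lA S).
Notation E := 'rV[R]_n.
Notation mA := (mA S).
Notation Hol := (Hol S).
Notation AdC := (AdC S).
Notation AdVC := (AdVC S).
Notation rho := (@rho _ _ S).
Notation sig := (@sig _ _ S).
Notation kap := (kap S).
Notation kap1 := (kap1 S).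
Notation Xi := (Xi S).
Notation tr := (@tr _ _ S).
Notation PS := (phase_space (lbr S)).
Notation LS := (leaf_space (lbr S)).
Notation PSchart := (PSchart S).
Notation PSatlas := (PSatlas S).
Implicit Types (U V W Z : normedModType R) (eta zeta : C0 E) (c d : chart E S).

Definition x0 (p : PS) : E := (sval p).1 0.
Definition hol (p : PS) : S := Hol (sval p).2.

Lemma PS_svalE (p : PS) : sval p = (Xi (x0 p, (sval p).2), (sval p).2).
Proof. by rewrite -(Xi_unique (svalP p)); case: (sval p). Qed.

(** Equal holonomies give a homotopy of forms by [Hol_inj], and equal initial values let
    [homeq_gauge] lift it with a fixed [x]. *)
Lemma gauge_equivP (p q : PS) : gauge_equiv p q <-> x0 p = x0 q /\ hol p = hol q.
Proof.
split; first exact: gauge_inv.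
move=> [xpq Hpq]; apply: (homeq_gauge (Hol_inj hsc Hpq) (PS_svalE p)).
by rewrite xpq; exact: PS_svalE.
Qed.

Lemma leaf_eqP (p q : PS) : leaf p = leaf q <-> x0 p = x0 q /\ hol p = hol q.
Proof.
split=> [/(congr1 sval) /= pq|[xpq Hpq]].
  have : [set c' | gauge_equiv q c'] q by apply/gauge_equivP.
  by rewrite -pq => /gauge_equivP.
apply: eq_exist; rewrite predeqE => c'; split=> /gauge_equivP[h1 h2]; apply/gauge_equivP.
  by rewrite -xpq -Hpq.
by rewrite xpq Hpq.
Qed.

Definition lrep (L : LS) : PS := sval (cid (svalP L)).

Lemma lrepK (L : LS) : leaf (lrep L) = L.
Proof.
case: L => L HL; apply: eq_exist; rewrite /lrep.
by case: (cid _) => c /= ->.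
Qed.

Definition PhiG (L : LS) : cotangent R n S := tr (hol (lrep L), x0 (lrep L)).

Lemma Phi_leaf (p : PS) : PhiG (leaf p) = tr (hol p, x0 p).
Proof. by have /leaf_eqP[h1 h2] := lrepK (leaf p); rewrite /PhiG h1 h2. Qed.

Definition hsec (g : S) : C0 E := sval (cid (Hol_surj hc g)).
Lemma hsecK g : Hol (hsec g) = g. Proof. exact: (svalP (cid (Hol_surj hc g))). Qed.

Lemma x0_bwd p : x0 (bwd PSchart p) = p.1. Proof. exact: Xi0. Qed.

Definition PsiG (q : cotangent R n S) : LS := leaf (bwd PSchart (trV q, hsec q.1)).

Lemma PsiGK : cancel PsiG PhiG.
Proof.
move=> q; apply: (etrans (Phi_leaf _)).
have -> : hol (bwd PSchart (trV q, hsec q.1)) = q.1 := hsecK q.1.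
have -> : x0 (bwd PSchart (trV q, hsec q.1)) = trV q := x0_bwd _.
exact: trVK.
Qed.

Lemma PhiGK : cancel PhiG PsiG.
Proof.
move=> L; have [p <-] : exists p, leaf p = L by exists (lrep L); exact: lrepK.
have -> : PhiG (leaf p) = tr (hol p, x0 p) := Phi_leaf p.
apply/leaf_eqP; split.
  by apply: (etrans (x0_bwd _)); exact: trK.
exact: (hsecK (hol p)).
Qed.

Definition AQ : atlas (E * E)%type LS := transport_atlas (cot_atlas A) PhiG PsiG.

Lemma AQ_manifold : is_manifold AQ.
Proof. exact: (transport_manifold (cot_manifold mA) PhiGK PsiGK). Qed.

Lemma AQ_second_countable : @second_countable (mspace A) -> @second_countable (mspace AQ).
Proof.
move=> /cot_second_countable [B cB [oB bB]].
exists ((fun U0 : set (cotangent R n S) => PhiG @^-1` U0) @` B); first exact: sub_countable (card_image_le _ _) cB.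
split; first by move=> _ [U BU <-]; apply/(transport_open (cot_atlas A) PsiGK); exact: oB.
move=> L N; rewrite nbhsE => -[V [oV VL] VN].
have VE : V = PhiG @^-1` (PsiG @^-1` V).
  by rewrite predeqE => x; rewrite /preimage /= PhiGK.
have oW : open (PsiG @^-1` V : set (mspace (cot_atlas A))).
  by apply/(transport_open (cot_atlas A) PsiGK); rewrite -VE.
have nW : nbhs (PhiG L : mspace (cot_atlas A)) (PsiG @^-1` V).
  by apply: open_nbhs_nbhs; split=> //; rewrite /preimage /= PhiGK.
have [U [BU UL] UV] := bB _ _ nW.
exists (PhiG @^-1` U); first by split=> //; exists U.
by move=> x Ux; apply: VN; rewrite VE; exact: UV.
Qed.

(** The projection onto the leaf space, read in [PSchart] and in the cotangent chart over [c]. *)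
Definition lcoord c (p : E * C0 E) : E * E :=
  (fwd c (Hol p.2), dual_map (sig c (fwd c (Hol p.2))) p.1).

Definition ldom c : set (E * C0 E) := [set p | dom c (Hol p.2)].

Lemma leaf_lcoord c p : charts A c -> ldom c p ->
  fwd (transport_chart PhiG PsiG (cot_chart A c)) (leaf (bwd PSchart p)) = lcoord c p.
Proof.
move=> Ac cp; apply: (etrans (congr1 (fwd (cot_chart A c)) (Phi_leaf (bwd PSchart p)))).
have -> : x0 (bwd PSchart p) = p.1 := x0_bwd p.
exact: fwd_tr.
Qed.

Lemma ldom_open c : charts A c -> open (ldom c).
Proof.
move=> Ac; have -> : ldom c = [set: E * C0 E] `&` snd @^-1` (Hol @^-1` dom c) by rewrite setTI.
apply: open_preim => //; first exact: openT.
  by move=> p _; exact: cvg_snd.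
exact: Hol_open.
Qed.

Lemma fwdHol_smooth c : charts A c -> smooth_on (ldom c) (fun p : E * C0 E => fwd c (Hol p.2)).
Proof.
move=> Ac; have oL := ldom_open Ac.
have [_ s] := @Hol_msmooth R n S c Ac.
apply: (smooth_comp oL _ _ s); first by move=> p.
by apply: smooth_lin => //; exact: contlin_snd.
Qed.

Lemma lcoord_smooth c : charts A c -> smooth_on (ldom c) (lcoord c).
Proof.
move=> Ac; have oL := ldom_open Ac; have s1 := fwdHol_smooth Ac.
apply: smooth_pair => //.
apply: (dual_map_smooth oL (chart_cod_open mA Ac) _ s1 _ (sig_smooth Ac)).
  by move=> p cp; exact: chart_fwd_cod.
by apply: smooth_lin => //; exact: contlin_fst.
Qed.

Lemma leaf_smooth : smooth_map PSatlas AQ (@leaf R n (lbr S)).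
Proof.
apply: (smooth_mapP (PS_manifold S)) => _ -> _ [_ [c Ac <-] <-].
have E1 : cod PSchart `&` (fun y => leaf (bwd PSchart y)) @^-1`
    dom (transport_chart PhiG PsiG (cot_chart A c)) = ldom c.
  rewrite PS_cod setTI predeqE => p.
  have e : dom c (PhiG (leaf (bwd PSchart p))).1 = ldom c p.
    exact: (congr1 (fun g : cotangent R n S => dom c g.1) (Phi_leaf (bwd PSchart p))).
  by split=> h; [rewrite -e|move: h; rewrite -e].
rewrite E1; split; first exact: ldom_open.
apply: smooth_ext (lcoord_smooth Ac); first exact: ldom_open.
by move=> p cp; rewrite leaf_lcoord.
Qed.

Lemma lcoord_diff c p : charts A c -> ldom c p -> differentiable (lcoord c) p.
Proof. by move=> Ac; exact: smooth_diff (lcoord_smooth Ac). Qed.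

Lemma fwdHol_is_diff c p : charts A c -> ldom c p ->
  is_diff p (fun p : E * C0 E => fwd c (Hol p.2)) (fun v : E * C0 E => rho c (fwd c (Hol p.2)) (kap1 p.2 v.2)).
Proof.
move=> Ac cp; exact: (is_diff_comp (contlin_is_diff p (contlin_snd E (C0 E))) (Hol_is_diff Ac cp)).
Qed.

Lemma lcoord_diff1 c p v : charts A c -> ldom c p ->
  ('d (lcoord c) p v).1 = rho c (fwd c (Hol p.2)) (kap1 p.2 v.2).
Proof.
move=> Ac cp.
have D : is_diff p (fun z => (lcoord c z).1) (fun v => ('d (lcoord c) p v).1).
  exact: (is_diff_comp (differentiableP (lcoord_diff Ac cp)) (contlin_is_diff _ (contlin_fst E E))).
exact: (is_diff_unique D (fwdHol_is_diff Ac cp) v).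
Qed.

Lemma lcoord_diff2 c p v w : charts A c -> ldom c p ->
  pairing ('d (lcoord c) p v).2 w = pairing v.1 (sig c (fwd c (Hol p.2)) w) +
    pairing p.1 ('d (fun z : E => sig c z w) (fwd c (Hol p.2)) (rho c (fwd c (Hol p.2)) (kap1 p.2 (snd v)))).
Proof.
move=> Ac cp; set q := fwd c (Hol p.2).
have D : is_diff p (fun z => pairing (lcoord c z).2 w : R) (fun v => pairing ('d (lcoord c) p v).2 w : R).
  have D1 := is_diff_comp (differentiableP (lcoord_diff Ac cp)) (contlin_is_diff _ (contlin_snd E E)).
  exact: (is_diff_comp D1 (contlin_is_diff _ (contbil_l w (@pairing_contbil R n)))).
have cq : cod c q by exact: chart_fwd_cod.
have oc := chart_cod_open mA Ac.
have ds : differentiable (fun z : E => sig c z w) q.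
  have sp : smooth_on (cod c) (fun z : E => (z, w)).
    by apply: smooth_pair => //; [exact: smooth_id|exact: smooth_cst].
  by apply: (smooth_diff (smooth_comp oc _ sp (sig_smooth Ac)) cq) => z cz.
have D2 := is_diff_comp (fwdHol_is_diff Ac cp) (differentiableP ds).
have D3 := is_diff_comp (is_diff_pair (contlin_is_diff p (contlin_fst E (C0 E))) D2)
  (contbil_is_diff (p.1, sig c q w) (@pairing_contbil R n)).
have H : {near p, (fun z => pairing (lcoord c z).2 w : R) =1
   (fun z : E * C0 E => pairing z.1 (sig c (fwd c (Hol z.2)) w) : R)}.
  by apply: filterE => z; apply: pairing_dual; exact: sig_linear.
have := is_diff_unique (near_is_diff H D) D3 v; rewrite /= => ->.
by rewrite addrC.
Qed.

Lemma leaf_mdiff (p : PS) v : mdiff PSatlas AQ (@leaf R n (lbr S)) p v =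
  'd (lcoord (chart_at A (hol p))) (x0 p, (sval p).2) v.
Proof.
rewrite /mdiff -[chart_at AQ (leaf p)]/(transport_chart PhiG PsiG (cot_chart A (chart_at A (PhiG (leaf p)).1))).
have -> : (PhiG (leaf p)).1 = hol p := congr1 fst (Phi_leaf p).
set c := chart_at A (hol p); have Ac : charts A c := chart_atA (hol p).
have cp : ldom c (x0 p, (sval p).2) := chart_at_in (hol p).
have H : {near ((x0 p, (sval p).2) : E * C0 E), lcoord c =1
   fwd (transport_chart PhiG PsiG (cot_chart A c)) \o @leaf R n (lbr S) \o bwd PSchart}.
  by apply: filterS (nbhs_open (ldom_open Ac) cp) => z cz; exact: esym (leaf_lcoord Ac cz).
exact: (near_diffE v H (lcoord_diff Ac cp)).
Qed.

(** The variation for which the integrand of [kap] is constantly [k]: a continuous linear right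
    inverse of [kap1 eta]. *)
Definition hfield eta (k : E) : C0 E := vC (C0cst k) (AdVC eta).

Lemma hfield_contlin eta : contlin (hfield eta).
Proof. exact: (contlin_comp (C0cst_contlin E) (contbil_l (AdVC eta) (@vC_contbil R n))). Qed.

Lemma kap1_hfield eta k : kap1 eta (hfield eta k) = k.
Proof.
rewrite /kap1 (kapE S eta (hfield eta k) (@unitI1 R)).
have -> : vC (hfield eta k) (AdC eta) = C0cst k.
  apply: C0_ext => u uI; apply: (etrans (vCE _ _ _)).
  apply: (etrans (congr1 (mulmx^~ _) (vCE (C0cst k) (AdVC eta) u))).
  by rewrite -mulmxA (BAC S eta uI) mulmx1.
by have := ray1 k; rewrite /ray C1primE add0r.
Qed.

Lemma contlin_add V W (f g : V -> W) : contlin f -> contlin g -> contlin (fun x => f x + g x).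
Proof.
move=> [lf cf] [lg cg]; split=> [a u v|x]; last exact: (cvgD (cf x) (cg x)).
by rewrite lf lg scalerDr addrACA.
Qed.

Lemma leaf_submersion : submersion PSatlas AQ (@leaf R n (lbr S)).
Proof.
split; first exact: leaf_smooth.
move=> p; set c := chart_at A (hol p); have Ac : charts A c := chart_atA (hol p).
pose p0 : E * C0 E := (x0 p, (sval p).2); pose eta := (sval p).2.
have cp : ldom c p0 := chart_at_in (hol p).
pose q := fwd c (hol p); have cq : cod c q := chart_at_cod (hol p).
pose Z (w1 : E) := hfield eta (sig c q w1).
have cs : contlin (sig c q) by exact: mx_lin_contlin (sig_linear c q).
have cZ : contlin Z := contlin_comp cs (hfield_contlin eta).
pose Dz (w1 : E) : E := ('d (lcoord c) p0 (0 : E, Z w1)).2.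
have cDz : contlin Dz.
  have c1 := contlin_pair (contlin_0 E E) cZ.
  exact: (contlin_comp (contlin_comp c1 (contlin_diff (lcoord_diff Ac cp))) (contlin_snd E E)).
(* The direction in the group is realized by [Z]; subtracting [Dz w.1] compensates what [Z]
   contributes to the covector component, and the rest is realized by varying X(0). *)
pose s (w : E * E) : E * C0 E := (dual_map (rho c q) (w.2 - Dz w.1), Z w.1).
have cdr : contlin (dual_map (rho c q)).
  apply: mx_lin_contlin => a u v; rewrite !dual_mapE mulmxDl -scalemxAl//.
have cS : contlin s.
  apply: contlin_pair; last exact: (contlin_comp (contlin_fst E E) cZ).
  have c1 := contlin_comp (contlin_comp (contlin_fst E E) cDz) (contlin_opp E).
  exact: (contlin_comp (contlin_add (contlin_snd E E) c1) cdr).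
exists (mklin cS.1); split; first exact: cS.2.
move=> w; rewrite leaf_mdiff -/c -/p0.
have E1 : ('d (lcoord c) p0 (s w)).1 = w.1.
  apply: (etrans (lcoord_diff1 (s w) Ac cp)).
  apply: (etrans (congr1 (rho c q) (kap1_hfield eta (sig c q w.1)))).
  exact: rho_sig.
have E2 : ('d (lcoord c) p0 (s w)).2 = w.2.
  apply: pairing_ext => u; apply: (etrans (lcoord_diff2 (s w) u Ac cp)).
  have D2 := lcoord_diff2 ((0 : E), Z w.1) u Ac cp.
  set T := pairing p0.1 _ in D2 *.
  have -> : pairing (s w).1 (sig c q u) = pairing (w.2 - Dz w.1) u.
    by apply: (etrans (pairing_dual _ _ (rho_linear c q))); rewrite rho_sig.
  have z0 (v : E) : pairing 0 v = 0 by rewrite /pairing big1// => i _; rewrite mxE mul0r.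
  move: D2; rewrite [pairing (0, _).1 _]z0 add0r => <-.
  by rewrite -pairingDl subrK.
by rewrite [LHS]surjective_pairing E1 E2; case: (w).
Qed.

Lemma FTC (F f : R -> R) : (forall u, der (F : R -> R) u (f u)) -> continuous f ->
  \int[lebesgue_measure]_(u in unitI) f u = F 1 - F 0.
Proof.
move=> dF cf; rewrite /Rintegral.
have := @continuous_FTC2 R f F 0 1 ltr01 _ _ _.
move=> ->//; first exact: continuous_subspaceT.
- split.
  + by move=> x _; case: (dF x).
  + by apply: cvg_at_right_filter; exact: (is_derive_continuous (dF 0)).
  + by apply: cvg_at_left_filter; exact: (is_derive_continuous (dF 1)).
- by move=> x _; exact: is_derive_derive1 (dF x).
Qed.

(** Here [k] is the primitive of a variation transformed by Ad, and the integrand is the derivative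
    of [F]: the variations of X(0) give the first two terms, while those of the path in the two
    summands of the form give, by antisymmetry, the two halves of the derivative of the bracket. As
    [F] vanishes at 0, its value at 1 remains. *)
Lemma field_formE p (v w : E * C0 E) :
  field_form ('d Xi p v, snd v) ('d Xi p w, snd w) =
  pairing v.1 (kap1 p.2 w.2) - pairing w.1 (kap1 p.2 v.2) + pairing p.1 (lbr S (kap1 p.2 v.2) (kap1 p.2 w.2)).
Proof.
pose kd (z : C0 E) := vC z (AdC p.2); pose k (z : C0 E) := vprim (kd z).
have kI z u : unitI u -> kap p.2 z u = k z u by move=> uI; exact: kapE.
have pc := @pairing_contbil R n; have lc := lbr_contbil S.
have dk z u : der (k z) u (kd z u) by exact: vprim_der.
pose F u := pairing v.1 (k w.2 u) - pairing w.1 (k v.2 u) + pairing p.1 (lbr S (k v.2 u) (k w.2 u)).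
pose f u := pairing v.1 (kd w.2 u) - pairing w.1 (kd v.2 u) +
  pairing p.1 (lbr S (k v.2 u) (kd w.2 u) + lbr S (kd v.2 u) (k w.2 u)).
have dF u : der (F : R -> R) u (f u).
  apply: derD; first apply: derB.
  - exact: (is_derive_contlin (contbil_r v.1 pc) (dk w.2 u)).
  - exact: (is_derive_contlin (contbil_r w.1 pc) (dk v.2 u)).
  - exact: (is_derive_contlin (contbil_r p.1 pc) (is_derive_bil lc (dk v.2 u) (dk w.2 u))).
have cf : continuous f.
  move=> u; have ck z : {for u, continuous (k z)} := is_derive_continuous (dk z u).
  have cd z : {for u, continuous (kd z)} by exact: C0_continuous.
  have ct (a : E) (g : R -> E) : {for u, continuous g} -> {for u, continuous (fun x => pairing a (g x))}.
    by move=> cg; exact: (continuous_comp cg ((contbil_r a pc).2 _)).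
  have c3 : {for u, continuous (fun x => lbr S (k v.2 x) (kd w.2 x))} := @contbil_cont _ _ _ _ _ _ _ u lc (ck v.2) (cd w.2).
  have c4 : {for u, continuous (fun x => lbr S (kd v.2 x) (k w.2 x))} := @contbil_cont _ _ _ _ _ _ _ u lc (cd v.2) (ck w.2).
  exact: (@continuousD _ _ _ _ _ u (continuousB (ct v.1 _ (cd w.2)) (ct w.1 _ (cd v.2))) (ct p.1 _ (continuousD c3 c4))).
have E1 : field_form ('d Xi p v, snd v) ('d Xi p w, snd w) = \int[lebesgue_measure]_(u in unitI) f u.
  apply: eq_Rintegral => u; rewrite inE => uI.
  have dX (a : E * C0 E) (b : E) : pairing ('d Xi p a u) b =
      pairing a.1 (b *m AdC p.2 u) + pairing p.1 (lbr S (k a.2 u) (b *m AdC p.2 u)).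
    by rewrite (Xi_diff S p a uI) pairingDl !pairing_tr mulmxA adME (kI _ _ uI).
  have E2 : \sum_i (('d Xi p v, snd v).1 u 0 i * ('d Xi p w, snd w).2 u 0 i -
      ('d Xi p w, snd w).1 u 0 i * ('d Xi p v, snd v).2 u 0 i) =
      pairing ('d Xi p v u) (w.2 u) - pairing ('d Xi p w u) (v.2 u).
    by rewrite big_split /= sumrN.
  apply: (etrans E2); rewrite (dX v) (dX w) /f.
  have kdE z : kd z u = z u *m AdC p.2 u by exact: vCE.
  rewrite -!kdE (lbr_anti S (k w.2 u)) pairingDr.
  have pN (a b : E) : pairing a (- b) = - pairing a b by rewrite -scaleN1r pairingZr mulN1r.
  rewrite (lbr_anti S (kd v.2 u) (k w.2 u)) !pN; ring.
rewrite E1 (FTC dF cf).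
have k0 z : k z 0 = 0 by exact: vprim0.
have k1 z : k z 1 = kap1 p.2 z by exact: esym (kapE S p.2 z (@unitI1 R)).
rewrite /F !k0 !k1.
have z0 (a : E) : pairing a 0 = 0 by exact: (contlin_map0 (contbil_r a pc)).
by rewrite (contlin_map0 (contbil_r 0 lc)) !z0 !subr0 addr0 subr0.
Qed.

Lemma pairing_alg (a b : R) (x y z : E) :
  a + pairing x y - (b + pairing x z) = a - b + pairing x (y - z).
Proof.
have pB : pairing x (y - z) = pairing x y - pairing x z.
  by rewrite pairingDr -scaleN1r pairingZr mulN1r.
by rewrite pB; ring.
Qed.

(** The dependence of [sig] on the base point contributes an antisymmetrized derivative, which the
    Maurer--Cartan equation turns into the bracket term found in [field_formE]. *)
Lemma om0_lcoord c p v w : charts A c -> ldom c p ->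
  om0 ('d (lcoord c) p v) ('d (lcoord c) p w) =
  pairing v.1 (kap1 p.2 w.2) - pairing w.1 (kap1 p.2 v.2) + pairing p.1 (lbr S (kap1 p.2 v.2) (kap1 p.2 w.2)).
Proof.
move=> Ac cp; set q := fwd c (Hol p.2); have cq : cod c q by exact: chart_fwd_cod.
have F1 := lcoord_diff1 v Ac cp; have F2 := lcoord_diff1 w Ac cp.
rewrite /om0 F1 F2 -/q.
have G1 := lcoord_diff2 v (rho c q (kap1 p.2 w.2)) Ac cp.
have G2 := lcoord_diff2 w (rho c q (kap1 p.2 v.2)) Ac cp.
have MC := sig_maurer_cartan (rho c q (kap1 p.2 v.2)) (rho c q (kap1 p.2 w.2)) Ac cq.
apply: (etrans (congr2 (fun x y => x - y) G1 G2)); apply: (etrans (pairing_alg _ _ _ _ _)).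
apply: congr2; last exact: (congr1 (pairing p.1) (etrans MC (congr2 (lbr S) (sig_rho _ Ac cq) (sig_rho _ Ac cq)))).
exact: (congr2 (fun x y => pairing v.1 x - pairing w.1 y) (sig_rho _ Ac cq) (sig_rho _ Ac cq)).
Qed.

Lemma leaf_pullback : pullback2 PSatlas AQ (@leaf R n (lbr S)) (fun _ => om0) =
  pullback2 PSatlas (space_atlas (C1 E * C0 E)%type) (fun p : PS => sval p) (fun _ v w => field_form v w).
Proof.
apply/funext => p; apply/funext => v; apply/funext => w.
rewrite /pullback2 !leaf_mdiff.
have Ac : charts A (chart_at A (hol p)) := chart_atA (hol p).
have cp : ldom (chart_at A (hol p)) (x0 p, (sval p).2) := chart_at_in (hol p).
apply: (etrans (om0_lcoord v w Ac cp)); apply: (etrans (esym (field_formE _ v w))).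
have M a : mdiff PSatlas (space_atlas (C1 E * C0 E)%type) (fun p : PS => sval p) p a =
    ('d Xi (x0 p, (sval p).2) a, snd a).
  have D := is_diff_pair (differentiableP (smooth_diff (Xi_smooth S) (I : setT (x0 p, (sval p).2))))
    (contlin_is_diff (x0 p, (sval p).2) (contlin_snd E (C0 E))).
  exact: (is_diffE a D).
by rewrite !M.
Qed.

End Leaves.

(** * Concatenation and the isomorphism *)

Section Concatenation.
Context {R : realType} {n : nat} (S : lie_setup R n).
Notation E := 'rV[R]_n.
Notation Hol := (Hol S).
Notation hpath := (hpath S).
Implicit Types (eta zeta : C0 E) (g h k : R -> S).

Lemma gder_scale g (s : R -> R) u s' v : der s u s' -> gder g (s u) v ->
  gder (fun x => g (s x)) u (s' *: v).
Proof.
move=> ds [ng dg]; split; last exact: (is_derive_diff_comp ds (derive1_is_diff dg)).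
have c : {for u, continuous s} := is_derive_continuous ds.
exact: (c _ ng).
Qed.

Lemma gder_lmul (a : S) g u v : gder g u v -> gder (fun x => a * g x)%g u v.
Proof.
have e s : ((a * g u)^-1 * (a * g s) = (g u)^-1 * g s)%g by rewrite invgM -mulgA mulKg.
move=> [ng dg]; split; first by apply: filterS ng => s; rewrite e.
by under eq_fun do rewrite e.
Qed.

Lemma der_affine (a b u : R) : der (fun x => a * x + b) u a.
Proof.
have := is_deriveD (is_deriveZ a (is_derive_id u (1 : R))) (is_derive_cst b u (1 : R)).
by rewrite addr0 -[a *: 1]/(a * 1) mulr1.
Qed.

Lemma half_in (u : R) : unitI u -> unitI (2^-1 * u + 0).
Proof. move=> /unitIP/andP[a b]; apply/unitIP; lra. Qed.

Lemma half_in' (u : R) : unitI u -> unitI (2^-1 * u + 2^-1).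
Proof. move=> /unitIP/andP[a b]; apply/unitIP; lra. Qed.

(** The first half of the path of [eta], run at half speed, has form [eta1] and starts at the unit.
    For the second half a left translation restores the starting point without changing the form. *)
Lemma concat_left eta1 eta : (forall u, unitI u -> eta (2^-1 * u + 0) = 2 *: eta1 u) ->
  forall u, unitI u -> hpath eta1 u = hpath eta (2^-1 * u + 0).
Proof.
move=> H u uI; apply: (hpathE (g := fun u => hpath eta (2^-1 * u + 0))) uI => {u}.
have [h0 dh] := hpath_lifts S eta.
split=> [|u uI]; first by rewrite mulr0 addr0.
have -> : eta1 u = 2^-1 *: eta (2^-1 * u + 0) by rewrite H// scalerA mulVf ?scale1r// pnatr_eq0.
exact: (gder_scale (der_affine _ _ _) (dh _ (half_in uI))).
Qed.

Lemma concat_right eta2 eta : (forall u, unitI u -> eta (2^-1 * u + 2^-1) = 2 *: eta2 u) ->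
  forall u, unitI u -> hpath eta2 u = ((hpath eta 2^-1)^-1 * hpath eta (2^-1 * u + 2^-1)%R)%g.
Proof.
move=> H u uI; apply: (hpathE (g := fun u => ((hpath eta 2^-1)^-1 * hpath eta (2^-1 * u + 2^-1)%R)%g)) uI => {u}.
have [h0 dh] := hpath_lifts S eta.
split=> [|u uI]; first by rewrite mulr0 add0r mulVg.
have -> : eta2 u = 2^-1 *: eta (2^-1 * u + 2^-1) by rewrite H// scalerA mulVf ?scale1r// pnatr_eq0.
apply: gder_lmul; exact: (gder_scale (der_affine _ _ _) (dh _ (half_in' uI))).
Qed.

Lemma concat_mid eta1 eta : (forall u, unitI u -> eta (2^-1 * u + 0) = 2 *: eta1 u) ->
  Hol eta1 = hpath eta 2^-1.
Proof.
move=> H; apply: (etrans (concat_left H (@unitI1 R))).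
by rewrite mulr1 addr0.
Qed.

Lemma concat_Hol eta1 eta2 eta : (forall u, unitI u -> eta (2^-1 * u + 0) = 2 *: eta1 u) ->
  (forall u, unitI u -> eta (2^-1 * u + 2^-1) = 2 *: eta2 u) -> Hol eta = (Hol eta1 * Hol eta2)%g.
Proof.
move=> H1 H2; apply: esym; apply: (etrans (congr2 (fun x y => (x * y)%g) (concat_mid H1) (concat_right H2 (@unitI1 R)))).
rewrite mulgA mulgV mul1g mulr1; apply: (congr1 (hpath eta)); lra.
Qed.

(** Running the path along a step function keeps its end point and multiplies the form by the
    derivative of the step, which is 0 at both ends. *)
Lemma reparam eta : exists zeta, [/\ zeta 0 = 0, zeta 1 = 0 & Hol zeta = Hol eta].
Proof.
have [s [s' [ds cs slo shi [sI s0 s1]]]] := @step_exists R.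
pose f u := s' u *: eta (s u).
have cf : forall u, unitI u -> {for u, continuous f}.
  move=> u _; have c1 : {for u, continuous (fun x => eta (s x))}.
    by apply: continuous_comp; [exact: (is_derive_continuous (ds u))|exact: C0_continuous].
  exact: (cvgZ (cs u) c1).
exists (C0of f); split.
- by rewrite (C0of_id cf unitI0) /f s0 scale0r.
- by rewrite (C0of_id cf unitI1) /f s1 scale0r.
- have [h0 dh] := hpath_lifts S eta.
  have l : lifts (C0of f) (fun u => hpath eta (s u)).
    split=> [|u uI]; first by rewrite slo.
    rewrite (C0of_id cf uI); exact: (gder_scale (ds u) (dh _ (sI u))).
  by apply: (etrans (HolE l)); rewrite shi.
Qed.

Lemma C0_left eta u : u <= 0 -> eta u = eta 0.
Proof.
move=> u0; rewrite (C0_clamp eta u); congr (eta _); rewrite /clampI.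
by apply/max_idPl; rewrite ge_min u0 orbT.
Qed.

Lemma C0_right eta u : 1 <= u -> eta u = eta 1.
Proof.
move=> u1; rewrite (C0_clamp eta u); congr (eta _); rewrite /clampI.
by rewrite (min_idPl u1) (max_idPr ler01).
Qed.

Lemma concat_exists eta1 eta2 : eta1 1 = 0 -> eta2 0 = 0 -> exists eta,
  (forall u, 0 <= u <= 2^-1 -> eta u = 2 *: eta1 (2 * u)) /\
  (forall u, 2^-1 <= u <= 1 -> eta u = 2 *: eta2 (2 * u - 1)).
Proof.
(* Elements of [C0] are constant beyond the ends of the interval, so with [eta1 1 = 0] and
   [eta2 0 = 0] each summand vanishes on the half of the other, and continuity needs no case
   distinction. *)
move=> z1 z2; pose f (u : R) := 2 *: eta1 (2 * u + 0) + 2 *: eta2 (2 * u - 1).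
have cf : forall u, unitI u -> {for u, continuous f}.
  move=> u _.
  have c (a b : R) zeta : {for u, continuous (fun x : R => 2 *: zeta (a * x + b) : E)}.
    have c1 : {for u, continuous (fun x : R => zeta (a * x + b))}.
      by apply: continuous_comp; [exact: (is_derive_continuous (der_affine a b u))|exact: C0_continuous].
    exact: (cvgZr c1).
  exact: (continuousD (c 2 0 eta1) (c 2 (-1) eta2)).
exists (C0of f); split=> u /andP[a b]; rewrite (C0of_id cf) ?/f ?addr0; try (by apply/unitIP; lra).
  have -> : eta2 (2 * u - 1) = 0 by rewrite C0_left ?z2//; lra.
  by rewrite scaler0 addr0.
have -> : eta1 (2 * u) = 0.
  by rewrite C0_right ?z1//; lra.
by rewrite scaler0 add0r.
Qed.

End Concatenation.

(** * The isomorphism of symplectic groupoids *)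

Section Isomorphism.
Context {R : realType} {n : nat} (S : lie_setup R n).
Hypotheses (hc : connected [set: mspace (lA S)]) (hsc : @simply_connected R (mspace (lA S))).
Notation E := 'rV[R]_n.
Notation A := (lA S).
Notation th := (lth S).
Notation th' := (lth' S).
Notation Hol := (Hol S).
Notation hpath := (hpath S).
Notation AdM := (@AdM _ _ S).
Notation PS := (phase_space (lbr S)).
Notation PSchart := (PSchart S).
Notation PhiG := (@PhiG R n S).

Lemma PS_right (p : PS) : (sval p).1 1 = x0 p *m (AdM (hol p))^T.
Proof.
rewrite {1}(PS_svalE p); apply: (etrans (XiE _ _ (@unitI1 R))).
by rewrite (ACE S _ (@unitI1 R)).
Qed.

(** X(1) is the coadjoint translate of X(0) by the holonomy, so matching ends is the stated relation
    between initial values. Conversely [reparam] and [concat_exists] provide the forms, and the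
    solution for the concatenated form restricts to the two given ones because the path of the
    second half carries the factor [hol p]. *)
Lemma leaf_mul_hol (p q s : PS) : leaf_mul (leaf p) (leaf q) (leaf s) <->
  [/\ x0 q = x0 p *m (AdM (hol p))^T, hol s = (hol p * hol q)%g & x0 s = x0 p].
Proof.
split.
  move=> [c1 [c2 [c [[lp lq ls X12] [_ [H1 H2]]]]]].
  have [xp hp] := iffLR (leaf_eqP hsc c1 p) lp.
  have [xq hq] := iffLR (leaf_eqP hsc c2 q) lq.
  have [xs hs] := iffLR (leaf_eqP hsc c s) ls.
  rewrite -xp -hp -xq -hq -xs -hs; split.
  - by rewrite -PS_right X12.
  - apply: concat_Hol => u uI.
      rewrite (H1 _ _).2; last by move/unitIP: uI => /andP[a b]; lra.
      by congr (_ *: (sval c1).2 _); lra.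
    rewrite (H2 _ _).2; last by move/unitIP: uI => /andP[a b]; lra.
    by congr (_ *: (sval c2).2 _); lra.
  - have [|+ _] := H1 0; first by rewrite lexx invr_ge0 ler0n.
    by rewrite mulr0.
move=> [xq hs xs].
have [z1 [z10 z11 h1]] := reparam S (sval p).2.
have [z2 [z20 z21 h2]] := reparam S (sval q).2.
have [z [Z1 Z2]] := concat_exists z11 z20.
have K1 u : unitI u -> z (2^-1 * u + 0) = 2 *: z1 u.
  move=> uI; rewrite Z1; last by move/unitIP: uI => /andP[a b]; lra.
  by congr (_ *: z1 _); lra.
have K2 u : unitI u -> z (2^-1 * u + 2^-1) = 2 *: z2 u.
  move=> uI; rewrite Z2; last by move/unitIP: uI => /andP[a b]; lra.
  by congr (_ *: z2 _); lra.
pose c1 : PS := bwd PSchart (x0 p, z1); pose c2 : PS := bwd PSchart (x0 q, z2).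
pose c : PS := bwd PSchart (x0 p, z).
have x1 : x0 c1 = x0 p by exact: x0_bwd.
have x2 : x0 c2 = x0 q by exact: x0_bwd.
have x3 : x0 c = x0 p by exact: x0_bwd.
exists c1, c2, c; split; [split|split; [exact: (And4 z10 z11 z20 z21)|split]].
- by apply/(leaf_eqP hsc); split.
- by apply/(leaf_eqP hsc); split.
- apply/(leaf_eqP hsc); split; first by rewrite x3 xs.
  by rewrite hs -[hol p]h1 -[hol q]h2; exact: concat_Hol.
- apply: (etrans (PS_right c1)); rewrite x1 -[hol c1]/(Hol z1) h1 -[(sval c2).1 0]/(x0 c2) x2.
  exact: esym xq.
- move=> u /andP[a b]; have uI : unitI u by apply/unitIP; lra.
  have uI2 : unitI (2 * u) by apply/unitIP; lra.
  split; last by apply: Z1; rewrite a b.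
  apply: (etrans (XiE S (x0 p, z) uI)); apply: esym; apply: (etrans (XiE S (x0 p, z1) uI2)).
  congr (x0 p *m _^T); apply: (etrans (ACE S _ uI2)); apply: esym; apply: (etrans (ACE S _ uI)).
  have e : u = 2^-1 * (2 * u) + 0 by lra.
  apply: (etrans (congr1 (fun x => AdM (hpath z x)) e)).
  by rewrite -(concat_left S K1 uI2).
- move=> u /andP[a b]; have uI : unitI u by apply/unitIP; lra.
  have uI2 : unitI (2 * u - 1) by apply/unitIP; lra.
  split; last by apply: Z2; rewrite a b.
  apply: (etrans (XiE S (x0 p, z) uI)); apply: esym; apply: (etrans (XiE S (x0 q, z2) uI2)).
  have gen (x y : E) (M N P : 'M[R]_n) : y = x *m N^T -> P = M *m N -> y *m M^T = x *m P^T.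
    by move=> -> ->; rewrite trmx_mul mulmxA.
  apply: (gen _ _ _ _ _ xq); apply: (etrans (ACE S z uI)); apply: esym.
  apply: (etrans (congr1 (mulmx^~ _) (ACE S z2 uI2))).
  have e : hpath z u = (hol p * hpath z2 (2 * u - 1))%g.
    have -> : hol p = hpath z 2^-1 := etrans (esym h1) (concat_mid S K1).
    rewrite (concat_right S K2 uI2) mulgA mulgV mul1g.
    by apply: (congr1 (hpath z)); lra.
  by rewrite e AdMM.
Qed.

Lemma leaf_mulP (p q s : leaf_space (lbr S)) :
  leaf_mul p q s <-> cot_mul A th (PhiG p) (PhiG q) (PhiG s).
Proof.
rewrite -(lrepK p) -(lrepK q) -(lrepK s) !(Phi_leaf hsc).
exact: (iff_trans (leaf_mul_hol _ _ _) (iff_sym (cot_mulP _ _ _ _ _ _))).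
Qed.

Lemma Phi_unit x : PhiG (leaf (unit_solution (lbr S) x)) = cot_unit th' x.
Proof.
by apply: (etrans (Phi_leaf hsc _)); apply: esym; apply: (etrans (cot_unit_tr S x)); rewrite -(Hol0 S).
Qed.

Lemma Phi_lr (p : PS) :
  cot_l A th (PhiG (leaf p)) = (sval p).1 0 /\ cot_r A th (PhiG (leaf p)) = (sval p).1 1.
Proof.
by rewrite (Phi_leaf hsc) cot_l_tr cot_r_tr PS_right.
Qed.

Lemma Phi_canonical : pullback2 (AQ hc) (cot_atlas A) PhiG (canonical_form A) = fun _ => om0.
Proof.
apply/funext => L; apply/funext => v; apply/funext => w; rewrite /pullback2.
have M a : mdiff (AQ hc) (cot_atlas A) PhiG L a = a.
  by apply: transport_mdiff; [exact: cot_manifold (mA S)|exact: (PsiGK hc hsc)].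
by rewrite !M (canonical_formE (mA S)).
Qed.

End Isomorphism.

Theorem theorem5p2 (R : realType) (n : nat)
    (br : 'rV[R]_n -> 'rV[R]_n -> 'rV[R]_n) (hbr : is_lie_bracket br)
    (G : groupType) (AG : atlas 'rV[R]_n G) (hG : is_lie_group AG)
    (hconn : connected [set: mspace AG])
    (hsc : @simply_connected R (mspace AG))
    (theta theta' : {linear 'rV[R]_n -> 'rV[R]_n})
    (htheta : is_lie_algebra_of AG br theta theta') :
  exists AC : atlas ('rV[R]_n * C0 'rV[R]_n)%type (phase_space br),
    is_submanifold AC /\
  exists AQ : atlas ('rV[R]_n * 'rV[R]_n)%type (leaf_space br),
    [/\ is_manifold AQ, @second_countable (mspace AQ) &
        submersion AC AQ (@leaf R n br)] /\
  exists omega : leaf_space br -> 'rV[R]_n * 'rV[R]_n ->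
                 'rV[R]_n * 'rV[R]_n -> R,
    symplectic AQ omega /\
    pullback2 AC AQ (@leaf R n br) omega =
      pullback2 AC (space_atlas (C1 'rV[R]_n * C0 'rV[R]_n)%type)
        (fun c => sval c) (fun _ v w => field_form v w) /\
  exists Phi : leaf_space br -> cotangent R n G,
    [/\ diffeomorphism AQ (cot_atlas AG) Phi,
        forall x, Phi (leaf (unit_solution br x)) = cot_unit theta' x,
        forall c : phase_space br,
          cot_l AG theta (Phi (leaf c)) = (sval c).1 0 /\
          cot_r AG theta (Phi (leaf c)) = (sval c).1 1,
        forall p q s : leaf_space br,
          leaf_mul p q s <-> cot_mul AG theta (Phi p) (Phi q) (Phi s) &
        pullback2 AQ (cot_atlas AG) Phi (canonical_form AG) = omega].
Proof.
pose S : lie_setup R n := LieSetup hbr hG htheta.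
have hc : connected [set: mspace (lA S)] := hconn.
have hs : @simply_connected R (mspace (lA S)) := hsc.
exists (PSatlas S); split; first exact: (@PS_submanifold R n S).
exists (AQ hc); split.
  split; [exact: (AQ_manifold hc hs)|by apply: (AQ_second_countable hc hs); have [] := hG|exact: (leaf_submersion hc hs)].
(* The charts are transported from T^*G, so the canonical form has components [om0] at every
   leaf. *)
exists (fun _ => @om0 R n); split.
  exact: (transport_symplectic (mA S) (PsiGK hc hs)).
split; first exact: (leaf_pullback hc hs).
exists (@PhiG R n S); split.
- by apply: transport_diffeo; [exact: cot_manifold (mA S)|exact: (PhiGK hc hs)|exact: (PsiGK hc hs)].
- exact: (Phi_unit hs).
- exact: (Phi_lr hs).
- exact: (leaf_mulP hs).
- exact: (Phi_canonical hc hs).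
Qed.
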